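(* Let $\phi_h\in U_h$ be a level-set function such that the surface $\Gamma_{\mathrm p,h}=\{x\in\Omega_{\mathrm{p,max}}:\phi_h(x)=0\}$ does not intersect any node (vertex) of the mesh $\mathscr T_h$. Let $p_h\in W_h$ be the solution of the state equation $$a(q_h,p_h)+\epsilon_{\mathrm s}\,s_h(q_h,p_h)=l(q_h)\qquad\forall q_h\in W_h,$$ and let $z_h\in W_h$ be the solution of the adjoint equation $$a(w_h,z_h)+\epsilon_{\mathrm s}\,s_h(w_h,z_h)=\frac1{|\Gamma_{\mathrm{out}}|}\int_{\Gamma_{\mathrm{out}}}w_h\qquad\forall w_h\in W_h .$$ Let $j(\phi_h)=\frac{1}{|\Gamma_{\mathrm{out}}|}\int_{\Gamma_{\mathrm{out}}}p_h$, and let $w_l$ be any function of the Lagrangian (nodal) basis of $U_h$. Then the directional derivative $$dj(\phi_h;w_l)=\lim_{t\to0}\frac{j(\phi_h+tw_l)-j(\phi_h)}{t}$$ is given by $$\begin{aligned} dj(\phi_h;w_l)={}&\int_{\Gamma_{\mathrm p,h}}\bigl(\nabla z_h\cdot\nabla p_h-k^2z_hp_h\bigr)\frac{w_l}{|\partial_n\phi_h|}\\ &+\delta_V\frac{\mathrm i-1}{2}\int_{\Gamma_{\mathrm p,h}}\Bigl(\frac{(P_T\nabla w_l)\cdot\nabla z_h}{|\partial_n\phi_h|}\frac{\partial p_h}{\partial n}+\frac{\partial z_h}{\partial n}\frac{(P_T\nabla w_l)\cdot\nabla p_h}{|\partial_n\phi_h|}\Bigr)\\ &+\int_{\Gamma_{\mathrm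 p,h}}\frac{\partial}{\partial n}\psi(z_h,p_h;\boldsymbol n)\,\frac{w_l}{|\partial_n\phi_h|} +\sum_{S\in\mathscr S_h}\int_{\Gamma_{\mathrm p,h}\cap S}\boldsymbol n^S\cdot[\![\psi(z_h,p_h;\boldsymbol n)\,\boldsymbol m]\!]\,\frac{w_l}{|\partial_{n^S}\phi_h|}. \end{aligned}$$
   Context: Geometry and mesh. $D\subset\mathbb R^3$ is a bounded hold-all domain triangulated by a fixed mesh $\mathscr T_h$ of tetrahedra with maximum diameter $h>0$. $\Omega_{\mathrm{p,max}}\subset D$ is a union of mesh elements (the mesh conforms to the interface between it and the rest of $D$), and $\Omega_0=D\setminus\Omega_{\mathrm{p,max}}$. $V_h^n$ denotes the continuous functions on $D$ (complex-valued when used for the acoustic problem) that are polynomials of degree at most $n$ on each $K\in\mathscr T_h$. $U_h=V_h^1|_{\Omega_{\mathrm{p,max}}}$ (real-valued), with its Lagrangian basis $\{w_i\}_{i=1}^M$. For $\phi_h\in U_h$, put $\Omega_{\mathrm p,h}=\{x\in\Omega_{\mathrm{p,max}}:\phi_h(x)<0\}$, $\Gamma_{\mathrm p,h}=\{x\in\Omega_{\mathrm{p,max}}:\phi_h(x)=0\}$, and $\Omega_h=\Omega_{\mathrm p,h}\cup\Omega_0$ (the computational domain). Boundary parts. $\Gamma_{\mathrm{out}}$ and $\Gamma_{\mathrm d}$ are fixed parts of $\partial\Omega_h$, contained in the boundary of $\Omega_0$ and independent of $\phi_h$. The lossy wall is $\Gamma_{\mathrm w,h}=\Gamma_{\mathrm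 w,0}\cup\Gamma_{\mathrm p,h}$, where $\Gamma_{\mathrm w,0}\supset\Gamma_{\mathrm d}$ is a fixed part of the boundary of $\Omega_0$ independent of $\phi_h$. No boundary integrals occur on the remainder of $\partial\Omega_h$. $\boldsymbol n$ is the outward unit normal to $\Omega_h$. On $\Gamma_{\mathrm p,h}$ it equals $\nabla\phi_h/|\nabla\phi_h|$ and is constant on each planar piece $\Gamma_{\mathrm p,h}\cap K$, $K\in\mathscr T_h$. Data. $k>0$, $\delta_V>0$, $\delta_T>0$, $\gamma>1$, $\rho_0>0$, $\epsilon_{\mathrm s}>0$ and $a_{\mathrm d}$ are constants, $\boldsymbol e_{\mathrm a}$ is a fixed unit vector, $\mathrm i$ is the imaginary unit. With the tangential gradient $\nabla_{\mathrm T}p=\nabla p-\boldsymbol n\,\frac{\partial p}{\partial n}$, define $$\psi(q,p;\boldsymbol n)=\delta_Tk^2\frac{(\mathrm i-1)(\gamma-1)}2\,qp+\delta_V\frac{\mathrm i-1}2\nabla_{\mathrm T}q\cdot\nabla_{\mathrm T}p=\delta_Tk^2\frac{(\mathrm i-1)(\gamma-1)}2\,qp+\delta_V\frac{\mathrm i-1}2\bigl(\nabla q\cdot\nabla p-(\boldsymbol n\cdot\nabla q)(\boldsymbol n\cdot\nabla p)\bigr),$$ $$a(q,p)=\int_{\Omega_h}\nabla q\cdot\nabla p-k^2\int_{\Omega_h}qp+\mathrm ik\int_{\Gamma_{\mathrm{out}}}qp+\int_{\Gamma_{\mathrm w,h}}\psi(q,p;\boldsymbol n),\qquad l(q)=\int_{\Gamma_{\mathrm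 d}}\rho_0\,q\,a_{\mathrm d}\,\boldsymbol n\cdot\boldsymbol e_{\mathrm a}.$$ There are no complex conjugates; $a$ is bilinear and symmetric. Discrete space and stabilization. $W_h=\{q_h|_{\Omega_h}:q_h\in V_h^2\}$; on an element cut by $\Gamma_{\mathrm p,h}$, a function in $W_h$ is determined by nodal values that may include nodes outside $\Omega_h$, and is identified with its polynomial extension to the whole element. The ghost penalty is $$s_h(p_h,q_h)=\sum_{S\in\mathscr S_h^g}\int_Sh^3[\![\boldsymbol n\cdot\nabla p_h]\!][\![\boldsymbol n\cdot\nabla q_h]\!],$$ where $\mathscr S_h^g$ is the set of interior faces belonging to elements $K\in\mathscr T_h$ that are cut by $\Gamma_{\mathrm p,h}$. Here, for a face $S$ shared by $K_1,K_2\in\mathscr T_h$ with outward unit normals $\boldsymbol n_1=-\boldsymbol n_2$ on $S$, $[\![\boldsymbol n\cdot\boldsymbol f]\!]=\boldsymbol n_1\cdot\boldsymbol f_1+\boldsymbol n_2\cdot\boldsymbol f_2$, with $\boldsymbol f_i(x)=\lim_{t\to0^+}\boldsymbol f(x-t\boldsymbol n_i)$ for $x\in S$. The state and adjoint problems are taken to be uniquely solvable, and the state problem also for all sufficiently small perturbations $\phi_h+tw_l$. The value $j(\phi_h+tw_l)$ is defined by the same formulas with $\phi_h$ replaced by $\phi_h+tw_l$ throughout (domain, wall, normal field, space, state solution). Notation in the derivative formula. $P_T=I-\boldsymbol n\otimes\boldsymbol n$ is the projector on the tangent plane of $\Gamma_{\mathrm p,h}$; $\partial_n=\frac{\partial}{\partial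 n}=\boldsymbol n\cdot\nabla$; all gradients and normal derivatives are taken elementwise, and in $\frac{\partial}{\partial n}\psi(z_h,p_h;\boldsymbol n)$ the vector $\boldsymbol n$ is constant on each element. $\mathscr S_h$ is the set of mesh faces; each nonempty intersection $\Gamma_{\mathrm p,h}\cap S$ is a line segment. $\boldsymbol n^S$ is the unit vector lying in the plane of $S$, normal to $\Gamma_{\mathrm p,h}\cap S$ and directed outward from $\Omega_h$; $\partial_{n^S}=\boldsymbol n^S\cdot\nabla$. For a face $S$ shared by two elements $K_1,K_2\in\mathscr T_h$, the conormal $\boldsymbol m_i$ is the unit vector in the plane of $\Gamma_{\mathrm p,h}\cap K_i$, normal to $\Gamma_{\mathrm p,h}\cap S$ and directed outward from $K_i$; for a function $f$ on $\Gamma_{\mathrm p,h}$ that is continuous up to the boundary on each $\Gamma_{\mathrm p,h}\cap K_i$, $f_i(x)=\lim_{t\to0^+}f(x-t\boldsymbol m_i)$ for $x\in\Gamma_{\mathrm p,h}\cap S$, and $[\![f\boldsymbol m]\!]=f_1\boldsymbol m_1+f_2\boldsymbol m_2$ (for $f=\psi(z_h,p_h;\boldsymbol n)$, the normal $\boldsymbol n$ in $f_i$ is that of $\Gamma_{\mathrm p,h}\cap K_i$). Integrals over surfaces and line segments are with respect to area and length measure. *)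

(* Defs.v *)
From HB Require Import structures.
From mathcomp Require Import all_boot all_order all_algebra.
From mathcomp Require Import all_classical all_reals all_analysis.
From mathcomp Require Import complex.
From mathcomp Require Import -(notations) mpoly.
Set Implicit Arguments.
Unset Strict Implicit.
Unset Printing Implicit Defensive.
Import Order.TTheory GRing.Theory Num.Theory.
Import numFieldNormedType.Exports.
Local Open Scope classical_set_scope.
Local Open Scope complex_scope.
Local Open Scope ring_scope.

(** * Vectors of R^3 *)

Definition dot (F : pzRingType) (u v : 'rV[F]_3) : F :=
  \sum_(i < 3) u 0 i * v 0 i.

(* The library norm `|u| on row vectors is the sup norm; lengths and unit
   vectors use the Euclidean norm. *)
Definition enorm (R : realType) (u : 'rV[R]_3) : R := Num.sqrt (dot u u).

Definition cvec (R : realType) (u : 'rV[R]_3) : 'rV[R[i]]_3 :=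
  \row_(i < 3) (u 0 i)%:C.

Definition boundary (T : topologicalType) (A : set T) : set T :=
  closure A `\` A°.

(** * Complex-valued integrals of volume, area and length *)

Definition cintegral (R : realType) d (T : measurableType d)
    (mu : {measure set T -> \bar R}) (E : set T) (f : T -> R[i]) : R[i] :=
  (\int[mu]_(x in E) complex.Re (f x)) +i* (\int[mu]_(x in E) complex.Im (f x)).

Definition leb2 (R : realType) := ((@lebesgue_measure R) \x (@lebesgue_measure R))%E.
Definition leb3 (R : realType) := (@leb2 R \x (@lebesgue_measure R))%E.

Definition pt3 (R : realType) (w : R * R * R) : 'rV[R]_3 :=
  \row_(i < 3) [:: w.1.1; w.1.2; w.2]`_i.

Definition vol_int (R : realType) (E : set 'rV[R]_3) (f : 'rV[R]_3 -> R[i]) :=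
  cintegral (@leb3 R) (@pt3 R @^-1` E) (f \o @pt3 R).

(* The area measure on a plane is the image of the Lebesgue measure of R^2 by
   any Cartesian coordinate chart (s, t) |-> o + s u + t v, with u, v
   orthonormal.  [plane_chart E] is such a chart (o, u, v) for a plane that
   contains E; the integral does not depend on the one selected.  [surf_int]
   is meaningful for planar E only. *)
Definition plane_pt (R : realType) (c : 'rV[R]_3 * 'rV[R]_3 * 'rV[R]_3)
    (w : R * R) : 'rV[R]_3 :=
  c.1.1 + w.1 *: c.1.2 + w.2 *: c.2.

Definition plane_chart (R : realType) (E : set 'rV[R]_3) :
    'rV[R]_3 * 'rV[R]_3 * 'rV[R]_3 :=
  xget (0, 0, 0) [set c | [/\ enorm c.1.2 = 1, enorm c.2 = 1,
                              dot c.1.2 c.2 = 0 & E `<=` range (plane_pt c)]].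

Definition surf_int (R : realType) (E : set 'rV[R]_3) (f : 'rV[R]_3 -> R[i]) :=
  cintegral (@leb2 R) (plane_pt (plane_chart E) @^-1` E)
    (f \o plane_pt (plane_chart E)).

(* Likewise for the length measure on a straight line o + R u. *)
Definition line_pt (R : realType) (c : 'rV[R]_3 * 'rV[R]_3) (s : R) : 'rV[R]_3 :=
  c.1 + s *: c.2.

Definition line_chart (R : realType) (E : set 'rV[R]_3) : 'rV[R]_3 * 'rV[R]_3 :=
  xget (0, 0) [set c | enorm c.2 = 1 /\ E `<=` range (line_pt c)].

Definition line_int (R : realType) (E : set 'rV[R]_3) (f : 'rV[R]_3 -> R[i]) :=
  cintegral (@lebesgue_measure R) (line_pt (line_chart E) @^-1` E)
    (f \o line_pt (line_chart E)).

(** * Polynomials on an element *)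

Definition peval (R : realType) (F : comNzRingType) (emb : R -> F)
    (p : mpoly 3 F) (x : 'rV[R]_3) : F := meval (fun i => emb (x 0 i)) p.

Definition reval (R : realType) (p : mpoly 3 R) (x : 'rV[R]_3) : R :=
  peval id p x.

Definition ceval (R : realType) (p : mpoly 3 R[i]) (x : 'rV[R]_3) : R[i] :=
  peval (real_complex R) p x.

Definition grad (R : realType) (p : mpoly 3 R) (x : 'rV[R]_3) : 'rV[R]_3 :=
  \row_(i < 3) reval (mderiv i p) x.

(* v . grad p, as a polynomial *)
Definition dirder (R : realType) (v : 'rV[R]_3) (p : mpoly 3 R[i]) :
    mpoly 3 R[i] :=
  \sum_(i < 3) (v 0 i)%:C *: mderiv i p.

Definition graddot (R : realType) (q p : mpoly 3 R[i]) : mpoly 3 R[i] :=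
  \sum_(i < 3) mderiv i q * mderiv i p.

Definition tanproj (R : realType) (n : 'rV[R]_3) : 'M[R]_3 := 1%:M - n^T *m n.

(** * Geometry *)

(* Elements are the 4-sets of nodes in [elts]; the mesh of Omega_p,max is
   [pmax].  [Gout], [Gd], [Gw0] are Gamma_out, Gamma_d, Gamma_w,0. *)
Record geometry (R : realType) (M : nat) := Geometry {
  vtx : 'I_M -> 'rV[R]_3;
  elts : {set {set 'I_M}};
  pmax : {set {set 'I_M}};
  Gout : set 'rV[R]_3;
  Gd : set 'rV[R]_3;
  Gw0 : set 'rV[R]_3
}.

(* Closed simplex spanned by the nodes in A *)
Definition simplex (R : realType) (M : nat) (G : geometry R M) (A : {set 'I_M}) :
    set 'rV[R]_3 :=
  [set x | exists c : 'I_M -> R,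
     [/\ forall i, 0 <= c i, forall i, i \notin A -> c i = 0,
         \sum_i c i = 1 & x = \sum_i c i *: vtx G i]].

Definition affinely_independent (R : realType) (M : nat) (G : geometry R M)
    (A : {set 'I_M}) : Prop :=
  forall c : 'I_M -> R, (forall i, i \notin A -> c i = 0) ->
    \sum_i c i = 0 -> \sum_i c i *: vtx G i = 0 -> forall i, c i = 0.

Definition is_mesh (R : realType) (M : nat) (G : geometry R M) : Prop :=
  [/\ exists K, K \in elts G,
      forall i, exists2 K, K \in elts G & i \in K,
      forall K, K \in elts G -> #|K| = 4%N /\ affinely_independent G K &
      forall K L, K \in elts G -> L \in elts G ->
        simplex G K `&` simplex G L = simplex G (K :&: L)].

Definition faces (R : realType) (M : nat) (G : geometry R M) : {set {set 'I_M}} :=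
  [set S : {set 'I_M} | (#|S| == 3%N) && [exists K in elts G, S \subset K]].

Definition region (R : realType) (M : nat) (G : geometry R M)
    (E : {set {set 'I_M}}) : set 'rV[R]_3 :=
  [set x | exists2 K, K \in E & simplex G K x].

Definition holdall (R : realType) (M : nat) (G : geometry R M) := region G (elts G).

Definition omega0 (R : realType) (M : nat) (G : geometry R M) : set 'rV[R]_3 :=
  holdall G `\` region G (pmax G).

Definition mesh_size (R : realType) (M : nat) (G : geometry R M) : R :=
  sup [set d | exists K x y,
    [/\ K \in elts G, simplex G K x, simplex G K y & d = enorm (x - y)]].

(* Outward unit normal to the element K on its face S *)
Definition face_normal (R : realType) (M : nat) (G : geometry R M)
    (K S : {set 'I_M}) : 'rV[R]_3 :=
  xget 0 [set n | [/\ enorm n = 1,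
    forall x y, simplex G S x -> simplex G S y -> dot n (x - y) = 0 &
    forall x y, simplex G S x -> simplex G K y -> dot n (y - x) <= 0]].

(** * Finite element spaces *)

(* A piecewise polynomial is given by the family of its element polynomials, so
   that elementwise derivatives and one-sided limits at a face are those of the
   polynomial of the element concerned. *)
Definition pwpoly (F : nzRingType) (M : nat) := {set 'I_M} -> mpoly 3 F.

(* V_h^n, real for emb = id and complex for emb = real_complex R *)
Definition Vh (R : realType) (M : nat) (G : geometry R M) (F : numFieldType)
    (emb : R -> F) (n : nat) : set (pwpoly F M) :=
  [set v | (forall K, K \in elts G -> (msize (v K) <= n.+1)%N) /\
    exists f : 'rV[R]_3 -> F^o, {within holdall G, continuous f} /\
      forall K x, K \in elts G -> simplex G K x -> f x = peval emb (v K) x].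

(* Restrictions to a union A of elements, each represented by its extension by
   zero to the other indices, so that Leibniz equality is equality on A *)
Definition restrictions (F : nzRingType) (M : nat) (A : {set 'I_M} -> Prop)
    (V : set (pwpoly F M)) : set (pwpoly F M) :=
  [set u | exists2 v, V v &
     (forall K, A K -> u K = v K) /\ (forall K, ~ A K -> u K = 0)].

Definition Uh (R : realType) (M : nat) (G : geometry R M) : set (pwpoly R M) :=
  restrictions (fun K => K \in pmax G) (Vh G (id : R -> R) 1%N).

Definition nodal_basis (R : realType) (M : nat) (G : geometry R M) (l : 'I_M)
    (w : pwpoly R M) : Prop :=
  [/\ Uh G w, exists2 K, K \in pmax G & l \in K &
      forall K m, K \in pmax G -> m \in K -> reval (w K) (vtx G m) = (m == l)%:R].

(** * Level set and cut mesh *)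

Section LevelSet.
Variables (R : realType) (M : nat) (G : geometry R M) (phi : pwpoly R M).

Definition omega_p : set 'rV[R]_3 :=
  [set x | exists K, [/\ K \in pmax G, simplex G K x & reval (phi K) x < 0]].

Definition gamma_p : set 'rV[R]_3 :=
  [set x | exists K, [/\ K \in pmax G, simplex G K x & reval (phi K) x = 0]].

Definition omega : set 'rV[R]_3 := omega_p `|` omega0 G.

Definition active (K : {set 'I_M}) : Prop :=
  K \in elts G /\ (simplex G K)° `&` omega !=set0.

Definition cut (K : {set 'I_M}) : Prop :=
  K \in elts G /\ (simplex G K)° `&` gamma_p !=set0.

(* W_h: on a cut element a function is its polynomial extension to the whole
   element, on an element that does not meet Omega_h it has no values. *)
Definition Wh : set (pwpoly R[i] M) :=
  restrictions active (Vh G (real_complex R) 2%N).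

(* Interior means shared by two elements on which functions of W_h are
   defined: on other faces of cut elements the jump has no meaning on W_h. *)
Definition ghost_faces : {set {set 'I_M}} :=
  [set S in faces G |
     [exists K in elts G, (S \subset K) && `[< cut K >]] &&
     (#|[set K in elts G | (S \subset K) && `[< active K >]]| == 2%N)].

(* Normal to Gamma_p,h on K; constant in x since phi K is affine *)
Definition lsnormal (K : {set 'I_M}) (x : 'rV[R]_3) : 'rV[R]_3 :=
  (enorm (grad (phi K) x))^-1 *: grad (phi K) x.

(* n^S *)
Definition seg_normal (S : {set 'I_M}) : 'rV[R]_3 :=
  xget 0 [set n | [/\ enorm n = 1,
    (exists c : 'I_M -> R, [/\ forall i, i \notin S -> c i = 0,
        \sum_i c i = 0 & n = \sum_i c i *: vtx G i]),
    forall x y, (simplex G S `&` gamma_p) x -> (simplex G S `&` gamma_p) y ->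
      dot n (x - y) = 0 &
    forall x y, (simplex G S `&` gamma_p) x -> (simplex G S `&` omega) y ->
      dot n (y - x) <= 0]].

(* The conormal m of Gamma_p,h `&` K on Gamma_p,h `&` S *)
Definition conormal (K S : {set 'I_M}) : 'rV[R]_3 :=
  xget 0 [set m | [/\ enorm m = 1,
    forall x, (simplex G K `&` gamma_p) x -> dot m (lsnormal K x) = 0,
    forall x y, (simplex G S `&` gamma_p) x -> (simplex G S `&` gamma_p) y ->
      dot m (x - y) = 0 &
    forall x y, (simplex G S `&` gamma_p) x -> (simplex G K `&` gamma_p) y ->
      dot m (y - x) <= 0]].

(* [[ f m ]] on Gamma_p,h `&` S for an elementwise function f on Gamma_p,h;
   a face on the boundary of Omega_p,max has one term only. *)
Definition conormal_jump (f : {set 'I_M} -> 'rV[R]_3 -> R[i]) (S : {set 'I_M})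
    (x : 'rV[R]_3) : 'rV[R[i]]_3 :=
  \sum_(K in pmax G | S \subset K) f K x *: cvec (conormal K S).

Definition omega_int (f : {set 'I_M} -> 'rV[R]_3 -> R[i]) : R[i] :=
  \sum_(K in elts G) vol_int (simplex G K `&` omega) (f K).

Definition gamma_int (f : {set 'I_M} -> 'rV[R]_3 -> R[i]) : R[i] :=
  \sum_(K in pmax G) surf_int (simplex G K `&` gamma_p) (f K).

End LevelSet.

(* Integral over a subset B of the boundary of Omega_0, which consists of the
   faces S contained in exactly one element K outside [pmax]; the integrand
   receives that K and S. *)
Definition bdry_int (R : realType) (M : nat) (G : geometry R M)
    (B : set 'rV[R]_3) (f : {set 'I_M} -> {set 'I_M} -> 'rV[R]_3 -> R[i]) : R[i] :=
  \sum_(S in faces G | #|[set K in elts G :\: pmax G | S \subset K]| == 1%N)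
    \sum_(K in elts G :\: pmax G | S \subset K)
      surf_int (simplex G S `&` B) (f K S).

(* An element of Omega_p,max with face S; if there are two, continuous piecewise
   polynomials have the same values and the same derivatives tangential to S on
   both. *)
Definition pside (R : realType) (M : nat) (G : geometry R M) (S : {set 'I_M}) :
    {set 'I_M} :=
  odflt finset.set0 [pick K in pmax G | S \subset K].

(** * State and adjoint problems *)

Record coefs (R : realType) := Coefs {
  wavenumber : R; delta_V : R; delta_T : R; heat_ratio : R; rho_0 : R;
  eps_s : R; a_d : R[i]; e_a : 'rV[R]_3
}.

(* psi(q, p; n), as a polynomial on an element, n being a constant vector *)
Definition psi (R : realType) (c : coefs R) (n : 'rV[R]_3)
    (q p : mpoly 3 R[i]) : mpoly 3 R[i] :=
  ((delta_T c * wavenumber c ^+ 2)%:C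
     * (('i%C - 1) * (heat_ratio c - 1)%:C / 2%:R)) *: (q * p)
  + ((delta_V c)%:C * (('i%C - 1) / 2%:R))
     *: (graddot q p - dirder n q * dirder n p).

Definition a_form (R : realType) (M : nat) (G : geometry R M) (c : coefs R)
    (phi : pwpoly R M) (q p : pwpoly R[i] M) : R[i] :=
  omega_int G phi (fun K => ceval (graddot (q K) (p K)))
  - (wavenumber c ^+ 2)%:C * omega_int G phi (fun K => ceval (q K * p K))
  + 'i%C * (wavenumber c)%:C
      * bdry_int G (Gout G) (fun K _ => ceval (q K * p K))
  + (bdry_int G (Gw0 G) (fun K S => ceval (psi c (face_normal G K S) (q K) (p K)))
     + gamma_int G phi
         (fun K x => ceval (psi c (lsnormal phi K x) (q K) (p K)) x)).

Definition l_form (R : realType) (M : nat) (G : geometry R M) (c : coefs R)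
    (q : pwpoly R[i] M) : R[i] :=
  bdry_int G (Gd G) (fun K S x =>
    (rho_0 c)%:C * ceval (q K) x * a_d c * (dot (face_normal G K S) (e_a c))%:C).

Definition normal_jump (R : realType) (M : nat) (G : geometry R M)
    (q : pwpoly R[i] M) (S : {set 'I_M}) (x : 'rV[R]_3) : R[i] :=
  \sum_(K in elts G | S \subset K) ceval (dirder (face_normal G K S) (q K)) x.

Definition s_form (R : realType) (M : nat) (G : geometry R M)
    (phi : pwpoly R M) (p q : pwpoly R[i] M) : R[i] :=
  \sum_(S in ghost_faces G phi) surf_int (simplex G S) (fun x =>
    (mesh_size G ^+ 3)%:C * normal_jump G p S x * normal_jump G q S x).

Definition area_out (R : realType) (M : nat) (G : geometry R M) : R[i] :=
  bdry_int G (Gout G) (fun _ _ _ => 1).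

Definition mean_out (R : realType) (M : nat) (G : geometry R M)
    (q : pwpoly R[i] M) : R[i] :=
  (area_out G)^-1 * bdry_int G (Gout G) (fun K _ => ceval (q K)).

Definition is_state (R : realType) (M : nat) (G : geometry R M) (c : coefs R)
    (phi : pwpoly R M) (p : pwpoly R[i] M) : Prop :=
  Wh G phi p /\ forall q, Wh G phi q ->
    a_form G c phi q p + (eps_s c)%:C * s_form G phi q p = l_form G c q.

Definition is_adjoint (R : realType) (M : nat) (G : geometry R M) (c : coefs R)
    (phi : pwpoly R M) (z : pwpoly R[i] M) : Prop :=
  Wh G phi z /\ forall q, Wh G phi q ->
    a_form G c phi q z + (eps_s c)%:C * s_form G phi q z = mean_out G q.

Definition objective (R : realType) (M : nat) (G : geometry R M) (c : coefs R)
    (phi : pwpoly R M) : R[i] :=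
  mean_out G (xget (fun=> 0) [set p | is_state G c phi p]).

Definition perturb (R : realType) (M : nat) (phi : pwpoly R M) (t : R)
    (w : pwpoly R M) : pwpoly R M := fun K => phi K + t *: w K.

(* Main.v *)
Require Import Defs.
From HB Require Import structures.
From mathcomp Require Import all_boot all_order all_algebra.
From mathcomp Require Import all_classical all_reals all_analysis.
From mathcomp Require Import measurable_realfun.
From mathcomp Require Import complex.
From mathcomp Require Import -(notations) mpoly.
From mathcomp Require Import ring lra.
Set Implicit Arguments.
Unset Strict Implicit.
Unset Printing Implicit Defensive.
Import Order.TTheory GRing.Theory Num.Theory.
Import numFieldNormedType.Exports.
Local Open Scope classical_set_scope.
Local Open Scope complex_scope.
Local Open Scope ring_scope.

(* For small t no node changes sign, so the discrete space and the ghost penalty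
   do not depend on t, and the forms a_t live on one finite-dimensional space.
   Since these forms are symmetric and converge to a_0, which is injective by the
   uniqueness of the adjoint solution, the states p_t converge to p by Cramer's
   rule, and j(t) - j(0) = a_0(p_t, z) - a_t(p_t, z) shows that dj is minus the
   derivative of t |-> a_t(z, p).  That derivative is computed on each element.
   The volume {phi + t w < 0} is a moving half-space cut by a simplex, written as
   a subgraph over the plane phi = 0.  The wall {phi + t w = 0} is a graph over
   that plane, and the integral over it is one over a planar polygon whose edges
   move; the weight of an edge is the cotangent of the angle between the wall and
   the face, which is n^S . m / |d phi / d n^S| times |grad phi|.  The rest is the
   derivative of the integrand, in which the normal depends on t, and the area
   element, which is stationary at t = 0 because the wall moves by a normal graph
   with affine height. *)

(** * Changes of variables *)

(** The surface and line integrals use a chart picked by choice for each set, and the wall, hence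
    its chart, changes with [t]. They are therefore first shown to be independent of the
    parametrization; after that one fixed chart of the unperturbed plane describes all perturbed
    walls. The edges of the wall polygon move simultaneously. The perturbed constraints are replaced
    by the unperturbed ones one at a time, so that each step is a single moving half-plane and the
    other indicators are continuous at almost every point of its edge. The absence of nodes on the
    wall excludes the degenerate positions: the plane of the wall is not the plane of a face and
    contains no edge line of the element, and an element on which the level function is constant is
    not cut at all. The integrand depends on the normal only through the products of its components.
    Once the unperturbed products are subtracted, these coefficients vanish at [t = 0], so the
    product rule asks no more of the integrals that they multiply than continuity in [t]. *)

(* [g] runs over nonnegative functions so that no integrability is needed. *)
Definition has_jacobian (R : realType) d1 d2 (T : measurableType d1)
    (U : measurableType d2) (mu : {measure set T -> \bar R})
    (nu : {measure set U -> \bar R}) (L : U -> T) (c : R) : Prop :=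
  [/\ measurable_fun setT L, 0 < c &
      forall g : T -> \bar R, measurable_fun setT g ->
        (forall x, 0 <= g x)%E ->
        (\int[mu]_x g x = c%:E * \int[nu]_y g (L y))%E].

Lemma has_jacobian_comp (R : realType) d1 d2 d3 (T : measurableType d1)
    (U : measurableType d2) (V : measurableType d3)
    (mu : {measure set T -> \bar R}) (nu : {measure set U -> \bar R})
    (xi : {measure set V -> \bar R}) L1 L2 c1 c2 :
  has_jacobian mu nu L1 c1 -> has_jacobian nu xi L2 c2 ->
  has_jacobian mu xi (L1 \o L2) (c1 * c2).
Proof.
move=> [m1 c1p h1] [m2 c2p h2]; split; first exact: measurableT_comp.
  exact: mulr_gt0.
move=> g mg g0; have mgL : measurable_fun setT (g \o L1) := measurableT_comp mg m1.
rewrite h1// EFinM -muleA (h2 _ mgL)// => x; exact: g0.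
Qed.

(** The positive and the negative part are transformed separately. If one of them has an infinite
    integral, [fine] sends the total to 0 on both sides, so the identity also holds without
    integrability. *)
Lemma has_jacobian_Rintegral (R : realType) d1 d2 (T : measurableType d1)
    (U : measurableType d2) (mu : {measure set T -> \bar R})
    (nu : {measure set U -> \bar R}) L c (f : T -> R) :
  has_jacobian mu nu L c -> measurable_fun setT f ->
  \int[mu]_x f x = c * \int[nu]_y f (L y).
Proof.
move=> [mL c0 h] mf; have mfe : measurable_fun setT (EFin \o f) by exact/measurable_EFinP.
have hp : (\int[mu]_x (EFin \o f)^\+ x = c%:E * \int[nu]_y (EFin \o f \o L)^\+ y)%E.
  have p0 x : (0 <= (EFin \o f)^\+ x)%E by exact: funepos_ge0.
  rewrite (h _ (measurable_funepos mfe) p0).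
by congr (_ * _)%E; apply: eq_integral => y _; rewrite !funeposE.
have hn : (\int[mu]_x (EFin \o f)^\- x = c%:E * \int[nu]_y (EFin \o f \o L)^\- y)%E.
  have p0 x : (0 <= (EFin \o f)^\- x)%E by exact: funeneg_ge0.
  rewrite (h _ (measurable_funeneg mfe) p0). by congr (_ * _)%E; apply: eq_integral => y _; rewrite !funenegE.
rewrite /Rintegral integralE [in RHS]integralE hp hn.
have : (0 <= \int[nu]_y (EFin \o f \o L)^\- y)%E by exact: integral_ge0.
have : (0 <= \int[nu]_y (EFin \o f \o L)^\+ y)%E by exact: integral_ge0.
case: (\int[nu]_y (EFin \o f \o L)^\+ y)%E => [u| |] //;
case: (\int[nu]_y (EFin \o f \o L)^\- y)%E => [v| |] //= _ _.
- by rewrite mulrBr.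
- by rewrite mulr_infty gtr0_sg// mul1e /= mulr0.
- by rewrite mulr_infty gtr0_sg// mul1e /= mulr0.
- by rewrite mulr_infty gtr0_sg// mul1e /= mulr0.
Qed.

Section line.
Variable R : realType.
Notation leb := (@lebesgue_measure R).
Notation RR := (measurableTypeR R).

(** The image measure scaled by [|a|] agrees with the Lebesgue measure on half-open intervals, hence
    everywhere. For negative [a] the preimage of such an interval is closed at the other end, which
    does not change its length. *)
Lemma lebesgue_affine (a b : R) : a != 0 ->
  has_jacobian leb leb (fun x : RR => a * x + b : RR) `|a|.
Proof.
move=> a0; have na0 : 0 < `|a| by rewrite normr_gt0.
have mL : measurable_fun setT (fun x : RR => a * x + b : RR).
  by apply: measurable_funD => //; exact: measurable_funM.
split => // g mg g0.
pose f : RR -> RR := fun x : RR => a * x + b.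
pose mu' := mscale (NngNum (ltW na0)) (pushforward leb f).
have mE : forall A, measurable A -> leb A = mu' mL A.
  apply: lebesgue_measure_unique => //= _ [[x y]] _ <-.
  rewrite /mu' /mscale /= /pushforward.
  have [a1|a1|/eqP] := ltgtP a 0; last by rewrite (negPf a0).
    rewrite [X in _ = (_ * leb X)%E](_ : _ = `[(y - b) / a, (x - b) / a[%classic).
      rewrite !lebesgue_measure_itv /= !lte_fin ltr_nM2r ?invr_lt0// ltrD2r.
      case: ifPn => _; last by rewrite mule0.
      by rewrite ltr0_norm// -EFinM -!EFinB; congr EFin; field.
    apply/seteqP; split => r /=; rewrite !in_itv /=.
      move=> /andP[h1 h2]; rewrite ler_ndivrMr// ltr_ndivlMr//.
      by rewrite ltrBlDr lerBrDr mulrC h1 h2.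
    rewrite ler_ndivrMr// ltr_ndivlMr// ltrBlDr lerBrDr mulrC.
    by move=> /andP[-> ->].
  rewrite [X in _ = (_ * leb X)%E](_ : _ = `](x - b) / a, (y - b) / a]%classic).
    rewrite !lebesgue_measure_itv /= !lte_fin ltr_pM2r ?invr_gt0// ltrD2r.
    case: ifPn => _; last by rewrite mule0.
    by rewrite gtr0_norm// -EFinM -!EFinB; congr EFin; field.
  apply/seteqP; split => r /=; rewrite !in_itv /=.
    move=> /andP[h1 h2]; rewrite ler_pdivlMr// ltr_pdivrMr//.
    by rewrite ltrBlDr lerBrDr mulrC h1 h2.
  rewrite ler_pdivlMr// ltr_pdivrMr// ltrBlDr lerBrDr mulrC.
  by move=> /andP[-> ->].
rewrite (eq_measure_integral (mu' mL))//; last by move=> A mA _; exact: mE.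
by rewrite ge0_integral_mscale//= ge0_integral_pushforward.
Qed.

(** By Tonelli, with the transformed coordinate integrated first, the claim reduces to one fiber; as
    [c] is the same on all fibers, it leaves the outer integral. *)
Lemma has_jacobian_fiber1 (d1 d2 : measure_display) (T1 : measurableType d1)
    (T2 : measurableType d2) (m1 : {sigma_finite_measure set T1 -> \bar R})
    (m2 : {sigma_finite_measure set T2 -> \bar R}) (L : T2 -> T1 -> T1) c :
  measurable_fun setT (fun w => L w.2 w.1) ->
  (forall t, has_jacobian m1 m1 (L t) c) -> 0 < c ->
  has_jacobian (m1 \x m2)%E (m1 \x m2)%E (fun w => (L w.2 w.1, w.2)) c.
Proof.
move=> mL hL c0.
have mLL : measurable_fun setT (fun w : T1 * T2 => (L w.2 w.1, w.2)).
  by apply/measurable_fun_pair.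
split => // g mg g0; rewrite fubini_tonelli2// fubini_tonelli2//; last first.
  exact: measurableT_comp mg mLL.
rewrite -ge0_integralZl//; last 3 first.
- by apply: measurable_fun_fubini_tonelli_G => //; exact: measurableT_comp mg mLL.
- by move=> t _; exact: integral_ge0.
- by rewrite lee_fin ltW.
apply: eq_integral => t _ /=.
have [_ _ h] := hL t; rewrite /fubini_G (h (fun s => g (s, t)))//.
exact: measurableT_comp.
Qed.

Lemma has_jacobian_fiber2 (d1 d2 : measure_display) (T1 : measurableType d1)
    (T2 : measurableType d2) (m1 : {sigma_finite_measure set T1 -> \bar R})
    (m2 : {sigma_finite_measure set T2 -> \bar R}) (L : T1 -> T2 -> T2) c :
  measurable_fun setT (fun w => L w.1 w.2) ->
  (forall t, has_jacobian m2 m2 (L t) c) -> 0 < c ->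
  has_jacobian (m1 \x m2)%E (m1 \x m2)%E (fun w => (w.1, L w.1 w.2)) c.
Proof.
move=> mL hL c0.
have mLL : measurable_fun setT (fun w : T1 * T2 => (w.1, L w.1 w.2)).
  by apply/measurable_fun_pair.
split => // g mg g0; rewrite fubini_tonelli1// fubini_tonelli1//; last first.
  exact: measurableT_comp mg mLL.
rewrite -ge0_integralZl//; last 3 first.
- by apply: measurable_fun_fubini_tonelli_F => //; exact: measurableT_comp mg mLL.
- by move=> t _; exact: integral_ge0.
- by rewrite lee_fin ltW.
apply: eq_integral => t _ /=.
have [_ _ h] := hL t; rewrite /fubini_F (h (fun s => g (t, s)))//.
exact: measurableT_comp.
Qed.

Lemma has_jacobian_swap (d1 d2 : measure_display) (T1 : measurableType d1)
    (T2 : measurableType d2) (m1 : {sigma_finite_measure set T1 -> \bar R})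
    (m2 : {sigma_finite_measure set T2 -> \bar R}) :
  has_jacobian (m1 \x m2)%E (m2 \x m1)%E (fun w => (w.2, w.1)) (1 : R).
Proof.
have mS : measurable_fun setT (fun w : T2 * T1 => (w.2, w.1)).
  by apply/measurable_fun_pair.
split => // g mg g0; rewrite mul1e fubini_tonelli1// fubini_tonelli2//.
exact: measurableT_comp mg mS.
Qed.

Notation leb2 := (@leb2 R).
Notation leb3 := (@leb3 R).

(* Gaussian elimination: a shear in each coordinate around a diagonal map,
   after a swap of the coordinates when [a = 0]. *)
Lemma lebesgue2_affine (p q a b c e : R) : a * e - b * c != 0 ->
  has_jacobian leb2 leb2
    (fun w : RR * RR => (p + a * w.1 + b * w.2 : RR, q + c * w.1 + e * w.2 : RR))
    `|a * e - b * c|.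
Proof.
wlog a0 : a b c e / a != 0.
  move=> H; have [->|a0] := eqVneq a 0; last exact: H.
  rewrite mul0r sub0r oppr_eq0 normrN => bc.
  have b0 : b != 0 by apply: contra bc => /eqP ->; rewrite mul0r.
  have := H b 0 e c b0; rewrite mul0r subr0 => /(_ bc) h1.
  have := has_jacobian_comp h1 (has_jacobian_swap leb leb).
  rewrite mulr1; congr (has_jacobian _ _ _ _).
  by apply/funext => -[x y] /=; congr (_, _); ring.
move=> d0; set d := a * e - b * c in d0 *.
pose A1 := fun w : RR * RR => (a * w.1 + (b * w.2 + p) : RR, w.2).
pose A2 := fun w : RR * RR => (w.1, (d / a) * w.2 + (c / a * (w.1 - p) + q) : RR).
have J1 : has_jacobian leb2 leb2 A1 `|a|.
  apply: (@has_jacobian_fiber1 _ _ _ _ _ _ (fun t x : RR => a * x + (b * t + p) : RR)).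
  - apply: measurable_funD; first exact: measurable_funM.
    by apply: measurable_funD => //; exact: measurable_funM.
  - by move=> t; exact: lebesgue_affine.
  - by rewrite normr_gt0.
have da0 : d / a != 0 by rewrite mulf_neq0// invr_neq0.
have J2 : has_jacobian leb2 leb2 A2 `|d / a|.
  apply: (@has_jacobian_fiber2 _ _ _ _ _ _ (fun t x : RR => (d / a) * x + (c / a * (t - p) + q) : RR)).
  - apply: measurable_funD; first exact: measurable_funM.
    apply: measurable_funD => //; apply: measurable_funM => //.
    by apply: measurable_funB.
  - by move=> t; exact: lebesgue_affine.
  - by rewrite normr_gt0.
have := has_jacobian_comp J2 J1.
rewrite -normrM divfK//; congr (has_jacobian _ _ _ _).
apply/funext => -[x y]; rewrite /A1 /A2 /=; congr (_, _); rewrite /d; first ring.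
by field.
Qed.

Lemma sigma_finite_leb2 : sigma_finite setT leb2.
Proof.
have /sigma_finiteP[F [TF ndF Foo]] := sigma_finiteT leb.
exists (fun n => F n `*` F n).
  rewrite -setXTT TF predeqE => -[x y]; split.
    move=> [/= [n _ Fnx] [k _ Gky]]; exists (maxn n k) => //; split.
    - by move: x Fnx; exact/subsetPset/ndF/leq_maxl.
    - by move: y Gky; exact/subsetPset/ndF/leq_maxr.
  by move=> [n _ []/= ? ?]; split; exists n.
move=> k; have [? ?] := Foo k.
split; first exact: measurableX.
by rewrite /leb2 product_measure1E// lte_mul_pinfty// ge0_fin_numE.
Qed.

(* The library's canonical sigma-finite structure on a product measure is the
   one for subprobabilities, so that of [leb2] has to be given explicitly. *)
Definition sleb2 : {sigma_finite_measure set (RR * RR)%type -> \bar R} :=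
  HB.pack (leb \x leb)%E
    (Measure_isSigmaFinite.Build _ _ _ (leb \x leb)%E sigma_finite_leb2).

(** After this shear the third coordinate runs along the lines of direction [(a, b, 1)], so a plane
    crossed by that direction becomes a graph over the first two coordinates. *)
Lemma lebesgue3_shear (a b : R) :
  has_jacobian leb3 leb3
    (fun w : RR * RR * RR => (w.1.1 + w.2 * a : RR, w.1.2 + w.2 * b : RR, w.2)) 1.
Proof.
apply: (@has_jacobian_fiber1 _ _ _ RR sleb2 leb
  (fun (t : RR) (x : RR * RR) => (x.1 + t * a : RR, x.2 + t * b : RR))) => //.
  apply/measurable_fun_pair => /=.
    apply: measurable_funD; first exact: measurableT_comp.
    exact: measurable_funM.
  apply: measurable_funD; first exact: measurableT_comp.
  exact: measurable_funM.
move=> t.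
have := @lebesgue2_affine (t * a) (t * b) 1 0 0 1.
rewrite mul1r mul0r subr0 normr1 oner_neq0 => /(_ isT).
congr (has_jacobian _ _ _ _).
by apply/funext => -[x y] /=; congr (_, _); ring.
Qed.

End line.

(** * Moving half-spaces *)

Lemma integrable_bounded (R : realType) d (T : measurableType d)
    (mu : {measure set T -> \bar R}) (D : set T) (f : T -> R) (C : R) :
  measurable D -> (mu D < +oo)%E -> measurable_fun setT f ->
  (forall x, `|f x| <= C) -> (forall x, ~ D x -> f x = 0) ->
  mu.-integrable setT (EFin \o f).
Proof.
move=> mD fD mf fC f0.
have -> : EFin \o f = (EFin \o f) \_ D.
  apply/funext => x; rewrite /patch /=; case: ifPn => // /negP.
  by rewrite in_setE => /f0 ->.
apply/(integrable_mkcond _ mD); apply: measurable_bounded_integrable => //.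
  exact: measurable_funS mf.
exists C; split; first exact: num_real.
by move=> M CM x _ /=; rewrite (le_trans (fC x))// ltW.
Qed.

Lemma integral_EFin_Rintegral (R : realType) d (T : measurableType d)
    (mu : {measure set T -> \bar R}) (f : T -> R) :
  mu.-integrable setT (EFin \o f) ->
  (\int[mu]_x (f x)%:E = (\int[mu]_x f x)%:E)%E.
Proof. by move=> intf; rewrite /Rintegral fineK// integrable_fin_num. Qed.

(** Integrability on every fiber, rather than on almost every one, makes the inner integral a
    real-valued function everywhere, so no null set has to be removed. *)
Lemma Rintegral_prod (R : realType) d1 d2 (T1 : measurableType d1)
    (T2 : measurableType d2) (m1 : {sigma_finite_measure set T1 -> \bar R})
    (m2 : {sigma_finite_measure set T2 -> \bar R}) (f : T1 * T2 -> R) :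
  (m1 \x m2)%E.-integrable setT (EFin \o f) ->
  (forall x, m2.-integrable setT (EFin \o (fun y => f (x, y)))) ->
  measurable_fun setT (fun x => \int[m2]_y f (x, y)) /\
  \int[(m1 \x m2)%E]_z f z = \int[m1]_x \int[m2]_y f (x, y).
Proof.
move=> intf intfx.
have e x : (\int[m2]_y (EFin \o f) (x, y) = (\int[m2]_y f (x, y))%:E)%E.
  exact: (integral_EFin_Rintegral (intfx x)).
have eF : fubini_F m2 (EFin \o f) = EFin \o (fun x => \int[m2]_y f (x, y)).
  by apply/funext => x; rewrite /fubini_F e.
split; first by apply/measurable_EFinP; rewrite -eF; apply: (@measurable_fubini_F _ _ _ _ _ m1).
by rewrite [LHS]/Rintegral -integral12_prod_meas1// eF.
Qed.

Section step.
Variable R : realType.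
Notation leb := (@lebesgue_measure R).
Notation RR := (measurableTypeR R).

Lemma measurable_indicator d (T : measurableType d) (f : T -> R) :
  measurable_fun setT f -> measurable_fun setT (fun x => (0 <= f x)%R%:R : R).
Proof.
move=> mf.
have mA : measurable [set x | 0 <= f x].
  rewrite (_ : [set x | _] = f @^-1` `[0, +oo[%classic); last first.
    by apply/seteqP; split => x /=; rewrite in_itv /= andbT.
  by rewrite -[_ @^-1` _]setTI; exact: mf.
rewrite (_ : (fun x => _) = \1_[set x | 0 <= f x]); first exact: measurable_indic.
apply/funext => x; rewrite indicE; congr (nat_of_bool _)%:R.
by apply/idP/idP; rewrite in_setE.
Qed.

(** The difference of indicators is, up to sign, the indicator of the interval between [u] and [v],
    where [f] is within [e] of [c]. The error is proportional to the length of that interval, hence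
    harmless after division by [t]. *)
Lemma step_integral_increasing (u v c e : R) (f : RR -> R) :
  measurable_fun setT f -> (exists C : R, forall r, `|f r| <= C) -> 0 <= e ->
  (forall r, `|r - u| <= `|u - v| -> `|f r - c| <= e) ->
  `|\int[leb]_r (((0 <= r - v)%R%:R - (0 <= r - u)%R%:R) * f r) - (u - v) * c|
    <= e * `|u - v|.
Proof.
move=> mf [C fC] e0 fe.
have key a b : a <= b -> (forall r, a <= r < b -> `|f r - c| <= e) ->
  `|\int[leb]_r ((a <= r < b)%R%:R * f r) - (b - a) * c| <= e * (b - a).
  move=> ab fab; pose I : set RR := `[a, b[%classic.
  have mI : measurable I by exact: measurable_itv.
  have lI : leb I = (b - a)%:E.
    rewrite lebesgue_measure_itv /= lte_fin; case: ifPn => [_|]; first by rewrite EFinB.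
    by rewrite -leNgt => ba; rewrite (le_anti (introT andP (conj ab ba))) subrr.
  have oneI : leb.-integrable I (EFin \o cst (1 : R)).
    apply: measurable_bounded_integrable => //; first by rewrite /= lI ltry.
    exact: bounded_cst.
  have intI (g : RR -> R) (M : R) : measurable_fun setT g -> (forall r, I r -> `|g r| <= M) ->
      leb.-integrable I (EFin \o g).
    move=> mg gM; apply: measurable_bounded_integrable => //.
    - by rewrite /= lI ltry.
    - exact: measurable_funS mg.
    - exists M; split; first exact: num_real.
      by move=> N MN x Ix /=; rewrite (le_trans (gM x Ix))// ltW.
  have cI k : \int[leb]_(r in I) (cst k r) = k * (b - a).
    by rewrite Rintegral_cst//= lI.
  rewrite (_ : \int[leb]_r _ = \int[leb]_(r in I) f r); last first.
    rewrite [RHS]Rintegral_mkcond; apply: eq_Rintegral => r _.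
    rewrite /patch; case: ifPn.
      by rewrite in_setE /I /= in_itv /= => ->; rewrite mul1r.
    move=> h; rewrite (_ : (a <= r < b) = false) ?mul0r//.
    by apply/negP => h'; move/negP: h; apply; rewrite in_setE /I /= in_itv.
  rewrite (mulrC _ c) -(cI c) -RintegralB//; last 2 first.
  - exact: (intI _ C).
  - by apply: (intI _ `|c|).
  apply: le_trans (le_normr_Rintegral _ _) _ => //.
    apply: (intI _ e); first exact: measurable_funB.
    by move=> r; rewrite /I /= in_itv /= => /fab.
  rewrite -(cI e); apply: le_Rintegral => //.
  - apply: (intI _ e); first by apply: measurableT_comp => //; exact: measurable_funB.
    by move=> r; rewrite /I /= in_itv /= normr_id => /fab.
  - by apply: (intI _ `|e|).
have [vu|uv] := leP v u.
  rewrite (_ : \int[leb]_r _ = \int[leb]_r ((v <= r < u)%R%:R * f r)).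
    rewrite [`|u - v|]ger0_norm ?subr_ge0//; apply: key => //.
    move=> r /andP[vr ru]; apply: fe.
    by rewrite ler_norml [`|u - v|]ger0_norm ?subr_ge0//; apply/andP; split; lra.
  apply: eq_Rintegral => r _; congr (_ * _); rewrite !subr_ge0.
  have [ur|ru] := leP u r; last by rewrite andbT subr0.
  by rewrite (le_trans vu ur) /= subrr.
rewrite (_ : \int[leb]_r _ = - \int[leb]_r ((u <= r < v)%R%:R * f r)).
  set A := \int[leb]_r _; rewrite (_ : - A - (u - v) * c = - (A - (v - u) * c)); last by ring.
  rewrite normrN [`|u - v|]ltr0_norm ?subr_lt0// opprB.
  apply: key => //; first exact: ltW.
  move=> r /andP[ur rv]; apply: fe.
  by rewrite ler_norml [`|u - v|]ltr0_norm ?subr_lt0//; apply/andP; split; lra.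
rewrite -[RHS]mulN1r -RintegralZl//.
  apply: eq_Rintegral => r _; rewrite mulrA; congr (_ * _); rewrite !subr_ge0.
  have [vr|rv] := leP v r; last by rewrite andbT sub0r mulN1r.
  by rewrite (le_trans (ltW uv) vr) /= subrr mulr0.
apply: (@integrable_bounded R _ RR leb (`[u, v[%classic : set RR) _ C) => //.
- by rewrite /= lebesgue_measure_itv /=; case: ifPn => _; rewrite -?EFinB ltry.
- apply: measurable_funM => //.
  rewrite (_ : (fun r : RR => _) = \1_(`[u, v[%classic : set RR)); first exact: measurable_indic.
  apply/funext => x; rewrite indicE; congr (nat_of_bool _)%:R.
  by apply/idP/idP; rewrite in_setE /= in_itv.
- move=> r; rewrite normrM normr_nat; case: (_ <= _ < _); rewrite ?mul1r ?mul0r//.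
  by rewrite (le_trans (normr_ge0 _) (fC r)).
- by move=> r /=; rewrite in_itv /= => /negP/negbTE ->; rewrite mul0r.
Qed.

(** The reflection [r -> - r] exchanges the two orientations of a half-line. *)
Lemma step_integral_decreasing (u v c e : R) (f : RR -> R) :
  measurable_fun setT f -> (exists C : R, forall r, `|f r| <= C) -> 0 <= e ->
  (forall r, `|r - u| <= `|u - v| -> `|f r - c| <= e) ->
  `|\int[leb]_r (((0 <= v - r)%R%:R - (0 <= u - r)%R%:R) * f r) - (v - u) * c|
    <= e * `|u - v|.
Proof.
move=> mf [C fC] e0 fe.
have mN : measurable_fun setT (fun r : RR => - r : RR) by exact: measurableT_comp.
have N10 : (-1 : R) != 0 by rewrite oppr_eq0 oner_eq0.
rewrite (has_jacobian_Rintegral (lebesgue_affine 0 N10)); last first.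
  apply: measurable_funM => //; apply: measurable_funB; apply: measurable_indicator;
  exact: measurable_funB.
rewrite normrN1 mul1r.
have := @step_integral_increasing (- u) (- v) c e (fun r => f (- r)) _ _ e0.
rewrite [- u - - v](_ : _ = v - u); last by ring.
rewrite [`|v - u|]distrC => H.
rewrite (_ : \int[leb]_r _ = \int[leb]_r (((0 <= r - - v)%R%:R - (0 <= r - - u)%R%:R) * f (- r))).
  apply: H.
  - exact: measurableT_comp mf mN.
  - by exists C.
  - by move=> r h; apply: fe; rewrite (_ : - r - u = - (r - - u)) ?normrN//; ring.
by apply: eq_Rintegral => r _; rewrite mulN1r addr0 !opprK ![_ + r]addrC.
Qed.

(* The half-line [0 <= l + k r] has boundary point [- l / k]. *)
Lemma halfline_integral (l l' k k' e c : R) (f : RR -> R) :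
  0 < k * k' ->
  measurable_fun setT f -> (exists C : R, forall r, `|f r| <= C) -> 0 <= e ->
  let u := - l / k in let v := - l' / k' in
  (forall r, `|r - u| <= `|u - v| -> `|f r - c| <= e) ->
  `|\int[leb]_r (((0 <= l' + k' * r)%R%:R - (0 <= l + k * r)%R%:R) * f r)
    - Num.sg k * (u - v) * c| <= e * `|u - v|.
Proof.
move=> kk mf fC e0 u v fe.
have k0 : k != 0 by apply: contraTneq kk => ->; rewrite mul0r ltxx.
have k'0 : k' != 0 by apply: contraTneq kk => ->; rewrite mulr0 ltxx.
have E r : l + k * r = k * (r - u) by rewrite /u; field.
have E' r : l' + k' * r = k' * (r - v) by rewrite /v; field.
have [kn|kp|/eqP] := ltgtP k 0; last by rewrite (negPf k0).
  have k'n : k' < 0 by rewrite nmulr_rgt0 in kk.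
  rewrite (ltr0_sg kn) mulN1r opprB; have := step_integral_decreasing mf fC e0 fe.
  rewrite (_ : \int[leb]_r _ = \int[leb]_r (((0 <= l' + k' * r)%R%:R - (0 <= l + k * r)%R%:R) * f r))//.
  apply: eq_Rintegral => r _; rewrite E E' !nmulr_rge0//.
  by rewrite !subr_ge0 !subr_le0.
have k'p : 0 < k' by rewrite pmulr_rgt0 in kk.
rewrite (gtr0_sg kp) mul1r; have := step_integral_increasing mf fC e0 fe.
rewrite (_ : \int[leb]_r _ = \int[leb]_r (((0 <= l' + k' * r)%R%:R - (0 <= l + k * r)%R%:R) * f r))//.
by apply: eq_Rintegral => r _; rewrite E E' !pmulr_rge0.
Qed.

End step.

Section moving_halfspace.
Context (R : realType) (d : measure_display) (X : measurableType d)
  (m : {sigma_finite_measure set X -> \bar R}).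
Notation leb := (@lebesgue_measure R).
Notation RR := (measurableTypeR R).
Variables (a0 b0 : X -> R) (al be : R) (F : R -> X * RR -> R) (B : set X)
  (C rho : R).
Hypothesis al0 : al != 0.
Hypothesis ma : measurable_fun setT a0.
Hypothesis mb : measurable_fun setT b0.
Hypothesis mB : measurable B.
Hypothesis finB : (m B < +oo)%E.
Hypothesis mF : forall t, measurable_fun setT (F t).
Hypothesis FC : forall t z, `|F t z| <= C.
Hypothesis suppF : forall t z, F t z != 0 -> B z.1 /\ `|z.2| <= rho.
Hypothesis aC : forall x, B x -> `|a0 x| <= C.
Hypothesis bC : forall x, B x -> `|b0 x| <= C.
Let h x := - a0 x / al.
Hypothesis cF : {ae m, forall x, B x ->
  {for (0, h x), continuous (fun q : R * R => F q.1 (x, q.2))}}.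

Let l t (z : X * RR) : R := a0 z.1 + t * b0 z.1 + (al + t * be) * z.2.
Let W t z : R := (0 <= l t z)%R%:R - (0 <= l 0 z)%R%:R.
(** For these [t] the perturbed slope has the sign of [al] and at least half its modulus, so every
    fiber meets the perturbed half-space in a half-line of the same orientation. *)
Let good t := `|al| ^+ 2 / 2 <= al * (al + t * be).
(** Bound for the velocity of the boundary point on a fiber: the numerator is bounded by means of
    [bC] and [hB], the denominator by [|al| / 2] for good [t]. *)
Let K := (C + `|be| * (C / `|al|)) / (`|al| / 2).

Let C0 : 0 <= C. Proof. by rewrite (le_trans (normr_ge0 _) (FC 0 (point, point))). Qed.

Let nal : 0 < `|al|. Proof. by rewrite normr_gt0. Qed.

Let K0 : 0 <= K.
Proof. by rewrite divr_ge0 ?divr_ge0// addr_ge0// mulr_ge0// divr_ge0. Qed.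

Let good_gt0 t : good t -> 0 < al * (al + t * be).
Proof. by apply: lt_le_trans; rewrite divr_gt0// exprn_gt0. Qed.

Let slope_neq0 t : good t -> al + t * be != 0.
Proof. by move/good_gt0; apply: contraTneq => ->; rewrite mulr0 ltxx. Qed.

Let hB x : B x -> `|h x| <= C / `|al|.
Proof. by move=> Bx; rewrite normrM normrN normfV ler_pM2r ?invr_gt0// aC. Qed.

Let root_diff t x : good t ->
  h x - - (a0 x + t * b0 x) / (al + t * be) = t * ((b0 x + be * h x) / (al + t * be)).
Proof. by move=> /slope_neq0 gt; rewrite /h; field; apply/andP. Qed.

Let quot_le t x : good t -> B x -> `|(b0 x + be * h x) / (al + t * be)| <= K.
Proof.
move=> gt Bx; rewrite normrM normfV; apply: ler_pM.
- exact: normr_ge0.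
- by rewrite invr_ge0.
- apply: le_trans (ler_normD _ _) _; apply: lerD; first exact: bC.
  by rewrite normrM ler_wpM2l// hB.
- rewrite lef_pV2 ?posrE ?normr_gt0 ?slope_neq0// ?divr_gt0//.
  rewrite -(ler_pM2l nal) -normrM (gtr0_norm (good_gt0 gt)).
  by apply: le_trans gt; rewrite expr2 mulrA.
Qed.

Let mW t : measurable_fun setT (W t).
Proof.
have mla s : measurable_fun setT (l s).
  apply: measurable_funD; last exact: measurable_funM.
  apply: measurable_funD; first exact: measurableT_comp.
  by apply: measurable_funM => //; exact: measurableT_comp.
by apply: measurable_funB; exact: measurable_indicator.
Qed.

Let W1 t z : `|W t z| <= 1.
Proof. by rewrite /W; case: (0 <= l t z); case: (0 <= l 0 z); rewrite /=  ?subrr ?subr0 ?sub0r ?normrN ?normr0 ?normr1. Qed.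

Let mWF t : measurable_fun setT (fun z => W t z * F t z).
Proof. by apply: measurable_funM; [exact: mW|exact: mF]. Qed.

Let WFC t z : `|W t z * F t z| <= C.
Proof. by rewrite normrM -[leRHS]mul1r ler_pM ?W1 ?FC. Qed.

Let I : set RR := `[- rho, rho]%classic.
Let mI : measurable I. Proof. exact: measurable_itv. Qed.
Let finI : (leb I < +oo)%E.
Proof. by rewrite lebesgue_measure_itv /=; case: ifPn => _; rewrite -?EFinB ltry. Qed.

Let int_prod t : (m \x leb)%E.-integrable setT (EFin \o (fun z => W t z * F t z)).
Proof.
apply: (@integrable_bounded R _ _ (m \x leb)%E (B `*` I) _ C) => //.
- exact: measurableX.
- by rewrite /= product_measure1E// lte_mul_pinfty// ge0_fin_numE.
- move=> z nz; apply/eqP; rewrite mulf_eq0; apply/orP; right.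
  apply/negPn/negP => /suppF [Bz zr]; apply: nz; split => //.
  by rewrite /I /= in_itv /= -ler_norml.
Qed.

Let int_fib t x : leb.-integrable setT (EFin \o (fun r : RR => W t (x, r) * F t (x, r))).
Proof.
apply: (@integrable_bounded R _ RR leb I _ C) => //.
- exact: measurableT_comp (mWF t) (pair1_measurable x).
- move=> r nr; apply/eqP; rewrite mulf_eq0; apply/orP; right.
  apply/negPn/negP => /suppF [_ zr]; apply: nr.
  by rewrite /I /= in_itv /= -ler_norml.
Qed.

Let J t x := \int[leb]_r (W t (x, r) * F t (x, r)).

Let J_near t x c e : good t -> B x -> 0 <= e ->
  (forall r, `|r - h x| <= `|t| * K -> `|F t (x, r) - c| <= e) ->
  `|J t x - Num.sg al * (t * ((b0 x + be * h x) / (al + t * be))) * c| <= e * (`|t| * K).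
Proof.
move=> gt Bx e0 Fe.
have hv : `|h x - - (a0 x + t * b0 x) / (al + t * be)| <= `|t| * K.
  by rewrite root_diff// normrM ler_wpM2l// quot_le.
have := @halfline_integral R (a0 x) (a0 x + t * b0 x) al (al + t * be) e c
  (fun r => F t (x, r)) (good_gt0 gt) _ _ e0.
move=> H; have {}H := H _ _ _.
rewrite (_ : J t x = \int[leb]_r (((0 <= a0 x + t * b0 x + (al + t * be) * r)%R%:R -
   (0 <= a0 x + al * r)%R%:R) * F t (x, r))); last first.
  by apply: eq_Rintegral => r _; rewrite /W /l /= !mul0r !addr0.
rewrite -root_diff//; apply: le_trans (H _ _ _) _.
- exact: measurableT_comp (mF t) (pair1_measurable x).
- by exists C => r; exact: FC.
- by move=> r rh; apply: Fe; exact: le_trans rh hv.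
- by rewrite ler_wpM2l.
Qed.

Let J_le t x : good t -> `|J t x| <= C * (`|t| * K) * \1_B x.
Proof.
move=> gt; rewrite indicE; case: (boolP (x \in B)) => Bx.
  rewrite mulr1; have := @J_near t x 0 C gt _ C0.
  rewrite mulr0 subr0; apply; first by rewrite in_setE in Bx.
  by move=> r _; rewrite subr0.
rewrite mulr0 /J (_ : \int[leb]_r _ = \int[leb]_(r in setT) cst 0 r).
  by rewrite Rintegral_cst// mul0r normr0.
apply: eq_Rintegral => r _; apply/eqP; rewrite mulf_eq0; apply/orP; right.
by apply/negPn/negP => /suppF [Bx' _]; move: Bx; rewrite notin_setE.
Qed.

Let G x := F 0 (x, h x) * ((b0 x + be * h x) / `|al|).

Let mG : measurable_fun setT G.
Proof.
have mh : measurable_fun setT h by apply: measurable_funM => //; exact: measurableT_comp.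
apply: measurable_funM.
  by apply: (measurableT_comp (mF 0)); apply/measurable_fun_pair.
apply: measurable_funM => //; apply: measurable_funD => //.
exact: measurable_funM.
Qed.

(** Only points at distance at most [|t| * K] from [h x] contribute on the fiber over [x], and there
    joint continuity in the parameter and the point makes the integrand close to [F 0 (x, h x)]. *)
Let ptwise (u : R^nat) x : (forall n, u n != 0) -> (forall n, good (u n)) ->
  u n @[n --> \oo] --> 0 -> B x ->
  {for (0, h x), continuous (fun q : R * R => F q.1 (x, q.2))} ->
  (u n)^-1 * J (u n) x @[n --> \oo] --> G x.
Proof.
move=> un0 gu u0 Bx cx.
pose c := F 0 (x, h x).
pose A n := Num.sg al * ((b0 x + be * h x) / (al + u n * be)).
have cvgA : A n * c @[n --> \oo] --> G x.
  rewrite (_ : G x = Num.sg al * ((b0 x + be * h x) / al) * c); last first.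
    rewrite /G mulrC; congr (_ * _).
    have [an|ap|/eqP] := ltgtP al 0; last by rewrite (negPf al0).
      by rewrite ltr0_sg// ltr0_norm// invrN mulrN mulN1r.
    by rewrite gtr0_sg// gtr0_norm// mul1r.
  apply: cvgMl; apply: cvgMr; apply: cvgMr; apply: cvgV => //.
  rewrite -[X in _ --> X]addr0 -[X in _ + X](mul0r be).
  by apply: cvgD; [exact: cvg_cst|apply: cvgMl].
have cvgE : (u n)^-1 * J (u n) x - A n * c @[n --> \oo] --> 0.
  apply/cvgr0Pnorm_le => /= e e0.
  (* [K + 1] replaces [K], which may be 0, as a divisor. *)
  have eK : 0 < e / (K + 1) by rewrite divr_gt0// ltr_wpDl.
  have /cvgrPdist_le /(_ _ eK) := cx.
  move=> /nbhs_ballP [dl dl0 Hd].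
  have dK : 0 < dl / (K + 1) by rewrite divr_gt0// ltr_wpDl.
  move/cvgr0Pnorm_lt : u0 => /(_ _ dK) [N _ uN].
  exists N => // n /= /uN uNn.
  have K1 : 0 < K + 1 by rewrite ltr_wpDl.
  have tK : `|u n| * K < dl.
    rewrite (le_lt_trans (y := `|u n| * (K + 1)))// ?ler_wpM2l ?lerDl//.
    by rewrite -ltr_pdivlMr.
  have t1 : `|u n| < dl.
    by move: dl0 => /= dl0; rewrite (lt_le_trans uNn)// ler_pdivrMr//; have := K0; nra.
  have := @J_near (u n) x c (e / (K + 1)) (gu n) Bx (ltW eK).
  move=> H; have {}H := H _.
  rewrite (_ : _ - _ = (u n)^-1 * (J (u n) x - Num.sg al * (u n * ((b0 x + be * h x) / (al + u n * be))) * c)); last first.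
    by rewrite /A; field; rewrite un0 slope_neq0.
  rewrite normrM normfV ler_pdivrMl ?normr_gt0//.
  apply: le_trans (H _) _.
    move=> r rh; rewrite distrC; apply: (Hd (u n, r)); split => /=.
      by rewrite /ball /= sub0r normrN.
    by rewrite /ball /= distrC (le_lt_trans rh).
  rewrite mulrCA ler_wpM2l// -mulrA -[leRHS]mulr1 ler_wpM2l ?(ltW e0)//.
  by rewrite mulrC ler_pdivrMr// mul1r lerDl.
rewrite -[X in _ --> X]addr0; apply: cvg_trans (cvgD cvgA cvgE).
by apply: near_eq_cvg; near=> n; rewrite addrC subrK.
Unshelve. all: by end_near. Qed.

(** Dominated convergence over the fibers with the majorant [C * K] on [B], which is why the
    parameter runs through a sequence. *)
Let seq_cvg (u : R^nat) : (forall n, u n != 0) -> (forall n, good (u n)) ->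
  u n @[n --> \oo] --> 0 ->
  (u n)^-1 * \int[(m \x leb)%E]_z (W (u n) z * F (u n) z) @[n --> \oo] --> \int[m]_x G x.
Proof.
move=> un0 gu u0.
have fub t := Rintegral_prod (int_prod t) (int_fib t).
have mJ t : measurable_fun setT (J t) by have [] := fub t.
have bnd n x : `|(u n)^-1 * J (u n) x| <= C * K * \1_B x.
  rewrite normrM normfV ler_pdivrMl ?normr_gt0//.
  by apply: le_trans (J_le x (gu n)) _; rewrite !mulrA [C * _]mulrC.
have intg : m.-integrable setT (EFin \o (fun x => C * K * \1_B x)).
  apply: (@integrable_bounded R _ X m B _ (C * K)) => //.
  - by apply: measurable_funM => //; exact: measurable_indic.
  - move=> x; rewrite indicE normrM (ger0_norm (mulr_ge0 C0 K0)).
    by case: (x \in B); rewrite ?normr1 ?normr0 ?mulr1 ?mulr0// mulr_ge0.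
  - by move=> x Bx; rewrite indicE memNset// mulr0.
have intJ n : m.-integrable setT (EFin \o (fun x => (u n)^-1 * J (u n) x)).
  apply: (@le_integrable _ _ _ m setT _ _ (EFin \o (fun x => C * K * \1_B x))) => //.
    by apply/measurable_EFinP; exact: measurable_funM.
  by move=> x _ /=; rewrite lee_fin (le_trans (bnd n x))// ler_norm.
have intJ' n : m.-integrable setT (EFin \o J (u n)).
  rewrite (_ : EFin \o J (u n) = (fun x => (u n)%:E * (EFin \o (fun x => (u n)^-1 * J (u n) x)%R) x)%E).
    exact: integrableZl.
  by apply/funext => x /=; rewrite -EFinM mulrA divff// mul1r.
have mJn n : measurable_fun setT (fun x => ((u n)^-1 * J (u n) x)%:E).
  by apply/measurable_EFinP; exact: measurable_funM.
have mGe : measurable_fun setT (fun x => (G x)%:E) by apply/measurable_EFinP.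
have ptw : {ae m, forall x, setT x -> ((u n)^-1 * J (u n) x)%:E @[n --> \oo] --> (G x)%:E}.
  move: cF; apply: filterS => x cx _; apply/fine_cvgP; split; first exact: nearW.
  have [Bx|nBx] := pselect (B x); first exact: (ptwise un0 gu u0 Bx (cx Bx)).
  have F0 t r : F t (x, r) = 0.
    by apply/eqP/negPn/negP => /suppF [].
  rewrite (_ : _ \o _ = cst 0); last first.
    apply/funext => n /=; apply/eqP; rewrite mulf_eq0; apply/orP; right.
    have := J_le x (gu n); rewrite indicE memNset// mulr0 => h0.
    by rewrite -normr_eq0 eq_le h0 normr_ge0.
  by rewrite /G F0 mul0r; exact: cvg_cst.
have dom : {ae m, forall x n, setT x -> (`|((u n)^-1 * J (u n) x)%:E| <= (C * K * \1_B x)%:E)%E}.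
  by apply: aeW => x n _; rewrite lee_fin.
have [intG _ cv] := dominated_convergence measurableT mJn mGe ptw intg dom.
rewrite (_ : (fun n => _) = (fun n => \int[m]_x ((u n)^-1 * J (u n) x))); last first.
  by apply/funext => n; rewrite (fub _).2 [RHS]RintegralZl//; exact: intJ'.
apply: fine_cvg; rewrite fineK; last exact: integrable_fin_num.
exact: cv.
Qed.

(* [h x] is the point of the fiber over [x] where the unperturbed affine
   function vanishes. *)
Lemma moving_halfspace :
  t^-1 * \int[(m \x leb)%E]_z
     (((0 <= a0 z.1 + t * b0 z.1 + (al + t * be) * z.2)%R%:R
       - (0 <= a0 z.1 + al * z.2)%R%:R) * F t z) @[t --> (0 : R)^'] -->
  \int[m]_x (F 0 (x, - a0 x / al) * ((b0 x + be * (- a0 x / al)) / `|al|)).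
Proof.
apply/cvgr_dnbhsP => u [un0 u0].
rewrite (_ : (fun n => _) =
  (fun n => (u n)^-1 * \int[(m \x leb)%E]_z (W (u n) z * F (u n) z))); last first.
  apply/funext => n; congr (_ * _); apply: eq_Rintegral => z _.
  by rewrite /W /l !mul0r !addr0.
(* Once [|u n| < |al| / (2 * (|be| + 1))], the term [al * (u n * be)] is at most [|al| ^+ 2 / 2] in
   modulus, which is what [good] asks. *)
have [N HN] : exists N, forall n, (N <= n)%N -> good (u n).
  have b1 : 0 < `|be| + 1 by rewrite ltr_wpDl.
  have dd : 0 < `|al| / (2 * (`|be| + 1)) by rewrite divr_gt0// mulr_gt0.
  move/cvgr0Pnorm_lt : u0 => /(_ _ dd) [N _ uN].
  exists N => n /uN /=; rewrite ltr_pdivlMr ?mulr_gt0// => h1.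
  rewrite /good real_normK ?num_real// mulrDr -expr2.
  have : `|al * (u n * be)| <= `|al| * (`|al| / 2).
    rewrite !normrM ler_wpM2l// ler_pdivlMr//.
    apply: le_trans (ltW h1); rewrite -mulrA ler_wpM2l// mulrC ler_wpM2l//.
    by rewrite lerDl.
  rewrite ler_norml => /andP[h2 _].
  move: h2; rewrite mulrA -expr2 real_normK ?num_real//; lra.
rewrite -(cvg_shiftn N) /=; apply: (seq_cvg (u := fun n => u (n + N)%N)) => //.
- by move=> n; apply: HN; rewrite leq_addl.
- by rewrite (cvg_shiftn N).
Qed.

End moving_halfspace.

Lemma continuous_indicator (R : realType) (T : topologicalType) (f : T -> R) (p : T) :
  {for p, continuous f} -> f p != 0 ->
  {for p, continuous (fun q => (0 <= f q)%R%:R : R)}.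
Proof.
move=> cf fp0; have nf : 0 < `|f p| by rewrite normr_gt0.
have H : \forall q \near p, (0 <= f q) = (0 <= f p).
  move/cvgrPdist_lt : (cf) => /(_ _ nf); apply: filterS => q.
  have [fn|fpos|/eqP] := ltgtP (f p) 0; last by rewrite (negPf fp0).
    rewrite (ltr0_norm fn) ltr_norml => /andP[h1 h2].
    by apply/negbTE; rewrite -ltNge; lra.
  by rewrite (gtr0_norm fpos) ltr_norml => /andP[h1 h2]; apply/idP; lra.
rewrite /continuous_at; apply: cvg_trans (cvg_cst _).
apply: near_eq_cvg; apply: filterS H => q ->//.
exact: nbhs_filter.
Qed.

Lemma continuous_pair_at (T U V : topologicalType) (f : T -> U) (g : T -> V) (p : T) :
  {for p, continuous f} -> {for p, continuous g} ->
  {for p, continuous (fun q => (f q, g q))}.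
Proof. by move=> cf cg; rewrite /prop_for /continuous_at; exact: (cvg_pair cf cg). Qed.

(** * Moving half-planes and half-spaces in Cartesian coordinates *)

Section affine_functions.
Variable R : realType.
Notation leb := (@lebesgue_measure R).
Notation RR := (measurableTypeR R).
Notation leb2 := (@leb2 R).
Notation leb3 := (@leb3 R).

Definition aff2 (a : R * R * R) (y : R * R) : R := a.1.1 + a.1.2 * y.1 + a.2 * y.2.

Definition aff3 (a : R * R * R * R) (y : R * R * R) : R :=
  a.1.1.1 + a.1.1.2 * y.1.1 + a.1.2 * y.1.2 + a.2 * y.2.

(* The zero of [aff2 a] on the line [(x, 0) + R (d, 1)]. *)
Definition line_zero (a : R * R * R) (d x : R) : R * R :=
  let h := - (a.1.1 + a.1.2 * x) / (a.1.2 * d + a.2) in (x + h * d, h).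

(* The zero of [aff3 a] on the line [(x, 0) + R (d1, d2, 1)]. *)
Definition plane_zero (a : R * R * R * R) (d : R * R) (x : R * R) : R * R * R :=
  let h := - (a.1.1.1 + a.1.1.2 * x.1 + a.1.2 * x.2) /
           (a.1.1.2 * d.1 + a.1.2 * d.2 + a.2) in
  (x.1 + h * d.1, x.2 + h * d.2, h).

Lemma measurable_aff2 a : measurable_fun setT (aff2 a : RR * RR -> R).
Proof.
apply: measurable_funD; last exact: measurable_funM.
by apply: measurable_funD => //; exact: measurable_funM.
Qed.

Lemma measurable_aff3 a : measurable_fun setT (aff3 a : RR * RR * RR -> R).
Proof.
apply: measurable_funD; last exact: measurable_funM.
apply: measurable_funD; last by apply: measurable_funM => //; exact: measurableT_comp.
by apply: measurable_funD => //; apply: measurable_funM => //; exact: measurableT_comp.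
Qed.

Lemma interval_lty (r : R) : (leb (`[(- r)%R, r]%classic : set RR) < +oo)%E.
Proof. by rewrite /= lebesgue_measure_itv /=; case: ifPn => _; rewrite -?EFinB ltry. Qed.

(** A shear turns the direction [(d, 1)] into the second axis. The free parameter [d] makes room for
    half-planes whose boundary is parallel to that axis, where [a.2] is 0. *)
Lemma moving_halfplane (a b : R * R * R) (d : R) (F : R -> R * R -> R) (C rho : R) :
  a.1.2 * d + a.2 != 0 ->
  (forall t, measurable_fun setT (F t : RR * RR -> R)) ->
  (forall t y, `|F t y| <= C) ->
  (forall t y, F t y != 0 -> `|y.1| <= rho /\ `|y.2| <= rho) ->
  {ae leb, forall x, {for (0, line_zero a d x),
     continuous (fun q : R * (R * R) => F q.1 q.2)}} ->
  t^-1 * \int[leb2]_y (((0 <= aff2 a y + t * aff2 b y)%R%:R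
       - (0 <= aff2 a y)%R%:R) * F t y) @[t --> (0 : R)^'] -->
  \int[leb]_x (F 0 (line_zero a d x) *
    (aff2 b (line_zero a d x) / `|a.1.2 * d + a.2|)).
Proof.
move=> al0 mF FC suppF cF.
have J : has_jacobian leb2 leb2 (fun w : RR * RR => (w.1 + w.2 * d : RR, w.2)) 1.
  have := @lebesgue2_affine R 0 0 1 d 0 1.
  rewrite mul1r mulr0 subr0 normr1 oner_neq0 => /(_ isT); congr (has_jacobian _ _ _ _).
  by apply/funext => -[x y] /=; congr (_, _); ring.
have mL : measurable_fun setT (fun w : RR * RR => (w.1 + w.2 * d : RR, w.2)) by case: J.
pose r1 := `|rho| + `|rho| * `|d|.
have r10 : 0 <= r1 by rewrite addr_ge0// mulr_ge0.
pose I : set RR := `[- r1, r1]%classic.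
pose D := Num.max C (Num.max (`|a.1.1| + `|a.1.2| * r1) (`|b.1.1| + `|b.1.2| * r1)).
have bnd (u v x : R) : I x -> `|u + v * x| <= `|u| + `|v| * r1.
  rewrite /I /= in_itv /= -ler_norml => xr.
  by rewrite (le_trans (ler_normD _ _))// lerD2l normrM ler_wpM2l.
pose h x := - (a.1.1 + a.1.2 * x) / (a.1.2 * d + a.2).
rewrite (_ : \int[leb]_x _ = \int[leb]_x (F 0 (x + h x * d, h x) *
    ((b.1.1 + b.1.2 * x + (b.1.2 * d + b.2) * h x) / `|a.1.2 * d + a.2|))); last first.
  by apply: eq_Rintegral => x _; rewrite /line_zero /aff2 /= -/(h x); congr (_ * (_ / _)); ring.
have := @moving_halfspace R _ RR leb (fun x => a.1.1 + a.1.2 * x)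
  (fun x => b.1.1 + b.1.2 * x) (a.1.2 * d + a.2) (b.1.2 * d + b.2)
  (fun t z => F t (z.1 + z.2 * d, z.2)) I D rho al0.
move=> H; have {}H := H _ _ _ _ _ _ _ _ _ _.
apply: cvg_trans; last first.
  apply: H.
  - by apply: measurable_funD => //; exact: measurable_funM.
  - by apply: measurable_funD => //; exact: measurable_funM.
  - exact: measurable_itv.
  - exact: interval_lty.
  - by move=> t; exact: measurableT_comp (mF t) mL.
  - by move=> t z; rewrite /D le_max FC.
  - move=> t [x r] /= /suppF /= [h1 h2]; split => //; rewrite /I /= in_itv /= -ler_norml.
    have -> : x = (x + r * d) - r * d by rewrite addrK.
    rewrite (le_trans (ler_normB _ _))// lerD//; first by rewrite (le_trans h1)// ler_norm.
    by rewrite normrM ler_wpM2r// (le_trans h2)// ler_norm.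
  - by move=> x Ix; rewrite /D !le_max bnd// orbT.
  - by move=> x Ix; rewrite /D !le_max bnd// !orbT.
  - apply: negligibleS cF => x /= nP cx; apply: nP => _.
    apply: (@continuous_comp _ _ _ (fun q : R * R => (q.1, (x + q.2 * d, q.2)))
      (fun q : R * (R * R) => F q.1 q.2)); last exact: cx.
    apply: continuous_pair_at => /=; first exact: cvg_fst.
    apply: continuous_pair_at => /=; last exact: cvg_snd.
    by apply: cvgD; [exact: cvg_cst|apply: cvgMl; exact: cvg_snd].
apply: near_eq_cvg; apply: nearW => t; congr (_ * _).
rewrite [RHS](has_jacobian_Rintegral J); last first.
  apply: measurable_funM => //; apply: measurable_funB; apply: measurable_indicator.
    apply: measurable_funD; first exact: measurable_aff2.
    by apply: measurable_funM => //; exact: measurable_aff2.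
  exact: measurable_aff2.
rewrite mul1r; apply: eq_Rintegral => -[x r] _ /=; rewrite /aff2 /=.
by congr ((_ - _) * _); congr (_%:R); congr (nat_of_bool _); congr (_ <= _); ring.
Qed.

(** The same reduction by a shear, now in space. The integrand is fixed because in the volume terms
    of the bilinear form only the domain depends on [t]. *)
Lemma moving_halfspace3 (a b : R * R * R * R) (d : R * R) (F : R * R * R -> R)
    (C rho : R) :
  a.1.1.2 * d.1 + a.1.2 * d.2 + a.2 != 0 ->
  measurable_fun setT (F : RR * RR * RR -> R) ->
  (forall y, `|F y| <= C) ->
  (forall y, F y != 0 -> [/\ `|y.1.1| <= rho, `|y.1.2| <= rho & `|y.2| <= rho]) ->
  {ae leb2, forall x, {for plane_zero a d x, continuous F}} ->
  t^-1 * \int[leb3]_y (((0 <= aff3 a y + t * aff3 b y)%R%:R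
       - (0 <= aff3 a y)%R%:R) * F y) @[t --> (0 : R)^'] -->
  \int[leb2]_x (F (plane_zero a d x) *
    (aff3 b (plane_zero a d x) / `|a.1.1.2 * d.1 + a.1.2 * d.2 + a.2|)).
Proof.
move=> al0 mF FC suppF cF.
have J := lebesgue3_shear d.1 d.2.
have mL : measurable_fun setT (fun w : RR * RR * RR =>
  (w.1.1 + w.2 * d.1 : RR, w.1.2 + w.2 * d.2 : RR, w.2)) by case: J.
pose r1 := `|rho| + `|rho| * (`|d.1| + `|d.2|).
have r10 : 0 <= r1 by rewrite addr_ge0// mulr_ge0// addr_ge0.
pose I : set (RR * RR) := (`[- r1, r1]%classic : set RR) `*` (`[- r1, r1]%classic : set RR).
pose D := Num.max C (Num.max (`|a.1.1.1| + `|a.1.1.2| * r1 + `|a.1.2| * r1)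
  (`|b.1.1.1| + `|b.1.1.2| * r1 + `|b.1.2| * r1)).
have bnd (u v v' : R) (x : RR * RR) : I x ->
    `|u + v * x.1 + v' * x.2| <= `|u| + `|v| * r1 + `|v'| * r1.
  rewrite /I /= !in_itv /= -!ler_norml => -[xr yr].
  rewrite (le_trans (ler_normD _ _))// lerD//; last by rewrite normrM ler_wpM2l.
  by rewrite (le_trans (ler_normD _ _))// lerD2l normrM ler_wpM2l.
have maff (u v v' : R) : measurable_fun setT (fun x : RR * RR => u + v * x.1 + v' * x.2).
  by apply: (measurable_aff2 (u, v, v')).
pose h (x : RR * RR) := - (a.1.1.1 + a.1.1.2 * x.1 + a.1.2 * x.2) / (a.1.1.2 * d.1 + a.1.2 * d.2 + a.2).
rewrite (_ : \int[_]_x _ = \int[leb2]_x (F (x.1 + h x * d.1, x.2 + h x * d.2, h x) *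
    ((b.1.1.1 + b.1.1.2 * x.1 + b.1.2 * x.2 + (b.1.1.2 * d.1 + b.1.2 * d.2 + b.2) * h x)
      / `|a.1.1.2 * d.1 + a.1.2 * d.2 + a.2|))); last first.
  by apply: eq_Rintegral => x _; rewrite /plane_zero /aff3 /= -/(h x); congr (_ * (_ / _)); ring.
have := @moving_halfspace R _ (RR * RR)%type (sleb2 R)
  (fun x => a.1.1.1 + a.1.1.2 * x.1 + a.1.2 * x.2)
  (fun x => b.1.1.1 + b.1.1.2 * x.1 + b.1.2 * x.2)
  (a.1.1.2 * d.1 + a.1.2 * d.2 + a.2) (b.1.1.2 * d.1 + b.1.2 * d.2 + b.2)
  (fun t z => F (z.1.1 + z.2 * d.1, z.1.2 + z.2 * d.2, z.2)) I D rho al0.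
move=> H; have {}H := H _ _ _ _ _ _ _ _ _ _.
apply: cvg_trans; last first.
  apply: H.
  - exact: maff.
  - exact: maff.
  - by apply: measurableX; exact: measurable_itv.
  - rewrite /= /leb2 product_measure1E//; try exact: measurable_itv.
    by rewrite lte_mul_pinfty// ?ge0_fin_numE// interval_lty.
  - by move=> t; exact: measurableT_comp mF mL.
  - by move=> t z; rewrite /D le_max FC.
  - move=> t [[x y] r] /= /suppF /= [h1 h2 h3]; split => //.
    have dd (s e : R) : `|s + r * e| <= rho -> `|e| <= `|d.1| + `|d.2| -> `|s| <= r1.
      move=> hs he; have -> : s = (s + r * e) - r * e by rewrite addrK.
      rewrite (le_trans (ler_normB _ _))// lerD//; first by rewrite (le_trans hs)// ler_norm.
      by rewrite normrM ler_pM// (le_trans h3)// ler_norm.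
    by rewrite /I /= !in_itv /= -!ler_norml; split;
      [apply: dd h1 _; rewrite lerDl|apply: dd h2 _; rewrite lerDr].
  - by move=> x Ix; rewrite /D !le_max bnd// orbT.
  - by move=> x Ix; rewrite /D !le_max bnd// !orbT.
  - apply: negligibleS cF => x /= nP cx; apply: nP => _.
    apply: (@continuous_comp _ _ _ (fun q : R * R => (x.1 + q.2 * d.1, x.2 + q.2 * d.2, q.2))
      F); last exact: cx.
    apply: continuous_pair_at => /=; last exact: cvg_snd.
    apply: continuous_pair_at => /=;
    by apply: cvgD; [exact: cvg_cst|apply: cvgMl; exact: cvg_snd].
apply: near_eq_cvg; apply: nearW => t; congr (_ * _).
rewrite [RHS](has_jacobian_Rintegral J); last first.
  apply: measurable_funM => //; apply: measurable_funB; apply: measurable_indicator.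
    apply: measurable_funD; first exact: measurable_aff3.
    by apply: measurable_funM => //; exact: measurable_aff3.
  exact: measurable_aff3.
rewrite mul1r; apply: eq_Rintegral => -[[x y] r] _ /=; rewrite /aff3 /=.
by congr ((_ - _) * _); congr (_%:R); congr (nat_of_bool _); congr (_ <= _); ring.
Qed.

Definition box2 (rho : R) : set (RR * RR) :=
  (`[- rho, rho]%classic : set RR) `*` (`[- rho, rho]%classic : set RR).

Lemma measurable_box2 rho : measurable (box2 rho).
Proof. by apply: measurableX; exact: measurable_itv. Qed.

Lemma box2_lty rho : (leb2 (box2 rho) < +oo)%E.
Proof.
rewrite /leb2 /box2 product_measure1E//; try exact: measurable_itv.
by rewrite lte_mul_pinfty// ?ge0_fin_numE// interval_lty.
Qed.

Lemma box2P rho (y : R * R) : box2 rho y <-> `|y.1| <= rho /\ `|y.2| <= rho.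
Proof. by rewrite /box2 /= !in_itv /= -!ler_norml. Qed.

Lemma integrable_box2 (f : RR * RR -> R) (C rho : R) :
  measurable_fun setT f -> (forall y, `|f y| <= C) ->
  (forall y, f y != 0 -> `|y.1| <= rho /\ `|y.2| <= rho) ->
  leb2.-integrable setT (EFin \o f).
Proof.
move=> mf fC f0.
apply: (@integrable_bounded R _ (RR * RR)%type leb2 (box2 rho) _ C) => //.
- exact: measurable_box2.
- exact: box2_lty.
- by move=> y nb; apply/eqP/negPn/negP => /f0 /box2P.
Qed.

Lemma measurable_prod_seq d (T : measurableType d) (I : Type) (s : seq I) (P : pred I) (f : I -> T -> R) :
  (forall i, measurable_fun setT (f i)) ->
  measurable_fun setT (fun x => \prod_(i <- s | P i) f i x).
Proof.
move=> mf; elim: s => [|i s IH].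
  by rewrite (_ : (fun _ => _) = cst 1)//; apply/funext => x; rewrite big_nil.
rewrite (_ : (fun _ => _) = (fun x => (if P i then f i x else 1) * \prod_(j <- s | P j) f j x)).
  by apply: measurable_funM => //; case: (P i).
by apply/funext => x; rewrite big_cons; case: (P i); rewrite ?mul1r.
Qed.

End affine_functions.

(** * Moving polygons *)

Lemma cvg_sum_seq (K : numFieldType) (V : normedModType K) (T : Type)
    (F : set_system T) (I : Type) (s : seq I) (P : pred I) (f : I -> T -> V)
    (l : I -> V) : Filter F ->
  (forall i, P i -> f i x @[x --> F] --> l i) ->
  \sum_(i <- s | P i) f i x @[x --> F] --> \sum_(i <- s | P i) l i.
Proof.
move=> FF fl; elim: s => [|i s IH].
  rewrite big_nil (_ : (fun _ => _) = fun=> 0); first exact: cvg_cst.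
  by apply/funext => x; rewrite big_nil.
rewrite (_ : (fun _ => _) = (fun x => (if P i then f i x else 0) + \sum_(j <- s | P j) f j x)).
  rewrite big_cons; case: ifPn => Pi; first by apply: cvgD IH; exact: fl.
  by under eq_fun do rewrite add0r.
by apply/funext => x; rewrite big_cons; case: (P i); rewrite ?add0r.
Qed.

Lemma continuous_prod_seq (R : realType) (T : topologicalType) (I : Type)
    (s : seq I) (P : pred I) (f : I -> T -> R) (p : T) :
  (forall i, P i -> {for p, continuous (f i)}) ->
  {for p, continuous (fun x => \prod_(i <- s | P i) f i x)}.
Proof.
move=> cf; elim: s => [|i s IH].
  rewrite (_ : (fun _ => _) = fun=> 1); last by apply/funext => x; rewrite big_nil.
  exact: cvg_cst.
rewrite (_ : (fun _ => _) = (fun x => (if P i then f i x else 1) * \prod_(j <- s | P j) f j x)).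
  apply: cvgM; last exact: IH.
  by case: ifPn => Pi; [exact: cf|exact: cvg_cst].
by apply/funext => x; rewrite big_cons; case: (P i); rewrite ?mul1r.
Qed.

Lemma prod_indicator_bound (R : realType) (I : Type) (s : seq I) (P : pred I) (f : I -> bool) :
  `|\prod_(i <- s | P i) (f i)%:R : R| <= 1.
Proof.
elim: s => [|i s IH]; first by rewrite big_nil normr1.
rewrite big_cons; case: (P i) => //; rewrite normrM -[leRHS]mulr1.
by apply: ler_pM => //; case: (f i); rewrite ?normr1 ?normr0.
Qed.

Lemma integrable_EFinB (R : realType) d (T : measurableType d)
    (mu : {measure set T -> \bar R}) (f g : T -> R) :
  mu.-integrable setT (EFin \o f) -> mu.-integrable setT (EFin \o g) ->
  mu.-integrable setT (EFin \o (fun x => f x - g x)).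
Proof. by move=> hf hg; have := integrableB measurableT hf hg; apply: eq_integrable. Qed.

Lemma integrable_EFinZl (R : realType) d (T : measurableType d)
    (mu : {measure set T -> \bar R}) (c : R) (f : T -> R) :
  mu.-integrable setT (EFin \o f) ->
  mu.-integrable setT (EFin \o (fun x => c * f x)).
Proof. by move=> hf; have := integrableZl measurableT c hf; apply: eq_integrable. Qed.

Section moving_polygon.
Variable R : realType.
Notation leb := (@lebesgue_measure R).
Notation RR := (measurableTypeR R).
Notation leb2 := (@leb2 R).
Variables (n : nat) (a b : 'I_n -> R * R * R) (d : 'I_n -> R)
  (F : R -> R * R -> R) (dF : R * R -> R) (C rho : R).
Let slope i := (a i).1.2 * d i + (a i).2.
Hypothesis slope0 : forall i, slope i = 0 ->
  [/\ (a i).1.2 = 0, (a i).2 = 0 & (a i).1.1 != 0].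
Hypothesis transversal : forall i j, i != j -> slope i != 0 ->
  exists x, aff2 (a j) (line_zero (a i) (d i) x) != 0.
Hypothesis mF : forall t, measurable_fun setT (F t : RR * RR -> R).
Hypothesis FC : forall t y, `|F t y| <= C.
Hypothesis suppF : forall t y, F t y != 0 -> `|y.1| <= rho /\ `|y.2| <= rho.
Hypothesis cF : forall y, {for (0, y), continuous (fun q : R * (R * R) => F q.1 q.2)}.
Hypothesis mdF : measurable_fun setT (dF : RR * RR -> R).
Hypothesis dFC : forall y, `|dF y| <= C.
Hypothesis suppdF : forall y, dF y != 0 -> `|y.1| <= rho /\ `|y.2| <= rho.
Hypothesis taylorF : forall t y, `|t| <= 1 -> `|F t y - F 0 y - t * dF y| <= C * t ^+ 2.

Let ind i t (y : R * R) : R := (0 <= aff2 (a i) y + t * aff2 (b i) y)%R%:R.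
(** Hybrid indicator: the constraints below [k] are frozen at 0, the others are perturbed. [mix 0]
    is the moving polygon, [mix n] the fixed one, and neighbours differ in one constraint. *)
Let mix k t y := \prod_(j < n) ind j (if (j < k)%N then 0 else t) y.

Let C0 : 0 <= C. Proof. by rewrite (le_trans (normr_ge0 _) (FC 0 (0, 0))). Qed.

Let mind i t : measurable_fun setT (ind i t : RR * RR -> R).
Proof.
apply: measurable_indicator; apply: measurable_funD; first exact: measurable_aff2.
by apply: measurable_funM => //; exact: measurable_aff2.
Qed.

Let indE i y : ind i 0 y = (0 <= aff2 (a i) y)%R%:R.
Proof. by rewrite /ind mul0r addr0. Qed.

(** The factor [u] treats a frozen constraint ([u = 0]) and a moving one ([u = 1]) together. *)
Let cind i u y : (u = 0 \/ u = 1) -> aff2 (a i) y != 0 ->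
  {for (0, y), continuous (fun q : R * (R * R) => ind i (u * q.1) q.2)}.
Proof.
move=> _ ay; apply: continuous_indicator; last by rewrite /= mulr0 mul0r addr0.
have caff (c : R * R * R) : {for (0, y), continuous (fun q : R * (R * R) => aff2 c q.2)}.
  have c1 : (fun q : R * (R * R) => q.2.1) @ nbhs ((0 : R), y) --> y.1.
    by apply: cvg_comp; [exact: cvg_snd|exact: cvg_fst].
  have c2 : (fun q : R * (R * R) => q.2.2) @ nbhs ((0 : R), y) --> y.2.
    by apply: cvg_comp; [exact: cvg_snd|exact: cvg_snd].
  apply: cvgD; last by apply: cvgMr.
  by apply: cvgD; [exact: cvg_cst|apply: cvgMr].
apply: cvgD; first exact: caff.
apply: cvgM; last exact: caff.
by apply: cvgMr; exact: cvg_fst.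
Qed.

Let aff_line_affine i j : exists p q, forall x, aff2 (a j) (line_zero (a i) (d i) x) = p + q * x.
Proof.
exists ((a j).1.1 - ((a j).1.2 * d i + (a j).2) * (a i).1.1 / slope i),
  ((a j).1.2 - ((a j).1.2 * d i + (a j).2) * (a i).1.2 / slope i) => x.
by rewrite /line_zero /aff2 /= -/(slope i); ring.
Qed.

(** Along the boundary line of constraint [i] the constraint [j] is an affine function of one
    variable; by transversality it is not identically zero, so it has at most one zero. *)
Let finite_zero i j : i != j -> slope i != 0 ->
  countable [set x | aff2 (a j) (line_zero (a i) (d i) x) = 0].
Proof.
move=> ij si; have [x0 x0P] := transversal ij si.
have [p [q E]] := aff_line_affine i j; rewrite E in x0P.
apply: (@sub_countable _ _ _ [set - p / q]); last exact: finite_set_countable.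
apply: subset_card_le => x /=; rewrite E => xP.
have q0 : q != 0.
  by apply: contra x0P => /eqP q0; move: xP; rewrite q0 !mul0r => ->.
apply: (mulfI q0); rewrite mulrCA divff// mulr1.
by apply/eqP; rewrite -addr_eq0 addrC xP.
Qed.

Let ae_transversal i : slope i != 0 ->
  {ae leb, forall x, forall j, i != j -> aff2 (a j) (line_zero (a i) (d i) x) != 0}.
Proof.
move=> si.
pose Z := \bigcup_(j in [set j | i != j]) [set x | aff2 (a j) (line_zero (a i) (d i) x) = 0].
have cZ : countable Z.
  apply: bigcup_countable; first exact: countableP.
  by move=> j /= ij; exact: finite_zero.
exists Z; split.
- by apply: countable_measurable cZ => x; exact: measurable_set1.
- exact: countable_lebesgue_measure0.
- move=> x /= nx; apply: contrapT => nZ; apply: nx => j ij; apply/eqP => e0.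
  by apply: nZ; exists j.
Qed.

Let others k t y := F t y * \prod_(j < n | j != k) ind j (if (j < k)%N then 0 else t) y.

Let mothers k t : measurable_fun setT (others k t : RR * RR -> R).
Proof. by apply: measurable_funM => //; apply: measurable_prod_seq => j; exact: mind. Qed.

Let bmul t y (m : R) : `|m| <= 1 -> `|F t y * m| <= C.
Proof. by move=> m1; rewrite normrM -[leRHS]mulr1 ler_pM. Qed.

Let smul t y (m : R) : F t y * m != 0 -> `|y.1| <= rho /\ `|y.2| <= rho.
Proof. by move=> h; apply: (suppF (t := t)); apply: contra h => /eqP ->; rewrite mul0r. Qed.

(** By [slope0] a constraint of slope 0 is a nonzero constant: it bounds no edge and contributes
    nothing. *)
Let edge k := if slope k == 0 then 0 else
  \int[leb]_x (F 0 (line_zero (a k) (d k) x)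
    * \prod_(j < n) (0 <= aff2 (a j) (line_zero (a k) (d k) x))%R%:R
    * (aff2 (b k) (line_zero (a k) (d k) x) / `|slope k|)).

Let step_cvg (k : 'I_n) :
  t^-1 * \int[leb2]_y ((ind k t y - ind k 0 y) * others k t y) @[t --> (0 : R)^'] --> edge k.
Proof.
rewrite /edge; case: ifPn => [/eqP sk|sk].
  have [k1 k2 k3] := slope0 sk.
  (* The constraint is a nonzero constant, and on the support of the integrand its perturbation is
     below [|t|] times this bound. For small [t] the sign is unchanged and the integrand vanishes;
     the summand 1 makes the bound a valid divisor. *)
  have B0 : 0 < `|(b k).1.1| + `|(b k).1.2| * `|rho| + `|(b k).2| * `|rho| + 1.
    by rewrite ltr_wpDl// !addr_ge0// mulr_ge0.
  apply: cvg_trans (cvg_cst (0 : R)).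
  apply: near_eq_cvg.
  have e0 : 0 < `|(a k).1.1| / (`|(b k).1.1| + `|(b k).1.2| * `|rho| + `|(b k).2| * `|rho| + 1).
    by rewrite divr_gt0// normr_gt0.
  have : \forall t \near (0 : R)^', `|t| < `|(a k).1.1| / (`|(b k).1.1| + `|(b k).1.2| * `|rho| + `|(b k).2| * `|rho| + 1).
    by apply: dnbhs0_lt.
  apply: filterS => t; rewrite ltr_pdivlMr// => tB.
  rewrite (_ : \int[leb2]_y _ = \int[leb2]_(y in setT) cst 0 y).
    by rewrite Rintegral_cst// mul0r mulr0.
  apply: eq_Rintegral => y _; apply/eqP; rewrite mulf_eq0.
  have [e1|] := eqVneq (others k t y) 0; first by apply/orP; right; apply/eqP.
  move/smul => [y1 y2]; rewrite orbF subr_eq0; apply/eqP.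
  rewrite indE /ind /aff2 k1 k2 !mul0r !addr0; congr (_%:R); congr nat_of_bool.
  set q := (b k).1.1 + _ + _.
  have : `|t * q| < `|(a k).1.1|.
    apply: le_lt_trans tB; rewrite normrM ler_wpM2l// ler_wpDr//.
    rewrite (le_trans (ler_normD _ _))// lerD//; last first.
      by rewrite normrM ler_wpM2l// (le_trans y2)// ler_norm.
    rewrite (le_trans (ler_normD _ _))// lerD2l.
    by rewrite normrM ler_wpM2l// (le_trans y1)// ler_norm.
  have [an|ap|/eqP] := ltgtP ((a k).1.1) 0; last by rewrite (negPf k3).
    by rewrite (ltr0_norm an) ltr_norml => /andP[h1 h2]; apply/negbTE; rewrite -ltNge; lra.
  by rewrite (gtr0_norm ap) ltr_norml => /andP[h1 h2]; apply/idP; lra.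
  exact: dnbhs_filter.
(* On its own boundary line constraint [k] is an equality, so its indicator is 1 and may be dropped
   from the full product. *)
rewrite (_ : \int[leb]_x _ = \int[leb]_x (others k 0 (line_zero (a k) (d k) x)
    * (aff2 (b k) (line_zero (a k) (d k) x) / `|slope k|))); last first.
  apply: eq_Rintegral => x _; congr (_ * _); rewrite /others; congr (_ * _).
  rewrite (bigD1 k)//= (_ : aff2 (a k) _ = 0) ?lexx ?mul1r; last first.
    by rewrite /line_zero /aff2 /=; field.
  by apply: eq_bigr => j _; rewrite if_same indE.
apply: cvg_trans; last first.
  apply: (@moving_halfplane R (a k) (b k) (d k) (others k) C rho sk).
  - exact: mothers.
  - by move=> t y; apply: bmul; exact: prod_indicator_bound.
  - by move=> t y; exact: smul.
  - apply: negligibleS (ae_transversal sk) => x /= nP tr; apply: nP.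
    apply: cvgM; first exact: cF.
    apply: continuous_prod_seq => j jk.
    have jx : aff2 (a j) (line_zero (a k) (d k) x) != 0 by apply: tr; rewrite eq_sym.
    have := @cind j (if (j < k)%N then 0 else 1) _ _ jx.
    rewrite (_ : (fun q : R * (R * R) => ind j (if (j < k)%N then 0 else q.1) q.2) =
      (fun q => ind j ((if (j < k)%N then 0 else 1) * q.1) q.2)); last first.
      by apply/funext => q; case: (_ < _)%N; rewrite ?mul0r ?mul1r.
    by apply; case: (_ < _)%N; [left|right].
apply: near_eq_cvg; apply: nearW => t; congr (_ * _); apply: eq_Rintegral => y _.
by rewrite indE.
Qed.

(** All constraints are frozen here, so only the integrand varies. The Taylor remainder
    [C * t ^+ 2], integrated over the box that contains the supports, leaves an error of order [t]
    in the quotient. *)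
Let bulk_cvg :
  t^-1 * \int[leb2]_y ((F t y - F 0 y) * mix n t y) @[t --> (0 : R)^'] -->
  \int[leb2]_y (dF y * \prod_(j < n) (0 <= aff2 (a j) y)%R%:R).
Proof.
pose m0 y : R := \prod_(j < n) (0 <= aff2 (a j) y)%R%:R.
have mixn t y : mix n t y = m0 y.
  by apply: eq_bigr => j _; rewrite ltn_ord indE.
have mm0 : measurable_fun setT (m0 : RR * RR -> R).
  by apply: measurable_prod_seq => j; apply: measurable_indicator; exact: measurable_aff2.
have m01 y : `|m0 y| <= 1 by exact: prod_indicator_bound.
have intdF : leb2.-integrable setT (EFin \o (fun y => dF y * m0 y)).
  apply: (@integrable_box2 _ _ C rho).
  - exact: measurable_funM.
  - by move=> y; rewrite normrM -[leRHS]mulr1 ler_pM.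
  - by move=> y h; apply: suppdF; apply: contra h => /eqP ->; rewrite mul0r.
have intF t s : leb2.-integrable setT (EFin \o (fun y => (F t y - F s y) * m0 y)).
  apply: (@integrable_box2 _ _ (C + C) rho).
  - by apply: measurable_funM => //; exact: measurable_funB.
  - move=> y; rewrite normrM -[leRHS]mulr1 ler_pM//.
    by rewrite (le_trans (ler_normB _ _))// lerD.
  - move=> y h; have [Ft|] := eqVneq (F t y) 0; last exact: suppF.
    have [Fs|] := eqVneq (F s y) 0; last exact: suppF.
    by move: h; rewrite Ft Fs subr0 mul0r eqxx.
pose V := fine (leb2 (box2 rho)).
have V0 : 0 <= V by rewrite fine_ge0.
apply/cvgrPdist_le => e e0.
have CV : 0 < C * V + 1 by rewrite ltr_wpDl// mulr_ge0.
have e' : 0 < Num.min 1 (e / (C * V + 1)) by rewrite lt_min ltr01 divr_gt0.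
have tn0 : \forall t \near (0 : R)^', t != 0 by exact: nbhs_dnbhs_neq.
near=> t.
have t0 : t != 0 by near: t.
have : `|t| < Num.min 1 (e / (C * V + 1)) by near: t; exact: dnbhs0_lt.
rewrite lt_min => /andP[t1 te].
rewrite distrC (_ : _ - _ = t^-1 * \int[leb2]_y ((F t y - F 0 y - t * dF y) * m0 y)); last first.
  rewrite (_ : \int[leb2]_y ((F t y - F 0 y - t * dF y) * m0 y) =
     \int[leb2]_y ((F t y - F 0 y) * m0 y - t * (dF y * m0 y))); last first.
    by apply: eq_Rintegral => y _; ring.
  rewrite RintegralB//; last first.
    exact: integrable_EFinZl.
  rewrite RintegralZl// mulrBr mulKf//; congr (_ * _ - _).
  by apply: eq_Rintegral => y _; rewrite mixn.
rewrite normrM normfV ler_pdivrMl ?normr_gt0//.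
have intR : leb2.-integrable setT (EFin \o (fun y => (F t y - F 0 y - t * dF y) * m0 y)).
  rewrite (_ : (fun y => _) = (fun y => (F t y - F 0 y) * m0 y - t * (dF y * m0 y))).
    apply: integrable_EFinB; first exact: intF.
    exact: integrable_EFinZl.
  by apply/funext => y; ring.
apply: le_trans (le_normr_Rintegral _ intR) _ => //.
have -> : \int[leb2]_y `|(F t y - F 0 y - t * dF y) * m0 y| =
    \int[leb2]_(y in box2 rho) `|(F t y - F 0 y - t * dF y) * m0 y|.
  rewrite [RHS]Rintegral_mkcond; apply: eq_Rintegral => y _; rewrite /patch.
  case: ifPn => //; rewrite notin_setE => /box2P ny.
  have z0 (x : R) : (x != 0 -> `|y.1| <= rho /\ `|y.2| <= rho) -> x = 0.
    by move=> h; apply/eqP/negPn/negP => /h.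
  rewrite (z0 (F t y)); last exact: suppF.
  rewrite (z0 (F 0 y)); last exact: suppF.
  rewrite (z0 (dF y)); last exact: suppdF.
  by rewrite mulr0 !subr0 mul0r normr0.
apply: (le_trans (y := \int[leb2]_(y in box2 rho) cst (C * t ^+ 2) y)).
  apply: le_Rintegral.
  - exact: measurable_box2.
  - apply: (integrableS measurableT) => //; first exact: measurable_box2.
    exact: (integrable_norm intR).
  - apply: measurable_bounded_integrable; first exact: measurable_box2.
    + exact: box2_lty.
    + exact: measurable_cst.
    + exact: bounded_cst.
  - move=> y _; rewrite normrM -[leRHS]mulr1 ler_pM//.
    by apply: taylorF; exact: ltW.
rewrite Rintegral_cst; last exact: measurable_box2.
rewrite -/V -[t ^+ 2]real_normK ?num_real// expr2.
rewrite (_ : C * (`|t| * `|t|) * V = `|t| * (C * V * `|t|)); last by ring.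
rewrite ler_wpM2l//; move: te; rewrite ltr_pdivlMr// => te.
have CV0 : 0 <= C * V by rewrite mulr_ge0.
have t00 : 0 <= `|t| by [].
nra.
Unshelve. all: by end_near. Qed.

Let mmix k t : measurable_fun setT (mix k t : RR * RR -> R).
Proof. by apply: measurable_prod_seq => j; exact: mind. Qed.

Let intFm s t k : leb2.-integrable setT (EFin \o (fun y => F s y * mix k t y)).
Proof.
apply: (@integrable_box2 _ _ C rho).
- exact: measurable_funM.
- by move=> y; apply: bmul; exact: prod_indicator_bound.
- by move=> y; exact: smul.
Qed.

Let mix_step (k : 'I_n) t y :
  F t y * mix k t y - F t y * mix k.+1 t y = (ind k t y - ind k 0 y) * others k t y.
Proof.
rewrite /mix /others (bigD1 k)//= [in X in _ - X](bigD1 k)//= ltnn ltnSn.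
rewrite [in X in _ - X](eq_bigr (fun j : 'I_n => ind j (if (j < k)%N then 0 else t) y)); first by ring.
by move=> j jk; rewrite ltnS leq_eqVlt val_eqE (negPf jk).
Qed.

(** Telescoping over the hybrids [mix k]: each step moves one edge, and what remains after the last
    step is the variation of the integrand on the fixed polygon. *)
Lemma moving_polygon :
  t^-1 * (\int[leb2]_y (F t y * \prod_(j < n) (0 <= aff2 (a j) y + t * aff2 (b j) y)%R%:R)
          - \int[leb2]_y (F 0 y * \prod_(j < n) (0 <= aff2 (a j) y)%R%:R))
    @[t --> (0 : R)^'] -->
  \int[leb2]_y (dF y * \prod_(j < n) (0 <= aff2 (a j) y)%R%:R) + \sum_(k < n) edge k.
Proof.
have tele t m : (m <= n)%N ->
   \int[leb2]_y (F t y * mix 0 t y) - \int[leb2]_y (F t y * mix m t y) =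
   \sum_(k < n | (k < m)%N) \int[leb2]_y ((ind k t y - ind k 0 y) * others k t y).
  elim: m => [|m IH] mn; first by rewrite subrr big_pred0.
  have E : \int[leb2]_y (F t y * mix m t y) - \int[leb2]_y (F t y * mix m.+1 t y) =
      \int[leb2]_y ((ind (Ordinal mn) t y - ind (Ordinal mn) 0 y) * others (Ordinal mn) t y).
    rewrite -RintegralB//.
    by apply: eq_Rintegral => y _; rewrite -mix_step.
  rewrite (bigD1 (Ordinal mn))//= -E.
  rewrite (_ : \sum_(_ < n | _) _ = \sum_(k < n | (k < m)%N) \int[leb2]_y ((ind k t y - ind k 0 y) * others k t y)).
    by rewrite -IH 1?ltnW//; ring.
  by apply: eq_bigl => k; rewrite ltnS -val_eqE /= andbC -ltn_neqAle.
have E t : t^-1 * (\int[leb2]_y (F t y * \prod_(j < n) (0 <= aff2 (a j) y + t * aff2 (b j) y)%R%:R)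
          - \int[leb2]_y (F 0 y * \prod_(j < n) (0 <= aff2 (a j) y)%R%:R)) =
   t^-1 * \int[leb2]_y ((F t y - F 0 y) * mix n t y) +
   \sum_(k < n) t^-1 * \int[leb2]_y ((ind k t y - ind k 0 y) * others k t y).
  rewrite -mulr_sumr -mulrDr; congr (_ * _).
  rewrite (_ : \sum_(k < n) _ = \int[leb2]_y (F t y * mix 0 t y) - \int[leb2]_y (F t y * mix n t y)); last first.
    by rewrite tele//; apply: eq_bigl => k; rewrite ltn_ord.
  rewrite (_ : \int[leb2]_y ((F t y - F 0 y) * mix n t y) =
     \int[leb2]_y (F t y * mix n t y) - \int[leb2]_y (F 0 y * mix n t y)); last first.
    rewrite -RintegralB//.
    by apply: eq_Rintegral => y _; rewrite mulrBl.
  rewrite (_ : \int[leb2]_y (F 0 y * \prod_(j < n) _) = \int[leb2]_y (F 0 y * mix n t y)); last first.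
    apply: eq_Rintegral => y _; congr (_ * _); apply: eq_bigr => j _.
    by rewrite ltn_ord indE.
  have -> : \int[leb2]_y (F t y * \prod_(j < n) (0 <= aff2 (a j) y + t * aff2 (b j) y)%R%:R)
    = \int[leb2]_y (F t y * mix 0 t y) by [].
  by ring.
under eq_fun do rewrite E.
by apply: cvgD; [exact: bulk_cvg|apply: cvg_sum_seq => k _; exact: step_cvg].
Qed.

End moving_polygon.

(** * Planes and lines in R^3 *)

Lemma Rintegral_negligible (R : realType) d (T : measurableType d)
    (mu : {measure set T -> \bar R}) (N : set T) (f : T -> R) :
  mu.-negligible N -> measurable_fun setT f -> (forall x, ~ N x -> f x = 0) ->
  \int[mu]_x f x = 0.
Proof.
move=> nN mf f0; rewrite /Rintegral (ae_eq_integral (cst 0%E))//.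
- by rewrite integral0.
- exact/measurable_EFinP.
- by apply: negligibleS nN => x /= h; apply: contrapT => /f0 fx; apply: h => _; rewrite fx.
Qed.

Section coordinates.
Variable R : realType.
Implicit Types u v w : 'rV[R]_3.

Definition i0 : 'I_3 := @Ordinal 3 0 isT.
Definition i1 : 'I_3 := @Ordinal 3 1 isT.
Definition i2 : 'I_3 := @Ordinal 3 2 isT.

Lemma I3E (i : 'I_3) : [\/ i = i0, i = i1 | i = i2].
Proof.
by case: i => [[|[|[|//]]] h]; [constructor 1|constructor 2|constructor 3]; apply/val_inj.
Qed.

Lemma sum3 (V : nmodType) (f : 'I_3 -> V) : \sum_i f i = f i0 + f i1 + f i2.
Proof.
rewrite !big_ord_recr big_ord0 /= add0r.
by congr (f _ + f _ + f _); exact: val_inj.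
Qed.

Lemma dot3 u v : dot u v = u 0 i0 * v 0 i0 + u 0 i1 * v 0 i1 + u 0 i2 * v 0 i2.
Proof. exact: sum3. Qed.

Lemma rv3P u v : [/\ u 0 i0 = v 0 i0, u 0 i1 = v 0 i1 & u 0 i2 = v 0 i2] -> u = v.
Proof. by case=> h0 h1 h2; apply/rowP => i; case: (I3E i) => ->. Qed.

Lemma dotC u v : dot u v = dot v u.
Proof. by rewrite !dot3; ring. Qed.
Lemma dotDl u v w : dot (u + v) w = dot u w + dot v w.
Proof. by rewrite !dot3 !mxE; ring. Qed.
Lemma dotDr u v w : dot w (u + v) = dot w u + dot w v.
Proof. by rewrite !dot3 !mxE; ring. Qed.
Lemma dotBl u v w : dot (u - v) w = dot u w - dot v w.
Proof. by rewrite !dot3 !mxE; ring. Qed.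
Lemma dotBr u v w : dot w (u - v) = dot w u - dot w v.
Proof. by rewrite !dot3 !mxE; ring. Qed.
Lemma dotZl (c : R) u v : dot (c *: u) v = c * dot u v.
Proof. by rewrite !dot3 !mxE; ring. Qed.
Lemma dotZr (c : R) u v : dot u (c *: v) = c * dot u v.
Proof. by rewrite !dot3 !mxE; ring. Qed.
Lemma dot0l u : dot 0 u = 0.
Proof. by rewrite dot3 !mxE; ring. Qed.
Lemma dot0r u : dot u 0 = 0.
Proof. by rewrite dot3 !mxE; ring. Qed.
Lemma dotNr u v : dot u (- v) = - dot u v.
Proof. by rewrite !dot3 !mxE; ring. Qed.
Lemma dotNl u v : dot (- u) v = - dot u v.
Proof. by rewrite !dot3 !mxE; ring. Qed.

Lemma dot_ge0 u : 0 <= dot u u.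
Proof. by rewrite dot3 !addr_ge0// -expr2 sqr_ge0. Qed.

Lemma dot_eq0 u : (dot u u == 0) = (u == 0).
Proof.
apply/eqP/eqP => [h|->]; last exact: dot0l.
move: h; rewrite dot3 => h; apply: rv3P; rewrite !mxE; split; nra.
Qed.

Lemma dot_gt0 u : (0 < dot u u) = (u != 0).
Proof. by rewrite lt_def dot_ge0 andbT dot_eq0. Qed.

Lemma enorm_sqr u : enorm u ^+ 2 = dot u u.
Proof. by rewrite sqr_sqrtr// dot_ge0. Qed.

Lemma enorm_ge0 u : 0 <= enorm u. Proof. exact: sqrtr_ge0. Qed.

Lemma enorm_gt0 u : (0 < enorm u) = (u != 0).
Proof. by rewrite sqrtr_gt0 dot_gt0. Qed.

Lemma enorm1 u : enorm u = 1 -> dot u u = 1.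
Proof. by move=> h; rewrite -enorm_sqr h expr1n. Qed.

Lemma enormZ (c : R) u : enorm (c *: u) = `|c| * enorm u.
Proof. by rewrite /enorm dotZl dotZr mulrA -expr2 sqrtrM ?sqr_ge0// sqrtr_sqr. Qed.

Lemma enorm_normalize u : u != 0 -> enorm ((enorm u)^-1 *: u) = 1.
Proof.
by move=> u0; rewrite enormZ ger0_norm ?invr_ge0 ?enorm_ge0// mulVf// gt_eqF// enorm_gt0.
Qed.

(** Gram determinant; its square root is the area factor of the parametrization [plane_pt]. *)
Definition gram u v : R := dot u u * dot v v - dot u v ^+ 2.

Definition cross u v : 'rV[R]_3 :=
  \row_(i < 3) [:: u 0 i1 * v 0 i2 - u 0 i2 * v 0 i1;
                   u 0 i2 * v 0 i0 - u 0 i0 * v 0 i2;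
                   u 0 i0 * v 0 i1 - u 0 i1 * v 0 i0]`_i.

Lemma gram_cross u v : gram u v = dot (cross u v) (cross u v).
Proof. by rewrite /gram !dot3 !mxE /=; ring. Qed.

Lemma dot_crossl u v : dot u (cross u v) = 0.
Proof. by rewrite !dot3 !mxE /=; ring. Qed.
Lemma dot_crossr u v : dot v (cross u v) = 0.
Proof. by rewrite !dot3 !mxE /=; ring. Qed.

(* Coordinates of [x - o] in the plane spanned by [u] and [v], by the dual basis. *)
Definition plane_coord (c : 'rV[R]_3 * 'rV[R]_3 * 'rV[R]_3) (x : 'rV[R]_3) : R * R :=
  let u := c.1.2 in let v := c.2 in let y := x - c.1.1 in
  ((dot v v * dot u y - dot u v * dot v y) / gram u v,
   (dot u u * dot v y - dot u v * dot u y) / gram u v).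

Lemma plane_ptK c : gram c.1.2 c.2 != 0 -> cancel (plane_pt c) (plane_coord c).
Proof.
case: c => q v; case: q => p u /= g0 [s t]; rewrite /plane_coord /plane_pt /=.
have -> : p + s *: u + t *: v - p = s *: u + t *: v by rewrite [LHS]addrC -addrA addKr.
move: g0; rewrite /gram !(dotDr, dotZr) (dotC v u) => g0.
by congr (_, _); field.
Qed.

Notation leb := (@lebesgue_measure R).
Notation RR := (measurableTypeR R).
Notation leb2 := (@leb2 R).

Lemma aff2_zero_measurable (a : R * R * R) :
  measurable [set y : RR * RR | aff2 a y = 0].
Proof.
rewrite (_ : [set y | _] = aff2 a @^-1` [set 0]); last by apply/seteqP; split.
by rewrite -[_ @^-1` _]setTI; apply: (measurable_aff2 a) => //; exact: measurable_set1.
Qed.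

Lemma aff2_zero_negligible (a : R * R * R) : (exists y, aff2 a y != 0) ->
  leb2.-negligible [set y | aff2 a y = 0].
Proof.
move=> [y0 y0P]; have mZ := aff2_zero_measurable a.
have [a2|a2] := eqVneq a.2 0; last first.
  apply/negligibleP => //.
  pose Z : set (RR * RR) := [set y | aff2 a y = 0].
  rewrite -[LHS]/(\int[leb]_x (leb \o xsection Z) x)%E.
  rewrite (eq_integral (cst 0%E)) ?integral0// => x _ /=.
  apply: countable_lebesgue_measure0.
  apply: (@sub_countable _ _ _ [set - (a.1.1 + a.1.2 * x) / a.2]); last exact: finite_set_countable.
  apply: subset_card_le => y; rewrite /xsection /= in_setE /Z /aff2 /= => h.
  by apply: (mulfI a2); rewrite mulrCA divff// mulr1; lra.
have [a1|a1] := eqVneq a.1.2 0.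
  rewrite (_ : [set y | _] = set0); first exact: negligible_set0.
  apply/seteqP; split => y //=; move: y0P; rewrite /aff2 a1 a2 !mul0r !addr0.
  by move=> /eqP.
pose N : set (RR * RR) := ([set - a.1.1 / a.1.2] : set RR) `*` setT.
exists N; split.
- by apply: measurableX => //; exact: measurable_set1.
- rewrite /leb2 /N product_measure1E//= [X in (X * _)%E](_ : _ = 0%E) ?mul0e//.
  exact: lebesgue_measure_set1.
- move=> [x y] /=; rewrite /aff2 /= a2 mul0r addr0 => h; split => //=.
  by apply: (mulfI a1); rewrite mulrCA divff// mulr1; lra.
Qed.

(** The displacement from a point of the first plane to its orthogonal projection on the second is
    affine in the parameters: it vanishes identically, or one of its coordinates is a nonzero affine
    function with a null zero set. *)
Lemma plane_pt_overlap (c1 c2 : 'rV[R]_3 * 'rV[R]_3 * 'rV[R]_3) :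
  gram c2.1.2 c2.2 != 0 ->
  (forall y, plane_pt c1 y = plane_pt c2 (plane_coord c2 (plane_pt c1 y))) \/
  leb2.-negligible [set y | range (plane_pt c2) (plane_pt c1 y)].
Proof.
move=> g0; pose D y := plane_pt c1 y - plane_pt c2 (plane_coord c2 (plane_pt c1 y)).
have [all0|] := pselect (forall y, D y = 0).
  by left => y; apply/eqP; rewrite -subr_eq0; apply/eqP; exact: all0.
move=> /existsNP[y0 /eqP y0P]; right.
have [j jP] : exists j, D y0 0 j != 0.
  apply: contrapT => nj; move/eqP: y0P; apply; apply/rowP => j; rewrite [RHS]mxE.
  by apply/eqP/negPn/negP => h; apply: nj; exists j.
have [a aE] : exists a, forall y, D y 0 j = aff2 a y.
  have affD (u : 'rV[R]_3) : exists k : R * R * R, forall y,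
      dot u (plane_pt c1 y - c2.1.1) = aff2 k y.
    exists (dot u (c1.1.1 - c2.1.1), dot u c1.1.2, dot u c1.2) => y.
    by rewrite /plane_pt /aff2 /= !(dotDr, dotBr, dotZr, dotNr); ring.
  have [ku kuE] := affD c2.1.2; have [kv kvE] := affD c2.2.
  set u := c2.1.2 in g0 kuE *; set v := c2.2 in g0 kvE *.
  pose G := gram u v.
  pose p k1 k2 : R * R * R := ((dot v v * k1.1.1 - dot u v * k2.1.1) / G,
    (dot v v * k1.1.2 - dot u v * k2.1.2) / G, (dot v v * k1.2 - dot u v * k2.2) / G).
  pose q k1 k2 : R * R * R := ((dot u u * k2.1.1 - dot u v * k1.1.1) / G,
    (dot u u * k2.1.2 - dot u v * k1.1.2) / G, (dot u u * k2.2 - dot u v * k1.2) / G).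
  pose pu := p ku kv; pose pv := q ku kv.
  exists (c1.1.1 0 j - c2.1.1 0 j - pu.1.1 * u 0 j - pv.1.1 * v 0 j,
    c1.1.2 0 j - pu.1.2 * u 0 j - pv.1.2 * v 0 j,
    c1.2 0 j - pu.2 * u 0 j - pv.2 * v 0 j) => y.
  rewrite /D [X in _ - X]/plane_pt /plane_coord /= -/u -/v kuE kvE !mxE /aff2 /pu /pv /p /q /= -/G.
  by ring.
apply: negligibleS (@aff2_zero_negligible a _); last by exists y0; rewrite -aE.
move=> y /= [w _ wE]; rewrite -aE /D -wE plane_ptK// wE subrr mxE //.
Qed.

(** Expressing the first frame in the second gives an affine change of parameters of determinant
    [det], and the Gram determinant is multiplied by [det ^+ 2]. *)
Lemma plane_pt_change (c1 c2 : 'rV[R]_3 * 'rV[R]_3 * 'rV[R]_3) (g : 'rV[R]_3 -> R) :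
  gram c1.1.2 c1.2 != 0 -> gram c2.1.2 c2.2 != 0 ->
  (forall y, plane_pt c1 y = plane_pt c2 (plane_coord c2 (plane_pt c1 y))) ->
  measurable_fun setT (g \o plane_pt c2 : RR * RR -> R) ->
  Num.sqrt (gram c1.1.2 c1.2) * \int[leb2]_y g (plane_pt c1 y) =
  Num.sqrt (gram c2.1.2 c2.2) * \int[leb2]_y g (plane_pt c2 y).
Proof.
move=> g10 g20 E mg.
set u := c2.1.2 in g20 E *; set v := c2.2 in g20 E *; set G := gram u v in g20 *.
pose cf (x : 'rV[R]_3) := (dot v v * dot u x - dot u v * dot v x) / G.
pose cg (x : 'rV[R]_3) := (dot u u * dot v x - dot u v * dot u x) / G.
pose L (y : RR * RR) : RR * RR :=
  (cf (c1.1.1 - c2.1.1) + cf c1.1.2 * y.1 + cf c1.2 * y.2 : RR,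
   cg (c1.1.1 - c2.1.1) + cg c1.1.2 * y.1 + cg c1.2 * y.2 : RR).
have LE y : plane_coord c2 (plane_pt c1 y) = L y.
  rewrite /plane_coord /L /cf /cg /plane_pt -/u -/v -/G.
  by congr (_, _); rewrite !(dotDr, dotBr, dotZr, dotNr); ring.
have E' y : plane_pt c1 y = plane_pt c2 (L y) by rewrite -LE.
(* Subtracting the identity at the origin of the parameters isolates the linear parts, even though
   the two origins may be different points. *)
have lin (w : R * R) : w.1 *: c1.1.2 + w.2 *: c1.2 =
    (cf c1.1.2 * w.1 + cf c1.2 * w.2) *: u + (cg c1.1.2 * w.1 + cg c1.2 * w.2) *: v.
  have := E' w; have := E' (0, 0); rewrite /plane_pt /L /= !mulr0 !addr0 !scale0r !addr0 -/u -/v.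
  set p := cf (c1.1.1 - _); set q := cg (c1.1.1 - _) => e0.
  rewrite e0 => e1; apply: (addrI (c2.1.1 + p *: u + q *: v)).
  by rewrite addrA e1; apply: rv3P; rewrite !mxE; split; ring.
have hu : c1.1.2 = cf c1.1.2 *: u + cg c1.1.2 *: v.
  by have := lin (1, 0); rewrite /= !mulr0 !mulr1 !addr0 scale1r scale0r addr0.
have hv : c1.2 = cf c1.2 *: u + cg c1.2 *: v.
  by have := lin (0, 1); rewrite /= !mulr0 !mulr1 !add0r scale1r scale0r add0r.
pose det := cf c1.1.2 * cg c1.2 - cf c1.2 * cg c1.1.2.
have gE : gram c1.1.2 c1.2 = det ^+ 2 * G.
  rewrite {1}hu {1}hv /G /det /gram !(dotDr, dotDl, dotZr, dotZl) (dotC v u).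
  by ring.
have d0 : det != 0 by apply: contraNneq g10 => d0; rewrite gE d0 expr0n mul0r.
have J := lebesgue2_affine (cf (c1.1.1 - c2.1.1)) (cg (c1.1.1 - c2.1.1)) d0.
rewrite [in RHS](has_jacobian_Rintegral J)// gE sqrtrM ?sqr_ge0// sqrtr_sqr.
have -> : \int[leb2]_y g (plane_pt c1 y) = \int[leb2]_y g (plane_pt c2 (L y)).
  by apply: eq_Rintegral => y _; rewrite E'.
by rewrite [`|det| * _]mulrC -mulrA.
Qed.

(* Two affine parametrizations of planes: the planes coincide, or they meet in
   a null set of parameters. *)
Lemma plane_pt_integral (c1 c2 : 'rV[R]_3 * 'rV[R]_3 * 'rV[R]_3)
    (E : set 'rV[R]_3) (g : 'rV[R]_3 -> R) :
  gram c1.1.2 c1.2 != 0 -> gram c2.1.2 c2.2 != 0 ->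
  E `<=` range (plane_pt c1) -> E `<=` range (plane_pt c2) ->
  (forall x, ~ E x -> g x = 0) ->
  (forall c, measurable_fun setT (g \o plane_pt c : RR * RR -> R)) ->
  Num.sqrt (gram c1.1.2 c1.2) * \int[leb2]_y g (plane_pt c1 y) =
  Num.sqrt (gram c2.1.2 c2.2) * \int[leb2]_y g (plane_pt c2 y).
Proof.
move=> g1 g2 E1 E2 g0 mg.
have [h12|n12] := plane_pt_overlap c1 g2; first exact: plane_pt_change.
have [h21|n21] := plane_pt_overlap c2 g1; first by apply/esym; exact: plane_pt_change.
rewrite (Rintegral_negligible n12 (mg c1)); last first.
  by move=> y /= ny; apply: g0 => /E2.
rewrite (Rintegral_negligible n21 (mg c2)) ?mulr0//.
by move=> y /= ny; apply: g0 => /E1.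
Qed.

(* Gram-Schmidt *)
Lemma plane_chart_exists (c : 'rV[R]_3 * 'rV[R]_3 * 'rV[R]_3) (E : set 'rV[R]_3) :
  gram c.1.2 c.2 != 0 -> E `<=` range (plane_pt c) ->
  [/\ enorm (plane_chart E).1.2 = 1, enorm (plane_chart E).2 = 1,
     dot (plane_chart E).1.2 (plane_chart E).2 = 0 &
     E `<=` range (plane_pt (plane_chart E))].
Proof.
case: c => q b; case: q => p a /= g0 Er.
have a0 : a != 0.
  by apply: contraNneq g0 => ->; rewrite /gram !dot0l mul0r expr0n subr0.
have na : enorm a != 0 by rewrite gt_eqF// enorm_gt0.
have aa0 : dot a a != 0 by rewrite dot_eq0.
pose u := (enorm a)^-1 *: a; pose b' := b - (dot a b / dot a a) *: a.
have b'0 : b' != 0.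
  apply: contra g0 => /eqP b'0; rewrite -(subrK ((dot a b / dot a a) *: a) b) -/b' b'0 add0r.
  by rewrite /gram !(dotZl, dotZr); apply/eqP; ring.
have nb : enorm b' != 0 by rewrite gt_eqF// enorm_gt0.
pose v := (enorm b')^-1 *: b'.
have : [set c : 'rV[R]_3 * 'rV[R]_3 * 'rV[R]_3 | [/\ enorm c.1.2 = 1, enorm c.2 = 1,
    dot c.1.2 c.2 = 0 & E `<=` range (plane_pt c)]] (p, u, v).
  split => /=.
  - exact: enorm_normalize.
  - exact: enorm_normalize.
  - by rewrite /u /v !(dotZl, dotZr) dotBr dotZr divfK// subrr !mulr0.
  - move=> x /Er[[s t] _ <-]; exists ((s + t * (dot a b / dot a a)) * enorm a, t * enorm b') => //.
    rewrite /plane_pt /= /u /v !scalerA !mulfK// /b'.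
    by apply: rv3P; rewrite !mxE; split; ring.
by move=> /(@xgetI _ (0, 0, 0)).
Qed.

Definition line_coord (c : 'rV[R]_3 * 'rV[R]_3) (x : 'rV[R]_3) : R :=
  dot c.2 (x - c.1) / dot c.2 c.2.

Lemma line_ptK c : c.2 != 0 -> cancel (line_pt c) (line_coord c).
Proof.
rewrite -dot_eq0 => c0 s; rewrite /line_coord /line_pt.
by rewrite !(dotBr, dotDr, dotZr); field.
Qed.

(** As for planes: the displacement to the projection on the second line is affine in one variable,
    so if it does not vanish identically, the common parameters lie in a single point. *)
Lemma line_pt_overlap (c1 c2 : 'rV[R]_3 * 'rV[R]_3) : c2.2 != 0 ->
  (forall s, line_pt c1 s = line_pt c2 (line_coord c2 (line_pt c1 s))) \/
  leb.-negligible [set s | range (line_pt c2) (line_pt c1 s)].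
Proof.
move=> c0; pose D s := line_pt c1 s - line_pt c2 (line_coord c2 (line_pt c1 s)).
have [all0|] := pselect (forall s, D s = 0).
  by left => s; apply/eqP; rewrite -subr_eq0; apply/eqP; exact: all0.
move=> /existsNP[s0 /eqP s0P]; right.
have [j jP] : exists j, D s0 0 j != 0.
  apply: contrapT => nj; move/eqP: s0P; apply; apply/rowP => j; rewrite [RHS]mxE.
  by apply/eqP/negPn/negP => h; apply: nj; exists j.
have [p [q pq]] : exists p q, forall s, D s 0 j = p + q * s.
  exists (c1.1 0 j - c2.1 0 j - dot c2.2 (c1.1 - c2.1) / dot c2.2 c2.2 * c2.2 0 j),
    (c1.2 0 j - dot c2.2 c1.2 / dot c2.2 c2.2 * c2.2 0 j) => s.
  rewrite /D [X in _ - X]/line_pt /line_coord !mxE /line_pt.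
  by rewrite !(dotBr, dotDr, dotZr); ring.
apply: (@negligibleS _ _ _ leb [set - p / q]).
  move=> s /= [w _ wE].
  have : D s 0 j = 0 by rewrite /D -wE line_ptK// subrr mxE.
  rewrite pq => h; rewrite pq in jP.
  have q0 : q != 0.
    by apply: contra jP => /eqP q0; move: h; rewrite q0 !mul0r => ->.
  by apply: (mulfI q0); rewrite mulrCA divff// mulr1; lra.
apply/negligibleP; first exact: measurable_set1.
exact: lebesgue_measure_set1.
Qed.

Lemma line_pt_change (c1 c2 : 'rV[R]_3 * 'rV[R]_3) (g : 'rV[R]_3 -> R) :
  c1.2 != 0 -> c2.2 != 0 ->
  (forall s, line_pt c1 s = line_pt c2 (line_coord c2 (line_pt c1 s))) ->
  measurable_fun setT (g \o line_pt c2 : RR -> R) ->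
  enorm c1.2 * \int[leb]_s g (line_pt c1 s) = enorm c2.2 * \int[leb]_s g (line_pt c2 s).
Proof.
move=> c10 c20 E mg.
pose k := dot c2.2 c1.2 / dot c2.2 c2.2; pose l := dot c2.2 (c1.1 - c2.1) / dot c2.2 c2.2.
have E' s : line_pt c1 s = line_pt c2 (k * s + l).
  rewrite [LHS]E; congr line_pt; rewrite /line_coord /line_pt /k /l.
  by rewrite !(dotBr, dotDr, dotZr); ring.
have dE : c1.2 = k *: c2.2.
  have := E' 1; have := E' 0; rewrite /line_pt scale0r addr0 scale1r mulr0 add0r mulr1 => ->.
  move=> h; apply: (addrI (c2.1 + l *: c2.2)); rewrite h.
  by apply: rv3P; rewrite !mxE; split; ring.
have k0 : k != 0 by apply: contraNneq c10 => k0; rewrite dE k0 scale0r.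
rewrite [in RHS](has_jacobian_Rintegral (lebesgue_affine l k0))// {1}dE enormZ.
have -> : \int[leb]_s g (line_pt c1 s) = \int[leb]_s g (line_pt c2 (k * s + l)).
  by apply: eq_Rintegral => s _; rewrite E'.
by rewrite [`|k| * _]mulrC -mulrA.
Qed.

Lemma line_pt_integral (c1 c2 : 'rV[R]_3 * 'rV[R]_3)
    (E : set 'rV[R]_3) (g : 'rV[R]_3 -> R) :
  c1.2 != 0 -> c2.2 != 0 ->
  E `<=` range (line_pt c1) -> E `<=` range (line_pt c2) ->
  (forall x, ~ E x -> g x = 0) ->
  (forall c, measurable_fun setT (g \o line_pt c : RR -> R)) ->
  enorm c1.2 * \int[leb]_s g (line_pt c1 s) = enorm c2.2 * \int[leb]_s g (line_pt c2 s).
Proof.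
move=> g1 g2 E1 E2 g0 mg.
have [h12|n12] := line_pt_overlap c1 g2; first exact: line_pt_change.
have [h21|n21] := line_pt_overlap c2 g1; first by apply/esym; exact: line_pt_change.
rewrite (Rintegral_negligible n12 (mg c1)); last first.
  by move=> y /= ny; apply: g0 => /E2.
rewrite (Rintegral_negligible n21 (mg c2)) ?mulr0//.
by move=> y /= ny; apply: g0 => /E1.
Qed.

Lemma line_chart_exists (c : 'rV[R]_3 * 'rV[R]_3) (E : set 'rV[R]_3) :
  c.2 != 0 -> E `<=` range (line_pt c) ->
  enorm (line_chart E).2 = 1 /\ E `<=` range (line_pt (line_chart E)).
Proof.
case: c => p a /= a0 Er.
have na : enorm a != 0 by rewrite gt_eqF// enorm_gt0.
have : [set c : 'rV[R]_3 * 'rV[R]_3 | enorm c.2 = 1 /\ E `<=` range (line_pt c)]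
    (p, (enorm a)^-1 *: a).
  split => /=; first exact: enorm_normalize.
  move=> x /Er[s _ <-]; exists (s * enorm a) => //.
  by rewrite /line_pt /= scalerA mulfK.
by move=> /(@xgetI _ (0, 0)).
Qed.

Definition rsurf_int (E : set 'rV[R]_3) (f : 'rV[R]_3 -> R) : R :=
  \int[leb2]_(y in plane_pt (plane_chart E) @^-1` E) f (plane_pt (plane_chart E) y).

Definition rline_int (E : set 'rV[R]_3) (f : 'rV[R]_3 -> R) : R :=
  \int[leb]_(s in line_pt (line_chart E) @^-1` E) f (line_pt (line_chart E) s).

Lemma surf_intE (E : set 'rV[R]_3) (f : 'rV[R]_3 -> R[i]) :
  surf_int E f = rsurf_int E (fun x => complex.Re (f x)) +i* rsurf_int E (fun x => complex.Im (f x)).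
Proof. by []. Qed.

Lemma line_intE (E : set 'rV[R]_3) (f : 'rV[R]_3 -> R[i]) :
  line_int E f = rline_int E (fun x => complex.Re (f x)) +i* rline_int E (fun x => complex.Im (f x)).
Proof. by []. Qed.

Lemma rsurf_int_mkcond (E : set 'rV[R]_3) f :
  rsurf_int E f = \int[leb2]_y (f \_ E) (plane_pt (plane_chart E) y).
Proof.
rewrite /rsurf_int Rintegral_mkcond; apply: eq_Rintegral => y _.
by rewrite /patch; congr (if _ then _ else _); apply/idP/idP; rewrite !in_setE.
Qed.

Lemma rline_int_mkcond (E : set 'rV[R]_3) f :
  rline_int E f = \int[leb]_s (f \_ E) (line_pt (line_chart E) s).
Proof.
rewrite /rline_int Rintegral_mkcond; apply: eq_Rintegral => y _.
by rewrite /patch; congr (if _ then _ else _); apply/idP/idP; rewrite !in_setE.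
Qed.

Lemma gram_orthonormal u v : enorm u = 1 -> enorm v = 1 -> dot u v = 0 -> gram u v = 1.
Proof. by move=> /enorm1 u1 /enorm1 v1 uv; rewrite /gram u1 v1 uv expr0n subr0 mulr1. Qed.

(** This frees the integral from the chart selected by [plane_chart]. Measurability is asked along
    every chart because nothing is known about the selected one beyond its defining properties. *)
Lemma rsurf_int_param (c : 'rV[R]_3 * 'rV[R]_3 * 'rV[R]_3) (E : set 'rV[R]_3) f :
  gram c.1.2 c.2 != 0 -> E `<=` range (plane_pt c) ->
  (forall c, measurable_fun setT ((f \_ E) \o plane_pt c : RR * RR -> R)) ->
  rsurf_int E f = Num.sqrt (gram c.1.2 c.2) * \int[leb2]_y (f \_ E) (plane_pt c y).
Proof.
move=> g0 Er mf; have [c1 c2 c3 c4] := plane_chart_exists g0 Er.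
have ch1 := gram_orthonormal c1 c2 c3.
rewrite rsurf_int_mkcond -[LHS]mul1r -sqrtr1 -ch1.
apply: plane_pt_integral Er _ mf => //; first by rewrite ch1 oner_neq0.
by move=> x nEx; rewrite /patch memNset.
Qed.

Lemma rline_int_param (c : 'rV[R]_3 * 'rV[R]_3) (E : set 'rV[R]_3) f :
  c.2 != 0 -> E `<=` range (line_pt c) ->
  (forall c, measurable_fun setT ((f \_ E) \o line_pt c : RR -> R)) ->
  rline_int E f = enorm c.2 * \int[leb]_s (f \_ E) (line_pt c s).
Proof.
move=> g0 Er mf; have [c1 c2] := line_chart_exists g0 Er.
rewrite rline_int_mkcond -[LHS]mul1r -{1}c1.
apply: line_pt_integral Er _ mf => //.
  by rewrite -enorm_gt0 c1 ltr01.
by move=> x nEx; rewrite /patch memNset.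
Qed.

End coordinates.

(** * Polynomials *)

(** The properties proved below, such as continuity, boundedness and the Taylor estimate, pass
    through sums and products, so induction over ring operations is more direct than induction over
    monomials. *)
Lemma mpoly_ring_ind (n : nat) (F : comNzRingType) (Q : mpoly n F -> Prop) :
  (forall c, Q (mpolyC n c)) -> (forall i, Q (mpolyX F (mnm1 i))) ->
  (forall p q, Q p -> Q q -> Q (p + q)) -> (forall p q, Q p -> Q q -> Q (p * q)) ->
  forall p, Q p.
Proof.
move=> QC QX QD QM; elim/mpolyind => [|c m p _ _ Qp]; first by rewrite -mpolyC0; exact: QC.
apply: QD => //; rewrite -mul_mpolyC; apply: (QM) => //.
rewrite mpolyXE_id; apply: (big_ind Q) => [|a b|i _]; first by rewrite -mpolyC1; exact: QC.
  exact: QM.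
elim: (m i) => [|k IH]; first by rewrite expr0 -mpolyC1; exact: QC.
by rewrite exprS; exact: QM.
Qed.

Lemma I3_eqE : ((i0 == i1) = false) * ((i0 == i2) = false) * ((i1 == i0) = false) *
  ((i1 == i2) = false) * ((i2 == i0) = false) * ((i2 == i1) = false).
Proof. by []. Qed.

Section polynomials.
Variable R : realType.
Notation RR := (measurableTypeR R).
Implicit Types (p q : mpoly 3 R) (x v : 'rV[R]_3).

Lemma revalC (c : R) x : reval (mpolyC 3 c) x = c. Proof. exact: mevalC. Qed.
Lemma revalX i x : reval (mpolyX R (mnm1 i)) x = x 0 i. Proof. exact: mevalXU. Qed.
Lemma revalD p q x : reval (p + q) x = reval p x + reval q x. Proof. exact: mevalD. Qed.
Lemma revalM p q x : reval (p * q) x = reval p x * reval q x. Proof. exact: mevalM. Qed.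
Lemma revalZ (c : R) p x : reval (c *: p) x = c * reval p x. Proof. exact: mevalZ. Qed.

Lemma mderivXU (F : comNzRingType) n (i j : 'I_n) :
  mderiv i (mpolyX F (mnm1 j)) = mpolyC n ((i == j)%:R : F).
Proof.
rewrite mderivX mnmE; have [->|ij] := eqVneq i j.
  rewrite scale1r (_ : mnm_sub _ _ = mnm0); first by rewrite mpolyX0 mpolyC1.
  by apply/mnmP => k; rewrite !mnmE subnn.
by rewrite scale0r mpolyC0.
Qed.

Lemma continuous_reval (T : topologicalType) (X : T -> 'rV[R]_3) (t : T) p :
  (forall i, {for t, continuous (fun s => X s 0 i)}) ->
  {for t, continuous (fun s => reval p (X s))}.
Proof.
move=> cX; elim/mpoly_ring_ind: p => [c|i|p q IHp IHq|p q IHp IHq].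
- rewrite (_ : (fun s => reval (mpolyC 3 c) (X s)) = fun=> c); last by apply/funext => s; rewrite revalC.
  exact: cvg_cst.
- rewrite (_ : (fun s => reval (mpolyX R (mnm1 i)) (X s)) = (fun s => X s 0 i)); last by apply/funext => s; rewrite revalX.
  exact: cX.
- rewrite (_ : (fun s => reval (p + q) (X s)) = (fun s => reval p (X s) + reval q (X s))); last by apply/funext => s; rewrite revalD.
  exact: cvgD.
- rewrite (_ : (fun s => reval (p * q) (X s)) = (fun s => reval p (X s) * reval q (X s))); last by apply/funext => s; rewrite revalM.
  exact: cvgM.
Qed.

Lemma measurable_reval d (T : measurableType d) (X : T -> 'rV[R]_3) p :
  (forall i, measurable_fun setT (fun s => X s 0 i)) ->
  measurable_fun setT (fun s => reval p (X s)).
Proof.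
move=> cX; elim/mpoly_ring_ind: p => [c|i|p q IHp IHq|p q IHp IHq].
- rewrite (_ : (fun s => reval (mpolyC 3 c) (X s)) = fun=> c); last by apply/funext => s; rewrite revalC.
  exact: measurable_cst.
- rewrite (_ : (fun s => reval (mpolyX R (mnm1 i)) (X s)) = (fun s => X s 0 i)); last by apply/funext => s; rewrite revalX.
  exact: cX.
- rewrite (_ : (fun s => reval (p + q) (X s)) = (fun s => reval p (X s) + reval q (X s))); last by apply/funext => s; rewrite revalD.
  exact: measurable_funD.
- rewrite (_ : (fun s => reval (p * q) (X s)) = (fun s => reval p (X s) * reval q (X s))); last by apply/funext => s; rewrite revalM.
  exact: measurable_funM.
Qed.

Definition rderiv v p : mpoly 3 R := \sum_(i < 3) v 0 i *: mderiv i p.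

Lemma reval_rderiv v p x : reval (rderiv v p) x = dot v (grad p x).
Proof.
rewrite /rderiv /dot /grad !sum3 !revalD !revalZ !mxE.
by [].
Qed.

Lemma reval_bounded p (rho : R) : exists2 C : R, 0 <= C &
  forall x, (forall i, `|x 0 i| <= rho) -> `|reval p x| <= C.
Proof.
elim/mpoly_ring_ind: p => [c|i|p q [C C0 HC] [D D0 HD]|p q [C C0 HC] [D D0 HD]].
- by exists `|c| => // x _; rewrite revalC.
- by exists `|rho| => // x xr; rewrite revalX (le_trans (xr i))// ler_norm.
- exists (C + D); first exact: addr_ge0.
  by move=> x xr; rewrite revalD (le_trans (ler_normD _ _))// lerD ?HC ?HD.
- exists (C * D); first exact: mulr_ge0.
  by move=> x xr; rewrite revalM normrM ler_pM ?HC ?HD.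
Qed.

(** The estimate is uniform over a box of base points and directions, as is needed for integration.
    It follows by induction on the construction of the polynomial, not from a mean value theorem. *)
Lemma reval_taylor p (rho : R) : 0 <= rho -> exists2 C : R, 0 <= C &
  forall x v t, (forall i, `|x 0 i| <= rho) -> (forall i, `|v 0 i| <= rho) -> `|t| <= 1 ->
   `|reval p (x + t *: v) - reval p x - t * dot v (grad p x)| <= C * t ^+ 2.
Proof.
move=> rho0; elim/mpoly_ring_ind: p => [c|i|p q [C C0 HC] [D D0 HD]|p q [C C0 HC] [D D0 HD]].
- exists 0 => // x v t _ _ _; rewrite !revalC dot3 !mxE !mderivC mul0r.
  have z y : reval (0 : mpoly 3 R) y = 0 by rewrite -mpolyC0 revalC.
  by rewrite !z !mulr0 !addr0 mulr0 subrr subr0 normr0.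
- exists 0 => // x v t _ _ _; rewrite !revalX mul0r dot3 !mxE !mderivXU !revalC.
  by case: (I3E i) => ->; rewrite ?eqxx ?I3_eqE normr_le0 /=; apply/eqP; ring.
- exists (C + D); first exact: addr_ge0.
  move=> x v t xr vr t1; rewrite !revalD.
  have -> : dot v (grad (p + q) x) = dot v (grad p x) + dot v (grad q x).
    by rewrite !dot3 !mxE !mderivD !revalD; ring.
  rewrite (_ : _ - _ = (reval p (x + t *: v) - reval p x - t * dot v (grad p x)) +
     (reval q (x + t *: v) - reval q x - t * dot v (grad q x))); last by ring.
  by rewrite (le_trans (ler_normD _ _))// mulrDl lerD ?HC ?HD.
- have [Bp Bp0 HBp] := reval_bounded p (rho + rho).
  have [Bq Bq0 HBq] := reval_bounded q (rho + rho).
  have dB (r : mpoly 3 R) : exists2 E : R, 0 <= E & forall x v, (forall i, `|x 0 i| <= rho) ->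
      (forall i, `|v 0 i| <= rho) -> `|dot v (grad r x)| <= E.
    have [E0 E00 HE0] := reval_bounded (mderiv i0 r) rho.
    have [E1 E10 HE1] := reval_bounded (mderiv i1 r) rho.
    have [E2 E20 HE2] := reval_bounded (mderiv i2 r) rho.
    exists (rho * E0 + rho * E1 + rho * E2); first by rewrite !addr_ge0// mulr_ge0.
    move=> x v xr vr; rewrite dot3 !mxE.
    rewrite (le_trans (ler_normD _ _))// lerD//; last by rewrite normrM ler_pM ?HE2.
    by rewrite (le_trans (ler_normD _ _))// lerD// normrM ler_pM ?HE0 ?HE1.
  have [Ep Ep0 HEp] := dB p; have [Eq Eq0 HEq] := dB q.
  (* With primes for values at [x + t v], the remainder of a product is [(P' - P - t dp) Q' + P (Q'
     - Q - t dq) + t dp (Q' - Q)]; the three summands of the constant bound these terms. The point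
     [x + t v] lies in the box of twice the radius, whence the bounds on [rho + rho]. *)
  exists (C * Bq + Bp * D + Ep * (Eq + D)); first by rewrite !addr_ge0// mulr_ge0// addr_ge0.
  move=> x v t xr vr t1; rewrite !revalM.
  have -> : dot v (grad (p * q) x) = dot v (grad p x) * reval q x + reval p x * dot v (grad q x).
    by rewrite !dot3 !mxE !mderivM !revalD !revalM; ring.
  have hp := HC x v t xr vr t1; have hq := HD x v t xr vr t1.
  have xr2 i : `|x 0 i| <= rho + rho by rewrite (le_trans (xr i))// lerDl.
  have xtr i : `|(x + t *: v) 0 i| <= rho + rho.
    rewrite !mxE (le_trans (ler_normD _ _))// lerD// normrM -[leRHS]mul1r ler_pM//.
  have hBp := HBp x xr2; have hBq := HBq _ xtr; have hEp := HEp x v xr vr; have hEq := HEq x v xr vr.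
  set P' := reval p (x + t *: v) in hp *; set Q' := reval q (x + t *: v) in hq hBq *.
  set P := reval p x in hp hBp *; set Q := reval q x in hq *.
  set dp := dot v (grad p x) in hp hEp *; set dq := dot v (grad q x) in hq hEq *.
  rewrite (_ : _ - _ = (P' - P - t * dp) * Q' + P * (Q' - Q - t * dq) +
     t * dp * (Q' - Q)); last by ring.
  have hQ : `|Q' - Q| <= `|t| * (Eq + D).
    rewrite (_ : Q' - Q = (Q' - Q - t * dq) + t * dq); last by ring.
    rewrite addrC mulrDr (le_trans (ler_normD _ _))// lerD//.
      by rewrite normrM ler_wpM2l.
    rewrite (le_trans hq)// mulrC ler_wpM2r// -real_normK ?num_real// expr2.
    by rewrite -[leRHS]mul1r ler_wpM2r.
  rewrite (_ : (_ + _) * t ^+ 2 = C * t ^+ 2 * Bq + Bp * (D * t ^+ 2) +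
     (`|t| * Ep) * (`|t| * (Eq + D))); last first.
    by rewrite -[t ^+ 2]real_normK ?num_real//; ring.
  rewrite (le_trans (ler_normD _ _))// lerD//.
    rewrite (le_trans (ler_normD _ _))// lerD//.
      by rewrite normrM ler_pM.
    by rewrite normrM ler_pM.
  rewrite normrM; apply: ler_pM => //.
  by rewrite normrM ler_wpM2l.
Qed.

Lemma reval_affine p : (msize p <= 2)%N -> exists (c : R) (g : 'rV[R]_3),
  (forall x, reval p x = c + dot g x) /\ (forall x, grad p x = g).
Proof.
move=> p2; exists (mcoeff mnm0 p), (\row_i mcoeff (mnm1 i) p).
have E : p = mpolyC 3 (mcoeff mnm0 p) + \sum_(i < 3) mcoeff (mnm1 i) p *: mpolyX R (mnm1 i).
  apply/mpolyP => m; rewrite mcoeffD mcoeffC raddf_sum /=.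
  under eq_bigr do rewrite mcoeffZ mcoeffX.
  have [m1|] := leqP (mdeg m) 1; last first.
    move=> m2; rewrite (memN_msupp_eq0 (msize_mdeg_ge (leq_trans p2 m2))).
    have -> : (m == mnm0) = false.
      by apply/negP => /eqP h; rewrite h mdeg0 in m2.
    rewrite mulr0 add0r big1// => i _; rewrite (_ : (_ == m) = false) ?mulr0//.
    by apply/negP => /eqP h; rewrite -h mdeg1 in m2.
  move: m1; rewrite leq_eqVlt ltnS leqn0 => /orP[|].
    move/mdeg1P => [i /eqP ->]; rewrite (bigD1 i)//= eqxx mulr1 big1 ?addr0.
      rewrite (_ : (_ == _) = false) ?mulr0 ?add0r//.
      by apply/negP => /eqP /(congr1 (@mdeg 3)); rewrite mdeg0 mdeg1.
    move=> j ji; rewrite (_ : (_ == _) = false) ?mulr0//.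
    apply/negP => /eqP /mnmP /(_ j); rewrite !mnmE eqxx.
    by rewrite eq_sym (negPf ji).
  rewrite mdeg_eq0 => /eqP ->; rewrite eqxx mulr1 big1 ?addr0// => i _.
  rewrite (_ : (_ == _) = false) ?mulr0//.
  by apply/negP => /eqP /(congr1 (@mdeg 3)); rewrite mdeg0 mdeg1.
have revE x : reval p x = mcoeff mnm0 p + dot (\row_i mcoeff (mnm1 i) p) x.
  rewrite {1}E revalD revalC sum3 !revalD !revalZ !revalX dot3 !mxE.
  by [].
split => // x; apply/rowP => i; rewrite !mxE {1}E mderivD mderivC sum3 !mderivD !mderivZ.
rewrite add0r !mderivXU !revalD !revalZ !revalC.
by case: (I3E i) => ->; rewrite ?eqxx ?I3_eqE /= !mulr1 !mulr0 ?addr0 ?add0r.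
Qed.

Implicit Types P Q : mpoly 3 R[i].

Lemma cevalC (c : R[i]) x : ceval (mpolyC 3 c) x = c. Proof. exact: mevalC. Qed.
Lemma cevalX i x : ceval (mpolyX R[i] (mnm1 i)) x = (x 0 i)%:C. Proof. exact: mevalXU. Qed.
Lemma cevalD P Q x : ceval (P + Q) x = ceval P x + ceval Q x. Proof. exact: mevalD. Qed.
Lemma cevalB P Q x : ceval (P - Q) x = ceval P x - ceval Q x. Proof. exact: mevalB. Qed.
Lemma cevalM P Q x : ceval (P * Q) x = ceval P x * ceval Q x. Proof. exact: mevalM. Qed.
Lemma cevalZ (c : R[i]) P x : ceval (c *: P) x = c * ceval P x. Proof. exact: mevalZ. Qed.

(** At real points the real and imaginary parts of a complex polynomial are real polynomials. The
    clause on partial derivatives carries normal derivatives over as well. *)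
Lemma ceval_ReIm P : exists A B : mpoly 3 R,
  (forall x, ceval P x = (reval A x +i* reval B x)) /\
  (forall i x, ceval (mderiv i P) x = (reval (mderiv i A) x +i* reval (mderiv i B) x)).
Proof.
elim/mpoly_ring_ind: P => [c|i|P Q [A1 [B1 [E1 D1]]] [A2 [B2 [E2 D2]]]|P Q [A1 [B1 [E1 D1]]] [A2 [B2 [E2 D2]]]].
- exists (mpolyC 3 (complex.Re c)), (mpolyC 3 (complex.Im c)); split => [x|i x].
    by rewrite cevalC !revalC; case: c.
  by rewrite !mderivC -!mpolyC0 cevalC !revalC.
- exists (mpolyX R (mnm1 i)), 0; split => [x|j x].
    by rewrite cevalX revalX -mpolyC0 revalC.
  by rewrite !mderivXU -mpolyC0 !mderivC -mpolyC0 cevalC !revalC; case: (j == i).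
- exists (A1 + A2), (B1 + B2); split => [x|i x].
    by rewrite cevalD E1 E2 !revalD.
  by rewrite !mderivD cevalD D1 D2 !revalD.
- exists (A1 * A2 - B1 * B2), (A1 * B2 + B1 * A2).
  have rB p q x : reval (p - q) x = reval p x - reval q x by exact: mevalB.
  split => [x|i x].
    by rewrite cevalM E1 E2 rB !revalD !revalM.
  rewrite mderivM cevalD !cevalM D1 D2 E1 E2 mderivB !mderivD !mderivM rB !revalD !revalM.
  by apply/eqP; rewrite eq_complex /=; apply/andP; split; apply/eqP; ring.
Qed.

End polynomials.

(** * Barycentric coordinates *)

Section barycentric.
Variables (R : realType) (M : nat) (G : geometry R M).
Implicit Types (K S : {set 'I_M}) (x y : 'rV[R]_3) (a : R * 'rV[R]_3).

Definition affr a x : R := a.1 + dot a.2 x.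

Lemma affr_conv a x y (s t : R) : s + t = 1 -> affr a (s *: x + t *: y) = s * affr a x + t * affr a y.
Proof. by move=> st; rewrite /affr dotDr !dotZr -[X in X + _]mulr1 -st; ring. Qed.

Lemma affrD a x v : affr a (x + v) = affr a x + dot a.2 v.
Proof. by rewrite /affr dotDr addrA. Qed.

Lemma affr_sum (I : finType) (P : pred I) a (c : I -> R) (f : I -> 'rV[R]_3) :
  \sum_(i | P i) c i = 1 ->
  affr a (\sum_(i | P i) c i *: f i) = \sum_(i | P i) c i * affr a (f i).
Proof.
move=> c1; rewrite /affr (eq_bigr (fun i => c i * a.1 + c i * dot a.2 (f i))); last first.
  by move=> i _; rewrite mulrDr.
rewrite big_split /= -mulr_suml c1 mul1r; congr (_ + _).
by elim/big_rec2: _ => [|i y1 y2 _ <-]; rewrite ?dot0r// dotDr dotZr.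
Qed.

Definition barycentric K (b : 'I_M -> R * 'rV[R]_3) : Prop :=
  [/\ forall x, \sum_(i in K) affr (b i) x = 1,
      forall x, x = \sum_(i in K) affr (b i) x *: vtx G i &
      forall i j, i \in K -> j \in K -> affr (b i) (vtx G j) = (i == j)%:R].

(** The rows [(1, vertex)] form a square matrix whose left kernel is trivial by affine independence.
    The columns of its inverse contain the coefficients of the barycentric coordinates. *)
Lemma barycentric_exists K : #|K| = 4%N -> affinely_independent G K ->
  exists b, barycentric K b.
Proof.
move=> K4 ai.
pose e (i : 'I_4) : 'I_M := enum_val (cast_ord (esym K4) i).
have eK i : e i \in K by exact: enum_valP.
have e_inj : injective e by move=> i j /enum_val_inj /cast_ord_inj.
have e_surj k : k \in K -> exists i, e i = k.
  move=> kK; exists (cast_ord K4 (enum_rank_in kK k)).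
  by rewrite /e cast_ordK enum_rankK_in.
have sumK (V : nmodType) (f : 'I_M -> V) : \sum_(k in K) f k = \sum_(i < 4) f (e i).
  rewrite (reindex_onto e (fun k => odflt ord0 [pick i | e i == k])) /=.
    apply: eq_bigl => i; rewrite eK /=; case: pickP => [j /eqP /e_inj ->|/(_ i)]; rewrite ?eqxx//.
  move=> k kK; case: pickP => [j /eqP //|] h.
  by have [i ie] := e_surj k kK; have := h i; rewrite ie eqxx.
pose A : 'M[R]_(4, 1 + 3) := row_mx (const_mx 1) (\matrix_i vtx G (e i)).
have uA (u : 'rV[R]_4) : u *m A = 0 -> u = 0.
  (* A kernel vector indexed by the four vertices is extended by 0 to all nodes, the format in which
     affine independence is stated. *)
  move=> uA0; pose c k : R := \sum_(i < 4 | e i == k) u 0 i.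
  have ce i : c (e i) = u 0 i.
    by rewrite /c (big_pred1 i)// => j; rewrite (inj_eq e_inj).
  have cK k : k \notin K -> c k = 0.
    move=> kK; rewrite /c big_pred0// => i; apply/negbTE; apply: contra kK => /eqP <-.
    exact: eK.
  have sc (V : nmodType) (f : 'I_M -> V) : (forall k, k \notin K -> f k = 0) ->
      \sum_k f k = \sum_(i < 4) f (e i).
    by move=> f0; rewrite -sumK [RHS]big_mkcond /=; apply: eq_bigr => k _; case: ifPn => // /f0.
  have [u1 u3] := eq_row_mx (etrans (esym (mul_mx_row _ _ _)) (etrans uA0 (esym (row_mx0 _ _ _ _)))).
  have c0 : forall k, c k = 0.
    apply: ai => //.
      rewrite sc//; under eq_bigr do rewrite ce.
      rewrite -[RHS](_ : (u *m (const_mx 1 : 'cV_4)) 0 0 = 0); last by rewrite u1 mxE.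
      by rewrite mxE; apply: eq_bigr => i _; rewrite mxE mulr1.
    rewrite sc; last by move=> k /cK ->; rewrite scale0r.
    under eq_bigr do rewrite ce.
    transitivity (u *m \matrix_i vtx G (e i)); last exact: u3.
    by rewrite mulmx_sum_row; apply: eq_bigr => i _; rewrite rowK.
  by apply/rowP => i; rewrite -ce c0 mxE.
have Au : (A : 'M[R]_4) \in unitmx.
  rewrite -row_free_unit -kermx_eq0; apply/eqP/row_matrixP => i; rewrite row0.
  by apply: uA; apply: sub_kermxP; rewrite row_sub.
pose B : 'M[R]_4 := invmx (A : 'M[R]_4).
pose lam (x : 'rV[R]_3) : 'rV[R]_4 := (row_mx (const_mx 1 : 'M[R]_1) x : 'rV[R]_4) *m B.
have lamA x : lam x *m A = row_mx (const_mx 1 : 'M[R]_1) x by rewrite /lam mulmxKV.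
have [sum1 rep] : (forall x, \sum_(i < 4) lam x 0 i = 1) /\
    (forall x, x = \sum_(i < 4) lam x 0 i *: vtx G (e i)).
  split => x; have := lamA x; rewrite mul_mx_row => /eq_row_mx[u1 u3].
    move/rowP : u1 => /(_ ord0); rewrite !mxE => <-.
    by apply: eq_bigr => i _; rewrite !mxE mulr1.
  by rewrite -{1}u3 mulmx_sum_row; apply: eq_bigr => i _; rewrite rowK.
pose r (k : 'I_M) : 'I_4 := odflt ord0 [pick i | e i == k].
have re i : r (e i) = i.
  by rewrite /r; case: pickP => [j /eqP /e_inj //|/(_ i)]; rewrite eqxx.
pose b k : R * 'rV[R]_3 := (B (lshift 3 (ord0 : 'I_1)) (r k), \row_j B (rshift 1 j) (r k)).
have bE k x : affr (b k) x = lam x 0 (r k).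
  rewrite /affr /lam /= mxE (big_split_ord _ _ _ (m := 1) (n := 3)) /= big_ord1.
  rewrite (row_mxEl (n1 := 1) (n2 := 3)) mxE mul1r; congr (_ + _).
  by apply: eq_bigr => j _; rewrite mxE (row_mxEr (n1 := 1) (n2 := 3)) mulrC.
exists b; split.
- by move=> x; rewrite sumK; under eq_bigr do rewrite bE re; exact: sum1.
- by move=> x; rewrite sumK; under eq_bigr do rewrite bE re; exact: rep.
- move=> i j /e_surj[i' <-] /e_surj[j' <-]; rewrite bE re (inj_eq e_inj).
  have -> : lam (vtx G (e j')) = row j' (1%:M : 'M[R]_4).
    rewrite -(mulmxV Au) row_mul /lam; congr (_ *m _).
    apply: etrans (esym (@row_row_mx _ 4 1 3 j' _ _)); rewrite rowK.
    by congr (row_mx _ _); apply/rowP => k; rewrite !mxE.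
  by rewrite !mxE eq_sym.
Qed.

Section element.
Variables (K : {set 'I_M}) (b : 'I_M -> R * 'rV[R]_3).
Hypothesis bK : barycentric K b.
Let lam i x := affr (b i) x.

Lemma bary_sum1 x : \sum_(i in K) lam i x = 1.
Proof. by case: bK => h _ _; exact: h. Qed.
Lemma bary_rep x : x = \sum_(i in K) lam i x *: vtx G i.
Proof. by case: bK => _ h _; exact: h. Qed.
Lemma bary_vtx i j : i \in K -> j \in K -> lam i (vtx G j) = (i == j)%:R.
Proof. by case: bK => _ _; exact. Qed.

Lemma bary_unique (c : 'I_M -> R) x : (forall i, i \notin K -> c i = 0) ->
  \sum_i c i = 1 -> x = \sum_i c i *: vtx G i -> forall i, i \in K -> c i = lam i x.
Proof.
move=> c0 c1 cx i iK.
have c1' : \sum_(j in K) c j = 1.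
  by rewrite -c1 big_mkcond /=; apply: eq_bigr => j _; case: ifPn => // /c0.
have cx' : x = \sum_(j in K) c j *: vtx G j.
  by rewrite cx big_mkcond [RHS]big_mkcond /=; apply: eq_bigr => j _; case: ifPn => // /c0 ->; rewrite scale0r.
rewrite /lam cx' affr_sum// (bigD1 i)//= -/(lam _ _) bary_vtx// eqxx mulr1 big1 ?addr0//.
by move=> j /andP[jK ji]; rewrite -/(lam _ _) bary_vtx// eq_sym (negPf ji) mulr0.
Qed.

Lemma affr_bary a x : affr a x = \sum_(i in K) lam i x * affr a (vtx G i).
Proof. by rewrite {1}[x]bary_rep affr_sum// bary_sum1. Qed.

Lemma simplex_baryP S x : S \subset K ->
  simplex G S x <-> (forall i, i \in S -> 0 <= lam i x) /\
                    (forall i, i \in K -> i \notin S -> lam i x = 0).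
Proof.
move=> SK; split=> [[c [c0 cS c1 cx]]|[l0 lS]].
  have cK i : i \notin K -> c i = 0.
    by move=> iK; apply: cS; apply: contra iK; exact: (fintype.subsetP SK).
  have E := bary_unique cK c1 cx.
  by split=> [i iS|i iK iS]; rewrite -E//; [exact: (fintype.subsetP SK)|exact: cS].
exists (fun i => if i \in K then lam i x else 0); split.
- move=> i; case: ifPn => // iK; have [iS|iS] := boolP (i \in S); first exact: l0.
  by rewrite lS.
- by move=> i iS; case: ifPn => // iK; exact: lS.
- by rewrite -big_mkcond /=; exact: bary_sum1.
- rewrite {1}[x]bary_rep big_mkcond /=; apply: eq_bigr => i _.
  by case: ifPn => // _; rewrite scale0r.
Qed.

Lemma simplexP x : simplex G K x <-> forall i, i \in K -> 0 <= lam i x.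
Proof.
rewrite simplex_baryP//; split=> [[]//|h]; split => // i ->.
by [].
Qed.

Lemma simplex_bounded : exists2 rho : R, 0 <= rho &
  forall x, simplex G K x -> forall j, `|x 0 j| <= rho.
Proof.
exists (\sum_(i in K) \sum_j `|vtx G i 0 j|).
  by apply: sumr_ge0 => i _; exact: sumr_ge0.
move=> x /simplexP x0 j; rewrite [x]bary_rep summxE.
apply: le_trans (ler_norm_sum _ _ _) _; apply: ler_sum => i iK.
have l1 : lam i x <= 1.
  rewrite -(bary_sum1 x) (bigD1 i)//= lerDl; apply: sumr_ge0 => k /andP[kK _]; exact: x0.
rewrite mxE normrM ger0_norm ?x0//.
apply: (@le_trans _ _ `|vtx G i 0 j|); first by rewrite ler_piMl.
by rewrite (bigD1 j)//= lerDl sumr_ge0.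
Qed.

Lemma continuous_affr a x : {for x, continuous (affr a)}.
Proof.
rewrite (_ : affr a = fun x => a.1 + (a.2 0 i0 * x 0 i0 + a.2 0 i1 * x 0 i1 + a.2 0 i2 * x 0 i2)); last first.
  by apply/funext => y; rewrite /affr dot3.
have cc i (c : R) : (fun y : 'rV[R]_3 => c * y 0 i) @ nbhs x --> c * x 0 i.
  by apply: (@cvgMr _ _ (nbhs x) (nbhs_filter x)); exact: coord_continuous.
apply: (@cvgD _ _ _ (nbhs x) (nbhs_filter x)); first exact: (@cvg_cst _ _ _ (nbhs x) (nbhs_filter x)).
apply: (@cvgD _ _ _ (nbhs x) (nbhs_filter x)) => //.
exact: (@cvgD _ _ _ (nbhs x) (nbhs_filter x)).
Qed.

Lemma interior_simplexP x : (simplex G K)° x <-> forall i, i \in K -> 0 < lam i x.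
Proof.
split=> [|l0].
  rewrite /interior => nx i iK; rewrite lt_neqAle.
  have xK : simplex G K x by exact: nbhs_singleton.
  rewrite (simplexP x).1// andbT; apply/negP => /eqP li0.
  (* If coordinate [i] vanished at an interior point, a small step away from vertex [i] would make
     it negative without leaving the simplex. *)
  have cf : {for (0 : R), continuous (fun t : R => x + t *: (x - vtx G i))}.
    by apply: cvgD; [exact: cvg_cst|apply: cvgZl; exact: cvg_id].
  have : \forall t \near (0 : R), simplex G K (x + t *: (x - vtx G i)).
    by apply: cf; rewrite scale0r addr0.
  move=> /nbhs_ballP[e /= e0 eP].
  have he : ball (0 : R) e (e / 2).
    by rewrite /ball /= sub0r normrN ger0_norm ?divr_ge0 ?ltW// ltr_pdivrMr// ltr_pMr// ltr1n.
  have /simplexP /(_ i iK) := eP _ he.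
  rewrite /lam affrD dotZr dotBr.
  have := li0; have := bary_vtx iK iK; rewrite eqxx mulr1n /lam /affr => h1 h2.
  have -> : dot (b i).2 x - dot (b i).2 (vtx G i) = -1 by lra.
  by move: h2; rewrite /affr => <-; rewrite add0r mulrN1 oppr_ge0 leNgt divr_gt0.
have : \forall y \near x, forall i : 'I_M, i \in K -> 0 < lam i y.
  apply: (@filter_forall _ _ _ _ (nbhs_filter x)) => i; have [iK|iK] := boolP (i \in K); last exact: nearW.
  have := @continuous_affr (b i) x => /cvgrPdist_lt /(_ _ (l0 i iK)).
  apply: filterS => y; rewrite -/(lam i x) -/(lam i y) => h _.
  by move: h; rewrite ltr_norml => /andP[_]; lra.
by apply: filterS => y h; apply/simplexP => i iK; rewrite ltW// h.
Qed.

End element.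

End barycentric.

(** * Integrals over a cut element *)

Section measurable3.
Variable R : realType.
Implicit Types (f g : 'rV[R]_3 -> R) (E : set 'rV[R]_3).

(* The library has no sigma-algebra on ['rV[R]_3]: measurability is tested along
   maps with measurable coordinates. *)
Definition mfun3 f : Prop := forall d (T : measurableType d) (X : T -> 'rV[R]_3),
  (forall i, measurable_fun setT (fun s => X s 0 i)) -> measurable_fun setT (f \o X).

Definition mset3 E : Prop := mfun3 (fun x => (x \in E)%:R).

Lemma mfun3_cst (c : R) : mfun3 (fun=> c).
Proof. by move=> d T X mX; exact: measurable_cst. Qed.

Lemma mfun3M f g : mfun3 f -> mfun3 g -> mfun3 (fun x => f x * g x).
Proof. by move=> mf mg d T X mX; apply: measurable_funM; [exact: mf|exact: mg]. Qed.

Lemma mfun3D f g : mfun3 f -> mfun3 g -> mfun3 (fun x => f x + g x).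
Proof. by move=> mf mg d T X mX; apply: measurable_funD; [exact: mf|exact: mg]. Qed.

Lemma mfun3_reval p : mfun3 (reval p).
Proof. by move=> d T X mX; exact: measurable_reval. Qed.

Lemma mfun3_affr a : mfun3 (@affr R a).
Proof.
move=> d T X mX; rewrite (_ : _ \o _ = fun s => a.1 + (a.2 0 i0 * X s 0 i0 + a.2 0 i1 * X s 0 i1 + a.2 0 i2 * X s 0 i2)); last first.
  by apply/funext => s; rewrite /= /affr dot3.
by do ![apply: measurable_funD => //|apply: measurable_funM => //].
Qed.

Lemma mfun3_ge0 f : mfun3 f -> mfun3 (fun x => (0 <= f x)%R%:R).
Proof. by move=> mf d T X mX; apply: measurable_indicator; exact: mf. Qed.

Lemma mfun3_prod (I : Type) (s : seq I) (P : pred I) (f : I -> 'rV[R]_3 -> R) :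
  (forall i, mfun3 (f i)) -> mfun3 (fun x => \prod_(i <- s | P i) f i x).
Proof. by move=> mf d T X mX; apply: measurable_prod_seq => i; exact: mf. Qed.

Lemma mset3I E E' : mset3 E -> mset3 E' -> mset3 (E `&` E').
Proof.
move=> mE mE'; have := mfun3M mE mE'; congr mfun3; apply/funext => x.
by rewrite in_setI -mulnb natrM.
Qed.

Lemma mset3_ge0 f : mfun3 f -> mset3 [set x | 0 <= f x].
Proof. by move=> /mfun3_ge0; congr mfun3; apply/funext => x; rewrite mem_setE. Qed.

Lemma mset3_lt0 f : mfun3 f -> mset3 [set x | f x < 0].
Proof.
move=> /mfun3_ge0 mf; have := mfun3D (mfun3_cst 1) (mfun3M (mfun3_cst (-1)) mf).
congr mfun3; apply/funext => x.
have -> : (x \in [set x | f x < 0]) = (f x < 0) by apply/idP/idP; rewrite in_setE.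
rewrite ltNge; case: (0 <= f x) => /=; lra.
Qed.

Lemma mset3_eq0 f : mfun3 f -> mset3 [set x | f x = 0].
Proof.
move=> mf; have mN := mfun3M (mfun3_cst (-1)) mf.
rewrite (_ : [set x | f x = 0] = [set x | 0 <= f x] `&` [set x | 0 <= -1 * f x]).
  by apply: mset3I; exact: mset3_ge0.
apply/seteqP; split=> x /=; first by move=> ->; rewrite mulr0 lexx.
by case=> h1 h2; apply/eqP; rewrite eq_le h1 andbT; move: h2; rewrite mulN1r oppr_ge0.
Qed.

(** The statement covers the faces of [K]. On a face the coordinates of the omitted nodes vanish,
    which is expressed by two opposite inequalities so that the indicator is a product of indicators
    of half-spaces. *)
Lemma mset3_simplex (M : nat) (G : geometry R M) (K S : {set 'I_M}) b :
  barycentric G K b -> S \subset K -> mset3 (simplex G S).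
Proof.
move=> bK SK.
have h : mfun3 (fun x => (\prod_(i in K) (0 <= affr (b i) x)%R%:R) *
                  \prod_(i in K | i \notin S) (0 <= - 1 * affr (b i) x)%R%:R).
  apply: mfun3M; apply: mfun3_prod => i; apply: mfun3_ge0; first exact: mfun3_affr.
  by apply: mfun3M; [exact: mfun3_cst|exact: mfun3_affr].
move: h; congr mfun3; apply/funext => x.
have [xS|xS] := boolP (x \in simplex G S).
  have {xS}/(simplex_baryP bK _ SK)[h1 h2] : simplex G S x by move/set_mem: xS.
  rewrite big1 ?big1 ?mulr1//.
    by move=> i /andP[iK iS]; rewrite h2// mulr0 lexx.
  by move=> i iK; have [iS|iS] := boolP (i \in S); [rewrite h1|rewrite h2// lexx].
apply/eqP; rewrite mulf_eq0.
apply/negPn/negP; rewrite negb_or => /andP[/prodf_neq0 h1 /prodf_neq0 h2].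
move/negP: xS; apply; apply/mem_set/(simplex_baryP bK _ SK).
have h1' i : i \in K -> 0 <= affr (b i) x.
  by move=> iK; have := h1 i iK; rewrite pnatr_eq0 eqb0 negbK.
split=> [i iS|i iK iS]; first exact/h1'/(fintype.subsetP SK).
have := h2 i; rewrite iK iS => /(_ isT); rewrite pnatr_eq0 eqb0 negbK mulN1r oppr_ge0 => h3.
by apply/eqP; rewrite eq_le h3 h1'.
Qed.

Lemma mfun3_patch E f : mset3 E -> mfun3 f -> mfun3 (f \_ E).
Proof.
move=> mE mf; have := mfun3M mf mE; congr mfun3; apply/funext => x.
by rewrite /patch; case: (x \in E); rewrite ?mulr1 ?mulr0.
Qed.

Lemma measurable_plane_pt c i : measurable_fun setT (fun y : measurableTypeR R * measurableTypeR R => plane_pt c y 0 i).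
Proof.
rewrite (_ : (fun _ => _) = fun y => aff2 (c.1.1 0 i, c.1.2 0 i, c.2 0 i) y); first exact: measurable_aff2.
by apply/funext => y; rewrite /plane_pt /aff2 !mxE /= mulrC [y.2 * _]mulrC.
Qed.

Lemma mfun3_plane f c : mfun3 f ->
  measurable_fun setT (f \o plane_pt c : measurableTypeR R * measurableTypeR R -> R).
Proof. by apply; exact: measurable_plane_pt. Qed.

Lemma measurable_line_pt c i : measurable_fun setT (fun y : measurableTypeR R => line_pt c y 0 i).
Proof.
rewrite (_ : (fun _ => _) = fun y => c.1 0 i + c.2 0 i * y).
  by apply: measurable_funD => //; apply: measurable_funM.
by apply/funext => y; rewrite /line_pt !mxE /= mulrC.
Qed.

Lemma mfun3_line f c : mfun3 f ->
  measurable_fun setT (f \o line_pt c : measurableTypeR R -> R).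
Proof. by apply; exact: measurable_line_pt. Qed.

Lemma measurable_pt3 i : measurable_fun setT
  (fun y : measurableTypeR R * measurableTypeR R * measurableTypeR R => @pt3 R y 0 i).
Proof.
rewrite (_ : (fun _ => _) = fun y => aff3 (0, (i == i0)%:R, (i == i1)%:R, (i == i2)%:R) y); first exact: measurable_aff3.
by apply/funext => y; case: (I3E i) => ->; rewrite /pt3 /aff3 !mxE ?eqxx ?I3_eqE /=; lra.
Qed.

Lemma mfun3_pt3 f : mfun3 f ->
  measurable_fun setT (f \o @pt3 R : measurableTypeR R * measurableTypeR R * measurableTypeR R -> R).
Proof. by apply; exact: measurable_pt3. Qed.

End measurable3.

(** * Position of the wall plane in a tetrahedron, and the derivative of the volume integral *)

Section element_cut.
Variables (R : realType) (M : nat) (G : geometry R M) (K : {set 'I_M}) (b : 'I_M -> R * 'rV[R]_3).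
Notation leb := (@lebesgue_measure R).
Notation RR := (measurableTypeR R).
Notation leb2 := (@leb2 R).
Notation leb3 := (@leb3 R).
Hypotheses (K4 : #|K| = 4%N) (bK : barycentric G K b).
Let lam i x := affr (b i) x.
Implicit Types (X : 'rV[R]_3) (a e : R * 'rV[R]_3).

Lemma bary_dir x : x = \sum_(i in K) dot (b i).2 x *: vtx G i.
Proof.
have := congr2 (fun u v => u - v) (bary_rep bK x) (bary_rep bK 0).
rewrite subr0 -sumrB => {1}->; apply: eq_bigr => i _.
by rewrite -scalerBl /affr dot0r addr0 addrC addKr.
Qed.

Lemma zero_plane_proj a x : a.2 != 0 ->
  affr a (x - (affr a x / dot a.2 a.2) *: a.2) = 0.
Proof.
rewrite -dot_eq0 => g0; rewrite affrD dotNr dotZr divfK// subrr//.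
Qed.

(** If coordinate [i] vanished on the zero plane of [a], it would be a multiple of [a]. Being 0 at
    another vertex, where [a] is not, it would vanish identically, against its value 1 at vertex
    [i]. Thus the wall is not in the plane of a face. *)
Lemma bary_not_flat a : a.2 != 0 -> (forall i, i \in K -> affr a (vtx G i) != 0) ->
  forall i, i \in K -> exists x, affr a x = 0 /\ lam i x != 0.
Proof.
move=> g0 av i iK; apply: contrapT => h.
have {}h x : affr a x = 0 -> lam i x = 0.
  by move=> ax; apply/eqP/negPn/negP => lx; apply: h; exists x.
have gg : dot a.2 a.2 != 0 by rewrite dot_eq0.
have lE x : lam i x = affr a x * (dot (b i).2 a.2 / dot a.2 a.2).
  have := h _ (zero_plane_proj x g0); rewrite /lam affrD dotNr dotZr => /eqP.
  by rewrite subr_eq0 => /eqP ->; rewrite mulrAC mulrA.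
have [j jK ji] : exists2 j, j \in K & j != i.
  have : (0 < #|K :\ i|)%N by have := K4; rewrite (cardsD1 i) iK add1n => -[->].
  by case/card_gt0P => j; rewrite !inE => /andP[ji jK]; exists j.
have /esym/eqP := lE (vtx G j); rewrite /lam (bary_vtx bK)// [i == j]eq_sym (negPf ji) mulf_eq0.
rewrite (negPf (av _ jK)) /= => /eqP c0.
by have := lE (vtx G i); rewrite c0 mulr0 /lam (bary_vtx bK)// eqxx => /eqP; rewrite oner_eq0.
Qed.

(** Two distinct points with both coordinates 0 span the line through the other two vertices. If [a]
    vanished at them, it would vanish at those vertices too. *)
Lemma bary_not_edge a i j X Y : (forall i, i \in K -> affr a (vtx G i) != 0) ->
  i \in K -> j \in K -> i != j -> X != Y -> affr a X = 0 -> affr a Y = 0 ->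
  lam i X = 0 -> lam i Y = 0 -> lam j X = 0 -> lam j Y = 0 -> False.
Proof.
move=> av iK jK ij XY aX aY iX iY jX jY.
pose D := Y - X.
have lD k : dot (b k).2 D = lam k Y - lam k X by rewrite /lam /D /affr dotBr; ring.
have aD : dot a.2 D = 0 by move: aX aY; rewrite /affr /D dotBr; lra.
have [k kK kD] : exists2 k, k \in K & dot (b k).2 D != 0.
  apply: contrapT => h; move/eqP: XY; apply; apply/esym/eqP; rewrite -subr_eq0; apply/eqP.
  rewrite -/D [D]bary_dir big1// => k kK; apply/eqP; rewrite scaler_eq0; apply/orP; left.
  by apply/negPn/negP => kD; apply: h; exists k.
have ki : k != i by apply: contra kD => /eqP ->; rewrite lD iX iY subrr.
have kj : k != j by apply: contra kD => /eqP ->; rewrite lD jX jY subrr.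
have : #|K :\ i :\ j :\ k| = 1%N.
  move: K4; rewrite (cardsD1 i) iK (cardsD1 j) !inE jK eq_sym ij /=.
  by rewrite (cardsD1 k) !inE kK ki kj /= => -[].
move/eqP/cards1P => [m Em].
have KE (V : nmodType) (f : 'I_M -> V) : \sum_(r in K) f r = f i + (f j + (f k + f m)).
  rewrite (big_setD1 i)//= (big_setD1 j)/= ?inE ?jK ?[j == i]eq_sym ?ij//.
  by rewrite (big_setD1 k)/= ?inE ?kK ?ki ?kj// Em big_set1.
(* The step along [D] is chosen to bring coordinate [k] to 1. Since the coordinates sum to 1 and
   those of [i] and [j] stay 0, this point is vertex [k]. *)
pose Z := X + ((1 - lam k X) / dot (b k).2 D) *: D.
have lZ r : lam r Z = lam r X + (1 - lam k X) / dot (b k).2 D * dot (b r).2 D.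
  by rewrite [LHS]affrD dotZr.
have Zi : lam i Z = 0 by rewrite lZ (lD i) iX iY subrr mulr0 addr0.
have Zj : lam j Z = 0 by rewrite lZ (lD j) jX jY subrr mulr0 addr0.
have Zk : lam k Z = 1 by rewrite lZ divfK// addrC subrK.
have Zm : lam m Z = 0.
  by have := bary_sum1 bK Z; rewrite KE -/(lam i Z) -/(lam j Z) -/(lam k Z) Zi Zj Zk; rewrite -/(lam m Z); lra.
have ZE : Z = vtx G k.
  rewrite [LHS](bary_rep bK) KE -/(lam i Z) -/(lam j Z) -/(lam k Z) -/(lam m Z) Zi Zj Zk Zm.
  by rewrite !scale0r scale1r addr0 !add0r.
move/eqP: (av _ kK); apply; rewrite -ZE affrD dotZr aD mulr0 aX addr0//.
Qed.

Definition rvol_int (E : set 'rV[R]_3) (f : 'rV[R]_3 -> R) : R :=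
  \int[leb3]_(y in @pt3 R @^-1` E) f (pt3 y).

Lemma vol_intE (E : set 'rV[R]_3) (f : 'rV[R]_3 -> R[i]) :
  vol_int E f = rvol_int E (fun x => complex.Re (f x)) +i* rvol_int E (fun x => complex.Im (f x)).
Proof. by []. Qed.

Lemma rvol_int_mkcond E f : rvol_int E f = \int[leb3]_y (f \_ E) (pt3 y).
Proof.
rewrite /rvol_int Rintegral_mkcond; apply: eq_Rintegral => y _.
by rewrite /patch; congr (if _ then _ else _); apply/idP/idP; rewrite !in_setE.
Qed.

Definition aff3_of a : R * R * R * R := (a.1, a.2 0 i0, a.2 0 i1, a.2 0 i2).

Lemma affr_pt3 a y : affr a (pt3 y) = aff3 (aff3_of a) y.
Proof. by rewrite /affr dot3 /pt3 !mxE /= /aff3 /= !addrA. Qed.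

Lemma patch_simplexE (f : 'rV[R]_3 -> R) x :
  (f \_ (simplex G K)) x = f x * \prod_(i in K) (0 <= affr (b i) x)%R%:R.
Proof.
rewrite /patch; case: ifPn => [/set_mem/(simplexP bK) xK|xK].
  by rewrite big1 ?mulr1// => i iK; rewrite xK.
case: (pselect (exists2 i, i \in K & ~~ (0 <= affr (b i) x))) => [[i iK li]|h].
  by rewrite (bigD1 i)//= (negPf li) mul0r mulr0.
exfalso; move/negP: xK; apply; apply/mem_set/(simplexP bK) => i iK.
by apply/negPn/negP => li; apply: h; exists i.
Qed.

Lemma patchI (f : 'rV[R]_3 -> R) E E' x : (f \_ (E `&` E')) x = (f \_ E) x * (x \in E')%:R.
Proof. by rewrite /patch in_setI; case: (x \in E); case: (x \in E'); rewrite ?mulr1 ?mulr0 ?mul0r. Qed.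

Lemma integrable_simplex_leb3 (f : 'rV[R]_3 -> R) E : mfun3 f -> mset3 E ->
  (forall rho : R, exists C, forall X, (forall j, `|X 0 j| <= rho) -> `|f X| <= C) ->
  leb3.-integrable setT (EFin \o ((f \_ (simplex G K `&` E)) \o @pt3 R)).
Proof.
move=> mf mE bf; have [rho rho0 rhoP] := simplex_bounded bK.
have [C CP] := bf rho.
pose B : set (RR * RR * RR) := box2 rho `*` (`[- rho, rho]%classic : set RR).
apply: (@integrable_bounded R _ (RR * RR * RR)%type leb3 B _ `|C|).
- by apply: measurableX; [exact: measurable_box2|exact: measurable_itv].
- rewrite [X in (X < _)%E](_ : _ = (leb2 (box2 rho) * leb (`[(- rho)%R, rho]%classic : set RR))%E); last first.
    apply: (@product_measure1E _ _ (RR * RR)%type RR R (sleb2 R)); first exact: measurable_box2.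
    exact: measurable_itv.
  by rewrite lte_mul_pinfty ?ge0_fin_numE ?box2_lty ?interval_lty.
- apply: mfun3_pt3; apply: mfun3_patch => //; apply: mset3I => //.
  exact: (mset3_simplex bK).
- move=> y; rewrite /= /patch; case: ifPn => [/set_mem[/rhoP h _]|]; last by rewrite normr0.
  by rewrite (le_trans (CP _ h))// ler_norm.
- move=> y nB; rewrite /= /patch; case: ifPn => // /set_mem[/rhoP h _]; exfalso; apply: nB.
  split; first by apply/box2P; have := h i0; have := h i1; rewrite !mxE.
  by have := h i2; rewrite /= !mxE in_itv /= -ler_norml.
Qed.

Lemma plane_coord_bounded c : exists rho' : R, forall X, simplex G K X ->
  `|(plane_coord c X).1| <= rho' /\ `|(plane_coord c X).2| <= rho'.
Proof.
have [rho rho0 rhoP] := simplex_bounded bK.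
pose u := c.1.2; pose v := c.2.
have bnd (h : 'rV[R]_3) : exists B : R, forall X, simplex G K X -> `|dot h (X - c.1.1)| <= B.
  exists (\sum_(j < 3) `|h 0 j| * (rho + `|c.1.1 0 j|)) => X /rhoP XK.
  rewrite /dot (le_trans (ler_norm_sum _ _ _))//; apply: ler_sum => j _.
  by rewrite normrM ler_wpM2l// !mxE (le_trans (ler_normB _ _))// lerD2r.
have [B1 P1] := bnd ((gram u v)^-1 *: (dot v v *: u - dot u v *: v)).
have [B2 P2] := bnd ((gram u v)^-1 *: (dot u u *: v - dot u v *: u)).
exists (Num.max B1 B2) => X XK; rewrite /plane_coord /= -/u -/v !le_max.
split; apply/orP; [left|right].
  by have := P1 X XK; rewrite dotZl dotBl !dotZl mulrC.
by have := P2 X XK; rewrite dotZl dotBl !dotZl mulrC.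
Qed.

Lemma integrable_simplex_plane (f : 'rV[R]_3 -> R) E c : gram c.1.2 c.2 != 0 ->
  mfun3 f -> mset3 E ->
  (forall rho : R, exists C, forall X, (forall j, `|X 0 j| <= rho) -> `|f X| <= C) ->
  leb2.-integrable setT (EFin \o ((f \_ (simplex G K `&` E)) \o plane_pt c)).
Proof.
move=> g0 mf mE bf; have [rho rho0 rhoP] := simplex_bounded bK.
have [C CP] := bf rho; have [r rP] := plane_coord_bounded c.
apply: (@integrable_box2 R _ `|C| r).
- apply: mfun3_plane; apply: mfun3_patch => //; apply: mset3I => //.
  exact: (mset3_simplex bK).
- move=> y; rewrite /= /patch; case: ifPn => [/set_mem[/rhoP h _]|]; last by rewrite normr0.
  by rewrite (le_trans (CP _ h))// ler_norm.
- move=> y; rewrite /= /patch; case: ifPn => [/set_mem[/rP h _] _|]; last by rewrite eqxx.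
  by move: h; rewrite plane_ptK.
Qed.

Lemma continuous_aff3 al (p : R * R * R) : {for p, continuous (@aff3 R al)}.
Proof.
have c1 : {for p, continuous (fun y : R * R * R => y.1.1)}.
  by apply: (@continuous_comp _ _ _ (@fst (R * R)%type R) fst); exact: cvg_fst.
have c2 : {for p, continuous (fun y : R * R * R => y.1.2)}.
  by apply: (@continuous_comp _ _ _ (@fst (R * R)%type R) snd); [exact: cvg_fst|exact: cvg_snd].
have c3 : {for p, continuous (fun y : R * R * R => y.2)} by exact: cvg_snd.
rewrite /aff3; apply: cvgD; last exact: cvgMr.
apply: cvgD; last exact: cvgMr.
by apply: cvgD; [exact: cvg_cst|exact: cvgMr].
Qed.

Section derivative.
Variables (a e : R * 'rV[R]_3) (f : mpoly 3 R).
Hypotheses (g0 : a.2 != 0) (av : forall i, i \in K -> affr a (vtx G i) != 0).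

(** No factor from the choice of coordinates survives: the weight [1 / |s|] of the sheared fibers
    and the area factor [enorm g / |s|] of the plane combine to [1 / enorm a.2]. *)
Lemma vol_derivative :
  t^-1 * (rvol_int (simplex G K `&` [set x | affr a x + t * affr e x < 0]) (reval f)
        - rvol_int (simplex G K `&` [set x | affr a x < 0]) (reval f)) @[t --> (0 : R)^'] -->
  - rsurf_int (simplex G K `&` [set x | affr a x = 0])
      (fun x => reval f x * (affr e x / enorm a.2)).
Proof.
have [rho rho0 rhoP] := simplex_bounded bK.
have [C C0 CP] := reval_bounded f rho.
have mlt t : mset3 [set x | affr a x + t * affr e x < 0].
  apply: mset3_lt0; apply: mfun3D; first exact: mfun3_affr.
  by apply: mfun3M; [exact: mfun3_cst|exact: mfun3_affr].
have mlt0 : mset3 [set x | affr a x < 0] by apply: mset3_lt0; exact: mfun3_affr.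
have bf r : exists C, forall X, (forall j, `|X 0 j| <= r) -> `|reval f X| <= C.
  by have [C' _ h] := reval_bounded f r; exists C'.
pose g := a.2.
(* The direction [(d.1, d.2, 1)] has to cross the plane. If the third component of the gradient is
   0, the choice [d = (g_0, g_1)] gives the slope [dot g g]. *)
have [d sd] : exists d : R * R, g 0 i0 * d.1 + g 0 i1 * d.2 + g 0 i2 != 0.
  have [g2|g2] := eqVneq (g 0 i2) 0; last by exists (0, 0); rewrite /= !mulr0 !add0r.
  exists (g 0 i0, g 0 i1); rewrite /= g2 addr0; apply: contra g0 => /eqP h.
  by rewrite -dot_eq0 dot3 -/g g2 mulr0 addr0 h.
set s := _ + _ in sd.
pose F := (reval f \_ (simplex G K)) \o @pt3 R.
have H := @moving_halfspace3 R (aff3_of a) (aff3_of e) d F C rho sd.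
have mK := mset3_simplex bK (fintype.subxx K).
have plane0 (x : R * R) : affr a (pt3 (plane_zero (aff3_of a) d x)) = 0.
  rewrite affr_pt3 /plane_zero /aff3 /= -/g -/s; set h := _ / s.
  have hs : h * s = - (a.1 + g 0 i0 * x.1 + g 0 i1 * x.2) by rewrite /h divfK.
  move: hs; rewrite /s; lra.
have {}H := H _ _ _ _.
have HL : t^-1 * \int[leb3]_y (((0 <= aff3 (aff3_of a) y + t * aff3 (aff3_of e) y)%R%:R
       - (0 <= aff3 (aff3_of a) y)%R%:R) * F y) @[t --> (0 : R)^'] -->
  \int[leb2]_x (F (plane_zero (aff3_of a) d x) *
    (aff3 (aff3_of e) (plane_zero (aff3_of a) d x) / `|s|)).
  apply: H.
  - by apply: mfun3_pt3; apply: mfun3_patch => //; exact: mfun3_reval.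
  - move=> y; rewrite /F /= /patch; case: ifPn => [/set_mem/rhoP /CP//|_]; by rewrite normr0.
  - move=> y; rewrite /F /= /patch; case: ifPn => [/set_mem/rhoP h _|_]; last by rewrite eqxx.
    by have := h i0; have := h i1; have := h i2; rewrite !mxE.
  (* On the plane each barycentric coordinate is an affine function of the chart parameters, here
     recovered from three values. It is not identically zero, so almost every point of the plane
     avoids all faces, and the truncated integrand is continuous there. *)
  - pose al i : R * R * R := let c (x : R * R) := affr (b i) (pt3 (plane_zero (aff3_of a) d x)) in
      (c (0, 0), c (1, 0) - c (0, 0), c (0, 1) - c (0, 0)).
    have alE i (x : R * R) : affr (b i) (pt3 (plane_zero (aff3_of a) d x)) = aff2 (al i) x.
      by rewrite /aff2 /al /= !affr_pt3 /plane_zero /aff3 /= -/g -/s; field.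
    have nz : {ae leb2, forall x, forall i, i \in K -> aff2 (al i) x != 0}.
      apply: (@filter_forall _ _ _ _ (ae_filter_ringOfSetsType (sleb2 R))) => i.
      have [iK|iK] := boolP (i \in K); last by apply: aeW.
      have [X [X0 lX]] := bary_not_flat g0 av iK.
      have ex : exists y, aff2 (al i) y != 0.
        exists (X 0 i0 - X 0 i2 * d.1, X 0 i1 - X 0 i2 * d.2); rewrite -alE.
        rewrite (_ : pt3 _ = X)//; move: X0; rewrite /affr dot3 -/g => X0.
        rewrite /plane_zero /= -/g -/s (_ : - _ / s = X 0 i2).
          by apply/rv3P; split; rewrite !mxE /= ?subrK.
        by apply: (mulIf sd); rewrite divfK// /s; lra.
      apply: negligibleS (aff2_zero_negligible ex) => x /= nP; apply: contrapT => h.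
      by apply: nP => _; exact/eqP.
    apply: negligibleS nz => x /= nP nz; apply: nP.
    rewrite (_ : F = fun y => reval f (pt3 y) * \prod_(i in K) (0 <= affr (b i) (pt3 y))%R%:R); last first.
      by apply/funext => y; rewrite /F /= patch_simplexE.
    apply: cvgM.
      apply: continuous_reval => j; rewrite (_ : (fun _ => _) = aff3 (0, (j == i0)%:R, (j == i1)%:R, (j == i2)%:R)).
        exact: continuous_aff3.
      by apply/funext => y; case: (I3E j) => ->; rewrite /pt3 /aff3 !mxE ?eqxx ?I3_eqE /=; lra.
    apply: continuous_prod_seq => i iK; apply: continuous_indicator; last by rewrite alE nz.
    rewrite (_ : (fun _ => _) = aff3 (aff3_of (b i))); first exact: continuous_aff3.
    by apply/funext => y; rewrite affr_pt3.
have rhsE : \int[leb2]_x (F (plane_zero (aff3_of a) d x) *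
    (aff3 (aff3_of e) (plane_zero (aff3_of a) d x) / `|s|)) =
  rsurf_int (simplex G K `&` [set x | affr a x = 0]) (fun x => reval f x * (affr e x / enorm a.2)).
  pose P0 := plane_zero (aff3_of a) d.
  pose c : 'rV[R]_3 * 'rV[R]_3 * 'rV[R]_3 := (pt3 (P0 (0, 0)), pt3 (P0 (1, 0)) - pt3 (P0 (0, 0)), pt3 (P0 (0, 1)) - pt3 (P0 (0, 0))).
  have cE y : plane_pt c y = pt3 (P0 y).
    apply/rv3P; split; rewrite /plane_pt /c /P0 /plane_zero /= !mxE /= -/g -/s; field; exact: sd.
  (* The cross product of the tangent vectors is normal to the plane; its length is the area
     factor. *)
  have crossE : cross c.1.2 c.2 = s^-1 *: g.
    have g2E : g 0 i2 = s - g 0 i0 * d.1 - g 0 i1 * d.2 by rewrite /s; ring.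
    clearbody s; apply/rv3P; split; rewrite /cross /c /P0 /plane_zero /= !mxE /= -/g -/s;
      rewrite ?g2E; field; exact: sd.
  have gramE : Num.sqrt (gram c.1.2 c.2) = enorm g / `|s|.
    by rewrite gram_cross crossE -[Num.sqrt _]/(enorm _) enormZ normrV ?unitfE// mulrC.
  have gn0 : gram c.1.2 c.2 != 0.
    by rewrite gram_cross crossE dot_eq0 scaler_eq0 invr_eq0 (negPf sd).
  have mf : mfun3 (fun x => reval f x * (affr e x / enorm a.2)).
    apply: mfun3M; first exact: mfun3_reval.
    by apply: mfun3M; [exact: mfun3_affr|exact: mfun3_cst].
  rewrite (@rsurf_int_param _ c) ?gramE//; first last.
  - move=> c'; apply: mfun3_plane; apply: mfun3_patch => //; apply: mset3I => //.
    by apply: mset3_eq0; exact: mfun3_affr.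
  - move=> X [_ /= X0]; exists (X 0 i0 - X 0 i2 * d.1, X 0 i1 - X 0 i2 * d.2) => //.
    rewrite cE; move: X0; rewrite /affr dot3 -/g => X0.
    rewrite /P0 /plane_zero /= -/g -/s (_ : - _ / s = X 0 i2).
      by apply/rv3P; split; rewrite !mxE /= ?subrK.
    by apply: (mulIf sd); rewrite divfK// /s; lra.
  have gp : 0 < enorm g by rewrite enorm_gt0.
  rewrite -RintegralZl//.
    apply: eq_Rintegral => y _; rewrite cE patchI /F /= /patch -/(P0 y) affr_pt3.
    rewrite (_ : (pt3 (P0 y) \in [set x | affr a x = 0]) = true); last first.
      by apply/idP/idP; rewrite in_setE /= plane0.
    rewrite mulr1; case: ifP => _; rewrite ?mul0r ?mulr0//.
    rewrite -/g; field; rewrite normr_eq0 sd gt_eqF//.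
  apply: integrable_simplex_plane => //.
    by apply: mset3_eq0; exact: mfun3_affr.
  move=> r; have [C1 C10 C1P] := reval_bounded f r.
  exists (C1 * ((`|e.1| + \sum_(j < 3) `|e.2 0 j| * r) / enorm a.2)) => X Xr.
  rewrite normrM ler_pM ?C1P// normrM normfV (ger0_norm (enorm_ge0 _)) ler_wpM2r ?invr_ge0 ?enorm_ge0//.
  rewrite /affr (le_trans (ler_normD _ _))// lerD2l /dot (le_trans (ler_norm_sum _ _ _))//.
  by apply: ler_sum => j _; rewrite normrM ler_wpM2l.
rewrite -rhsE.
(* The domain is the complement of the half-space whose motion was differentiated, which accounts
   for the minus sign. *)
have -> : (fun t => t^-1 * (rvol_int (simplex G K `&` [set x | affr a x + t * affr e x < 0]) (reval f)
        - rvol_int (simplex G K `&` [set x | affr a x < 0]) (reval f))) =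
   (fun t => - (t^-1 * \int[leb3]_y (((0 <= aff3 (aff3_of a) y + t * aff3 (aff3_of e) y)%R%:R
       - (0 <= aff3 (aff3_of a) y)%R%:R) * F y))).
  apply/funext => t; rewrite -mulrN; congr (_ * _).
  rewrite !rvol_int_mkcond -RintegralB//; first last.
  - exact: (integrable_simplex_leb3 (mfun3_reval f)).
  - exact: (integrable_simplex_leb3 (mfun3_reval f)).
  have hlt z y : (pt3 y \in [set x | affr a x + z * affr e x < 0])%:R
      = 1 - (0 <= affr a (pt3 y) + z * affr e (pt3 y))%R%:R :> R.
    rewrite (_ : (_ \in _) = (affr a (pt3 y) + z * affr e (pt3 y) < 0)); last by apply/idP/idP; rewrite in_setE.
    by rewrite ltNge; case: (0 <= _)%R; rewrite ?subrr ?subr0.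
  have hlt0 y : (pt3 y \in [set x | affr a x < 0])%:R = 1 - (0 <= affr a (pt3 y))%R%:R :> R.
    rewrite (_ : (_ \in _) = (affr a (pt3 y) < 0)); last by apply/idP/idP; rewrite in_setE.
    by rewrite ltNge; case: (0 <= _)%R; rewrite ?subrr ?subr0.
  rewrite -[RHS]mulN1r -RintegralZl//.
    apply: eq_Rintegral => y _.
    rewrite !patchI -mulrBr hlt hlt0 /F /= -!affr_pt3; ring.
  have := @integrable_EFinB _ _ _ leb3 _ _ (integrable_simplex_leb3 (mfun3_reval f) mlt0 bf) (integrable_simplex_leb3 (mfun3_reval f) (mlt t) bf).
  apply: eq_integrable => // y _; congr EFin; rewrite /= !patchI -mulrBr hlt hlt0 /F /= -!affr_pt3; ring.
exact: cvgN HL.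
Qed.

End derivative.

End element_cut.

(** * Orthonormal frames, area element of a graph, and a cut-off function *)

Section orthonormal.
Variable R : realType.
Implicit Types (u v n g h Z : 'rV[R]_3).

Lemma orthonormal_exists g : g != 0 -> exists u v,
  [/\ enorm u = 1, enorm v = 1, dot u v = 0, dot u g = 0 & dot v g = 0].
Proof.
move=> g0.
have [h h0 hg] : exists2 h, h != 0 & dot h g = 0.
  have [g01|g01] := boolP ((g 0 i0 == 0) && (g 0 i1 == 0)).
    move: g01 => /andP[/eqP ga /eqP gb]; exists (delta_mx 0 i0).
      by apply/eqP => /rowP /(_ i0) /eqP; rewrite !mxE !eqxx oner_eq0.
    by rewrite dot3 !mxE ga gb !eqxx !I3_eqE /= mulr0 !mul0r !addr0.
  exists (\row_(i < 3) [:: - g 0 i1; g 0 i0; 0]`_i).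
    apply: contra g01 => /eqP /rowP h; have := h i0; have := h i1; rewrite !mxE /= => -> /eqP.
    by rewrite oppr_eq0 eqxx.
  by rewrite dot3 !mxE /=; ring.
pose u := (enorm h)^-1 *: h; pose k := cross g u.
have u1 : enorm u = 1 by exact: enorm_normalize.
have ug : dot u g = 0 by rewrite dotZl hg mulr0.
have k0 : k != 0.
  rewrite -dot_eq0 -gram_cross /gram (enorm1 u1) [dot g u]dotC ug expr0n subr0 mulr1.
  by rewrite dot_eq0.
exists u, ((enorm k)^-1 *: k); split => //.
- exact: enorm_normalize.
- by rewrite dotZr /k dot_crossr mulr0.
- by rewrite dotZl dotC /k dot_crossl mulr0.
Qed.

(** The frame matrix [A] satisfies [A *m A^T = 1], hence also [A^T *m A = 1], which is the
    expansion. *)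
Lemma orthonormal_decomp u v n Z : enorm u = 1 -> enorm v = 1 -> enorm n = 1 ->
  dot u v = 0 -> dot u n = 0 -> dot v n = 0 ->
  Z = dot u Z *: u + dot v Z *: v + dot n Z *: n.
Proof.
move=> /enorm1 u1 /enorm1 v1 /enorm1 n1 uv un vn.
pose A : 'M[R]_3 := \matrix_(i < 3) [:: u; v; n]`_i.
have dAA (x y : 'rV[R]_3) : x *m y^T = (dot x y)%:M.
  apply/matrixP => i j; rewrite !ord1 !mxE eqxx mulr1n; apply: eq_bigr => k _.
  by rewrite !mxE.
have AA : A *m A^T = 1%:M.
  apply/matrixP => i j; rewrite !mxE.
  transitivity (dot ([:: u; v; n]`_i) ([:: u; v; n]`_j)).
    by apply: eq_bigr => k _; rewrite !mxE.
  by case: (I3E i) => ->; case: (I3E j) => -> /=; rewrite ?u1 ?v1 ?n1 ?uv ?un ?vn // dotC ?uv ?un ?vn.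
have {}AA := mulmx1C AA.
rewrite -[LHS]mulmx1 -AA mulmxA; apply/rowP => j; rewrite !mxE sum3 !mxE /=.
have e (x : 'rV[R]_3) (i : 'I_3) : [:: u; v; n]`_i = x -> \sum_(j0 < 3) Z 0 j0 * A^T j0 i = dot x Z.
  by move=> <-; apply: eq_bigr => k _; rewrite !mxE mulrC.
by rewrite (e u i0)// (e v i1)// (e n i2).
Qed.

(** Area element of a graph over an orthonormal frame. There is no term of first order in the slopes
    [p] and [q], which makes the area stationary under a normal perturbation. *)
Lemma gram_graph u v n (p q : R) : enorm u = 1 -> enorm v = 1 -> enorm n = 1 ->
  dot u v = 0 -> dot u n = 0 -> dot v n = 0 ->
  gram (u + p *: n) (v + q *: n) = 1 + p ^+ 2 + q ^+ 2.
Proof.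
move=> /enorm1 u1 /enorm1 v1 /enorm1 n1 uv un vn.
rewrite /gram !(dotDl, dotDr, dotZl, dotZr) [dot n u]dotC [dot n v]dotC.
rewrite u1 v1 n1 un vn uv; ring.
Qed.

End orthonormal.

Section bump.
Variable R : realType.

(** A continuous cut-off, 1 on [[- r, r]] and 0 outside [[- r - 1, r + 1]]: the lemma on moving
    polygons wants integrands with compact support that are continuous everywhere. *)
Definition bump (r s : R) : R := Num.max 0 (Num.min 1 (r + 1 - `|s|)).

Lemma bump1 r s : `|s| <= r -> bump r s = 1.
Proof.
move=> h; rewrite /bump (_ : Num.min _ _ = 1); first by rewrite max_r.
by apply/min_idPl; lra.
Qed.

Lemma bump_ge0 r s : 0 <= bump r s. Proof. by rewrite /bump le_max lexx. Qed.

Lemma bump_le1 r s : bump r s <= 1.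
Proof. by rewrite /bump ge_max ler01 ge_min lexx. Qed.

Lemma bump_supp r s : bump r s != 0 -> `|s| <= r + 1.
Proof.
move=> h; rewrite leNgt; apply: contra h => h; rewrite /bump.
rewrite (_ : Num.min _ _ = r + 1 - `|s|).
  by apply/eqP/max_idPl; lra.
by apply/min_idPr; lra.
Qed.

Lemma continuous_bump r : continuous (bump r).
Proof.
move=> s; apply: (@continuous_max R R (cst 0) (fun s => Num.min 1 (r + 1 - `|s|)) s).
  exact: cvg_cst.
apply: (@continuous_min R R (cst 1) (fun s => r + 1 - `|s|) s); first exact: cvg_cst.
by apply: cvgB; [exact: cvg_cst|exact: norm_continuous].
Qed.

End bump.

Section integral_set0.
Variable R : realType.
Implicit Type f : 'rV[R]_3 -> R.

Lemma rline_int_set0 f : rline_int set0 f = 0.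
Proof. by rewrite /rline_int preimage_set0 /Rintegral integral_set0. Qed.

Lemma rsurf_int_set0 f : rsurf_int set0 f = 0.
Proof. by rewrite /rsurf_int preimage_set0 /Rintegral integral_set0. Qed.

End integral_set0.

Section locally_bounded.
Variable R : realType.
Implicit Types f g : 'rV[R]_3 -> R.

Definition lbd f : Prop :=
  forall rho : R, exists C : R, forall X : 'rV[R]_3, (forall j, `|X 0 j| <= rho) -> `|f X| <= C.

Lemma lbd_cst (c : R) : lbd (fun=> c).
Proof. by move=> rho; exists `|c|. Qed.

Lemma lbdM f g : lbd f -> lbd g -> lbd (fun x => f x * g x).
Proof.
move=> bf bg rho; have [C fC] := bf rho; have [D gD] := bg rho.
by exists (C * D) => X XP; rewrite normrM ler_pM ?fC ?gD.
Qed.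

Lemma lbd_reval p : lbd (reval p).
Proof. by move=> r; have [C _ CP] := reval_bounded p r; exists C. Qed.

Lemma lbd_affr a : lbd (@affr R a).
Proof.
move=> r; exists (`|a.1| + \sum_(j < 3) `|a.2 0 j| * r) => X Xr.
rewrite /affr (le_trans (ler_normD _ _))// lerD2l /dot (le_trans (ler_norm_sum _ _ _))//.
by apply: ler_sum => j _; rewrite normrM ler_wpM2l.
Qed.

Lemma integrable_simplex_line (M : nat) (G : geometry R M) (K : {set 'I_M}) b f E l :
  barycentric G K b -> l.2 != 0 -> mfun3 f -> mset3 E -> E `<=` simplex G K -> lbd f ->
  (@lebesgue_measure R).-integrable setT (EFin \o ((f \_ E) \o line_pt l)).
Proof.
move=> bK l0 mf mE EK bf; have [rho rho0 rhoP] := simplex_bounded bK.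
have [C CP] := bf rho.
pose r := (\sum_(j < 3) `|l.2 0 j| * (rho + `|l.1 0 j|)) / dot l.2 l.2.
have rP X : simplex G K X -> `|line_coord l X| <= r.
  move=> /rhoP XK; rewrite /line_coord normrM normfV (ger0_norm (dot_ge0 _)) ler_wpM2r ?invr_ge0 ?dot_ge0//.
  rewrite /dot (le_trans (ler_norm_sum _ _ _))//; apply: ler_sum => j _.
  by rewrite normrM ler_wpM2l// !mxE (le_trans (ler_normB _ _))// lerD2r.
apply: (@integrable_bounded R _ (measurableTypeR R) (@lebesgue_measure R) `[- r, r]%classic _ `|C|).
- exact: measurable_itv.
- exact: interval_lty.
- by apply: mfun3_line; exact: mfun3_patch.
- move=> y; rewrite /= /patch; case: ifPn => [/set_mem/EK/rhoP h|]; last by rewrite normr0.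
  by rewrite (le_trans (CP _ h))// ler_norm.
- move=> y nB; rewrite /= /patch; case: ifPn => // /set_mem/EK/rP; rewrite line_ptK// => yr.
  by exfalso; apply: nB; rewrite /= in_itv /= -ler_norml.
Qed.

End locally_bounded.

(** * Derivative of a wall integral over one element, in a fixed orthonormal chart *)

Section surface_derivative.
Variables (R : realType) (M : nat) (G : geometry R M) (K : {set 'I_M}) (b : 'I_M -> R * 'rV[R]_3).
Notation leb := (@lebesgue_measure R).
Notation RR := (measurableTypeR R).
Notation leb2 := (@leb2 R).
Hypotheses (K4 : #|K| = 4%N) (bK : barycentric G K b).
Variables (a e : R * 'rV[R]_3) (f : mpoly 3 R).
Hypotheses (g0 : a.2 != 0) (av : forall i, i \in K -> affr a (vtx G i) != 0).
Variables (u v : 'rV[R]_3).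
Variables (n o : 'rV[R]_3) (P : R * R -> 'rV[R]_3) (w : R * R -> R).
Let ng := enorm a.2.
Let c := (o, u, v).
Hypotheses (u1 : enorm u = 1) (v1 : enorm v = 1) (n1 : enorm n = 1) (uv : dot u v = 0)
  (un : dot u n = 0) (vn : dot v n = 0).
Hypotheses (ao : affr a o = 0) (gE : a.2 = ng *: n).
Hypotheses (PE : forall y, P y = plane_pt c y) (wE : forall y, w y = affr e (P y)).
Let ng0 : 0 < ng. Proof. by rewrite /ng enorm_gt0. Qed.
Let gn : dot a.2 n = ng. Proof. by rewrite gE dotZl (enorm1 n1) mulr1. Qed.
Let gu : dot a.2 u = 0. Proof. by rewrite dotC gE dotZr un mulr0. Qed.
Let gv : dot a.2 v = 0. Proof. by rewrite dotC gE dotZr vn mulr0. Qed.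
Let cof (h : R * 'rV[R]_3) : R * R * R := (affr h o, dot h.2 u, dot h.2 v).
Let affrP h y : affr h (P y) = aff2 (cof h) y.
Proof. by rewrite PE /plane_pt /= !affrD !dotZr /aff2 /= mulrC [y.2 * _]mulrC. Qed.
Let aP y : affr a (P y) = 0.
Proof. by rewrite affrP /aff2 /= ao gu gv !mul0r !addr0. Qed.
Let gram1 : gram u v = 1. Proof. exact: gram_orthonormal. Qed.
Let gramc : gram c.1.2 c.2 != 0. Proof. by rewrite gram1 oner_neq0. Qed.
Let XE X : X = P (dot u (X - o), dot v (X - o)) + dot n (X - o) *: n.
Proof.
have := orthonormal_decomp (X - o) u1 v1 n1 uv un vn.
by rewrite PE /plane_pt /= -!addrA => <-; rewrite addrC subrK.
Qed.
Let aPE X : affr a X = 0 -> X = P (dot u (X - o), dot v (X - o)).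
Proof.
move=> aX; have := XE X; rewrite (_ : dot n (X - o) = 0) ?scale0r ?addr0//.
move: aX; rewrite {1}(XE X) affrD aP add0r dotZr gn => /eqP.
by rewrite mulf_eq0 (gt_eqF ng0) orbF => /eqP.
Qed.
(** [om] is the squared length of the tangential gradient of [e], and [ka] below is the normal
    derivative of [e]. *)
Let om := dot e.2 u ^+ 2 + dot e.2 v ^+ 2.
Let ka := dot e.2 n.
Let cc (th : R) := (o + (th * affr e o) *: n, u + (th * dot e.2 u) *: n, v + (th * dot e.2 v) *: n).
Let ccE th y : plane_pt (cc th) y = P y + (th * w y) *: n.
Proof.
rewrite wE affrP PE /aff2 /plane_pt /cc /=; apply/rowP => j; rewrite !mxE; ring.
Qed.
Let gram_cc th : gram (cc th).1.2 (cc th).2 = 1 + th ^+ 2 * om.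
Proof.
by rewrite /cc /= gram_graph// /om; ring.
Qed.
Let om0 : 0 <= om. Proof. by rewrite addr_ge0// sqr_ge0. Qed.
Let gram_cc0 th : 0 < gram (cc th).1.2 (cc th).2.
Proof. by rewrite gram_cc ltr_wpDr// mulr_ge0// sqr_ge0. Qed.
(** At height [s] above [P y] the perturbed level function is [ng * (s + t * (w y + s * ka))], which
    vanishes for [s = theta t * w y]. The wall thus depends on [t] through [theta t] only, and
    [theta] becomes the new parameter. *)
Let theta t := - t / (1 + t * ka).

Let surface t := simplex G K `&` [set x | affr a x + t * (ng * affr e x) = 0].

Let surface_range t : 1 + t * ka != 0 -> surface t `<=` range (plane_pt (cc (theta t))).
Proof.
move=> nt X [_ /= Xt].
have [y [s Xy]] : exists y s, X = P y + s *: n.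
  by exists (dot u (X - o), dot v (X - o)), (dot n (X - o)); exact: XE.
exists y => //; rewrite ccE Xy; congr (_ + _ *: _).
move: Xt; rewrite Xy !affrD aP add0r !dotZr gn -wE -/ka => Xt.
apply: (mulIf nt); rewrite /theta mulrAC divfK//; apply: (mulIf (lt0r_neq0 ng0)).
by move: Xt; lra.
Qed.

Let surface_cc t y : 1 + t * ka != 0 ->
  affr a (plane_pt (cc (theta t)) y) + t * (ng * affr e (plane_pt (cc (theta t)) y)) = 0.
Proof.
move=> nt; rewrite ccE !affrD aP add0r !dotZr gn -wE -/ka.
have := divfK nt (- t); rewrite -/(theta t) => h.
rewrite (_ : _ + _ = ng * (w y * (theta t * (1 + t * ka)) + t * w y)); last by ring.
by rewrite h; ring.
Qed.

(* The truncation keeps the integrand bounded uniformly in the parameter. *)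
Let trunc (th : R) : R := if `|th| <= 1 then th else 0.

Let trunc_le th : `|trunc th| <= 1.
Proof. by rewrite /trunc; case: ifP => //; rewrite normr0 ler01. Qed.

Variables (r C rho : R).
Hypothesis r0 : 0 <= r.
Hypothesis rP : forall X, simplex G K X -> `|dot u (X - o)| <= r /\ `|dot v (X - o)| <= r.
Hypothesis boxP : forall y : R * R, `|y.1| <= r + 1 -> `|y.2| <= r + 1 ->
  forall i, `|P y 0 i| <= rho /\ `|(w y *: n) 0 i| <= rho.
Hypothesis taylorP : forall (x V : 'rV[R]_3) (t : R), (forall i, `|x 0 i| <= rho) -> (forall i, `|V 0 i| <= rho) -> `|t| <= 1 ->
  [/\ `|reval f (x + t *: V)| <= C, `|dot V (grad f x)| <= C &
   `|reval f (x + t *: V) - reval f x - t * dot V (grad f x)| <= C * t ^+ 2].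

Let chi (y : R * R) := bump r y.1 * bump r y.2.
Let F th y := reval f (P y + trunc th *: (w y *: n)) * chi y.
Let dF y := dot (w y *: n) (grad f (P y)) * chi y.

Let chi_ge0 y : 0 <= chi y. Proof. by rewrite mulr_ge0// bump_ge0. Qed.
Let chi_le1 y : chi y <= 1. Proof. by rewrite mulr_ile1// ?bump_ge0// bump_le1. Qed.
Let chi_supp y : chi y != 0 -> `|y.1| <= r + 1 /\ `|y.2| <= r + 1.
Proof. by rewrite mulf_eq0 negb_or => /andP[/bump_supp h1 /bump_supp h2]. Qed.

(** The constraints are indexed by all nodes; a node outside [K] receives the constant 1, which
    always holds and has no edge. *)
Let al j : R * R * R := if j \in K then cof (b j) else (1, 0, 0).
(** First-order change of coordinate [j] when the point moves by [w y] along [n]: the normal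
    derivative of the coordinate times the affine function [w]. *)
Let be j : R * R * R := if j \in K then
  let k := dot (b j).2 n in (k * affr e o, k * dot e.2 u, k * dot e.2 v) else (0, 0, 0).
(** The direction [(0, 1)] is used when the second coefficient is nonzero, and [(1, 1)] otherwise.
    The slope then vanishes only if the constraint is constant. *)
Let d j : R := if (al j).2 == 0 then 1 else 0.
Let slope j := (al j).1.2 * d j + (al j).2.

Let C0 : 0 <= C.
Proof.
have rr : `|r| <= r + 1 by rewrite ger0_norm// lerDl.
have r00 : `|0 : R| <= r + 1 by rewrite normr0 addr_ge0.
have h1 := @boxP (0, 0) r00 r00.
have [] := @taylorP (P (0, 0)) (w (0, 0) *: n) 0 (fun i => (h1 i).1) (fun i => (h1 i).2).
  by rewrite normr0 ler01.
by move=> h _ _; exact: le_trans h.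
Qed.
Let cchi : continuous chi.
Proof.
move=> y; apply: cvgM.
  by apply: (@continuous_comp _ _ _ fst (bump r)); [exact: cvg_fst|exact: continuous_bump].
by apply: (@continuous_comp _ _ _ snd (bump r)); [exact: cvg_snd|exact: continuous_bump].
Qed.

Let mchi : measurable_fun setT (chi : RR * RR -> R).
Proof.
have mb : measurable_fun setT (bump r : RR -> R) by apply: continuous_measurable_fun; exact: continuous_bump.
by apply: measurable_funM; apply: (measurableT_comp mb).
Qed.

Let mP i : measurable_fun setT (fun y : RR * RR => P y 0 i).
Proof.
by rewrite (_ : (fun _ => _) = fun y => plane_pt c y 0 i); [exact: measurable_plane_pt|apply/funext => y; rewrite PE].
Qed.

Let mw : measurable_fun setT (w : RR * RR -> R).
Proof.
rewrite (_ : w = affr e \o plane_pt c); first exact: (mfun3_plane c (mfun3_affr e)).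
by apply/funext => y; rewrite /= -PE wE.
Qed.

Let mF th : measurable_fun setT (F th : RR * RR -> R).
Proof.
apply: measurable_funM => //; apply: measurable_reval => i.
rewrite (_ : (fun _ => _) = fun y => P y 0 i + trunc th * (w y * n 0 i)); last first.
  by apply/funext => y; rewrite !mxE.
by apply: measurable_funD => //; apply: measurable_funM => //; apply: measurable_funM.
Qed.

Let mdF : measurable_fun setT (dF : RR * RR -> R).
Proof.
apply: measurable_funM => //.
rewrite (_ : (fun _ => _) = fun y => w y * reval (rderiv n f) (P y)); last first.
  by apply/funext => y; rewrite reval_rderiv dotZl.
by apply: measurable_funM => //; exact: measurable_reval.
Qed.

Let box y : chi y != 0 -> (forall i, `|P y 0 i| <= rho) /\ (forall i, `|(w y *: n) 0 i| <= rho).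
Proof. by move=> /chi_supp[h1 h2]; split => i; have [] := boxP h1 h2 i. Qed.

Let mulchi_le x y D : 0 <= D -> (chi y != 0 -> `|x| <= D) -> `|x * chi y| <= D.
Proof.
move=> D0; have [->|h] := eqVneq (chi y) 0; first by rewrite mulr0 normr0.
move=> /(_ isT) xD; rewrite normrM (ger0_norm (chi_ge0 y)) -[leRHS]mulr1 ler_pM//.
Qed.

Let FC th y : `|F th y| <= C.
Proof. by apply: mulchi_le => // /box[h1 h2]; have [] := taylorP h1 h2 (trunc_le th). Qed.

Let dFC y : `|dF y| <= C.
Proof. by apply: mulchi_le => // /box[h1 h2]; have [] := taylorP h1 h2 (trunc_le 0). Qed.

Let supp x y : x * chi y != 0 -> `|y.1| <= r + 1 /\ `|y.2| <= r + 1.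
Proof. by rewrite mulf_eq0 negb_or => /andP[_ /chi_supp]. Qed.

Let taylorF t y : `|t| <= 1 -> `|F t y - F 0 y - t * dF y| <= C * t ^+ 2.
Proof.
move=> t1; rewrite (_ : _ - _ - _ = (reval f (P y + t *: (w y *: n)) - reval f (P y)
    - t * dot (w y *: n) (grad f (P y))) * chi y); last first.
  rewrite /F /dF /trunc t1 normr0 ler01 scale0r addr0; ring.
apply: mulchi_le; first by rewrite mulr_ge0// sqr_ge0.
by move=> /box[h1 h2]; have [_ _] := taylorP h1 h2 t1.
Qed.

Let cF y : {for (0, y), continuous (fun q : R * (R * R) => F q.1 q.2)}.
Proof.
have c2 (h : R * R -> R) : {for y, continuous h} -> {for (0 : R, y), continuous (fun q : R * (R * R) => h q.2)}.
  by move=> ch; apply: (@continuous_comp _ _ _ snd h); [exact: cvg_snd|exact: ch].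
apply: cvgM; last by apply: c2; exact: cchi.
apply: (@continuous_reval R _ (fun q : R * (R * R) => P q.2 + trunc q.1 *: (w q.2 *: n)) (0, y) f) => i.
rewrite (_ : (fun _ => _) = fun q : R * (R * R) => P q.2 0 i + trunc q.1 * (w q.2 * n 0 i)); last first.
  by apply/funext => q; rewrite !mxE.
have ca2 h : {for y, continuous (@aff2 R h)}.
  rewrite /aff2; apply: cvgD; last by apply: cvgMr; exact: cvg_snd.
  by apply: cvgD; [exact: cvg_cst|apply: cvgMr; exact: cvg_fst].
apply: cvgD.
  apply: (c2 (fun y => P y 0 i)).
  rewrite (_ : (fun _ => _) = aff2 (o 0 i, u 0 i, v 0 i)); first exact: ca2.
  by apply/funext => z; rewrite PE /plane_pt /aff2 !mxE /= mulrC [z.2 * _]mulrC.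
apply: cvgM.
  apply: (@continuous_comp _ _ _ fst trunc); first exact: cvg_fst.
  have t0 : trunc 0 = 0 by rewrite /trunc normr0 ler01.
  change (trunc x @[x --> (0 : R)] --> trunc 0); rewrite t0.
  apply: cvg_trans (@cvg_id _ (nbhs (0 : R))); apply: near_eq_cvg.
  apply/nbhs_ballP; exists 1 => //= x; rewrite /ball /= sub0r normrN => /ltW x1.
  by rewrite /trunc x1.
apply: cvgMl; apply: (c2 w).
by rewrite (_ : w = aff2 (cof e)); [exact: ca2|apply/funext => z; rewrite wE affrP].
Qed.

Let slope0 j : slope j = 0 -> [/\ (al j).1.2 = 0, (al j).2 = 0 & (al j).1.1 != 0].
Proof.
rewrite /slope /d; case: eqP => [h2|h]; last by rewrite mulr0 add0r => /h.
rewrite h2 mulr1 addr0 => h1; split => //; move: h1 h2; rewrite /al.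
case: ifPn => jK /=; last by rewrite oner_neq0.
move=> ju jv; have [x [ax lx]] := bary_not_flat K4 bK g0 av jK.
by move: lx; rewrite (aPE ax) affrP /aff2 /= ju jv !mul0r !addr0.
Qed.

(** If constraint [j] vanished along the boundary line of constraint [i], two barycentric
    coordinates would be 0 on a line of the wall plane, contrary to [bary_not_edge]. *)
Let transversal i j : i != j -> slope i != 0 ->
  exists x, aff2 (al j) (line_zero (al i) (d i) x) != 0.
Proof.
move=> ij si; apply: contrapT => h.
have {}h x : aff2 (al j) (line_zero (al i) (d i) x) = 0.
  by apply/eqP/negPn/negP => hx; apply: h; exists x.
have jK : j \in K.
  apply/negPn/negP => jK; have := h 0; rewrite /al (negPf jK) /aff2 /= !mul0r !addr0 => /eqP.
  by rewrite oner_eq0.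
have iK : i \in K.
  by apply/negPn/negP => iK; move: si; rewrite /slope /al (negPf iK) /= mul0r addr0 eqxx.
have li x : aff2 (al i) (line_zero (al i) (d i) x) = 0.
  rewrite /aff2 /line_zero /= -/(slope i).
  set k := - _ / _; have hk : k * slope i = - ((al i).1.1 + (al i).1.2 * x) by rewrite /k divfK.
  by move: hk; rewrite /slope; lra.
have lE m x : m \in K -> affr (b m) (P x) = aff2 (al m) x by move=> mK; rewrite affrP /al mK.
apply: (@bary_not_edge R M G K b K4 bK a i j (P (line_zero (al i) (d i) 0)) (P (line_zero (al i) (d i) 1))) => //;
  rewrite ?lE//.
rewrite !PE; apply/negP => /eqP /(can_inj (plane_ptK gramc)); rewrite /line_zero.
by move=> -[h1 h2]; rewrite h2 in h1; move/addIr: h1 => /esym /eqP; rewrite oner_eq0.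
Qed.

Let ind th y : R := \prod_(j < M) (0 <= aff2 (al j) y + th * aff2 (be j) y)%R%:R.
Let ind0 y : R := \prod_(j < M) (0 <= aff2 (al j) y)%R%:R.
Let I th := \int[leb2]_y (F th y * ind th y).
Let I0 := \int[leb2]_y (F 0 y * ind0 y).

Let edge k := if slope k == 0 then 0 else
  \int[leb]_x (F 0 (line_zero (al k) (d k) x)
    * \prod_(j < M) (0 <= aff2 (al j) (line_zero (al k) (d k) x))%R%:R
    * (aff2 (be k) (line_zero (al k) (d k) x) / `|slope k|)).

Let I_cvg : t^-1 * (I t - I0) @[t --> (0 : R)^'] -->
  \int[leb2]_y (dF y * ind0 y) + \sum_(k < M) edge k.
Proof.
apply: (moving_polygon slope0 transversal mF FC _ cF mdF dFC _ taylorF) => //.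
- by move=> t y; exact: supp.
- by move=> y; exact: supp.
Qed.

Let indE th y : ind th y = \prod_(i in K) (0 <= affr (b i) (P y + (th * w y) *: n))%R%:R.
Proof.
rewrite /ind [RHS]big_mkcond /=; apply: eq_bigr => j _; rewrite /al /be.
case: ifPn => jK; last by rewrite /aff2 /= !mul0r !addr0 mulr0 addr0 ler01.
rewrite affrD dotZr affrP wE affrP; congr ((_ <= _ + _)%R%:R).
by rewrite /aff2 /=; ring.
Qed.

Let ind01 : ind 0 = ind0.
Proof.
by apply/funext => y; apply: eq_bigr => j _; rewrite mul0r addr0.
Qed.

(** Where the polygon indicator is nonzero the point lies in [K], and by [rP] the cut-off is 1
    there. Truncation therefore does not change the integral. *)
Let indF th y h : `|th| <= 1 -> h * chi y * ind th y = (fun=> h) \_ (simplex G K) (P y + (th * w y) *: n).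
Proof.
move=> th1; rewrite (patch_simplexE bK) -indE.
have [->|] := eqVneq (ind th y) 0; first by rewrite !mulr0.
rewrite indE => /prodf_neq0 h0; suff -> : chi y = 1 by rewrite mulr1.
have XK : simplex G K (P y + (th * w y) *: n).
  by apply/(simplexP bK) => i iK; have := h0 i iK; rewrite pnatr_eq0 eqb0 negbK.
have [] := rP XK.
have -> : P y + (th * w y) *: n - o = y.1 *: u + y.2 *: v + (th * w y) *: n.
  by rewrite PE /plane_pt; apply/rowP => i; rewrite !mxE /=; ring.
rewrite !dotDr !dotZr un vn [dot v u]dotC uv (enorm1 u1) (enorm1 v1) !mulr0 !mulr1 !addr0 add0r.
by move=> h1 h2; rewrite /chi !bump1 ?mulr1.
Qed.

Let patchF th y : `|th| <= 1 ->
  (reval f \_ (simplex G K)) (P y + (th * w y) *: n) = F th y * ind th y.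
Proof.
move=> th1; rewrite /F /trunc th1 scalerA indF// /patch; by case: ifP.
Qed.

Let msurface t : mset3 (surface t).
Proof.
apply: mset3I; first exact: (mset3_simplex bK).
apply: mset3_eq0; apply: mfun3D; first exact: mfun3_affr.
by do ![apply: mfun3M; first exact: mfun3_cst]; exact: mfun3_affr.
Qed.

Let rsurf_surface t : 1 + t * ka != 0 -> `|theta t| <= 1 ->
  rsurf_int (surface t) (reval f) = Num.sqrt (1 + theta t ^+ 2 * om) * I (theta t).
Proof.
move=> nt th1; rewrite (@rsurf_int_param _ (cc (theta t))) ?gram_cc//.
- congr (_ * _); apply: eq_Rintegral => y _; rewrite patchI.
  rewrite (_ : (_ \in _) = true) ?mulr1; first by rewrite ccE patchF.
  by apply/idP/idP; rewrite in_setE /= surface_cc.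
- by rewrite -gram_cc gt_eqF.
- exact: surface_range.
- by move=> c'; apply: mfun3_plane; apply: mfun3_patch => //; exact: mfun3_reval.
Qed.

Let surface0 := simplex G K `&` [set x | affr a x = 0].

Let rsurf_surface0 : rsurf_int surface0 (reval f) = I0.
Proof.
have t0 : theta 0 = 0 by rewrite /theta oppr0 mul0r.
have := @rsurf_surface 0; rewrite t0 mul0r addr0 oner_neq0 normr0 ler01.
rewrite (_ : I0 = I 0); last by rewrite /I ind01.
move=> /(_ isT isT); rewrite expr0n /= mul0r addr0 sqrtr1 mul1r => <-.
by congr rsurf_int; rewrite /surface0 /surface; congr (_ `&` _); apply/seteqP; split => x /=; rewrite mul0r addr0.
Qed.

Let surface0_range : surface0 `<=` range (plane_pt c).
Proof. by move=> X [_ /= /aPE ->]; exists (dot u (X - o), dot v (X - o)) => //; rewrite PE. Qed.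

Let msurface0 : mset3 surface0.
Proof.
apply: mset3I; first exact: (mset3_simplex bK).
by apply: mset3_eq0; exact: mfun3_affr.
Qed.

Let chi_simplex y h : h * chi y * ind0 y = (fun=> h) \_ (simplex G K) (P y).
Proof.
have := @indF 0 y h; rewrite normr0 ler01 mul0r scale0r addr0 ind01 => -> //.
Qed.

Let bulkE : \int[leb2]_y (dF y * ind0 y) =
  rsurf_int surface0 (fun x => dot n (grad f x) * affr e x).
Proof.
have mh : mfun3 (fun x => dot n (grad f x) * affr e x).
  apply: mfun3M; last exact: mfun3_affr.
  rewrite (_ : (fun _ => _) = reval (rderiv n f)); first exact: mfun3_reval.
  by apply/funext => x; rewrite reval_rderiv.
rewrite (@rsurf_int_param _ c)//; last by move=> c'; apply: mfun3_plane; exact: mfun3_patch.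
rewrite gram1 sqrtr1 mul1r; apply: eq_Rintegral => y _.
rewrite /dF chi_simplex patchI -PE (_ : (P y \in _) = true) ?mulr1; last first.
  by apply/idP/idP; rewrite in_setE /= aP.
by rewrite /patch dotZl mulrC wE.
Qed.

(** Tangential part of the gradient of coordinate [k]. It is normal, inside the wall, to the edge on
    the face opposite to [k], and points into the element. *)
Let tau k := (b k).2 - dot (b k).2 n *: n.
Let side k := simplex G (K :\ k) `&` [set x | affr a x = 0].

Let sideE k X : k \in K -> side k X <-> [/\ simplex G K X, affr (b k) X = 0 & affr a X = 0].
Proof.
move=> kK; rewrite /side /=; split.
  move=> [/(simplex_baryP bK _ (subD1set K k)) [h1 h2] aX]; split => //.
    apply/(simplexP bK) => i iK; have [->|ik] := eqVneq i k; first by rewrite h2// !inE eqxx.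
    by apply: h1; rewrite !inE ik.
  by apply: h2 => //; rewrite !inE eqxx.
move=> [/(simplexP bK) h1 h2 aX]; split => //.
apply/(simplex_baryP bK _ (subD1set K k)); split => i; first by rewrite !inE => /andP[_ /h1].
by move=> iK; rewrite !inE iK andbT negbK => /eqP ->.
Qed.

Let line_zeroP k x : slope k != 0 -> aff2 (al k) (line_zero (al k) (d k) x) = 0.
Proof.
move=> si; rewrite /aff2 /line_zero /= -/(slope k).
set h := - _ / _; have hk : h * slope k = - ((al k).1.1 + (al k).1.2 * x) by rewrite /h divfK.
by move: hk; rewrite /slope; lra.
Qed.

Let edgeE k : edge k = if k \in K then
  rline_int (side k) (fun x => reval f x * (dot (b k).2 n / enorm (tau k) * affr e x)) else 0.
Proof.
rewrite /edge; case: (boolP (k \in K)) => kK; last by rewrite ifT// /slope /al (negPf kK) /= mul0r addr0.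
case: ifPn => [/eqP sk|sk].
  (* A coordinate that is constant on the wall plane is nonzero there, so the wall does not meet
     that face and both sides are 0. *)
  have [h1 h2 h3] := slope0 sk.
  rewrite (_ : side k = set0).
    by rewrite rline_int_set0.
  apply/seteqP; split => // X /(sideE _ kK) [_ lX /aPE XP]; exfalso.
  move: lX; rewrite XP affrP; move/eqP: h3; move: h1 h2; rewrite /al kK /aff2 => -> ->.
  by rewrite !mul0r !addr0.
pose p1 := (al k).1.2; pose p2 := (al k).2.
pose lz := line_zero (al k) (d k).
have sE : slope k = p1 * d k + p2 by [].
have tauE : tau k = p1 *: u + p2 *: v.
  have := orthonormal_decomp (b k).2 u1 v1 n1 uv un vn; rewrite [dot n _]dotC => h.
  rewrite /tau {1}h addrK.
  by rewrite /p1 /p2 /al kK /= dotC [dot v _]dotC.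
have enorm_uv (x y : R) : enorm (x *: u + y *: v) = Num.sqrt (x ^+ 2 + y ^+ 2).
  rewrite /enorm !dotDl !dotDr !dotZl !dotZr [dot v u]dotC uv (enorm1 u1) (enorm1 v1).
  by congr Num.sqrt; ring.
(* The zero of the constraint moves along the edge with this constant velocity, of length
   [enorm (tau k) / |slope k|]. It converts the weight [1 / |slope k|] of the fibers into
   [1 / enorm (tau k)] for the length measure. *)
pose l := (P (lz 0), (p2 / slope k) *: u - (p1 / slope k) *: v).
have lE x : line_pt l x = P (lz x).
  rewrite /l /line_pt /lz /line_zero -/(slope k) -/p1 !PE /plane_pt /=.
  apply/rowP => i; rewrite !mxE /= sE; field; rewrite -sE; exact: sk.
have p12 : 0 < p1 ^+ 2 + p2 ^+ 2.
  rewrite lt_neqAle addr_ge0 ?sqr_ge0// andbT eq_sym paddr_eq0 ?sqr_ge0// !sqrf_eq0.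
  by apply: contra sk => /andP[/eqP h1 /eqP h2]; rewrite sE h1 h2 mul0r addr0.
have tau0 : 0 < enorm (tau k) by rewrite tauE enorm_uv sqrtr_gt0.
have nl : enorm l.2 = enorm (tau k) / `|slope k|.
  rewrite /l /= -scaleNr enorm_uv tauE enorm_uv -normrV ?unitfE// -sqrtr_sqr -sqrtrM ?ltW//.
  by congr Num.sqrt; field.
have l0 : l.2 != 0.
  by rewrite -enorm_gt0 nl divr_gt0// normr_gt0.
have mside : mset3 (side k).
  apply: mset3I; first exact: (mset3_simplex bK (subD1set K k)).
  by apply: mset3_eq0; exact: mfun3_affr.
pose h x := reval f x * (dot (b k).2 n / enorm (tau k) * affr e x).
have mh : mfun3 h.
  apply: mfun3M; first exact: mfun3_reval.
  by apply: mfun3M; [exact: mfun3_cst|exact: mfun3_affr].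
rewrite -/h (@rline_int_param _ l)//; first last.
- by move=> c'; apply: mfun3_line; exact: mfun3_patch.
- move=> X /(sideE _ kK) [_ lX /aPE]; set y := (_, _) => XP; clearbody y.
  move: lX; rewrite XP affrP => aX; exists (y.1 - y.2 * d k) => //; rewrite lE /lz; congr P.
  rewrite /line_zero (_ : - _ / _ = y.2) ?subrK; first by case: y {XP aX}.
  apply: (mulIf sk); rewrite divfK//; move: aX; rewrite sE /p1 /p2 /al kK /aff2 /=; lra.
rewrite -RintegralZl//; last first.
  apply: (integrable_simplex_line bK) => //; first by move=> X /(sideE _ kK) [].
  by apply: lbdM; [exact: lbd_reval|apply: lbdM; [exact: lbd_cst|exact: lbd_affr]].
apply: eq_Rintegral => x _.
have cP y : F 0 y * ind0 y = (reval f \_ (simplex G K)) (P y).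
  rewrite /F /trunc normr0 ler01 scale0r addr0 chi_simplex /patch; by case: ifP.
rewrite -/lz -/(ind0 (lz x)) cP lE.
have -> : (h \_ (side k)) (P (lz x)) = (h \_ (simplex G K)) (P (lz x)).
  rewrite /patch; congr (if _ then _ else _); apply/idP/idP; rewrite !in_setE.
    by move=> /(sideE _ kK) [].
  move=> XK; apply/(sideE _ kK); split => //.
  have alk : al k = cof (b k) by rewrite /al kK.
  by rewrite affrP -alk line_zeroP.
rewrite nl /patch; case: ifP => _; rewrite ?mul0r ?mulr0// /h.
have -> : aff2 (be k) (lz x) = dot (b k).2 n * affr e (P (lz x)).
  by rewrite affrP /be kK /aff2 /=; ring.
by field; rewrite normr_eq0 sk gt_eqF.
Qed.

Let lin_cvg : (1 + t * ka) @[t --> (0 : R)] --> (1 : R).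
Proof.
rewrite -[X in _ --> X]addr0 -[X in _ --> _ + X](mul0r ka); apply: cvgD; first exact: cvg_cst.
by apply: cvgMl; exact: cvg_id.
Qed.

Let theta_nz : \forall t \near (0 : R), 1 + t * ka != 0.
Proof.
have /cvgrPdist_lt /(_ 1 ltr01) := lin_cvg; apply: filterS => t.
by apply: contraTneq => ->; rewrite subr0 normr1 ltxx.
Qed.

Let theta_cvg : theta t @[t --> (0 : R)^'] --> (0 : R)^'.
Proof.
have h2 : theta t @[t --> (0 : R)] --> (0 : R).
  have := cvgM (cvgN (@cvg_id _ (nbhs (0 : R)))) (cvgV (oner_neq0 R) lin_cvg).
  by move=> /(_ (nbhs_filter _) (nbhs_filter _) (nbhs_filter _)); rewrite oppr0 mul0r.
move=> A A0; have nA : \forall t \near (0 : R), theta t != 0 -> A (theta t) by exact: (h2 _ A0).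
change (\forall t \near (0 : R), t != 0 -> A (theta t)).
apply: filterS2 nA theta_nz => t /= h nt t0; apply: h.
by rewrite /theta mulf_eq0 oppr_eq0 invr_eq0 negb_or t0.
Qed.

(** Chain rule for the reparametrization by [theta], whose derivative at 0 is -1: the wall moves
    against the gradient where [e] is positive, hence the overall sign. *)
Lemma surface_derivative_chart :
  t^-1 * (rsurf_int (surface t) (reval f) - rsurf_int surface0 (reval f)) @[t --> (0 : R)^'] -->
  - (rsurf_int surface0 (fun x => dot n (grad f x) * affr e x) +
     \sum_(k in K) rline_int (side k) (fun x => reval f x * (dot (b k).2 n / enorm (tau k) * affr e x))).
Proof.
have -> : \sum_(k in K) rline_int (side k) (fun x => reval f x * (dot (b k).2 n / enorm (tau k) * affr e x))
   = \sum_(k < M) edge k.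
  by rewrite big_mkcond /=; apply: eq_bigr => k _; rewrite edgeE.
rewrite -bulkE; set L := _ + _.
have t0 : \forall t \near (0 : R)^', t != 0.
  exact: nbhs_dnbhs_neq.
have thcvg : theta t @[t --> (0 : R)^'] --> (0 : R).
  by apply: cvg_trans theta_cvg _; apply: cvg_within.
pose s t := Num.sqrt (1 + theta t ^+ 2 * om).
have s1 : s t @[t --> (0 : R)^'] --> (1 : R).
  have -> : (1 : R) = Num.sqrt (1 + 0 ^+ 2 * om) by rewrite expr0n mul0r addr0 sqrtr1.
  apply: (@cvg_comp _ _ _ (fun t => 1 + theta t ^+ 2 * om) Num.sqrt); last exact: sqrt_continuous.
  apply: cvgD; first exact: cvg_cst.
  by apply: cvgMl; under eq_fun do rewrite expr2; rewrite expr2; exact: cvgM.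
have ratio : theta t / t @[t --> (0 : R)^'] --> (-1 : R).
  have h1 : - (1 + t * ka)^-1 @[t --> (0 : R)^'] --> (-1 : R).
    rewrite -[X in _ --> - X]invr1; apply: cvgN; apply: cvgV; first exact: oner_neq0.
    apply: cvg_within_filter => //; exact: lin_cvg.
  apply: cvg_trans h1; apply: near_eq_cvg; apply: filterS t0 => t t0.
  by rewrite /theta; case: (eqVneq (1 + t * ka) 0) => [->|nt]; [rewrite invr0 !mulr0 mul0r oppr0|field; rewrite t0 nt].
(* The quotient splits into the variation of the flat integral and that of the area factor [s t].
   Since [(s t - 1) * (s t + 1) = theta t ^+ 2 * om], the second part tends to 0. *)
have H : s t * ((theta t)^-1 * (I (theta t) - I0)) * (theta t / t) + I0 * (theta t / t * theta t * om / (s t + 1))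
    @[t --> (0 : R)^'] --> - L.
  rewrite (_ : - L = 1 * L * (-1) + I0 * (-1 * 0 * om / (1 + 1))); last by ring.
  apply: cvgD.
    by apply: cvgM => //; apply: cvgM => //; exact: (@cvg_comp _ _ _ theta (fun th => th^-1 * (I th - I0)) _ _ _ theta_cvg I_cvg).
  apply: cvgMr; apply: cvgM; first by apply: cvgMl; exact: cvgM.
  apply: cvgV; first by rewrite lt0r_neq0// addr_gt0.
  by apply: cvgD => //; exact: cvg_cst.
apply: cvg_trans H; apply: near_eq_cvg.
have nz : \forall t \near (0 : R)^', 1 + t * ka != 0.
  exact: (cvg_within _ theta_nz).
have th1 : \forall t \near (0 : R)^', `|theta t| <= 1.
  have /cvgrPdist_le /(_ 1 ltr01) := thcvg; apply: filterS => t.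
  by rewrite sub0r normrN.
apply: filterS3 nz th1 t0 => t nt tt t0.
rewrite rsurf_surface// rsurf_surface0 -/(s t).
have th0 : theta t != 0 by rewrite /theta mulf_eq0 oppr_eq0 invr_eq0 negb_or t0.
have s2 : s t ^+ 2 = 1 + theta t ^+ 2 * om.
  by rewrite sqr_sqrtr// addr_ge0// mulr_ge0// sqr_ge0.
have sp : 0 < s t + 1 by rewrite ltr_wpDl// sqrtr_ge0.
have -> : I0 * (theta t / t * theta t * om / (s t + 1)) = I0 * (s t - 1) / t.
  have -> : theta t / t * theta t * om = (s t - 1) * (s t + 1) / t.
    rewrite (_ : (s t - 1) * (s t + 1) = s t ^+ 2 - 1); last by ring.
    by rewrite s2; ring.
  by field; rewrite t0 gt_eqF.
by field; rewrite t0 th0.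
Qed.

End surface_derivative.

Section surface_derivative_thm.
Variables (R : realType) (M : nat) (G : geometry R M) (K : {set 'I_M}) (b : 'I_M -> R * 'rV[R]_3).
Hypotheses (K4 : #|K| = 4%N) (bK : barycentric G K b).
Variables (a e : R * 'rV[R]_3) (f : mpoly 3 R).
Hypotheses (g0 : a.2 != 0) (av : forall i, i \in K -> affr a (vtx G i) != 0).
Let n := (enorm a.2)^-1 *: a.2.

Let taylor_bound (rho : R) : 0 <= rho -> exists C : R,
  forall (x V : 'rV[R]_3) (t : R), (forall i, `|x 0 i| <= rho) -> (forall i, `|V 0 i| <= rho) -> `|t| <= 1 ->
  [/\ `|reval f (x + t *: V)| <= C, `|dot V (grad f x)| <= C &
   `|reval f (x + t *: V) - reval f x - t * dot V (grad f x)| <= C * t ^+ 2].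
Proof.
move=> rho0; have [C1 C10 P1] := reval_taylor f rho0.
have [C2 C20 P2] := reval_bounded f (rho + rho).
have cC i : exists C, 0 <= C /\ forall x : 'rV[R]_3, (forall i, `|x 0 i| <= rho) -> `|reval (mderiv i f) x| <= C.
  by have [C' h1 h2] := reval_bounded (mderiv i f) rho; exists C'.
have [D DP] := choice cC.
have S0 : 0 <= \sum_(i < 3) rho * D i by apply: sumr_ge0 => i _; rewrite mulr_ge0// (DP i).1.
exists (C1 + C2 + \sum_(i < 3) rho * D i) => x V t xr Vr t1; split.
- apply: (@le_trans _ _ C2); last by lra.
  apply: P2 => i; rewrite !mxE (le_trans (ler_normD _ _))// lerD// normrM.
  by rewrite -[leRHS]mul1r ler_pM.
- apply: (@le_trans _ _ (\sum_(i < 3) rho * D i)); last by lra.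
  rewrite /dot (le_trans (ler_norm_sum _ _ _))//; apply: ler_sum => i _.
  by rewrite normrM ler_pM// mxE (DP i).2.
- by rewrite (le_trans (P1 _ _ _ xr Vr t1))// ler_wpM2r ?sqr_ge0//; lra.
Qed.

Lemma surface_derivative :
  t^-1 * (rsurf_int (simplex G K `&` [set x | affr a x + t * affr e x = 0]) (reval f)
        - rsurf_int (simplex G K `&` [set x | affr a x = 0]) (reval f)) @[t --> (0 : R)^'] -->
  - (rsurf_int (simplex G K `&` [set x | affr a x = 0])
       (fun x => dot n (grad f x) * (affr e x / enorm a.2)) +
     \sum_(k in K) rline_int (simplex G (K :\ k) `&` [set x | affr a x = 0])
       (fun x => reval f x * (dot (b k).2 n / enorm ((b k).2 - dot (b k).2 n *: n)
                              * (affr e x / enorm a.2)))).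
Proof.
have [u [v [u1 v1 uv ug vg]]] := orthonormal_exists g0.
pose ng := enorm a.2; have ng0 : 0 < ng by rewrite /ng enorm_gt0.
have n1 : enorm n = 1 by exact: enorm_normalize.
have un : dot u n = 0 by rewrite dotZr ug mulr0.
have vn : dot v n = 0 by rewrite dotZr vg mulr0.
(* The foot of the perpendicular from the origin to the wall plane. *)
pose o := - (a.1 / dot a.2 a.2) *: a.2.
have ao : affr a o = 0 by rewrite /affr /o dotZr mulNr divfK ?subrr// dot_eq0.
clearbody o.
have gE : a.2 = ng *: n by rewrite scalerA divff ?scale1r// gt_eqF.
(* Division by the slope of [a] turns [e] into the normal speed of the wall, up to sign. *)
pose e' : R * 'rV[R]_3 := (e.1 / ng, ng^-1 *: e.2).
have eE x : affr e' x = affr e x / ng by rewrite /affr dotZl /=; ring.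
pose c := (o, u, v).
have [r0 r0P] := plane_coord_bounded bK c.
pose r := `|r0|.
have rP X : simplex G K X -> `|dot u (X - o)| <= r /\ `|dot v (X - o)| <= r.
  move=> /r0P; rewrite /plane_coord /= (gram_orthonormal u1 v1 uv) !divr1 (enorm1 u1) (enorm1 v1) uv.
  by rewrite !mul1r !mul0r !subr0 => -[h1 h2]; split; rewrite /r (le_trans _ (ler_norm _)).
have r10 : 0 <= r + 1 by rewrite addr_ge0 ?normr_ge0 ?ler01.
pose S i := `|o 0 i| + (r + 1) * `|u 0 i| + (r + 1) * `|v 0 i|.
pose W := `|affr e' o| + (r + 1) * `|dot e'.2 u| + (r + 1) * `|dot e'.2 v|.
have S0 i : 0 <= S i by rewrite /S !addr_ge0// mulr_ge0.
have W0 : 0 <= W by rewrite /W !addr_ge0// mulr_ge0.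
have aff_le (p q s y1 y2 : R) : `|y1| <= r + 1 -> `|y2| <= r + 1 ->
    `|p + y1 * q + y2 * s| <= `|p| + (r + 1) * `|q| + (r + 1) * `|s|.
  move=> h1 h2; rewrite (le_trans (ler_normD _ _))// lerD//; last by rewrite normrM ler_wpM2r.
  by rewrite (le_trans (ler_normD _ _))// lerD2l normrM ler_wpM2r.
(* [S i] bounds coordinate [i] of chart points with parameters up to [r + 1], and [W] bounds the
   height there; [rho] dominates both the base points and the directions in the Taylor estimate. *)
pose rho := \sum_i S i + \sum_i W * `|n 0 i|.
have S1 : 0 <= \sum_i S i by apply: sumr_ge0 => i _.
have W1 : 0 <= \sum_i W * `|n 0 i| by apply: sumr_ge0 => i _; rewrite mulr_ge0.
have rho0 : 0 <= rho by rewrite addr_ge0.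
have boxP (y : R * R) : `|y.1| <= r + 1 -> `|y.2| <= r + 1 ->
    forall i, `|plane_pt c y 0 i| <= rho /\ `|(affr e' (plane_pt c y) *: n) 0 i| <= rho.
  move=> h1 h2 i; split.
    rewrite /plane_pt !mxE /=; apply: le_trans (aff_le _ _ _ _ _ h1 h2) _.
    by rewrite -/(S i) /rho (bigD1 i)//= -addrA lerDl addr_ge0//; exact: sumr_ge0.
  rewrite /plane_pt /= !affrD !dotZr mxE normrM.
  apply: (@le_trans _ _ (W * `|n 0 i|)); first by rewrite ler_wpM2r// aff_le.
  rewrite /rho [\sum_i W * _](bigD1 i)//= addrCA lerDl addr_ge0//; apply: sumr_ge0 => j _; exact: mulr_ge0.
have [C CP] := taylor_bound rho0.
have H := surface_derivative_chart K4 bK g0 av u1 v1 n1 uv un vn ao gE (fun=> erefl) (fun=> erefl)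
  (normr_ge0 r0) rP boxP CP.
have h1 (x : 'rV[R]_3) : affr e x / enorm a.2 = affr e' x by rewrite eE.
have h2 t : [set x | affr a x + t * affr e x = 0] = [set x | affr a x + t * (enorm a.2 * affr e' x) = 0].
  by apply/funext => x /=; rewrite eE -/ng [ng * _]mulrC divfK// gt_eqF.
have h3 : (fun x => dot n (grad f x) * (affr e x / enorm a.2)) = (fun x => dot n (grad f x) * affr e' x).
  by apply/funext => x; rewrite h1.
rewrite h3 (eq_bigr (fun k => rline_int (simplex G (K :\ k) `&` [set x | affr a x = 0])
   (fun x => reval f x * (dot (b k).2 n / enorm ((b k).2 - dot (b k).2 n *: n) * affr e' x)))); last first.
  by move=> k _; congr rline_int; apply/funext => x; rewrite h1.
apply: cvg_trans H; apply: near_eq_cvg; apply: nearW => t; rewrite -h2//.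
Qed.

End surface_derivative_thm.

(** * Derivatives of complex-valued integrals *)

Section complex_limits.
Variable R : realType.
Notation C := (R[i]).

Lemma normc_real (r : R) : `|r%:C : C| = `|r|%:C.
Proof. by rewrite normc_def /= expr0n addr0 sqrtr_sqr. Qed.

Lemma gt0_complex (e : C) : 0 < e -> exists2 r : R, 0 < r & e = r%:C.
Proof. by case: e => a b; rewrite ltcE /= => /andP[/eqP -> a0]; exists a. Qed.

Lemma cvg_real_complex (T : Type) (F : set_system T) (FF : Filter F) (f : T -> R) (l : R) :
  f x @[x --> F] --> l -> ((f x)%:C : C^o) @[x --> F] --> (l%:C : C^o).
Proof.
move=> fl; apply/cvgrPdist_lt => e /gt0_complex[r r0 ->].
have /cvgrPdist_lt /(_ r r0) := fl; apply: filterS => x.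
by rewrite -raddfB /= normc_real ltcR.
Qed.

Lemma cvg_complex (T : Type) (F : set_system T) (FF : Filter F) (f : T -> C) (l : C) :
  complex.Re (f x) @[x --> F] --> complex.Re l ->
  complex.Im (f x) @[x --> F] --> complex.Im l ->
  (f x : C^o) @[x --> F] --> (l : C^o).
Proof.
move=> fR fI.
have -> : (fun x => f x : C^o) = (fun x => ((complex.Re (f x))%:C + 'i%C * (complex.Im (f x))%:C : C^o)).
  by apply/funext => x; rewrite {1}[f x]complexE.
rewrite [l in X in _ --> X]complexE; apply: cvgD; first exact: cvg_real_complex.
by apply: cvgMr; exact: cvg_real_complex.
Qed.

Definition cdiff (F : R -> C) (D : C) : Prop :=
  ((F t - F 0) / t%:C : C^o) @[t --> (0 : R)^'] --> (D : C^o).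

Lemma cdiff_ReIm F D :
  t^-1 * (complex.Re (F t) - complex.Re (F 0)) @[t --> (0 : R)^'] --> complex.Re D ->
  t^-1 * (complex.Im (F t) - complex.Im (F 0)) @[t --> (0 : R)^'] --> complex.Im D ->
  cdiff F D.
Proof.
move=> hR hI; apply: cvg_complex.
  apply: cvg_trans hR; apply: near_eq_cvg; apply: nearW => t.
  by rewrite -fmorphV; case: (F t) => a b; case: (F 0) => c d /=; ring.
apply: cvg_trans hI; apply: near_eq_cvg; apply: nearW => t.
by rewrite -fmorphV; case: (F t) => a b; case: (F 0) => c d /=; ring.
Qed.

Lemma cdiff_of (f : R -> C) F D : (f t : C^o) @[t --> (0 : R)^'] --> (D : C^o) ->
  (\forall t \near (0 : R)^', f t = (F t - F 0) / t%:C) -> cdiff F D.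
Proof. by move=> fD fF; apply: cvg_trans fD; apply: near_eq_cvg. Qed.

Lemma cdiff_near F H D : cdiff F D -> F 0 = H 0 ->
  (\forall t \near (0 : R)^', F t = H t) -> cdiff H D.
Proof.
move=> FD F0 FH; apply: cvg_trans FD; apply: near_eq_cvg; apply: filterS FH => t ->.
by rewrite F0.
Qed.

Lemma cdiff_cst c : cdiff (fun=> c) 0.
Proof. by rewrite /cdiff; under eq_fun do rewrite subrr mul0r; exact: cvg_cst. Qed.

Lemma cdiffD F H D E : cdiff F D -> cdiff H E -> cdiff (fun t => F t + H t) (D + E).
Proof.
move=> FD HE; apply: (cdiff_of (@cvgD _ _ _ _ (dnbhs_filter 0) _ _ _ _ FD HE)).
by apply: nearW => t /=; rewrite -mulrDl; congr (_ / _); ring.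
Qed.

Lemma cdiffZ c F D : cdiff F D -> cdiff (fun t => c * F t) (c * D).
Proof.
move=> FD; apply: (cdiff_of (@cvgMr _ _ _ (dnbhs_filter (0 : R)) _ c _ FD)).
by apply: nearW => t /=; rewrite mulrA mulrBr.
Qed.

Lemma cdiff_sum (I : Type) (s : seq I) (P : pred I) (F : I -> R -> C) (D : I -> C) :
  (forall i, P i -> cdiff (F i) (D i)) ->
  cdiff (fun t => \sum_(i <- s | P i) F i t) (\sum_(i <- s | P i) D i).
Proof.
move=> FD; elim: s => [|i s IH].
  rewrite big_nil (_ : (fun _ => _) = fun=> 0); first exact: cdiff_cst.
  by apply/funext => t; rewrite big_nil.
rewrite big_cons; have [Pi|Pi] := boolP (P i).
  rewrite (_ : (fun _ => _) = fun t => F i t + \sum_(j <- s | P j) F j t).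
    by apply: cdiffD; [exact: FD|exact: IH].
  by apply/funext => t; rewrite big_cons Pi.
by rewrite (_ : (fun _ => _) = fun t => \sum_(j <- s | P j) F j t)//; apply/funext => t; rewrite big_cons (negPf Pi).
Qed.

Lemma cdiff_continuous F D : cdiff F D -> (F t : C^o) @[t --> (0 : R)^'] --> (F 0 : C^o).
Proof.
move=> FD.
have tc : (t%:C : C^o) @[t --> (0 : R)^'] --> (0%:C : C^o).
  by apply: cvg_real_complex; apply: cvg_trans (@cvg_id _ (nbhs (0 : R))); exact: nbhs_dnbhs.
have h := @cvgM _ _ _ (dnbhs_filter (0 : R)) _ _ _ _ FD tc; rewrite mulr0 in h.
rewrite -[F 0 in X in _ --> X]addr0.
have := @cvgD _ _ _ _ (dnbhs_filter (0 : R)) _ _ _ _ (@cvg_cst _ (F 0 : C^o) _ _ (dnbhs_filter (0 : R))) h.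
apply: cvg_trans; apply: near_eq_cvg.
have : \forall t \near (0 : R)^', t != 0 by exact: nbhs_dnbhs_neq.
apply: filterS => t t0; change (F 0 + (F t - F 0) / t%:C * t%:C = F t).
have tn0 : t%:C != 0 :> C by rewrite (inj_eq (@complexI _)).
by rewrite divfK// addrC subrK.
Qed.

(** As the first factor vanishes at 0, only its derivative survives in the product rule; the second
    factor enters through its limit. This serves the coefficients by which the moving normal differs
    from the fixed one. *)
Lemma cdiffM0 F H D E : F 0 = 0 -> cdiff F D -> cdiff H E ->
  cdiff (fun t => F t * H t) (D * H 0).
Proof.
move=> F0 FD HE.
apply: (cdiff_of (@cvgM _ _ _ (dnbhs_filter (0 : R)) _ _ _ _ FD (cdiff_continuous HE))).
by apply: nearW => t /=; rewrite F0 mul0r !subr0 mulrAC.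
Qed.

End complex_limits.

(** * Derivatives of the complex-valued integrals over one element *)

Section complex_element.
Variables (R : realType) (M : nat) (G : geometry R M) (K : {set 'I_M}) (b : 'I_M -> R * 'rV[R]_3).
Hypotheses (K4 : #|K| = 4%N) (bK : barycentric G K b).
Variables (a e : R * 'rV[R]_3).
Hypothesis av : forall i, i \in K -> affr a (vtx G i) != 0.
Let n := (enorm a.2)^-1 *: a.2.

Lemma near_sign (p q : R) : p != 0 ->
  \forall t \near (0 : R), (p + t * q < 0) = (p < 0) /\ p + t * q != 0.
Proof.
move=> p0; have h : p + t * q @[t --> (0 : R)] --> p.
  rewrite -[X in _ --> X]addr0 -[X in _ --> _ + X](mul0r q); apply: cvgD; first exact: cvg_cst.
  by apply: cvgMl; exact: cvg_id.
have p0' : 0 < `|p| by rewrite normr_gt0.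
have /cvgrPdist_lt /(_ _ p0') := h; apply: filterS => t.
have [pn|pp|/eqP] := ltgtP p 0; last by rewrite (negPf p0).
  by rewrite (ltr0_norm pn) ltr_norml => /andP[h1 h2]; split; [|rewrite lt_eqF]; lra.
rewrite (gtr0_norm pp) ltr_norml => /andP[h1 h2]; split; last by rewrite gt_eqF//; lra.
by apply/negbTE; rewrite -leNgt; lra.
Qed.

Lemma uncut_near : a.2 = 0 -> \forall t \near (0 : R),
  simplex G K `&` [set x | affr a x + t * affr e x < 0] = simplex G K `&` [set x | affr a x < 0] /\
  simplex G K `&` [set x | affr a x + t * affr e x = 0] = set0.
Proof.
move=> a0.
have aE x : affr a x = a.1 by rewrite /affr a0 dot0l addr0.
have [rho rho0 rhoP] := simplex_bounded bK; have [B BP] := lbd_affr e rho.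
have a1 : a.1 != 0.
  have : (0 < #|K|)%N by rewrite K4.
  by case/card_gt0P => i iK; rewrite -(aE (vtx G i)) av.
(* [t * B] and [t * - B] enclose [t * affr e x] for all [x] in [K], so two sign conditions control
   the whole element. *)
have hp := near_sign B a1; have hn := near_sign (- B) a1.
apply: filterS2 hp hn => t [p1 p2] [n1 n2].
have key x : simplex G K x -> (a.1 + t * affr e x < 0) = (a.1 < 0) /\ a.1 + t * affr e x != 0.
  move=> /rhoP /BP eB; have : `|t * affr e x| <= `|t * B|.
    by rewrite !normrM ler_wpM2l// (le_trans eB)// ler_norm.
  move: p1 n1 p2 n2; rewrite mulrN; move: (t * B) (t * affr e x) => u v p1 n1 p2 n2.
  have {p1 p2 n1 n2} : `|u| < `|a.1|.
    rewrite ltr_norml; have [h|h|/eqP] := ltgtP a.1 0; last by rewrite (negPf a1).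
      by move: p1 n1; rewrite h (ltr0_norm h); lra.
    move: p1 n1 p2 n2; rewrite (lt_gtF h) => /negbT + /negbT; rewrite -!leNgt !le_eqVlt (gtr0_norm h).
    by case/predU1P => [<-|p]; case/predU1P => [<-|q]; rewrite ?eqxx//; lra.
  have [h|h|/eqP] := ltgtP a.1 0; last by rewrite (negPf a1).
    rewrite (ltr0_norm h) => ul vu; have := le_lt_trans vu ul; rewrite ltr_norml => /andP[v1 v2].
    have h' : a.1 + v < 0 by lra.
    by split; [exact: h'|rewrite lt_eqF].
  rewrite (gtr0_norm h) => ul vu; have := le_lt_trans vu ul; rewrite ltr_norml => /andP[v1 v2].
  have h' : 0 < a.1 + v by lra.
  by split; [exact: (lt_gtF h')|rewrite gt_eqF].
split; apply/seteqP; split => x //=.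
- by move=> [xK]; rewrite !aE (key x xK).1.
- by move=> [xK]; rewrite !aE (key x xK).1.
- by move=> [xK]; rewrite aE => /eqP; rewrite (negPf (key x xK).2).
Qed.

Let K0 := simplex G K `&` [set x | affr a x = 0].

Let uncut0 : a.2 = 0 -> K0 = set0.
Proof.
move=> a0; have : (0 < #|K|)%N by rewrite K4.
case/card_gt0P => i iK; apply/seteqP; split => x //= -[_ /=].
rewrite /affr a0 dot0l addr0 => a10; have := av iK.
by rewrite /affr a0 dot0l addr0 a10 eqxx.
Qed.

Lemma ReM_real (z : R[i]) (r : R) : complex.Re (z * r%:C) = complex.Re z * r.
Proof. by case: z => x y /=; rewrite mulr0 subr0. Qed.

Lemma ImM_real (z : R[i]) (r : R) : complex.Im (z * r%:C) = complex.Im z * r.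
Proof. by case: z => x y /=; rewrite mulr0 add0r. Qed.

Lemma ReND (x y : R[i]) : complex.Re (- (x + y)) = - (complex.Re x + complex.Re y).
Proof. by case: x; case: y. Qed.

Lemma ImND (x y : R[i]) : complex.Im (- (x + y)) = - (complex.Im x + complex.Im y).
Proof. by case: x; case: y. Qed.

Lemma Re_sum (I : Type) (s : seq I) (P : pred I) (F : I -> R[i]) :
  complex.Re (\sum_(i <- s | P i) F i) = \sum_(i <- s | P i) complex.Re (F i).
Proof. by apply: big_morph => // -[x y] [x' y']. Qed.

Lemma Im_sum (I : Type) (s : seq I) (P : pred I) (F : I -> R[i]) :
  complex.Im (\sum_(i <- s | P i) F i) = \sum_(i <- s | P i) complex.Im (F i).
Proof. by apply: big_morph => // -[x y] [x' y']. Qed.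

Lemma Re_surf_int E (f : 'rV[R]_3 -> R[i]) :
  complex.Re (surf_int E f) = rsurf_int E (fun x => complex.Re (f x)).
Proof. by []. Qed.

Lemma Im_surf_int E (f : 'rV[R]_3 -> R[i]) :
  complex.Im (surf_int E f) = rsurf_int E (fun x => complex.Im (f x)).
Proof. by []. Qed.

Lemma Re_line_int E (f : 'rV[R]_3 -> R[i]) :
  complex.Re (line_int E f) = rline_int E (fun x => complex.Re (f x)).
Proof. by []. Qed.

Lemma Im_line_int E (f : 'rV[R]_3 -> R[i]) :
  complex.Im (line_int E f) = rline_int E (fun x => complex.Im (f x)).
Proof. by []. Qed.

Lemma surf_int_set0 (f : 'rV[R]_3 -> R[i]) : surf_int set0 f = 0.
Proof. by rewrite surf_intE !rsurf_int_set0. Qed.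

Lemma line_int_set0 (f : 'rV[R]_3 -> R[i]) : line_int set0 f = 0.
Proof. by rewrite line_intE !rline_int_set0. Qed.

Lemma cdiff_vol P :
  cdiff (fun t => vol_int (simplex G K `&` [set x | affr a x + t * affr e x < 0]) (ceval P))
        (- surf_int K0 (fun x => ceval P x * (affr e x / enorm a.2)%:C)).
Proof.
have E0 : [set x | affr a x + 0 * affr e x < 0] = [set x | affr a x < 0].
  by apply/funext => x /=; rewrite mul0r addr0.
have [a0|a0] := eqVneq a.2 0.
  rewrite uncut0// surf_int_set0 oppr0.
  apply: (cdiff_near (cdiff_cst (vol_int (simplex G K `&` [set x | affr a x < 0]) (ceval P)))).
    by rewrite E0.
  by apply: nbhs_dnbhs; have := uncut_near a0; apply: filterS => t [-> _].
have [A [B [AB _]]] := ceval_ReIm P.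
have ReP : (fun x => complex.Re (ceval P x)) = reval A by apply/funext => x; rewrite AB.
have ImP : (fun x => complex.Im (ceval P x)) = reval B by apply/funext => x; rewrite AB.
have ReS : (fun x => complex.Re (ceval P x * (affr e x / enorm a.2)%:C)) =
    (fun x => reval A x * (affr e x / enorm a.2)) by apply/funext => x; rewrite ReM_real AB.
have ImS : (fun x => complex.Im (ceval P x * (affr e x / enorm a.2)%:C)) =
    (fun x => reval B x * (affr e x / enorm a.2)) by apply/funext => x; rewrite ImM_real AB.
apply: cdiff_ReIm; rewrite E0 surf_intE /= ?ReS ?ImS.
  have := @vol_derivative _ _ _ _ _ K4 bK a e A a0 av; apply: cvg_trans; apply: near_eq_cvg; apply: nearW => t.
  by rewrite -ReP.
have := @vol_derivative _ _ _ _ _ K4 bK a e B a0 av; apply: cvg_trans; apply: near_eq_cvg; apply: nearW => t.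
by rewrite -ImP.
Qed.

Lemma ceval_dirder_ReIm (A B : mpoly 3 R) (P : mpoly 3 R[i]) v x :
  (forall i x, ceval (mderiv i P) x = (reval (mderiv i A) x +i* reval (mderiv i B) x)) ->
  ceval (dirder v P) x = dot v (grad A x) +i* dot v (grad B x).
Proof.
move=> AB; rewrite /dirder !dot3 sum3 !cevalD !cevalZ !AB !mxE.
by apply/eqP; rewrite eq_complex /=; apply/andP; split; apply/eqP; ring.
Qed.

(* Velocity of the edge of the wall on the face opposite to [k], in the plane of
   the wall, when the wall moves with unit normal velocity *)
Definition edge_weight k : R := dot (b k).2 n / enorm ((b k).2 - dot (b k).2 n *: n).

(** The geometry is independent of the integrand, so the real formula applies to the real and
    imaginary parts separately. If the gradient of the level function is 0, all sets in the formula
    are empty. *)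
Lemma cdiff_surf P :
  cdiff (fun t => surf_int (simplex G K `&` [set x | affr a x + t * affr e x = 0]) (ceval P))
    (- (surf_int K0 (fun x => ceval (dirder n P) x * (affr e x / enorm a.2)%:C) +
        \sum_(k in K) line_int (simplex G (K :\ k) `&` [set x | affr a x = 0])
          (fun x => ceval P x * (edge_weight k * (affr e x / enorm a.2))%:C))).
Proof.
have E0 : [set x | affr a x + 0 * affr e x = 0] = [set x | affr a x = 0].
  by apply/funext => x /=; rewrite mul0r addr0.
have [a0|a0] := eqVneq a.2 0.
  rewrite uncut0// surf_int_set0 big1; last first.
    move=> k kK; rewrite (_ : _ `&` _ = set0) ?line_int_set0//.
    have := uncut0 a0 => K00; apply/seteqP; split => x // -[xS xa].
    rewrite -K00; split => //; apply/(simplexP bK) => i iK.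
    have := (simplex_baryP bK x (subD1set K k)).1 xS => -[h1 h2].
    have [iS|iS] := boolP (i \in K :\ k); first exact: h1.
    by rewrite h2.
  rewrite addr0 oppr0; apply: (cdiff_near (cdiff_cst 0)).
    by rewrite E0 -/K0 uncut0// surf_int_set0.
  by apply: nbhs_dnbhs; have := uncut_near a0; apply: filterS => t [_ ->]; rewrite surf_int_set0.
have [A [B [AB dAB]]] := ceval_ReIm P.
have ReP : (fun x => complex.Re (ceval P x)) = reval A by apply/funext => x; rewrite AB.
have ImP : (fun x => complex.Im (ceval P x)) = reval B by apply/funext => x; rewrite AB.
apply: cdiff_ReIm; rewrite E0 ?ReND ?ImND ?Re_sum ?Im_sum.
- have -> : complex.Re (surf_int K0 (fun x => ceval (dirder n P) x * (affr e x / enorm a.2)%:C)) =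
      rsurf_int K0 (fun x => dot n (grad A x) * (affr e x / enorm a.2)).
    rewrite Re_surf_int; congr rsurf_int; apply/funext => x; by rewrite ReM_real (ceval_dirder_ReIm _ _ dAB).
  rewrite (eq_bigr (fun k => rline_int (simplex G (K :\ k) `&` [set x | affr a x = 0])
       (fun x => reval A x * (edge_weight k * (affr e x / enorm a.2))))); last first.
    move=> k _; rewrite Re_line_int; congr rline_int; apply/funext => x; by rewrite ReM_real AB.
  have := @surface_derivative _ _ _ _ _ K4 bK a e A a0 av.
  by apply: cvg_trans; apply: near_eq_cvg; apply: nearW => t; rewrite -ReP.
- have -> : complex.Im (surf_int K0 (fun x => ceval (dirder n P) x * (affr e x / enorm a.2)%:C)) =
      rsurf_int K0 (fun x => dot n (grad B x) * (affr e x / enorm a.2)).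
    rewrite Im_surf_int; congr rsurf_int; apply/funext => x; by rewrite ImM_real (ceval_dirder_ReIm _ _ dAB).
  rewrite (eq_bigr (fun k => rline_int (simplex G (K :\ k) `&` [set x | affr a x = 0])
       (fun x => reval B x * (edge_weight k * (affr e x / enorm a.2))))); last first.
    move=> k _; rewrite Im_line_int; congr rline_int; apply/funext => x; by rewrite ImM_real AB.
  have := @surface_derivative _ _ _ _ _ K4 bK a e B a0 av.
  by apply: cvg_trans; apply: near_eq_cvg; apply: nearW => t; rewrite -ImP.
Qed.

End complex_element.

(** * Linearity of the complex-valued integrals *)

Section cintegral.
Variables (R : realType) (d : measure_display) (T : measurableType d)
  (mu : {measure set T -> \bar R}).
Implicit Types (D : set T) (f g : T -> R[i]).

Definition cintegrable D f : Prop :=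
  mu.-integrable D (EFin \o (fun x => complex.Re (f x))) /\
  mu.-integrable D (EFin \o (fun x => complex.Im (f x))).

Lemma ReD (x y : R[i]) : complex.Re (x + y) = complex.Re x + complex.Re y.
Proof. by case: x; case: y. Qed.

Lemma ImD (x y : R[i]) : complex.Im (x + y) = complex.Im x + complex.Im y.
Proof. by case: x; case: y. Qed.

Lemma ReM (x y : R[i]) : complex.Re (x * y) = complex.Re x * complex.Re y - complex.Im x * complex.Im y.
Proof. by case: x; case: y. Qed.

Lemma ImM (x y : R[i]) : complex.Im (x * y) = complex.Re x * complex.Im y + complex.Im x * complex.Re y.
Proof. by case: x; case: y. Qed.

Lemma cintegralD D f g : measurable D -> cintegrable D f -> cintegrable D g ->
  cintegral mu D (fun x => f x + g x) = cintegral mu D f + cintegral mu D g.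
Proof.
move=> mD [f1 f2] [g1 g2]; apply/eqP; rewrite eq_complex /=; apply/andP; split; apply/eqP.
  by under eq_Rintegral do rewrite ReD; exact: RintegralD.
by under eq_Rintegral do rewrite ImD; exact: RintegralD.
Qed.

Let intZ D (k : R) (f : T -> R) : measurable D -> mu.-integrable D (EFin \o f) ->
  mu.-integrable D (EFin \o (fun x => k * f x)).
Proof. by move=> mD mf; have := integrableZl mD k mf; apply: eq_integrable. Qed.

Lemma cintegralZ (k : R[i]) D f : measurable D -> cintegrable D f ->
  cintegral mu D (fun x => k * f x) = k * cintegral mu D f.
Proof.
move=> mD [f1 f2]; apply/eqP; rewrite eq_complex /=; apply/andP; split; apply/eqP.
  under eq_Rintegral do rewrite ReM.
  rewrite (RintegralB mD (intZ (complex.Re k) mD f1) (intZ (complex.Im k) mD f2)) !RintegralZl//.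
  by case: k.
under eq_Rintegral do rewrite ImM.
rewrite (RintegralD mD (intZ (complex.Re k) mD f2) (intZ (complex.Im k) mD f1)) !RintegralZl//.
by case: k.
Qed.

End cintegral.

Section nice.
Variable R : realType.
Implicit Types (f g : 'rV[R]_3 -> R[i]) (E : set 'rV[R]_3).

(** A class of integrands that is closed under sums and products and contains the polynomials; its
    members are integrable over every bounded measurable set. *)
Definition nice f : Prop :=
  [/\ mfun3 (fun x => complex.Re (f x)), mfun3 (fun x => complex.Im (f x)),
      lbd (fun x => complex.Re (f x)) & lbd (fun x => complex.Im (f x))].

Lemma lbdD (f g : 'rV[R]_3 -> R) : lbd f -> lbd g -> lbd (fun x => f x + g x).
Proof.
move=> bf bg rho; have [C fC] := bf rho; have [D gD] := bg rho.
by exists (C + D) => X XP; rewrite (le_trans (ler_normD _ _))// lerD ?fC ?gD.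
Qed.

Lemma lbdZ (k : R) (g : 'rV[R]_3 -> R) : lbd g -> lbd (fun x => k * g x).
Proof. by move=> bg; apply: lbdM => //; exact: lbd_cst. Qed.

Lemma mfun3Z (k : R) (g : 'rV[R]_3 -> R) : mfun3 g -> mfun3 (fun x => k * g x).
Proof. by move=> bg; apply: mfun3M => //; exact: mfun3_cst. Qed.

Lemma niceD f g : nice f -> nice g -> nice (fun x => f x + g x).
Proof.
move=> [f1 f2 f3 f4] [g1 g2 g3 g4]; split.
- by rewrite (_ : (fun _ => _) = fun x => complex.Re (f x) + complex.Re (g x)); [exact: mfun3D|apply/funext => x; rewrite ReD].
- by rewrite (_ : (fun _ => _) = fun x => complex.Im (f x) + complex.Im (g x)); [exact: mfun3D|apply/funext => x; rewrite ImD].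
- by rewrite (_ : (fun _ => _) = fun x => complex.Re (f x) + complex.Re (g x)); [exact: lbdD|apply/funext => x; rewrite ReD].
- by rewrite (_ : (fun _ => _) = fun x => complex.Im (f x) + complex.Im (g x)); [exact: lbdD|apply/funext => x; rewrite ImD].
Qed.

Lemma niceM f g : nice f -> nice g -> nice (fun x => f x * g x).
Proof.
move=> [f1 f2 f3 f4] [g1 g2 g3 g4].
have e1 : (fun x => complex.Re (f x * g x)) =
    (fun x => complex.Re (f x) * complex.Re (g x) + -1 * (complex.Im (f x) * complex.Im (g x))).
  by apply/funext => x; rewrite ReM mulN1r.
have e2 : (fun x => complex.Im (f x * g x)) =
    (fun x => complex.Re (f x) * complex.Im (g x) + complex.Im (f x) * complex.Re (g x)).
  by apply/funext => x; rewrite ImM.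
split; rewrite ?e1 ?e2.
- by apply: mfun3D; [exact: mfun3M|apply: mfun3Z; exact: mfun3M].
- by apply: mfun3D; exact: mfun3M.
- by apply: lbdD; [exact: lbdM|apply: lbdZ; exact: lbdM].
- by apply: lbdD; exact: lbdM.
Qed.

Lemma nice_cst (k : R[i]) : nice (fun=> k).
Proof. by split; [exact: mfun3_cst|exact: mfun3_cst|exact: lbd_cst|exact: lbd_cst]. Qed.

Lemma nice_ceval P : nice (ceval P).
Proof.
have [A [B [AB _]]] := ceval_ReIm P.
have ReP : (fun x => complex.Re (ceval P x)) = reval A by apply/funext => x; rewrite AB.
have ImP : (fun x => complex.Im (ceval P x)) = reval B by apply/funext => x; rewrite AB.
by split; rewrite ?ReP ?ImP; [exact: mfun3_reval|exact: mfun3_reval|exact: lbd_reval|exact: lbd_reval].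
Qed.

Lemma nice_sum (I : Type) (s : seq I) (P : pred I) (F : I -> 'rV[R]_3 -> R[i]) :
  (forall i, P i -> nice (F i)) -> nice (fun x => \sum_(i <- s | P i) F i x).
Proof.
move=> nF; elim: s => [|i s IH].
  by rewrite (_ : (fun _ => _) = fun=> 0); [exact: nice_cst|apply/funext => x; rewrite big_nil].
have [Pi|Pi] := boolP (P i).
  rewrite (_ : (fun _ => _) = fun x => F i x + \sum_(j <- s | P j) F j x).
    by apply: niceD; [exact: nF|exact: IH].
  by apply/funext => x; rewrite big_cons Pi.
by rewrite (_ : (fun _ => _) = fun x => \sum_(j <- s | P j) F j x)//; apply/funext => x; rewrite big_cons (negPf Pi).
Qed.

Lemma nice_affr (a : R * 'rV[R]_3) : nice (fun x => (affr a x)%:C).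
Proof.
have e1 : (fun x => complex.Re (affr a x)%:C) = affr a by [].
by split => /=; rewrite ?e1; [exact: mfun3_affr|exact: mfun3_cst|exact: lbd_affr|exact: lbd_cst].
Qed.

Definition bounded3 E : Prop := exists rho : R, forall X, E X -> forall j, `|X 0 j| <= rho.

Definition planar E : Prop := exists c, gram c.1.2 c.2 != 0 /\ E `<=` range (@plane_pt R c).

Notation RR := (measurableTypeR R).
Notation leb2 := (@leb2 R).
Notation leb3 := (@leb3 R).

Lemma mset3_measurable E d (T : measurableType d) (X : T -> 'rV[R]_3) :
  mset3 E -> (forall i, measurable_fun setT (fun s => X s 0 i)) -> measurable (X @^-1` E).
Proof.
move=> mE mX; have := mE _ _ X mX => h.
have -> : X @^-1` E = [set s | 1 <= ((X s \in E)%:R : R)].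
  apply/seteqP; split => s /=; first by move=> /mem_set ->.
  by case: (boolP (X s \in E)) => [/set_mem //|_]; rewrite ler10.
rewrite -[X in measurable X]setTI.
have := h measurableT `[1, +oo[%classic (measurable_itv _).
by congr (measurable (_ `&` _)); apply/funext => s; rewrite /= in_itv /= andbT.
Qed.

Lemma plane_coord_bound E c : bounded3 E -> exists r : R, forall X, E X ->
  `|(plane_coord c X).1| <= r /\ `|(plane_coord c X).2| <= r.
Proof.
move=> [rho rhoP].
pose u := c.1.2; pose v := c.2.
have bnd (h : 'rV[R]_3) : exists B : R, forall X, E X -> `|dot h (X - c.1.1)| <= B.
  exists (\sum_(j < 3) `|h 0 j| * (rho + `|c.1.1 0 j|)) => X /rhoP XK.
  rewrite /dot (le_trans (ler_norm_sum _ _ _))//; apply: ler_sum => j _.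
  by rewrite normrM ler_wpM2l// !mxE (le_trans (ler_normB _ _))// lerD2r.
have [B1 P1] := bnd ((gram u v)^-1 *: (dot v v *: u - dot u v *: v)).
have [B2 P2] := bnd ((gram u v)^-1 *: (dot u u *: v - dot u v *: u)).
exists (Num.max B1 B2) => X XK; rewrite /plane_coord /= -/u -/v !le_max.
split; apply/orP; [left|right].
  by have := P1 X XK; rewrite dotZl dotBl !dotZl mulrC.
by have := P2 X XK; rewrite dotZl dotBl !dotZl mulrC.
Qed.

Let integrable_surf_real E (f : 'rV[R]_3 -> R) : mset3 E -> bounded3 E -> planar E ->
  mfun3 f -> lbd f ->
  leb2.-integrable (plane_pt (plane_chart E) @^-1` E) (EFin \o (fun y => f (plane_pt (plane_chart E) y))).
Proof.
move=> mE bE [c [c0 Ec]] mf bf; have [c1 c2 c3 c4] := plane_chart_exists c0 Ec.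
have g0 : gram (plane_chart E).1.2 (plane_chart E).2 != 0 by rewrite gram_orthonormal// oner_neq0.
have mD : measurable (plane_pt (plane_chart E) @^-1` E : set (RR * RR)).
  by apply: mset3_measurable => // i; exact: measurable_plane_pt.
apply/(integrable_mkcond _ mD).
have [r rP] := plane_coord_bound (plane_chart E) bE; have [rho rhoP] := bE; have [B BP] := bf rho.
rewrite (_ : _ \_ _ = EFin \o ((f \_ E) \o plane_pt (plane_chart E))); last first.
  apply/funext => y; rewrite /= /patch (_ : (y \in _) = (plane_pt (plane_chart E) y \in E)); last first.
    by apply/idP/idP; rewrite !in_setE.
  by case: ifP.
apply: (@integrable_box2 R _ `|B| r).
- by apply: mfun3_plane; exact: mfun3_patch.
- move=> y; rewrite /= /patch; case: ifPn => [/set_mem/rhoP h|]; last by rewrite normr0.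
  by rewrite (le_trans (BP _ h))// ler_norm.
- move=> y; rewrite /= /patch; case: ifPn => [/set_mem/rP h _|]; last by rewrite eqxx.
  by move: h; rewrite plane_ptK.
Qed.

Lemma cintegrable_surf E f : mset3 E -> bounded3 E -> planar E -> nice f ->
  cintegrable leb2 (plane_pt (plane_chart E) @^-1` E) (f \o plane_pt (plane_chart E)).
Proof. by move=> mE bE pE [f1 f2 f3 f4]; split; [exact: (integrable_surf_real mE bE pE f1 f3)|exact: (integrable_surf_real mE bE pE f2 f4)]. Qed.

(** The sets for which a genuine chart exists and nice integrands are integrable, so that [surf_int]
    is linear. The empty wall of an uncut element is among them. *)
Definition flat E : Prop := [/\ mset3 E, bounded3 E & planar E].

Lemma surf_intD E f g : flat E -> nice f -> nice g ->
  surf_int E (fun x => f x + g x) = surf_int E f + surf_int E g.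
Proof.
move=> [mE bE pE] nf ng; apply: cintegralD; last 2 first.
- exact: cintegrable_surf.
- exact: cintegrable_surf.
- by apply: mset3_measurable => // i; exact: measurable_plane_pt.
Qed.

Lemma surf_intZ (k : R[i]) E f : flat E -> nice f ->
  surf_int E (fun x => k * f x) = k * surf_int E f.
Proof.
move=> [mE bE pE] nf; apply: cintegralZ; last exact: cintegrable_surf.
by apply: mset3_measurable => // i; exact: measurable_plane_pt.
Qed.

Lemma integrable_leb3_bounded E (f : 'rV[R]_3 -> R) : mset3 E -> bounded3 E -> mfun3 f -> lbd f ->
  leb3.-integrable (@pt3 R @^-1` E) (EFin \o (fun y => f (pt3 y))).
Proof.
move=> mE [rho rhoP] mf bf; have [C CP] := bf rho.
have mD : measurable (@pt3 R @^-1` E : set (RR * RR * RR)).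
  by apply: mset3_measurable => // i; exact: measurable_pt3.
apply/(integrable_mkcond _ mD).
rewrite (_ : _ \_ _ = EFin \o ((f \_ E) \o @pt3 R)); last first.
  apply/funext => y; rewrite /= /patch (_ : (y \in _) = (@pt3 R y \in E)); last first.
    by apply/idP/idP; rewrite !in_setE.
  by case: ifP.
pose B : set (RR * RR * RR) := box2 rho `*` (`[- rho, rho]%classic : set RR).
apply: (@integrable_bounded R _ (RR * RR * RR)%type leb3 B _ `|C|).
- by apply: measurableX; [exact: measurable_box2|exact: measurable_itv].
- rewrite [X in (X < _)%E](_ : _ = (leb2 (box2 rho) * (@lebesgue_measure R) (`[(- rho)%R, rho]%classic : set RR))%E); last first.
    apply: (@product_measure1E _ _ (RR * RR)%type RR R (sleb2 R)); first exact: measurable_box2.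
    exact: measurable_itv.
  by rewrite lte_mul_pinfty ?ge0_fin_numE ?box2_lty ?interval_lty.
- by apply: mfun3_pt3; exact: mfun3_patch.
- move=> y; rewrite /= /patch; case: ifPn => [/set_mem/rhoP h|]; last by rewrite normr0.
  by rewrite (le_trans (CP _ h))// ler_norm.
- move=> y nB; rewrite /= /patch; case: ifPn => // /set_mem/rhoP h; exfalso; apply: nB.
  split; first by apply/box2P; have := h i0; have := h i1; rewrite !mxE.
  by have := h i2; rewrite /= !mxE in_itv /= -ler_norml.
Qed.

Lemma cintegrable_vol E f : mset3 E -> bounded3 E -> nice f ->
  cintegrable leb3 (@pt3 R @^-1` E) (f \o @pt3 R).
Proof. by move=> mE bE [f1 f2 f3 f4]; split; [exact: (integrable_leb3_bounded mE bE f1 f3)|exact: (integrable_leb3_bounded mE bE f2 f4)]. Qed.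

Lemma vol_intD E f g : mset3 E -> bounded3 E -> nice f -> nice g ->
  vol_int E (fun x => f x + g x) = vol_int E f + vol_int E g.
Proof.
move=> mE bE nf ng; apply: cintegralD; last 2 first.
- exact: cintegrable_vol.
- exact: cintegrable_vol.
- by apply: mset3_measurable => // i; exact: measurable_pt3.
Qed.

Lemma vol_intZ (k : R[i]) E f : mset3 E -> bounded3 E -> nice f ->
  vol_int E (fun x => k * f x) = k * vol_int E f.
Proof.
move=> mE bE nf; apply: cintegralZ; last exact: cintegrable_vol.
by apply: mset3_measurable => // i; exact: measurable_pt3.
Qed.

Lemma surf_int_sum (I : Type) (s : seq I) (P : pred I) E (F : I -> 'rV[R]_3 -> R[i]) :
  flat E -> (forall i, P i -> nice (F i)) ->
  surf_int E (fun x => \sum_(i <- s | P i) F i x) = \sum_(i <- s | P i) surf_int E (F i).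
Proof.
move=> fE nF; elim: s => [|i s IH].
  rewrite big_nil (_ : (fun _ => _) = fun x : 'rV[R]_3 => 0 * (fun=> 0) x).
    by rewrite surf_intZ ?mul0r//; exact: nice_cst.
  by apply/funext => x; rewrite big_nil mul0r.
have [Pi|Pi] := boolP (P i); rewrite big_cons ?Pi ?(negPf Pi).
  rewrite -IH -surf_intD//; last 2 first.
  - exact: nF.
  - by apply: nice_sum => j; exact: nF.
  by congr surf_int; apply/funext => x; rewrite big_cons Pi.
by rewrite -IH; congr surf_int; apply/funext => x; rewrite big_cons (negPf Pi).
Qed.

End nice.

Section flat_sets.
Variable R : realType.
Implicit Types E : set 'rV[R]_3.

Lemma planarS E E' : E `<=` E' -> planar E' -> planar E.
Proof. by move=> EE' [c [c0 cE]]; exists c; split => // x /EE' /cE. Qed.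

Lemma planar_affr (a : R * 'rV[R]_3) : a.2 != 0 -> planar [set x | affr a x = 0].
Proof.
move=> g0; have [u [v [u1 v1 uv ug vg]]] := orthonormal_exists g0.
pose n := (enorm a.2)^-1 *: a.2; have n1 : enorm n = 1 by exact: enorm_normalize.
pose o := - (a.1 / dot a.2 a.2) *: a.2.
have ao : affr a o = 0 by rewrite /affr /o dotZr mulNr divfK ?subrr// dot_eq0.
exists (o, u, v); split; first by rewrite gram_orthonormal// oner_neq0.
move=> x /= ax; exists (dot u (x - o), dot v (x - o)) => //; rewrite /plane_pt /=.
have un : dot u n = 0 by rewrite dotZr ug mulr0.
have vn : dot v n = 0 by rewrite dotZr vg mulr0.
have := orthonormal_decomp (x - o) u1 v1 n1 uv un vn.
have -> : dot n (x - o) = 0.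
  by rewrite dotZl dotBr; move: ax ao; rewrite /affr => h1 h2; rewrite (_ : _ - _ = 0) ?mulr0//; lra.
by rewrite scale0r addr0 -addrA => <-; rewrite addrC subrK.
Qed.

Lemma planar0 : @planar R set0.
Proof.
apply: (@planarS _ [set x | affr (0, delta_mx 0 i0 : 'rV[R]_3) x = 0]) => //.
apply: planar_affr => /=; apply/eqP => /rowP /(_ i0) /eqP; by rewrite !mxE !eqxx oner_eq0.
Qed.

Lemma bounded3S E E' : E `<=` E' -> bounded3 E' -> bounded3 E.
Proof. by move=> EE' [r rP]; exists r => x /EE' /rP. Qed.

Lemma affr_pert (a e : R * 'rV[R]_3) t x :
  affr a x + t * affr e x = affr (a.1 + t * e.1, a.2 + t *: e.2) x.
Proof. by rewrite /affr /= dotDl dotZl; ring. Qed.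

Lemma near_neq0 (g e : 'rV[R]_3) : g != 0 -> \forall t \near (0 : R), g + t *: e != 0.
Proof.
move=> g0; have := near_sign (dot e g) (_ : dot g g != 0); rewrite dot_eq0 => /(_ g0).
apply: filterS => t [_]; apply: contra => /eqP h.
by rewrite -dotZl -dotDl h dot0l.
Qed.

End flat_sets.

(** * Derivative of the unit normal *)

Section unit_normal.
Variables (R : realType) (g e : 'rV[R]_3).
Hypothesis g0 : g != 0.
Let n := (enorm g)^-1 *: g.
Let nt t := (enorm (g + t *: e))^-1 *: (g + t *: e).

(** The tangential projection of [e] over the length of [g]; for the level function this is P_T grad
    w / |d phi / dn|. *)
Definition normal_der : 'rV[R]_3 := (enorm g)^-1 *: (e - dot e n *: n).

Let ng0 : 0 < enorm g. Proof. by rewrite enorm_gt0. Qed.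

Let r t := enorm (g + t *: e).

Let id_cvg : (t : R) @[t --> (0 : R)^'] --> (0 : R).
Proof. by apply: cvg_trans (@cvg_id _ (nbhs (0 : R))); exact: nbhs_dnbhs. Qed.

Let r_cvg : r t @[t --> (0 : R)^'] --> enorm g.
Proof.
have h : dot g g + t * (2 * dot g e + t * dot e e) @[t --> (0 : R)^'] --> dot g g.
  rewrite -[X in _ --> X]addr0; apply: cvgD; first exact: cvg_cst.
  rewrite -[X in _ --> X](mul0r (2 * dot g e + 0 * dot e e)); apply: cvgM => //.
  by apply: cvgD; [exact: cvg_cst|exact: cvgMl].
have := @cvg_comp _ _ _ (fun t => dot g g + t * (2 * dot g e + t * dot e e)) Num.sqrt _ _ _ h (@sqrt_continuous R (dot g g)).
apply: cvg_trans; apply: near_eq_cvg; apply: nearW => t; rewrite /r /enorm; congr Num.sqrt.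
rewrite dotDl !dotDr !dotZl !dotZr [dot e g]dotC; ring.
Qed.

Lemma unit_normal_derivative i :
  t^-1 * (nt t 0 i - n 0 i) @[t --> (0 : R)^'] --> normal_der 0 i.
Proof.
(* The difference of the inverse lengths is written with the denominator
   [enorm g * r t * (enorm g + r t)], whose numerator [r t ^+ 2 - enorm g ^+ 2] is divisible by [t].
   No derivative of the square root is taken. *)
have h : e 0 i / r t - g 0 i * (2 * dot g e + t * dot e e) / (enorm g * r t * (enorm g + r t))
    @[t --> (0 : R)^'] --> normal_der 0 i.
  have nn : enorm g != 0 by rewrite gt_eqF.
  have -> : normal_der 0 i = e 0 i / enorm g - g 0 i * (2 * dot g e + 0 * dot e e) / (enorm g * enorm g * (enorm g + enorm g)).
    rewrite !mxE dotZr [dot e g]dotC.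
    rewrite mul0r addr0 (_ : enorm g + enorm g = 2 * enorm g); last by ring.
    by field.
  apply: cvgB; first by apply: cvgMr; exact: cvgV.
  apply: cvgM.
    by apply: cvgMr; apply: cvgD; [exact: cvg_cst|exact: cvgMl].
  apply: cvgV.
    by rewrite !mulf_neq0// gt_eqF// addr_gt0.
  by apply: cvgM; [exact: cvgMr|apply: cvgD => //; exact: cvg_cst].
apply: cvg_trans h; apply: near_eq_cvg.
have t0 : \forall t \near (0 : R)^', t != 0 by exact: nbhs_dnbhs_neq.
have nz : \forall t \near (0 : R)^', g + t *: e != 0.
  by apply: nbhs_dnbhs; exact: near_neq0.
apply: filterS2 t0 nz => t t0 nz.
have rp : 0 < r t by rewrite /r enorm_gt0.
have r2 : r t ^+ 2 = enorm g ^+ 2 + t * (2 * dot g e + t * dot e e).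
  rewrite /r !enorm_sqr dotDl !dotDr !dotZl !dotZr [dot e g]dotC; ring.
have -> : 2 * dot g e + t * dot e e = (r t ^+ 2 - enorm g ^+ 2) / t by rewrite r2; field.
rewrite !mxE -/(r t); field.
by rewrite t0 !gt_eqF// addr_gt0.
Qed.

(** The products of components are what enters [psi], since the normal occurs there
    quadratically. *)
Lemma unit_normal_prod_derivative i j :
  t^-1 * (nt t 0 i * nt t 0 j - n 0 i * n 0 j) @[t --> (0 : R)^'] -->
  normal_der 0 i * n 0 j + n 0 i * normal_der 0 j.
Proof.
have dj := @unit_normal_derivative j; have di := @unit_normal_derivative i.
have t0 : \forall t \near (0 : R)^', t != 0 by exact: nbhs_dnbhs_neq.
have c : nt t 0 j @[t --> (0 : R)^'] --> n 0 j.
  have -> : n 0 j = n 0 j + 0 * normal_der 0 j by rewrite mul0r addr0.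
  have := cvgD (@cvg_cst _ (n 0 j) _ (0 : R)^' _) (cvgM id_cvg dj) => /(_ (dnbhs_filter _) (dnbhs_filter _) (dnbhs_filter _)).
  apply: cvg_trans; apply: near_eq_cvg; apply: filterS t0 => t t0.
  change (n 0 j + t * (t^-1 * (nt t 0 j - n 0 j)) = nt t 0 j).
  by rewrite mulVKf// addrC subrK.
have dj' := @cvgMr _ _ _ (dnbhs_filter (0 : R)) _ (n 0 i) _ dj.
have := cvgD (cvgM di c) dj' => /(_ (dnbhs_filter _) (dnbhs_filter _)).
apply: cvg_trans; apply: near_eq_cvg; apply: nearW => t.
change (t^-1 * (nt t 0 i - n 0 i) * nt t 0 j + n 0 i * (t^-1 * (nt t 0 j - n 0 j)) =
   t^-1 * (nt t 0 i * nt t 0 j - n 0 i * n 0 j)).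
ring.
Qed.

End unit_normal.

Lemma sum3_product_rule (R : realType) (u v : 'rV[R]_3) (f g : 'I_3 -> R[i]) :
  (\sum_i (u 0 i)%:C * f i) * (\sum_i (v 0 i)%:C * g i) +
  (\sum_i (v 0 i)%:C * f i) * (\sum_i (u 0 i)%:C * g i) =
  \sum_i \sum_j (u 0 i * v 0 j + v 0 i * u 0 j)%:C * (f i * g j).
Proof.
rewrite !mulr_suml -big_split; apply: eq_bigr => i _ /=.
rewrite !mulr_sumr -big_split; apply: eq_bigr => j _ /=.
by rewrite rmorphD !rmorphM /=; ring.
Qed.

Section ceval_forms.
Variable R : realType.
Implicit Types (x v : 'rV[R]_3) (q p : mpoly 3 R[i]).

Lemma ceval_sum3 (F : 'I_3 -> mpoly 3 R[i]) x :
  ceval (\sum_(i < 3) F i) x = \sum_(i < 3) ceval (F i) x.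
Proof. by rewrite !sum3 cevalD cevalD. Qed.

Lemma ceval_dirder v p x : ceval (dirder v p) x = \sum_(i < 3) (v 0 i)%:C * ceval (mderiv i p) x.
Proof. by rewrite ceval_sum3; apply: eq_bigr => i _; rewrite cevalZ. Qed.

Lemma ceval_graddot q p x :
  ceval (graddot q p) x = \sum_(i < 3) ceval (mderiv i q) x * ceval (mderiv i p) x.
Proof. by rewrite ceval_sum3; apply: eq_bigr => i _; rewrite cevalM. Qed.

Lemma ceval_psi (c : coefs R) v q p x :
  ceval (psi c v q p) x =
  (delta_T c * wavenumber c ^+ 2)%:C * (('i%C - 1) * (heat_ratio c - 1)%:C / 2%:R)
    * (ceval q x * ceval p x)
  + (delta_V c)%:C * (('i%C - 1) / 2%:R)
    * (ceval (graddot q p) x - ceval (dirder v q) x * ceval (dirder v p) x).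
Proof. by rewrite /psi cevalD cevalZ cevalZ cevalB cevalM cevalM. Qed.

End ceval_forms.

(** * The wall term with a varying normal *)

Section wall_element.
Variables (R : realType) (M : nat) (G : geometry R M) (K : {set 'I_M}) (b : 'I_M -> R * 'rV[R]_3).
Hypotheses (K4 : #|K| = 4%N) (bK : barycentric G K b).
Variables (a e : R * 'rV[R]_3) (c : coefs R) (q p : mpoly 3 R[i]).
Hypothesis av : forall i, i \in K -> affr a (vtx G i) != 0.
Let n := (enorm a.2)^-1 *: a.2.
Let nt t := (enorm (a.2 + t *: e.2))^-1 *: (a.2 + t *: e.2).
Let Kt t := simplex G K `&` [set x | affr a x + t * affr e x = 0].
Let K0 := simplex G K `&` [set x | affr a x = 0].
Let n' := normal_der a.2 e.2.
Let beta : R[i] := (delta_V c)%:C * (('i%C - 1) / 2%:R).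
Let Q i j := mderiv i q * mderiv j p.

Let Kt0 : Kt 0 = K0.
Proof. by rewrite /Kt /K0; congr (_ `&` _); apply/funext => x /=; rewrite mul0r addr0. Qed.

Lemma flat_level (a' : R * 'rV[R]_3) : a'.2 != 0 -> flat (simplex G K `&` [set x | affr a' x = 0]).
Proof.
move=> a0; split.
- apply: mset3I; first exact: (mset3_simplex bK).
  by apply: mset3_eq0; exact: mfun3_affr.
- have [rho _ rhoP] := simplex_bounded bK.
  by exists rho => X [/rhoP].
- by apply: planarS (planar_affr a0) => x [].
Qed.

Let flat_Kt : a.2 != 0 -> \forall t \near (0 : R), flat (Kt t).
Proof.
move=> /(near_neq0 e.2); apply: filterS => t nt0; rewrite /Kt.
rewrite (_ : [set x | _] = [set x | affr (a.1 + t * e.1, a.2 + t *: e.2) x = 0]).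
  exact: flat_level.
by apply/funext => x /=; rewrite affr_pert.
Qed.

(** Both normal derivatives are linear in the normal, so a change of normal is a combination of the
    fixed polynomials [Q i j] with coefficients constant in [x]. This separates the motion of the
    normal from that of the wall. *)
Lemma ceval_psi_normal (m m' : 'rV[R]_3) x :
  ceval (psi c m q p) x = ceval (psi c m' q p) x +
    \sum_(i < 3) \sum_(j < 3) (m 0 i * m 0 j - m' 0 i * m' 0 j)%:C * (- beta * ceval (Q i j) x).
Proof.
have sq (u : 'rV[R]_3) : ceval (dirder u q) x * ceval (dirder u p) x =
    \sum_(i < 3) \sum_(j < 3) (u 0 i * u 0 j)%:C * ceval (Q i j) x.
  rewrite (ceval_dirder u q) (ceval_dirder u p) mulr_suml; apply: eq_bigr => i _.
  rewrite mulr_sumr; apply: eq_bigr => j _.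
  by rewrite cevalM rmorphM /= mulrACA.
have E : \sum_(i < 3) \sum_(j < 3) (m 0 i * m 0 j - m' 0 i * m' 0 j)%:C * (- beta * ceval (Q i j) x) =
   beta * (ceval (dirder m' q) x * ceval (dirder m' p) x - ceval (dirder m q) x * ceval (dirder m p) x).
  rewrite !sq -sumrB mulr_sumr; apply: eq_bigr => i _; rewrite -sumrB mulr_sumr; apply: eq_bigr => j _.
  by rewrite -mulrBl -rmorphB mulNr mulrN -mulNr -rmorphN opprB mulrCA.
pose A : R[i] := (delta_T c * wavenumber c ^+ 2)%:C * (('i%C - 1) * (heat_ratio c - 1)%:C / 2%:R)
    * (ceval q x * ceval p x).
have h (u : 'rV[R]_3) : ceval (psi c u q p) x = A + beta * (ceval (graddot q p) x - ceval (dirder u q) x * ceval (dirder u p) x).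
  exact: ceval_psi.
apply: etrans (h m) _; apply: etrans _ (esym (congr2 (@GRing.add _) (h m') E)); clear.
move: (ceval _ x) (ceval _ x * _) (ceval _ x * _) => X Y Z.
by rewrite -addrA -mulrDr addrA subrK.
Qed.

(** With the normal frozen, [cdiff_surf] applies. The correction is a finite sum of coefficients
    that vanish at 0 times wall integrals of fixed polynomials. *)
Lemma cdiff_wall :
  cdiff (fun t => surf_int (Kt t) (ceval (psi c (nt t) q p)))
    (- (surf_int K0 (fun x => ceval (dirder n (psi c n q p)) x * (affr e x / enorm a.2)%:C) +
        \sum_(k in K) line_int (simplex G (K :\ k) `&` [set x | affr a x = 0])
          (fun x => ceval (psi c n q p) x * (edge_weight b a k * (affr e x / enorm a.2))%:C))
     - beta * surf_int K0 (fun x => ceval (dirder n' q) x * ceval (dirder n p) x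
                                  + ceval (dirder n q) x * ceval (dirder n' p) x)).
Proof.
have C1 := @cdiff_surf R M G K b K4 bK a e av (psi c n q p).
have [a0|a0] := eqVneq a.2 0.
  have K00 : K0 = set0.
    apply/seteqP; split => x //= -[_]; have : (0 < #|K|)%N by rewrite K4.
    case/card_gt0P => i iK /=; have := av iK; rewrite /affr a0 !dot0l !addr0 => /eqP //.
  rewrite {1}/K0 -/K0 [in X in _ - X]K00 surf_int_set0 mulr0 subr0.
  apply: (cdiff_near C1).
    have z f : surf_int (Kt 0) f = 0 by rewrite Kt0 K00 surf_int_set0.
    exact: etrans (z _) (esym (z _)).
  apply: nbhs_dnbhs; have := @uncut_near R M G K b K4 bK a e av a0; apply: filterS => t [_ h].
  have z f : surf_int (Kt t) f = 0 by rewrite /Kt h surf_int_set0.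
  exact: etrans (z _) (esym (z _)).
have N0 i j : (nt 0 0 i * nt 0 0 j - n 0 i * n 0 j)%:C = 0 :> R[i].
  by rewrite /nt scale0r addr0 subrr.
have C2 i j : cdiff (fun t => (nt t 0 i * nt t 0 j - n 0 i * n 0 j)%:C) (n' 0 i * n 0 j + n 0 i * n' 0 j)%:C.
  apply: (cdiff_of (cvg_real_complex _ (@unit_normal_prod_derivative R a.2 e.2 a0 i j))).
  by apply: nearW => t; rewrite N0 subr0 -fmorphV -rmorphM /= mulrC.
have C3 i j := cdiffZ (c := - beta) (@cdiff_surf R M G K b K4 bK a e av (Q i j)).
(* Only the integrals over the unperturbed wall appear in these derivatives, since the coefficients
   are 0 at the start. *)
have C4 i j := cdiffM0 (N0 i j) (C2 i j) (C3 i j).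
have C5 : cdiff (fun t => surf_int (Kt t) (ceval (psi c n q p)) +
    \sum_(i < 3) \sum_(j < 3) (nt t 0 i * nt t 0 j - n 0 i * n 0 j)%:C * (- beta * surf_int (Kt t) (ceval (Q i j))))
   (- (surf_int K0 (fun x => ceval (dirder n (psi c n q p)) x * (affr e x / enorm a.2)%:C) +
        \sum_(k in K) line_int (simplex G (K :\ k) `&` [set x | affr a x = 0])
          (fun x => ceval (psi c n q p) x * (edge_weight b a k * (affr e x / enorm a.2))%:C)) +
    \sum_(i < 3) \sum_(j < 3) (n' 0 i * n 0 j + n 0 i * n' 0 j)%:C * (- beta * surf_int (Kt 0) (ceval (Q i j)))).
  by apply: cdiffD C1 _; apply: cdiff_sum => i _; apply: cdiff_sum => j _; exact: C4.
have fK0 : flat K0 by exact: flat_level.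
rewrite -[X in cdiff _ (_ + X)]mulNr.
have -> : - beta * surf_int K0 (fun x => ceval (dirder n' q) x * ceval (dirder n p) x
                                  + ceval (dirder n q) x * ceval (dirder n' p) x) =
   \sum_(i < 3) \sum_(j < 3) (n' 0 i * n 0 j + n 0 i * n' 0 j)%:C * (- beta * surf_int K0 (ceval (Q i j))).
  have E : (fun x => ceval (dirder n' q) x * ceval (dirder n p) x + ceval (dirder n q) x * ceval (dirder n' p) x) =
     (fun x => \sum_(i < 3) \sum_(j < 3) (n' 0 i * n 0 j + n 0 i * n' 0 j)%:C * ceval (Q i j) x).
    apply/funext => x.
    have cd (u : 'rV[R]_3) P := ceval_dirder u P x.
    apply: etrans (congr2 (@GRing.add _) (congr2 (@GRing.mul _) (cd n' q) (cd n p))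
      (congr2 (@GRing.mul _) (cd n q) (cd n' p))) _.
    apply: etrans (@sum3_product_rule _ _ _ _ _) _.
    by apply: eq_bigr => i _; apply: eq_bigr => j _; rewrite cevalM.
  have nQ i j : nice (fun x => (n' 0 i * n 0 j + n 0 i * n' 0 j)%:C * ceval (Q i j) x).
    by apply: niceM; [exact: nice_cst|exact: nice_ceval].
  rewrite E surf_int_sum//; last by move=> i _; apply: nice_sum => j _.
  rewrite mulr_sumr; apply: eq_bigr => i _; rewrite surf_int_sum// mulr_sumr; apply: eq_bigr => j _.
  by rewrite surf_intZ//; [rewrite mulrCA|exact: nice_ceval].
have key t : flat (Kt t) -> surf_int (Kt t) (ceval (psi c (nt t) q p)) =
    surf_int (Kt t) (ceval (psi c n q p)) +
    \sum_(i < 3) \sum_(j < 3) (nt t 0 i * nt t 0 j - n 0 i * n 0 j)%:C * (- beta * surf_int (Kt t) (ceval (Q i j))).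
  move=> ft.
  have nQ i j : nice (fun x => (nt t 0 i * nt t 0 j - n 0 i * n 0 j)%:C * (- beta * ceval (Q i j) x)).
    by apply: niceM; [exact: nice_cst|apply: niceM; [exact: nice_cst|exact: nice_ceval]].
  transitivity (surf_int (Kt t) (fun x => ceval (psi c n q p) x +
     \sum_(i < 3) \sum_(j < 3) (nt t 0 i * nt t 0 j - n 0 i * n 0 j)%:C * (- beta * ceval (Q i j) x))).
    by congr (surf_int _ _); apply/funext => x; exact: ceval_psi_normal.
  rewrite surf_intD//; [|exact: nice_ceval|by apply: nice_sum => i _; apply: nice_sum].
  congr (_ + _); rewrite surf_int_sum//; last by move=> i _; apply: nice_sum.
  apply: eq_bigr => i _; rewrite surf_int_sum//; apply: eq_bigr => j _.
  rewrite surf_intZ//; last by apply: niceM; [exact: nice_cst|exact: nice_ceval].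
  by rewrite surf_intZ//; exact: nice_ceval.
rewrite Kt0 in C5; apply: (cdiff_near C5).
  by rewrite [RHS]key// Kt0.
apply: nbhs_dnbhs; have := flat_Kt a0; apply: filterS => t ft.
exact: esym (key t ft).
Qed.

End wall_element.

(** * Normals on the faces of a cut element *)

Section unit_unique.
Variable R : realType.
Implicit Types u v q z x g l : 'rV[R]_3.

(* Up to sign there is only one unit vector orthogonal to two orthogonal directions. *)
Lemma unit_unique u v q z x : u != 0 -> v != 0 -> dot u v = 0 ->
  dot u q = 0 -> dot v q = 0 -> enorm z = 1 -> dot u z = 0 -> dot v z = 0 ->
  dot q x < 0 -> dot z x <= 0 -> z = (enorm q)^-1 *: q.
Proof.
move=> u0 v0 uv uq vq z1 uz vz qx zx.
have q0 : q != 0 by apply/negP => /eqP h; move: qx; rewrite h dot0l ltxx.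
have := orthonormal_decomp z (enorm_normalize u0) (enorm_normalize v0) (enorm_normalize q0).
rewrite !dotZl !dotZr uv uq vq uz vz !mulr0 => /(_ erefl erefl erefl).
rewrite !scale0r !add0r; set k := _ * _; rewrite scalerA => zE.
have eq0 : 0 < enorm q by rewrite enorm_gt0.
have k0 : 0 <= k.
  rewrite leNgt; apply/negP => kn; move: zx; rewrite zE dotZl leNgt => /negP; apply.
  by rewrite nmulr_lgt0// pmulr_llt0 ?invr_gt0.
have := z1; rewrite zE enormZ normrM normfV (ger0_norm k0) (gtr0_norm eq0) mulfVK ?gt_eqF// => k1.
by rewrite k1 mul1r.
Qed.

(** [q] is [g] projected to the plane of the face with normal [l], and [tau] is [l] projected to the
    wall. As [dot q g = dot q q] and [dot q tau] is [- (dot g l / dot g g) * dot q q], the length of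
    [q] cancels, leaving the cotangent of the angle between wall and face over [enorm g]. *)
Lemma conormal_identity g l : g != 0 -> l != 0 ->
  let n := (enorm g)^-1 *: g in
  let q := g - (dot g l / dot l l) *: l in
  let tau := l - dot l n *: n in
  q != 0 -> tau != 0 ->
  dot ((enorm q)^-1 *: q) ((enorm (- tau))^-1 *: - tau) / `|dot ((enorm q)^-1 *: q) g|
  = dot l n / enorm tau / enorm g.
Proof.
move=> g0 l0 n q tau q0 t0.
have eg : enorm g != 0 by rewrite gt_eqF// enorm_gt0.
have et : enorm tau != 0 by rewrite gt_eqF// enorm_gt0.
have eq : enorm q != 0 by rewrite gt_eqF// enorm_gt0.
have ll : dot l l != 0 by rewrite dot_eq0.
have gg : dot g g != 0 by rewrite dot_eq0.
have qq : dot q q = dot g g - dot g l ^+ 2 / dot l l.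
  by rewrite /q !dotBl !dotBr !dotZl !dotZr [dot l g]dotC; field.
have qg : dot q g = dot q q by rewrite qq /q dotBl dotZl [dot l g]dotC; field.
have qt : dot q tau = - (dot g l / dot g g) * dot q q.
  rewrite qq /q /tau /n !dotBl !dotBr !dotZl !dotZr [dot l g]dotC -!enorm_sqr; field.
  by rewrite eg gt_eqF// enorm_gt0.
have ent : enorm (- tau) = enorm tau by rewrite /enorm dotNl dotNr opprK.
rewrite !dotZl dotZr dotNr qg qt ent -enorm_sqr normrM normfV !ger0_norm ?sqr_ge0 ?enorm_ge0 ?dot_ge0//.
by rewrite dotZr [dot l g]dotC -enorm_sqr; field; rewrite eq et eg.
Qed.

End unit_unique.

Section level_segment.
Variables (R : realType) (M : nat) (G : geometry R M) (K : {set 'I_M}) (b : 'I_M -> R * 'rV[R]_3).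
Hypotheses (K4 : #|K| = 4%N) (bK : barycentric G K b).
Variable a : R * 'rV[R]_3.
Hypothesis av : forall i, i \in K -> affr a (vtx G i) != 0.
Implicit Types i j k m : 'I_M.
Let lam i x := affr (b i) x.

(** Linear interpolation between the two vertices. The zero lies in the open edge, so exactly the
    coordinates of its endpoints are positive there. *)
Lemma zero_between i j : i \in K -> j \in K -> i != j ->
  affr a (vtx G i) * affr a (vtx G j) < 0 ->
  exists Z, [/\ simplex G K Z, affr a Z = 0, 0 < lam i Z, 0 < lam j Z &
    forall m, m \in K -> m != i -> m != j -> lam m Z = 0].
Proof.
move=> iK jK ij; set fi := affr a _; set fj := affr a _ => fij.
have d0 : fi - fj != 0.
  by apply/negP => /eqP /subr0_eq h; move: fij; rewrite h -expr2 ltNge sqr_ge0.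
pose s := fi / (fi - fj); pose t := - fj / (fi - fj).
have st : t + s = 1 by rewrite /s /t; field.
have s0 : 0 < s by rewrite (_ : s = fi * (fi - fj) / (fi - fj) ^+ 2) ?divr_gt0 ?exprn_even_gt0//; [nra|rewrite /s; field].
have t0 : 0 < t by rewrite (_ : t = - fj * (fi - fj) / (fi - fj) ^+ 2) ?divr_gt0 ?exprn_even_gt0//; [nra|rewrite /t; field].
pose Z := t *: vtx G i + s *: vtx G j.
have lZ m : lam m Z = t * lam m (vtx G i) + s * lam m (vtx G j) by exact: affr_conv.
have li : lam i Z = t by rewrite lZ /lam !(bary_vtx bK)// eqxx (negPf ij) mulr0 addr0 mulr1.
have lj : lam j Z = s by rewrite lZ /lam !(bary_vtx bK)// eqxx eq_sym (negPf ij) mulr0 add0r mulr1.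
have lm m : m \in K -> m != i -> m != j -> lam m Z = 0.
  by move=> mK mi mj; rewrite lZ /lam !(bary_vtx bK)// (negPf mi) (negPf mj) !mulr0 addr0.
exists Z; split => //; rewrite ?li ?lj//.
- apply/(simplexP bK) => m mK; have [->|mi] := eqVneq m i; first by rewrite -/(lam i Z) li ltW.
  have [->|mj] := eqVneq m j; first by rewrite -/(lam j Z) lj ltW.
  by rewrite -/(lam m Z) lm.
- by rewrite affr_conv// -/fi -/fj /s /t; field.
Qed.

(** A convex combination of nonzero numbers of one sign is not 0, so a face met by the wall has
    vertices of both signs. *)
Lemma side_opposite_signs k x : k \in K -> simplex G (K :\ k) x -> affr a x = 0 ->
  exists i j, [/\ i \in K :\ k, j \in K :\ k, affr a (vtx G i) < 0 & 0 < affr a (vtx G j)].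
Proof.
move=> kK xS ax; apply: contrapT => h.
have [h1 h2] := (simplex_baryP bK x (subD1set K k)).1 xS.
have E : \sum_(i in K :\ k) lam i x * affr a (vtx G i) = 0.
  rewrite -[RHS]ax (affr_bary bK a x) (big_setD1 k kK) /= (h2 k kK) ?mul0r ?add0r//.
  by rewrite !inE eqxx.
have E1 : \sum_(i in K :\ k) lam i x = 1.
  rewrite -(bary_sum1 bK x) (big_setD1 k kK) /= (h2 k kK) ?add0r//.
  by rewrite !inE eqxx.
have sgn (s : R) : s = 1 \/ s = -1 -> (forall i, i \in K :\ k -> 0 < s * affr a (vtx G i)) -> False.
  move=> s1 hs.
  have E' : \sum_(i in K :\ k) lam i x * (s * affr a (vtx G i)) = 0.
    have -> : \sum_(i in K :\ k) lam i x * (s * affr a (vtx G i)) = s * \sum_(i in K :\ k) lam i x * affr a (vtx G i).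
      by rewrite mulr_sumr; apply: eq_bigr => i _; rewrite mulrCA.
    by rewrite E mulr0.
  have pos i : i \in K :\ k -> 0 <= lam i x * (s * affr a (vtx G i)).
    by move=> iS; rewrite mulr_ge0 ?h1// ltW// hs.
  have /psumr_eq0P z := E'; move: E1; rewrite big1 => [/eqP|i iS]; first by rewrite eq_sym oner_eq0.
  have /eqP := z pos i iS; rewrite mulf_eq0 (gt_eqF (hs i iS)) orbF => /eqP //.
have nz i : i \in K :\ k -> affr a (vtx G i) != 0 by rewrite !inE => /andP[_ /av].
case: (pselect (exists i, i \in K :\ k /\ affr a (vtx G i) < 0)) => [[i [iS ai]]|hn].
  case: (pselect (exists j, j \in K :\ k /\ 0 < affr a (vtx G j))) => [[j [jS aj]]|hp].
    by apply: h; exists i, j.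
  apply: (sgn (-1)); first by right.
  move=> j jS; rewrite mulN1r oppr_gt0 lt_neqAle nz// leNgt; apply/negP => aj.
  by apply: hp; exists j.
apply: (sgn 1); first by left.
move=> j jS; rewrite mul1r lt_neqAle eq_sym nz// leNgt; apply/negP => aj.
by apply: hn; exists j.
Qed.

Section side.
Variables (k : 'I_M) (x0 : 'rV[R]_3).
Hypotheses (kK : k \in K) (x0S : simplex G (K :\ k) x0) (ax0 : affr a x0 = 0).
Let S := K :\ k.
Let l := (b k).2.
Let g := a.2.
Let n := (enorm g)^-1 *: g.
Let q := g - (dot g l / dot l l) *: l.
Let tau := l - dot l n *: n.

Let sideP x : simplex G S x <-> simplex G K x /\ lam k x = 0.
Proof.
split.
  move=> /(simplex_baryP bK _ (subD1set K k)) [h1 h2]; split.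
    apply/(simplexP bK) => i iK; have [->|ik] := eqVneq i k; first by rewrite h2// !inE eqxx.
    by apply: h1; rewrite !inE ik.
  by apply: h2 => //; rewrite !inE eqxx.
move=> [/(simplexP bK) h1 h2].
apply/(simplex_baryP bK _ (subD1set K k)); split => i; first by rewrite !inE => /andP[_ /h1].
by move=> iK; rewrite !inE iK andbT negbK => /eqP ->.
Qed.

Let vtxS i : i \in S -> simplex G S (vtx G i).
Proof.
rewrite !inE => /andP[ik iK]; apply/sideP; split.
  by apply/(simplexP bK) => j jK; rewrite (bary_vtx bK)// ler0n.
by rewrite /lam (bary_vtx bK)// eq_sym (negPf ik).
Qed.

(** The data that make the normals of the segment unique: a nonzero direction [D] of the segment, a
    wall point [y] off the face to orient the conormal, and a vertex [v] of the face inside the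
    domain to orient the normal in the face. *)
Let segment_facts : exists D y v,
  [/\ D != 0, dot l D = 0, dot g D = 0,
      (exists x x', [/\ simplex G S x, simplex G S x', affr a x = 0, affr a x' = 0 & D = x - x']) &
      [/\ simplex G K y, affr a y = 0, 0 < lam k y, simplex G S v & affr a v < 0]].
Proof.
have [i [j [iS jS ai aj]]] := side_opposite_signs kK x0S ax0.
have ij : i != j by apply/eqP => h; move: ai; rewrite h => /lt_gtF; rewrite aj.
have iK : i \in K by move: iS; rewrite !inE => /andP[].
have jK : j \in K by move: jS; rewrite !inE => /andP[].
have ki : k != i by move: iS; rewrite !inE eq_sym => /andP[].
have kj : k != j by move: jS; rewrite !inE eq_sym => /andP[].
have fij : affr a (vtx G i) * affr a (vtx G j) < 0 by rewrite nmulr_rlt0.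
have [Z [ZK aZ iZ jZ oZ]] := zero_between iK jK ij fij.
have ZS : simplex G S Z by apply/sideP; split => //; exact: oZ.
have : #|K :\ k :\ i :\ j| = 1%N.
  have := K4; rewrite (cardsD1 k) kK (cardsD1 i) !inE iK eq_sym ki /=.
  have ji : j != i by rewrite eq_sym.
  have jk : j != k by rewrite eq_sym.
  by rewrite (cardsD1 j) !inE jK ji jk /= => -[].
move=> cm; have /card_gt0P[m] : (0 < #|K :\ k :\ i :\ j|)%N by rewrite cm.
rewrite !inE => /and4P[mj mi mk mK].
have nm r := zero_between mK (j := r).
(* The third vertex [m] of the face has the sign opposite to one of [i] and [j]. The zero on that
   edge has a positive [m]-coordinate, unlike [Z], so the segment does not degenerate to a point. *)
have [Z' [Z'S aZ' mZ']] : exists Z', [/\ simplex G S Z', affr a Z' = 0 & 0 < lam m Z'].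
  have other r : r \in S -> m != r -> affr a (vtx G m) * affr a (vtx G r) < 0 ->
      exists Z', [/\ simplex G S Z', affr a Z' = 0 & 0 < lam m Z'].
    rewrite !inE => /andP[rk rK] mr h; have [Z' [h1 h2 h3 h4 h5]] := zero_between mK rK mr h.
    by exists Z'; split => //; apply/sideP; split => //; rewrite h5// eq_sym.
  have [am|am] := ltP (affr a (vtx G m)) 0.
    by apply: (other j) => //; rewrite nmulr_rlt0.
  have am' : 0 < affr a (vtx G m) by rewrite lt_neqAle eq_sym av.
  by apply: (other i) => //; rewrite pmulr_rlt0.
have [y [yK ay ky]] : exists y, [/\ simplex G K y, affr a y = 0 & 0 < lam k y].
  have [ak|ak] := ltP (affr a (vtx G k)) 0.
    have akj : affr a (vtx G k) * affr a (vtx G j) < 0 by rewrite nmulr_rlt0.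
    by have [y [h1 h2 h3 _ _]] := zero_between kK jK kj akj; exists y.
  have ak' : 0 < affr a (vtx G k) by rewrite lt_neqAle eq_sym av.
  have aki : affr a (vtx G k) * affr a (vtx G i) < 0 by rewrite pmulr_rlt0.
  by have [y [h1 h2 h3 _ _]] := zero_between kK iK ki aki; exists y.
exists (Z' - Z), y, (vtx G i); split.
- apply/negP => /eqP /subr0_eq h; by move: mZ'; rewrite h (oZ m mK mi mj) ltxx.
- have [_ h1] := (sideP _).1 ZS; have [_ h2] := (sideP _).1 Z'S.
  by move: h1 h2; rewrite /lam /affr dotBr -/l; lra.
- by move: aZ aZ'; rewrite /affr dotBr -/g; lra.
- by exists Z', Z.
- by split => //; exact: vtxS.
Qed.

Let l_ne0 : l != 0.
Proof.
apply/eqP => l0; have := bary_vtx bK kK kK; have [i [j [iS _ _ _]]] := side_opposite_signs kK x0S ax0.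
move: iS; rewrite !inE => /andP[ik iK]; have := bary_vtx bK kK iK.
rewrite /affr -/l l0 !dot0l !addr0 eqxx eq_sym (negPf ik) => -> /eqP.
by rewrite eq_sym oner_eq0.
Qed.

Lemma level_grad_neq0 : g != 0.
Proof.
apply/eqP => g0'; have [D [y [v [_ _ _ _ [_ ay _ _ av']]]]] := segment_facts.
by move: ay av'; rewrite /affr -/g g0' !dot0l => ->; rewrite ltxx.
Qed.

Let lx x : simplex G S x -> lam k x = 0. Proof. by case/sideP. Qed.

Let dot_q x y : simplex G S x -> simplex G S y -> dot q (y - x) = affr a y - affr a x.
Proof.
move=> /lx hx /lx hy; rewrite /q dotBl dotZl.
have -> : dot l (y - x) = 0 by move: hx hy; rewrite /lam /affr dotBr -/l; lra.
by rewrite mulr0 subr0 /affr dotBr -/g; ring.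
Qed.

Let dot_tau x y : affr a x = 0 -> affr a y = 0 -> dot tau (y - x) = lam k y - lam k x.
Proof.
move=> hx hy; rewrite /tau dotBl dotZl /n dotZl.
have -> : dot g (y - x) = 0 by move: hx hy; rewrite /affr dotBr -/g; lra.
by rewrite !mulr0 subr0 /lam /affr dotBr -/l; ring.
Qed.

Let q_ne0 : q != 0.
Proof.
have [D [y [v [_ _ _ [x [_ [xS _ ax _ _]]] [_ _ _ vS av']]]]] := segment_facts.
by apply/eqP => h; have := dot_q xS vS; rewrite h dot0l ax subr0 => h'; move: av'; rewrite -h' ltxx.
Qed.

Let tau_ne0 : tau != 0.
Proof.
have [D [y [v [_ _ _ [x [_ [xS _ ax _ _]]] [yK ay ky _ _]]]]] := segment_facts.
by apply/eqP => h; have := dot_tau ax ay; rewrite h dot0l (lx xS) subr0 => h'; move: ky; rewrite -h' ltxx.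
Qed.

(** In the plane of the face, a unit vector orthogonal to the segment is determined up to sign, and
    the vertex [v] inside the domain fixes the sign. *)
Lemma side_normal_unique z :
  enorm z = 1 ->
  (exists c : 'I_M -> R, [/\ forall i, i \notin S -> c i = 0, \sum_i c i = 0 & z = \sum_i c i *: vtx G i]) ->
  (forall x y, simplex G S x -> affr a x = 0 -> simplex G S y -> affr a y = 0 -> dot z (x - y) = 0) ->
  (forall x y, simplex G S x -> affr a x = 0 -> simplex G S y -> affr a y < 0 -> dot z (y - x) <= 0) ->
  z = (enorm q)^-1 *: q.
Proof.
move=> z1 [c [c0 c1 zE]] z2 z3.
have [D [y [v [D0 lD gD [x [x' [xS x'S ax ax' DE]]] [yK ay ky vS av']]]]] := segment_facts.
have lq : dot l q = 0.
  by rewrite /q dotBr dotZr [dot g l]dotC divfK ?subrr// dot_eq0 l_ne0.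
have Dq : dot D q = 0 by rewrite /q dotBr dotZr dotC gD [dot D l]dotC lD mulr0 subrr.
apply: (unit_unique l_ne0 D0 lD lq Dq z1 _ _ (x := v - x)).
(* Coordinate [k] vanishes at the vertices of the face, so a combination of them with coefficients
   of sum 0 is orthogonal to its gradient [l]. *)
- have -> : dot l z = \sum_i c i * (affr (b k) (vtx G i) - (b k).1).
    rewrite zE; elim/big_rec2: _ => [|i y1 y2 _ <-]; first by rewrite dot0r.
    by rewrite dotDr dotZr /affr -/l; ring.
  rewrite (eq_bigr (fun i => - (b k).1 * c i)); first by rewrite -mulr_sumr c1 mulr0.
  move=> i _; have [iS|iS] := boolP (i \in S); last by rewrite c0// mul0r mulr0.
  by rewrite -/(lam k _) lx ?sub0r 1?mulrC//; exact: vtxS.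
- by rewrite DE dotC z2.
- by rewrite dot_q// ax subr0.
- by apply: z3.
Qed.

(** Existence ensures that the choice in [seg_normal] does not fall back on its default 0. *)
Lemma side_normal_exists :
  [/\ enorm ((enorm q)^-1 *: q) = 1,
  (exists c : 'I_M -> R, [/\ forall i, i \notin S -> c i = 0, \sum_i c i = 0 & (enorm q)^-1 *: q = \sum_i c i *: vtx G i]),
  (forall x y, simplex G S x -> affr a x = 0 -> simplex G S y -> affr a y = 0 -> dot ((enorm q)^-1 *: q) (x - y) = 0) &
  (forall x y, simplex G S x -> affr a x = 0 -> simplex G S y -> affr a y < 0 -> dot ((enorm q)^-1 *: q) (y - x) <= 0)].
Proof.
have q0 := q_ne0; split.
- exact: enorm_normalize.
- have lq : dot l q = 0.
    by rewrite /q dotBr dotZr [dot g l]dotC divfK ?subrr// dot_eq0 l_ne0.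
  have qE := bary_dir bK ((enorm q)^-1 *: q).
  exists (fun i => if i \in K then dot (b i).2 ((enorm q)^-1 *: q) else 0); split.
  + move=> i; rewrite !inE negb_and negbK; case: ifPn => // iK; rewrite orbF => /eqP ->.
    by rewrite dotZr lq mulr0.
  + rewrite -big_mkcond /=.
    have := bary_sum1 bK (0 + (enorm q)^-1 *: q).
    rewrite (eq_bigr (fun i => affr (b i) 0 + dot (b i).2 ((enorm q)^-1 *: q))); last by move=> i _; exact: affrD.
    by rewrite big_split /= (bary_sum1 bK) => h; move: h; lra.
  + rewrite {1}qE big_mkcond /=; apply: eq_bigr => i _; case: ifPn => // _; by rewrite scale0r.
- by move=> x y xS ax yS ay; rewrite dotZl dot_q// ax ay subrr mulr0.
- move=> x y xS ax yS ay; rewrite dotZl dot_q// ax subr0.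
  by rewrite mulr_ge0_le0 ?invr_ge0 ?enorm_ge0// ltW.
Qed.

(** As for the normal in the face, with the plane of the wall in its place and the wall point [y]
    off the face fixing the sign. *)
Lemma conormal_unique z : enorm z = 1 -> dot z n = 0 ->
  (forall x y, simplex G S x -> affr a x = 0 -> simplex G S y -> affr a y = 0 -> dot z (x - y) = 0) ->
  (forall x y, simplex G S x -> affr a x = 0 -> simplex G K y -> affr a y = 0 -> dot z (y - x) <= 0) ->
  z = (enorm (- tau))^-1 *: - tau.
Proof.
move=> z1 zn z2 z3.
have [D [y [v [D0 lD gD [x [x' [xS x'S ax ax' DE]]] [yK ay ky vS av']]]]] := segment_facts.
have nD : dot n D = 0 by rewrite dotZl gD mulr0.
have n1 : enorm n = 1 by apply: enorm_normalize; exact: level_grad_neq0.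
have n0 : n != 0 by rewrite -enorm_gt0 n1.
apply: (unit_unique n0 D0 nD _ _ z1 _ _ (x := y - x)).
- by rewrite dotNr /tau dotBr dotZr (enorm1 n1) mulr1 dotC subrr oppr0.
- by rewrite dotNr /tau dotBr dotZr [dot D l]dotC lD [dot D n]dotC nD mulr0 subrr oppr0.
- by rewrite dotC.
- by rewrite dotC DE z2.
- by rewrite dotNl dot_tau// (lx xS) subr0 oppr_lt0.
- exact: z3.
Qed.

Lemma conormal_exists :
  [/\ enorm ((enorm (- tau))^-1 *: - tau) = 1, dot ((enorm (- tau))^-1 *: - tau) n = 0,
  (forall x y, simplex G S x -> affr a x = 0 -> simplex G S y -> affr a y = 0 -> dot ((enorm (- tau))^-1 *: - tau) (x - y) = 0) &
  (forall x y, simplex G S x -> affr a x = 0 -> simplex G K y -> affr a y = 0 -> dot ((enorm (- tau))^-1 *: - tau) (y - x) <= 0)].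
Proof.
have t0 := tau_ne0.
have n1 : enorm n = 1 by apply: enorm_normalize; exact: level_grad_neq0.
split.
- by apply: enorm_normalize; rewrite oppr_eq0.
- by rewrite dotZl dotNl /tau dotBl dotZl (enorm1 n1) mulr1 subrr oppr0 mulr0.
- by move=> x y xS ax yS ay; rewrite dotZl dotNl dot_tau// !lx// subrr oppr0 mulr0.
- move=> x y xS ax yK ay; rewrite dotZl dotNl dot_tau// (lx xS) subr0.
  rewrite mulrN oppr_le0 mulr_ge0 ?invr_ge0 ?enorm_ge0//; exact: (simplexP bK _).1.
Qed.

Lemma edge_weight_identity :
  dot ((enorm q)^-1 *: q) ((enorm (- tau))^-1 *: - tau) / `|dot ((enorm q)^-1 *: q) g|
  = edge_weight b a k / enorm g.
Proof.
by rewrite (conormal_identity level_grad_neq0 l_ne0 q_ne0 tau_ne0).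
Qed.

End side.

End level_segment.

Section mset3_more.
Variable R : realType.
Implicit Types E : set 'rV[R]_3.

Lemma mset3C E : mset3 E -> mset3 (~` E).
Proof.
move=> mE; have := mfun3D (mfun3_cst (R := R) 1) (mfun3Z (-1) mE).
congr mfun3; apply/funext => x; rewrite in_setC; case: (x \in E) => /=; lra.
Qed.

Lemma mset3U E E' : mset3 E -> mset3 E' -> mset3 (E `|` E').
Proof.
by move=> mE mE'; rewrite -[E `|` E']setCK setCU; apply: mset3C; apply: mset3I; exact: mset3C.
Qed.

Lemma mset3_set0 : @mset3 R set0.
Proof. by have := mfun3_cst (R := R) 0; congr mfun3; apply/funext => x; rewrite in_set0. Qed.

Lemma mset3_exists (I : finType) (P : pred I) (E : I -> set 'rV[R]_3) :
  (forall i, P i -> mset3 (E i)) -> mset3 [set x | exists2 i, P i & E i x].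
Proof.
move=> mE.
have : forall s : seq I, mset3 [set x | exists2 i, (i \in s) && P i & E i x].
  elim=> [|i s IH].
    by rewrite (_ : [set x | _] = set0); [exact: mset3_set0|apply/seteqP; split => x //= -[]].
  have [Pi|Pi] := boolP (P i); last first.
    rewrite (_ : [set x | _] = [set x | exists2 i, (i \in s) && P i & E i x])//.
    apply/seteqP; split => x /= [j]; rewrite ?inE => /andP[jE Pj] jx; exists j => //.
      by move: jE => /predU1P[ji|->//]; move: Pi; rewrite -ji Pj.
    by rewrite inE jE Pj orbT.
  rewrite (_ : [set x | _] = E i `|` [set x | exists2 i, (i \in s) && P i & E i x]).
    by apply: mset3U => //; exact: mE.
  apply/seteqP; split => x /=.
    by move=> [j]; rewrite inE => /andP[/predU1P[-> _|js Pj]] jx; [left|right; exists j; rewrite ?js].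
  move=> [ix|[j /andP[js Pj] jx]]; [exists i|exists j] => //; rewrite inE ?eqxx//.
  by rewrite js Pj orbT.
move=> /(_ (enum I)); congr mset3; apply/seteqP; split => x /= [j].
  by rewrite mem_enum => Pj jx; exists j.
by move=> Pj jx; exists j => //; rewrite mem_enum.
Qed.

Lemma aff3_zero_negligible (a : R * R * R * R) : (exists y, aff3 a y != 0) ->
  (@leb3 R).-negligible [set y | aff3 a y = 0].
Proof.
move=> [y0 y0P].
have mZ : measurable ([set y | aff3 a y = 0] : set (measurableTypeR R * measurableTypeR R * measurableTypeR R)).
  rewrite (_ : [set y | _] = aff3 a @^-1` [set 0]); last by apply/seteqP; split.
  by rewrite -[_ @^-1` _]setTI; apply: (measurable_aff3 a) => //; exact: measurable_set1.
have [a2|a2] := eqVneq a.2 0; last first.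
  apply/negligibleP => //.
  pose Z : set (measurableTypeR R * measurableTypeR R * measurableTypeR R) := [set y | aff3 a y = 0].
  rewrite -[LHS]/(\int[@leb2 R]_x ((@lebesgue_measure R) \o xsection Z) x)%E.
  rewrite (eq_integral (cst 0%E)) ?integral0// => x _ /=.
  apply: countable_lebesgue_measure0.
  apply: (@sub_countable _ _ _ [set - (a.1.1.1 + a.1.1.2 * x.1 + a.1.2 * x.2) / a.2]); last exact: finite_set_countable.
  apply: subset_card_le => y; rewrite /xsection /= in_setE /Z /aff3 /= => h.
  by apply: (mulfI a2); rewrite mulrCA divff// mulr1; lra.
have ex2 : exists y, aff2 a.1 y != 0.
  by exists y0.1; move: y0P; rewrite /aff3 a2 mul0r addr0.
have [N [mN N0 NP]] := aff2_zero_negligible ex2.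
exists (N `*` (setT : set (measurableTypeR R))); split.
- exact: measurableX.
- transitivity (leb2 N * (@lebesgue_measure R) (setT : set (measurableTypeR R)))%E.
    by apply: (@product_measure1E _ _ (measurableTypeR R * measurableTypeR R)%type (measurableTypeR R) R (sleb2 R)).
  by rewrite N0 mul0e.
- move=> [y z] /=; rewrite /aff3 /= a2 mul0r addr0 => h; split => //=.
  exact: NP.
Qed.

End mset3_more.

(** * Interiors of the elements, and signs of an affine function on them *)

Section mesh.
Variables (R : realType) (M : nat) (G : geometry R M).
Hypothesis mesh_G : is_mesh G.
Implicit Types K L : {set 'I_M}.

Lemma card_elt K : K \in elts G -> #|K| = 4%N.
Proof. by case: mesh_G => _ _ h _ /h[]. Qed.

Lemma elt_barycentric K : K \in elts G -> exists b, barycentric G K b.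
Proof. by case: mesh_G => _ _ h _ /h[K4 ai]; exact: barycentric_exists. Qed.

Lemma vtx_simplex K i : i \in K -> simplex G K (vtx G i).
Proof.
move=> iK; exists (fun j => (j == i)%:R); split.
- by move=> j; rewrite ler0n.
- by move=> j jK; case: eqP => // ji; move: jK; rewrite ji iK.
- by rewrite (bigD1 i)//= eqxx big1 ?addr0// => j /negPf ->.
- by rewrite (bigD1 i)//= eqxx scale1r big1 ?addr0// => j /negPf ->; rewrite scale0r.
Qed.

(** A common point lies in the simplex of the common nodes, while all its coordinates in [K] are
    positive. Hence [K] is contained in [L], and both have four nodes. *)
Lemma interior_disjoint K L x : K \in elts G -> L \in elts G -> (simplex G K)° x ->
  simplex G L x -> K = L.
Proof.
move=> Ke Le xK xL; have [b bK] := elt_barycentric Ke.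
have lx := (interior_simplexP bK x).1 xK.
have : (simplex G K `&` simplex G L) x by split => //; exact: interior_subset.
have -> : simplex G K `&` simplex G L = simplex G (K :&: L) by case: mesh_G => _ _ _; exact.
move=> /(simplex_baryP bK _ (finset.subsetIl K L))[_ h].
have KL : K \subset L.
  apply/fintype.subsetP => i iK; apply/negPn/negP => iL.
  by have := lx i iK; rewrite h ?ltxx// inE iK.
by apply/eqP; rewrite eqEcard KL !card_elt.
Qed.

Lemma interior_elt K : K \in elts G -> exists x, (simplex G K)° x.
Proof.
move=> Ke; have [b bK] := elt_barycentric Ke.
exists (\sum_(i in K) (4%:R^-1 : R) *: vtx G i); apply/(interior_simplexP bK) => i iK.
rewrite affr_sum; last by rewrite sumr_const card_elt// -[LHS]mulr_natr mulVf// pnatr_eq0.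
rewrite (bigD1 i)//= (bary_vtx bK)// eqxx mulr1 big1 ?addr0 ?invr_gt0 ?ltr0n//.
by move=> j /andP[jK ji]; rewrite (bary_vtx bK)// eq_sym (negPf ji) mulr0.
Qed.

Section signs.
Variables (K : {set 'I_M}) (b : 'I_M -> R * 'rV[R]_3) (a : R * 'rV[R]_3).
Hypotheses (Ke : K \in elts G) (bK : barycentric G K b).
Hypothesis av : forall i, i \in K -> affr a (vtx G i) != 0.

Let toward_vertex (x : 'rV[R]_3) i (s : R) : (simplex G K)° x -> i \in K -> 0 < s <= 1 ->
  (simplex G K)° (s *: x + (1 - s) *: vtx G i).
Proof.
move=> /(interior_simplexP bK) xK iK /andP[s0 s1]; apply/(interior_simplexP bK) => j jK.
rewrite affr_conv; last by rewrite addrC subrK.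
by rewrite ltr_pwDl ?mulr_gt0 ?xK// mulr_ge0 ?subr_ge0// (bary_vtx bK)// ler0n.
Qed.

Let interior_sign i : i \in K -> exists x, (simplex G K)° x /\ 0 < affr a x * affr a (vtx G i).
Proof.
move=> iK; have [x xK] := interior_elt Ke.
pose f := affr a x; pose g := affr a (vtx G i).
have g2 : 0 < g * g by rewrite -expr2 exprn_even_gt0 //= av.
(* At the point [s *: x + (1 - s) *: vtx G i] the product of [affr a] with [g] is at least
   [g * g - s * (g * g + |f * g|)], which for this [s] equals [s * (g * g)]. *)
pose s := g * g / (g * g + `|f * g| + g * g).
have d0 : 0 < g * g + `|f * g| + g * g by rewrite addr_gt0// ltr_wpDr.
have s01 : 0 < s <= 1.
  rewrite /s divr_gt0//= ler_pdivrMr// mul1r -addrA lerDl addr_ge0// ltW//.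
exists (s *: x + (1 - s) *: vtx G i); split; first exact: toward_vertex.
rewrite affr_conv; last by rewrite addrC subrK.
rewrite -/f -/g mulrDl -mulrA -mulrA.
have E : s * (g * g + `|f * g| + g * g) = g * g by rewrite /s divfK// gt_eqF.
have h1 : - `|f * g| <= f * g by rewrite lerNl ler_normr lexx orbT.
have h2 : s * - `|f * g| <= s * (f * g) by rewrite ler_wpM2l//; case/andP: s01 => /ltW.
have := E; case/andP: s01 => s0 s1; nra.
Qed.

Lemma interior_neg : (exists x, (simplex G K)° x /\ affr a x < 0) <->
  exists2 i, i \in K & affr a (vtx G i) < 0.
Proof.
split=> [[x [xK ax]]|[i iK ai]].
  apply: contrapT => h; move: ax; rewrite (affr_bary bK) ltNge => /negP; apply.
  apply: sumr_ge0 => i iK; rewrite mulr_ge0 ?(ltW ((interior_simplexP bK x).1 xK i iK))//.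
  by rewrite leNgt; apply/negP => ai; apply: h; exists i.
have [x [xK h]] := interior_sign iK; exists x; split => //.
by move: h; rewrite nmulr_lgt0.
Qed.

(** Interior points near the vertices inherit their signs, and the segment between two interior
    points of opposite signs contains an interior zero. Whether an element is cut can thus be read
    off its vertices. *)
Lemma interior_zero : (exists x, (simplex G K)° x /\ affr a x = 0) <->
  (exists2 i, i \in K & affr a (vtx G i) < 0) /\ (exists2 i, i \in K & 0 < affr a (vtx G i)).
Proof.
split=> [[x [xK ax]]|[[i iK ai] [j jK aj]]].
  have lx := (interior_simplexP bK x).1 xK.
  have sgn (s : R) : s != 0 -> (forall i, i \in K -> 0 <= s * affr a (vtx G i)) -> False.
    move=> s0 hs; have : \sum_(i in K) affr (b i) x * (s * affr a (vtx G i)) = 0.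
      have -> : \sum_(i in K) affr (b i) x * (s * affr a (vtx G i)) = s * affr a x.
        by rewrite [in RHS](affr_bary bK) mulr_sumr; apply: eq_bigr => i _; rewrite mulrCA.
      by rewrite ax mulr0.
    move=> /psumr_eq0P h; have /card_gt0P[i iK] : (0 < #|K|)%N by rewrite card_elt.
    have /eqP := h (fun i iK => mulr_ge0 (ltW (lx i iK)) (hs i iK)) i iK.
    by rewrite !mulf_eq0 (gt_eqF (lx i iK)) (negPf s0) (negPf (av iK)).
  split; apply: contrapT => h.
    apply: (sgn 1) => [|i iK]; first exact: oner_neq0.
    by rewrite mul1r leNgt; apply/negP => ai; apply: h; exists i.
  apply: (sgn (-1)) => [|i iK]; first by rewrite oppr_eq0 oner_neq0.
  by rewrite mulN1r oppr_ge0 leNgt; apply/negP => ai; apply: h; exists i.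
have [x [xK hx]] := interior_sign iK; have [y [yK hy]] := interior_sign jK.
have ax : affr a x < 0 by move: hx; rewrite nmulr_lgt0.
have ay : 0 < affr a y by move: hy; rewrite pmulr_lgt0.
pose f := affr a x; pose g := affr a y.
have gf : 0 < g - f by rewrite subr_gt0 (lt_trans ax).
pose s := g / (g - f); pose t := - f / (g - f).
have st : s + t = 1 by rewrite /s /t; field; rewrite gt_eqF.
have s0 : 0 < s by rewrite divr_gt0.
have t0 : 0 < t by rewrite divr_gt0 ?oppr_gt0.
exists (s *: x + t *: y); split; last first.
  by rewrite affr_conv// -/f -/g /s /t; field; rewrite gt_eqF.
apply/(interior_simplexP bK) => k kK; rewrite affr_conv// addr_gt0// mulr_gt0//.
  exact: (interior_simplexP bK x).1.
exact: (interior_simplexP bK y).1.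
Qed.

End signs.

End mesh.

(** * Perturbation of the level set function *)

Section level_functions.
Variables (R : realType) (M : nat) (G : geometry R M).
Hypotheses (mesh_G : is_mesh G) (pmax_elts : pmax G \subset elts G).
Implicit Types (K L : {set 'I_M}) (phi w : pwpoly R M) (x : 'rV[R]_3).

Let pmaxE K : K \in pmax G -> K \in elts G. Proof. exact: (fintype.subsetP pmax_elts). Qed.

(** The properties of [Uh] that the derivation relies on; they are inherited by [perturb]. *)
Definition piecewise_affine phi : Prop :=
  (forall K L x, K \in pmax G -> L \in pmax G -> simplex G K x -> simplex G L x ->
     reval (phi K) x = reval (phi L) x) /\
  (forall K, K \in pmax G -> exists a : R * 'rV[R]_3,
     (forall x, reval (phi K) x = affr a x) /\ (forall x, grad (phi K) x = a.2)).

Lemma Uh_piecewise_affine phi : Uh G phi -> piecewise_affine phi.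
Proof.
move=> [v [vdeg [f [_ fE]]] [phiE _]]; split.
  move=> K L x KP LP Kx Lx; rewrite !phiE// /reval.
  by rewrite -(fE K x)// ?pmaxE// -(fE L x)// pmaxE.
move=> K KP; rewrite phiE//; have [k [g [h1 h2]]] := reval_affine (vdeg K (pmaxE KP)).
by exists (k, g); split => x; rewrite ?h1 ?h2.
Qed.

Lemma perturb0 phi w : perturb phi 0 w = phi.
Proof. by apply/funext => K; rewrite /perturb scale0r addr0. Qed.

Lemma reval_perturb phi w t K x :
  reval (perturb phi t w K) x = reval (phi K) x + t * reval (w K) x.
Proof. by rewrite /perturb revalD revalZ. Qed.

Lemma grad_perturb phi w t K x :
  grad (perturb phi t w K) x = grad (phi K) x + t *: grad (w K) x.
Proof. by apply/rowP => i; rewrite !mxE /perturb mderivD mderivZ revalD revalZ. Qed.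

Lemma piecewise_affine_perturb phi w t :
  piecewise_affine phi -> piecewise_affine w -> piecewise_affine (perturb phi t w).
Proof.
move=> [c1 a1] [c2 a2]; split.
  by move=> K L x KP LP Kx Lx; rewrite !reval_perturb (c1 K L)// (c2 K L).
move=> K KP; have [a [ha1 ha2]] := a1 K KP; have [e [he1 he2]] := a2 K KP.
exists (a.1 + t * e.1, a.2 + t *: e.2); split => x.
  by rewrite reval_perturb ha1 he1 affr_pert.
by rewrite grad_perturb ha2 he2.
Qed.

Lemma gamma_pE phi K : piecewise_affine phi -> K \in pmax G ->
  simplex G K `&` gamma_p G phi = simplex G K `&` [set x | reval (phi K) x = 0].
Proof.
move=> [c _] KP; apply/seteqP; split => x /= [xK].
  by move=> [L [LP xL]]; rewrite (c K L).
by move=> h; split => //; exists K.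
Qed.

Lemma omegaE phi K : piecewise_affine phi -> K \in pmax G ->
  simplex G K `&` omega G phi = simplex G K `&` [set x | reval (phi K) x < 0].
Proof.
move=> [c _] KP; apply/seteqP; split => x /= [xK].
  by move=> [[L [LP xL]]|[_ []]]; [rewrite (c K L)|exists K].
by move=> h; split => //; left; exists K.
Qed.

Lemma interior_outside phi K x : K \in elts G -> K \notin pmax G -> (simplex G K)° x ->
  omega G phi x /\ ~ gamma_p G phi x.
Proof.
move=> Ke KP xK; have nL L : L \in pmax G -> ~ simplex G L x.
  move=> LP xL; move: KP; rewrite (interior_disjoint mesh_G Ke _ xK xL) ?LP//.
  exact: pmaxE.
split; last by move=> [L [LP xL _]]; exact: (nL L).
right; split; first by exists K => //; exact: interior_subset.
by move=> [L LP]; exact: nL.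
Qed.

Definition vertex_signs phi phi' : Prop := forall K i, K \in pmax G -> i \in K ->
  [/\ reval (phi K) (vtx G i) != 0, reval (phi' K) (vtx G i) != 0 &
      (reval (phi' K) (vtx G i) < 0) = (reval (phi K) (vtx G i) < 0)].

Section same_signs.
Variables phi phi' : pwpoly R M.
Hypotheses (aphi : piecewise_affine phi) (aphi' : piecewise_affine phi').
Hypothesis ss : vertex_signs phi phi'.

(** An element of [pmax] is active exactly if one of its vertex values is negative, and the elements
    outside [pmax] are always active. *)
Lemma active_same_signs : active G phi' = active G phi.
Proof.
apply/funext => K; apply/propext; rewrite /active.
have [Ke|Ke] := boolP (K \in elts G); last by split; case.
have [KP|KP] := boolP (K \in pmax G); last first.
  have [x xK] := interior_elt mesh_G Ke.
  by split=> _; split => //; exists x; split => //; exact: (interior_outside _ Ke KP xK).1.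
have [b bK] := elt_barycentric mesh_G Ke.
have key psi : piecewise_affine psi -> (forall i, i \in K -> reval (psi K) (vtx G i) != 0) ->
    ((simplex G K)° `&` omega G psi !=set0) <-> exists2 i, i \in K & reval (psi K) (vtx G i) < 0.
  move=> apsi nz; have [a [aE _]] := apsi.2 K KP.
  have av i : i \in K -> affr a (vtx G i) != 0 by move=> /nz; rewrite aE.
  split.
    move=> [x [xK xo]].
    have ax : affr a x < 0.
      have : (simplex G K `&` omega G psi) x by split => //; exact: interior_subset.
      by rewrite omegaE//= -aE => -[].
    have [i iK ai] := (interior_neg mesh_G Ke bK av).1 (ex_intro _ x (conj xK ax)).
    by exists i; rewrite ?aE.
  move=> [i iK]; rewrite aE => ai.
  have [x [xK ax]] := (interior_neg mesh_G Ke bK av).2 (ex_intro2 _ _ i iK ai).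
  exists x; split => //.
  have : (simplex G K `&` [set x | reval (psi K) x < 0]) x.
    by split; [exact: interior_subset|rewrite /= aE].
  by rewrite -omegaE// => -[].
rewrite !key//; try by move=> i iK; have [] := ss KP iK.
split=> -[_ [i iK]]; have [_ _ E] := ss KP iK; split => //; exists i => //; by [rewrite -E|rewrite E].
Qed.

Lemma cut_same_signs : Defs.cut G phi' = Defs.cut G phi.
Proof.
apply/funext => K; apply/propext; rewrite /Defs.cut.
have [Ke|Ke] := boolP (K \in elts G); last by split; case.
have [KP|KP] := boolP (K \in pmax G); last first.
  by split=> -[_ [x [xK xg]]]; have [_ ng] := interior_outside phi Ke KP xK; have [_ ng'] := interior_outside phi' Ke KP xK.
have [b bK] := elt_barycentric mesh_G Ke.
have key psi : piecewise_affine psi -> (forall i, i \in K -> reval (psi K) (vtx G i) != 0) ->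
    ((simplex G K)° `&` gamma_p G psi !=set0) <->
    (exists2 i, i \in K & reval (psi K) (vtx G i) < 0) /\ (exists2 i, i \in K & 0 < reval (psi K) (vtx G i)).
  move=> apsi nz; have [a [aE _]] := apsi.2 K KP.
  have av i : i \in K -> affr a (vtx G i) != 0 by move=> /nz; rewrite aE.
  split.
    move=> [x [xK xo]].
    have ax : affr a x = 0.
      have : (simplex G K `&` gamma_p G psi) x by split => //; exact: interior_subset.
      by rewrite gamma_pE//= -aE => -[].
    have [[i iK ai] [j jK aj]] := (interior_zero mesh_G Ke bK av).1 (ex_intro _ x (conj xK ax)).
    by split; [exists i|exists j]; rewrite ?aE.
  move=> [[i iK ai] [j jK aj]]; rewrite !aE in ai aj.
  have [x [xK ax]] := (interior_zero mesh_G Ke bK av).2 (conj (ex_intro2 _ _ i iK ai) (ex_intro2 _ _ j jK aj)).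
  exists x; split => //.
  have : (simplex G K `&` [set x | reval (psi K) x = 0]) x.
    by split; [exact: interior_subset|rewrite /= aE].
  by rewrite -gamma_pE// => -[].
have pos i : i \in K -> (0 < reval (phi' K) (vtx G i)) = (0 < reval (phi K) (vtx G i)).
  move=> iK; have [n1 n2 E] := ss KP iK.
  by rewrite !lt_neqAle ![0 == _]eq_sym n1 n2 !leNgt E.
rewrite !key//; try by move=> i iK; have [] := ss KP iK.
split=> -[_ [[i iK ai] [j jK aj]]]; split => //; split; [exists i|exists j|exists i|exists j] => //;
  by [rewrite -pos|rewrite pos|have [_ _ <-] := ss KP iK|have [_ _ ->] := ss KP iK].
Qed.

Lemma Wh_same_signs : Wh G phi' = Wh G phi.
Proof. by rewrite /Wh active_same_signs. Qed.

Lemma s_form_same_signs q p : s_form G phi' q p = s_form G phi q p.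
Proof. by rewrite /s_form /ghost_faces active_same_signs cut_same_signs. Qed.

End same_signs.

Lemma near_vertex_signs phi w : piecewise_affine phi -> (forall i, ~ gamma_p G phi (vtx G i)) ->
  \forall t \near (0 : R), vertex_signs phi (perturb phi t w).
Proof.
move=> aphi nn.
have nz K i : K \in pmax G -> i \in K -> reval (phi K) (vtx G i) != 0.
  by move=> KP iK; apply/eqP => h; apply: (nn i); exists K; split => //; exact: vtx_simplex.
have : \forall t \near (0 : R), forall K : {set 'I_M}, forall i : 'I_M, K \in pmax G -> i \in K ->
    reval (perturb phi t w K) (vtx G i) != 0 /\
    (reval (perturb phi t w K) (vtx G i) < 0) = (reval (phi K) (vtx G i) < 0).
  apply: (@filter_forall _ {set 'I_M} _ _ (nbhs_filter (0 : R))) => K.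
  apply: (@filter_forall _ 'I_M _ _ (nbhs_filter (0 : R))) => i.
  have [KP|KP] := boolP (K \in pmax G); last by apply: nearW.
  have [iK|iK] := boolP (i \in K); last by apply: nearW.
  have := near_sign (reval (w K) (vtx G i)) (nz K i KP iK).
  by apply: filterS => t [h1 h2] _ _; rewrite reval_perturb h1 h2.
apply: filterS => t h K i KP iK; have [h1 h2] := h K i KP iK.
by split => //; exact: nz.
Qed.

Lemma mset3_omega phi : piecewise_affine phi -> mset3 (omega G phi).
Proof.
move=> aphi.
have mK K : K \in elts G -> mset3 (simplex G K).
  by move=> Ke; have [b bK] := elt_barycentric mesh_G Ke; exact: (mset3_simplex bK).
apply: mset3U.
  rewrite (_ : omega_p G phi = [set x | exists2 K, K \in pmax G & (simplex G K `&` [set x | reval (phi K) x < 0]) x]).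
    apply: mset3_exists => K KP; apply: mset3I; first by apply: mK; exact: pmaxE.
    by apply: mset3_lt0; exact: mfun3_reval.
  by apply/seteqP; split => x [K]; [move=> [KP xK h]; exists K|move=> KP [xK h]; exists K].
rewrite /omega0 setDE; apply: mset3I.
  by apply: mset3_exists => K Ke; exact: mK.
by apply: mset3C; apply: mset3_exists => K KP; apply: mK; exact: pmaxE.
Qed.

Lemma bounded3_simplex K : K \in elts G -> bounded3 (simplex G K).
Proof.
by move=> Ke; have [b bK] := elt_barycentric mesh_G Ke; have [r _ rP] := simplex_bounded bK; exists r.
Qed.

Let rvol_null E E' N (f : 'rV[R]_3 -> R) : mset3 E -> mset3 E' -> bounded3 E -> bounded3 E' ->
  mfun3 f -> lbd f -> (@leb3 R).-negligible N ->
  (forall y, ~ N y -> E (pt3 y) <-> E' (pt3 y)) -> rvol_int E f = rvol_int E' f.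
Proof.
move=> mE mE' bE bE' mf bf nN EE'.
have mD F : mset3 F -> measurable (@pt3 R @^-1` F : set (measurableTypeR R * measurableTypeR R * measurableTypeR R)).
  by move=> mF; apply: mset3_measurable => // i; exact: measurable_pt3.
have int F : mset3 F -> bounded3 F -> (@leb3 R).-integrable setT (EFin \o ((f \_ F) \o @pt3 R)).
  move=> mF bF; have := integrable_leb3_bounded mF bF mf bf; rewrite (integrable_mkcond _ (mD _ mF)).
  apply: eq_integrable => // y _; rewrite /= /patch (_ : (y \in _) = (pt3 y \in F)); last first.
    by apply/idP/idP; rewrite !in_setE.
  by case: ifP.
rewrite !rvol_int_mkcond; apply/eqP; rewrite -subr_eq0 -RintegralB//; [|exact: int|exact: int].
apply/eqP; apply: (Rintegral_negligible nN).
  by apply: measurable_funB; apply: mfun3_pt3; exact: mfun3_patch.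
move=> y /EE' h; rewrite /patch (_ : (pt3 y \in E) = (pt3 y \in E')) ?subrr//.
by apply/idP/idP; rewrite !in_setE => /h.
Qed.

(** [omega0] removes the closed region of [pmax], so [K] may lose boundary points. There some
    barycentric coordinate vanishes, hence they form a null set. *)
Lemma vol_int_outside phi K (f : 'rV[R]_3 -> R[i]) : piecewise_affine phi ->
  K \in elts G -> K \notin pmax G -> nice f ->
  vol_int (simplex G K `&` omega G phi) f = vol_int (simplex G K) f.
Proof.
move=> aphi Ke KP [f1 f2 f3 f4].
have [b bK] := elt_barycentric mesh_G Ke.
have mK := mset3_simplex bK (fintype.subxx K).
have bK' := bounded3_simplex Ke.
have mE : mset3 (simplex G K `&` omega G phi) by apply: mset3I => //; exact: mset3_omega.
have bE : bounded3 (simplex G K `&` omega G phi) by apply: bounded3S bK' => x [].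
have nz : {ae @leb3 R, forall y, forall i, i \in K -> affr (b i) (pt3 y) != 0}.
  apply: (@filter_forall _ _ _ _ (ae_filter_ringOfSetsType (@leb3 R))) => i.
  have [iK|iK] := boolP (i \in K); last by apply: aeW.
  have ex : exists y, aff3 (aff3_of (b i)) y != 0.
    have v1 := bary_vtx bK iK iK; rewrite eqxx in v1.
    exists (vtx G i 0 i0, vtx G i 0 i1, vtx G i 0 i2); rewrite -affr_pt3.
    rewrite (_ : pt3 _ = vtx G i) ?v1 ?oner_neq0//.
    by apply/rv3P; split; rewrite !mxE.
  apply: negligibleS (aff3_zero_negligible ex) => y /= nP; apply: contrapT => h.
  by apply: nP => _; apply/eqP => h'; apply: h; rewrite -affr_pt3.
have EE y : ~ (~ (forall i, i \in K -> affr (b i) (pt3 y) != 0)) ->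
    (simplex G K `&` omega G phi) (pt3 y) <-> simplex G K (pt3 y).
  move=> /contrapT ny; split=> [[]//|yK]; split => //.
  apply: (interior_outside phi Ke KP _).1; apply/(interior_simplexP bK) => i iK.
  by rewrite lt_neqAle eq_sym ny//; exact: (simplexP bK _).1.
by rewrite !vol_intE; congr (_ +i* _); apply: rvol_null EE.
Qed.

Lemma omega_int_split phi (f : {set 'I_M} -> 'rV[R]_3 -> R[i]) : piecewise_affine phi ->
  (forall K, nice (f K)) ->
  omega_int G phi f =
  \sum_(K in pmax G) vol_int (simplex G K `&` [set x | reval (phi K) x < 0]) (f K) +
  \sum_(K in elts G | K \notin pmax G) vol_int (simplex G K) (f K).
Proof.
move=> aphi nf; rewrite /omega_int (bigID (mem (pmax G))) /=; congr (_ + _).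
  rewrite (eq_bigl (mem (pmax G))); last first.
    by move=> K /=; apply: andb_idl; exact: pmaxE.
  by apply: eq_bigr => K KP; rewrite omegaE.
by apply: eq_bigr => K /andP[Ke KP]; rewrite vol_int_outside.
Qed.

End level_functions.

Lemma eq_surf_int (R : realType) (E E' : set 'rV[R]_3) (f f' : 'rV[R]_3 -> R[i]) :
  E = E' -> f =1 f' -> surf_int E f = surf_int E' f'.
Proof. by move=> -> /funext ->. Qed.

Lemma eq_line_int (R : realType) (E E' : set 'rV[R]_3) (f f' : 'rV[R]_3 -> R[i]) :
  E = E' -> f =1 f' -> line_int E f = line_int E' f'.
Proof. by move=> -> /funext ->. Qed.

Section form_derivative.
Variables (R : realType) (M : nat) (G : geometry R M) (c : coefs R).
Hypotheses (mesh_G : is_mesh G) (pmax_elts : pmax G \subset elts G).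
Implicit Types (K L : {set 'I_M}) (phi w : pwpoly R M) (q p : pwpoly R[i] M).

Let pmaxE K : K \in pmax G -> K \in elts G. Proof. exact: (fintype.subsetP pmax_elts). Qed.

(** An affine function is determined by its value and gradient at the origin, so no choice of
    coefficients is required. *)
Definition level phi K : R * 'rV[R]_3 := (reval (phi K) 0, grad (phi K) 0).

Lemma level_reval phi K x : piecewise_affine G phi -> K \in pmax G ->
  reval (phi K) x = affr (level phi K) x.
Proof.
move=> [_ h] /h[a [ha1 ha2]]; rewrite ha1 /affr /= ha1 ha2 /affr.
by rewrite [dot _ 0]big1 ?addr0// => i _; rewrite mxE mulr0.
Qed.

Lemma level_grad phi K x : piecewise_affine G phi -> K \in pmax G ->
  grad (phi K) x = (level phi K).2.
Proof. by move=> [_ h] /h[a [_ ha]]; rewrite /= !ha. Qed.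

Definition bary K : 'I_M -> R * 'rV[R]_3 := xget (fun=> (0, 0)) [set b | barycentric G K b].

Lemma baryP K : K \in elts G -> barycentric G K (bary K).
Proof.
move=> Ke; have [b bK] := elt_barycentric mesh_G Ke.
by have := @xgetPex _ (fun=> (0, 0)) [set b | barycentric G K b] (ex_intro _ b bK).
Qed.

Definition lvl0 phi K : set 'rV[R]_3 := simplex G K `&` [set x | reval (phi K) x = 0].

Definition normal phi K : 'rV[R]_3 := (enorm (level phi K).2)^-1 *: (level phi K).2.

Definition wall_der phi w q p K : R[i] :=
  - (surf_int (lvl0 phi K) (fun x =>
       ceval (dirder (normal phi K) (psi c (normal phi K) (q K) (p K))) x *
       (reval (w K) x / enorm (level phi K).2)%:C) +
     \sum_(k in K) line_int (simplex G (K :\ k) `&` [set x | reval (phi K) x = 0]) (fun x =>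
       ceval (psi c (normal phi K) (q K) (p K)) x *
       (edge_weight (bary K) (level phi K) k * (reval (w K) x / enorm (level phi K).2))%:C))
  - (delta_V c)%:C * (('i%C - 1) / 2) *
    surf_int (lvl0 phi K) (fun x =>
      ceval (dirder (normal_der (level phi K).2 (level w K).2) (q K)) x * ceval (dirder (normal phi K) (p K)) x +
      ceval (dirder (normal phi K) (q K)) x * ceval (dirder (normal_der (level phi K).2 (level w K).2) (p K)) x).

Definition form_der phi w q p : R[i] :=
  \sum_(K in pmax G) - surf_int (lvl0 phi K) (fun x =>
      ceval (graddot (q K) (p K)) x * (reval (w K) x / enorm (level phi K).2)%:C)
  - (wavenumber c ^+ 2)%:C * \sum_(K in pmax G) - surf_int (lvl0 phi K) (fun x =>
      ceval (q K * p K) x * (reval (w K) x / enorm (level phi K).2)%:C)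
  + \sum_(K in pmax G) wall_der phi w q p K.

Lemma cdiff_a_form phi w q p : piecewise_affine G phi -> piecewise_affine G w ->
  (forall i, ~ gamma_p G phi (vtx G i)) ->
  cdiff (fun t => a_form G c (perturb phi t w) q p) (form_der phi w q p).
Proof.
move=> aphi aw nn.
have K4 K : K \in elts G -> #|K| = 4%N by move=> /(card_elt mesh_G).
have av K : K \in pmax G -> forall i, i \in K -> affr (level phi K) (vtx G i) != 0.
  move=> KP i iK; rewrite -level_reval//; apply/eqP => h; apply: (nn i).
  by exists K; split => //; exact: vtx_simplex.
have volE P : cdiff (fun t => omega_int G (perturb phi t w) (fun K => ceval (P K)))
    (\sum_(K in pmax G) - surf_int (lvl0 phi K) (fun x => ceval (P K) x * (reval (w K) x / enorm (level phi K).2)%:C)).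
  have -> : (fun t => omega_int G (perturb phi t w) (fun K => ceval (P K))) = fun t =>
      \sum_(K in pmax G) vol_int (simplex G K `&` [set x | reval (phi K) x + t * reval (w K) x < 0]) (ceval (P K)) +
      \sum_(K in elts G | K \notin pmax G) vol_int (simplex G K) (ceval (P K)).
    apply/funext => t; rewrite omega_int_split//; last 2 first.
    - exact: piecewise_affine_perturb.
    - by move=> K; exact: nice_ceval.
    congr (_ + _); apply: eq_bigr => K KP; congr (vol_int (_ `&` _) _).
    by apply/seteqP; split => x /=; rewrite reval_perturb.
  rewrite -[X in cdiff _ X]addr0; apply: cdiffD; last exact: cdiff_cst.
  apply: cdiff_sum => K KP.
  have h := cdiff_vol (K4 K (pmaxE KP)) (baryP (pmaxE KP)) (av K KP) (e := level w K) (P := P K).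
  have e1 : (fun t : R => vol_int (simplex G K `&` [set x | reval (phi K) x + t * reval (w K) x < 0]) (ceval (P K)))
     = (fun t : R => vol_int (simplex G K `&` [set x | affr (level phi K) x + t * affr (level w K) x < 0]) (ceval (P K))).
    apply/funext => t; congr (vol_int (_ `&` _) _).
    by apply/seteqP; split => x /=; rewrite !level_reval.
  rewrite e1.
  have -> : surf_int (lvl0 phi K) (fun x => ceval (P K) x * (reval (w K) x / enorm (level phi K).2)%:C) =
     surf_int (simplex G K `&` [set x | affr (level phi K) x = 0]) (fun x => ceval (P K) x * (affr (level w K) x / enorm (level phi K).2)%:C).
    congr surf_int; first by rewrite /lvl0; congr (_ `&` _); apply/seteqP; split => x /=; rewrite level_reval.
    by apply/funext => x; rewrite level_reval.
  exact: h.
have wallE : cdiff (fun t => gamma_int G (perturb phi t w)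
         (fun K x => ceval (psi c (lsnormal (perturb phi t w) K x) (q K) (p K)) x))
    (\sum_(K in pmax G) wall_der phi w q p K).
  have -> : (fun t => gamma_int G (perturb phi t w)
         (fun K x => ceval (psi c (lsnormal (perturb phi t w) K x) (q K) (p K)) x)) = fun t =>
      \sum_(K in pmax G) surf_int (simplex G K `&` [set x | affr (level phi K) x + t * affr (level w K) x = 0])
        (ceval (psi c ((enorm ((level phi K).2 + t *: (level w K).2))^-1 *: ((level phi K).2 + t *: (level w K).2)) (q K) (p K))).
    apply/funext => t; apply: eq_bigr => K KP.
    apply: eq_surf_int.
      etransitivity; first exact: (gamma_pE (piecewise_affine_perturb t aphi aw) KP).
      by congr (_ `&` _); apply/seteqP; split => x /=; rewrite reval_perturb !level_reval.
    move=> x; suff -> : lsnormal (perturb phi t w) K x =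
      (enorm ((level phi K).2 + t *: (level w K).2))^-1 *: ((level phi K).2 + t *: (level w K).2) by [].
    by rewrite /lsnormal grad_perturb !level_grad.
  apply: cdiff_sum => K KP.
  have h := cdiff_wall (K4 K (pmaxE KP)) (baryP (pmaxE KP)) (c := c) (q := q K) (p := p K) (av K KP) (e := level w K).
  have -> : wall_der phi w q p K = 
      - (surf_int (simplex G K `&` [set x | affr (level phi K) x = 0]) (fun x =>
       ceval (dirder (normal phi K) (psi c (normal phi K) (q K) (p K))) x *
       (affr (level w K) x / enorm (level phi K).2)%:C) +
     \sum_(k in K) line_int (simplex G (K :\ k) `&` [set x | affr (level phi K) x = 0]) (fun x =>
       ceval (psi c (normal phi K) (q K) (p K)) x *
       (edge_weight (bary K) (level phi K) k * (affr (level w K) x / enorm (level phi K).2))%:C))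
  - (delta_V c)%:C * (('i%C - 1) / 2) *
    surf_int (simplex G K `&` [set x | affr (level phi K) x = 0]) (fun x =>
      ceval (dirder (normal_der (level phi K).2 (level w K).2) (q K)) x * ceval (dirder (normal phi K) (p K)) x +
      ceval (dirder (normal phi K) (q K)) x * ceval (dirder (normal_der (level phi K).2 (level w K).2) (p K)) x).
    have z0 S : simplex G S `&` [set x | reval (phi K) x = 0] = simplex G S `&` [set x | affr (level phi K) x = 0].
      by congr (_ `&` _); apply/seteqP; split => x /=; rewrite level_reval.
    rewrite /wall_der /lvl0 z0; congr (- (_ + _) - _).
      by congr surf_int; apply/funext => x; rewrite level_reval.
    by apply: eq_bigr => k kK; rewrite z0; congr line_int; apply/funext => x; rewrite level_reval.
  exact: h.
rewrite /a_form /form_der.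
have := cdiffD (cdiffD (volE (fun K => graddot (q K) (p K)))
  (cdiffZ (c := - (wavenumber c ^+ 2)%:C) (volE (fun K => q K * p K))))
  (cdiffD (cdiff_cst ('i%C * (wavenumber c)%:C * bdry_int G (Gout G) (fun K _ => ceval (q K * p K))
     + bdry_int G (Gw0 G) (fun K S => ceval (psi c (face_normal G K S) (q K) (p K))))) wallE).
rewrite add0r !mulNr; congr cdiff; apply/funext => t.
by rewrite mulNr !addrA.
Qed.

End form_derivative.

(** * Linearity of the forms *)

Section borel.
Variable R : realType.

Lemma mset3P (E : set 'rV[R]_3) : mset3 E <->
  forall d (T : measurableType d) (X : T -> 'rV[R]_3),
    (forall i, measurable_fun setT (fun s => X s 0 i)) -> measurable (X @^-1` E).
Proof.
split=> [mE d T X mX|h d T X mX]; first exact: mset3_measurable.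
rewrite (_ : _ \o _ = \1_(X @^-1` E)); first by apply: measurable_indic; exact: h.
apply/funext => s; rewrite /= indicE (_ : (X s \in E) = (s \in X @^-1` E))//.
Qed.

(** An open set is the union of the boxes with rational center and radius [1 / (k + 1)] that it
    contains, a countable family. *)
Lemma mset3_open (O : set 'rV[R]_3) : open O -> mset3 O.
Proof.
move=> oO; apply/mset3P => d T X mX.
pose box (z : {ffun 'I_3 -> rat} * nat) : set 'rV[R]_3 :=
  [set x | forall i, `|x 0 i - ratr (z.1 i)| < z.2.+1%:R^-1].
have mbox z : measurable (X @^-1` box z).
  rewrite (_ : _ @^-1` _ = \bigcap_(i in [set: 'I_3]) ((fun s => X s 0 i) @^-1` (ball (ratr (z.1 i) : R) z.2.+1%:R^-1))); last first.
    apply/seteqP; split => s /=.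
      by move=> h i _; rewrite /ball /= distrC; exact: h.
    by move=> h i; rewrite distrC; exact: (h i I).
  apply: fin_bigcap_measurable => [|i _]; first exact: finite_finset; rewrite -[_ @^-1` _]setTI; apply: mX => //.
  exact: measurable_ball.
rewrite (_ : X @^-1` O = \bigcup_z (if `[< box z `<=` O >] then X @^-1` box z else set0)).
  apply: countable_bigcupT_measurable; first exact: countableP.
  by move=> z; case: ifP => _ //; exact: mbox.
apply/seteqP; split => s /=; last first.
  by move=> [z _]; case: ifPn => [/asboolP zO /zO|].
move=> Os; have : nbhs (X s) O by exact: open_nbhs_nbhs.
move=> /nbhs_ballP[e /= e0 eO].
(* The factor 2 allows for two steps: from the given point to the rational center and on to any
   point of the box. *)
have [k _ kP] : exists2 k : nat, True & 2 * k.+1%:R^-1 < e.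
  have [k kP] : exists k : nat, k.+1%:R^-1 < e / 2.
    have e20 : 0 < e / 2 by rewrite divr_gt0.
    by have [k _ h] := near_infty_natSinv_lt (PosNum e20); exists k; exact: (h k (leqnn k)).
  by exists k => //; rewrite mulrC -ltr_pdivlMr.
have k0 : 0 < k.+1%:R^-1 :> R by rewrite invr_gt0.
have ex i : exists r : rat, `|X s 0 i - ratr r| < k.+1%:R^-1.
  have /rat_in_itvoo[r /itvP rP] : X s 0 i - k.+1%:R^-1 < X s 0 i by rewrite ltrBlDr ltrDl.
  exists r; rewrite ger0_norm ?subr_ge0 ?rP// ltrBlDr -ltrBlDl.
  by rewrite rP.
pose z := ([ffun i => xget (0 : rat) [set r | `|X s 0 i - ratr r| < k.+1%:R^-1]], k).
have zP : box z (X s).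
  move=> i; rewrite /z /= ffunE.
  by have [r rP] := ex i; exact: (@xgetPex _ 0%R [set r | `|X s 0 i - ratr r| < k.+1%:R^-1] (ex_intro _ r rP)).
exists z => //; case: ifPn => // /asboolP; case => y yz; apply: eO; split => // i j.
rewrite !ord1 {i} /ball /=.
rewrite (_ : _ - _ = (X s 0 j - ratr (z.1 j)) - (y 0 j - ratr (z.1 j))); last by ring.
rewrite (le_lt_trans (ler_normB _ _))// (lt_trans (ltrD (zP j) (yz j)))//= -mulr2n -[_ *+ 2]mulr_natl; exact: kP.
Qed.

Lemma mset3_borel (B : set 'rV[R]_3) : <<s @open 'rV[R]_3 >> B -> mset3 B.
Proof.
move=> mB; apply: (smallest_sub _ _ mB) => [|O]; last exact: mset3_open.
split=> [|A mA|F mF].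
- exact: mset3_set0.
- by rewrite setTD; exact: mset3C.
- apply/mset3P => d T X mX; rewrite preimage_bigcup; apply: bigcupT_measurable => k.
  by apply: (mset3P _).1 => //; exact: mF.
Qed.

End borel.

Section faces.
Variables (R : realType) (M : nat) (G : geometry R M).
Hypotheses (mesh_G : is_mesh G).

Lemma simplexS (S K : {set 'I_M}) : S \subset K -> simplex G S `<=` simplex G K.
Proof.
move=> SK x [l [l1 l2 l3 l4]]; exists l; split => // i iK.
by apply: l2; apply: contra iK; exact: (fintype.subsetP SK).
Qed.

Lemma face_setD1 (S K : {set 'I_M}) : S \in faces G -> K \in elts G -> S \subset K ->
  exists2 k, k \in K & S = K :\ k.
Proof.
rewrite inE => /andP[/eqP S3 _] Ke SK; have K4 := card_elt mesh_G Ke.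
have /fintype.subsetPn[k kK kS] : ~~ (K \subset S).
  by apply/negP => /subset_leq_card; rewrite K4 S3.
exists k => //; apply/eqP; rewrite eqEcard; apply/andP; split.
  apply/fintype.subsetP => i iS; rewrite !inE (fintype.subsetP SK)// andbT.
  by apply: contraNneq kS => <-.
by have := cardsD1 k K; rewrite kK K4 S3 add1n => -[<-].
Qed.

Lemma facesP (S : {set 'I_M}) : S \in faces G ->
  exists K k, [/\ K \in elts G, k \in K & S = K :\ k].
Proof.
move=> SF; have := SF; rewrite inE => /andP[_ /existsP[K /andP[Ke SK]]].
by have [k kK SE] := face_setD1 SF Ke SK; exists K, k.
Qed.

(** The face opposite to [k] lies in the zero plane of coordinate [k], whose gradient is nonzero
    because the coordinate takes both values 0 and 1. *)
Lemma flat_face (S : {set 'I_M}) (B : set 'rV[R]_3) : S \in faces G -> mset3 B ->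
  flat (simplex G S `&` B).
Proof.
move=> /facesP[K [k [Ke kK ->]]] mB.
have bK := baryP mesh_G Ke; have sub : K :\ k \subset K by rewrite subD1set.
split; first by apply: mset3I => //; exact: (mset3_simplex bK sub).
  by apply: bounded3S (bounded3_simplex mesh_G Ke) => x [/(simplexS sub)].
have k0 : (bary G K k).2 != 0.
  have K1 : (0 < #|K :\ k|)%N by have := cardsD1 k K; rewrite kK (card_elt mesh_G Ke) add1n => -[<-].
  have /fintype.card_gt0P [j] := K1; rewrite !inE => /andP[jk jK].
  have d0 x : dot 0 x = 0 :> R by rewrite /dot big1// => i _; rewrite mxE mul0r.
  apply/eqP => h; have := bary_vtx bK kK kK; have := bary_vtx bK kK jK.
  by rewrite /affr h !d0 !addr0 eqxx eq_sym (negPf jk) => -> /esym/eqP; rewrite oner_eq0.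
apply: planarS (planar_affr k0) => x [/(simplex_baryP bK x sub) [_ h] _] /=.
by apply: h; rewrite // !inE eqxx.
Qed.

End faces.

Section linear_forms.
Variables (R : realType) (M : nat).
Implicit Types (q p : pwpoly R[i] M) (n : nat).

Definition lincomb n (u : 'I_n -> R[i]) (e : 'I_n -> pwpoly R[i] M) : pwpoly R[i] M :=
  fun K => \sum_j u j *: e j K.

(** Linearity is stated for finite combinations of any length, the form in which expansions in a
    basis are inserted. *)
Definition linear_form (L : pwpoly R[i] M -> R[i]) : Prop :=
  forall n u e, L (@lincomb n u e) = \sum_j u j * L (e j).

Lemma linear_formD L L' : linear_form L -> linear_form L' -> linear_form (fun q => L q + L' q).
Proof.
move=> h h' n u e; rewrite h h' -big_split; apply: eq_bigr => j _ /=.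
by rewrite mulrDr.
Qed.

Lemma linear_formZ k L : linear_form L -> linear_form (fun q => k * L q).
Proof. by move=> h n u e; rewrite h mulr_sumr; apply: eq_bigr => j _; rewrite mulrCA. Qed.

Lemma linear_form_sum (I : Type) (s : seq I) (P : pred I) (L : I -> pwpoly R[i] M -> R[i]) :
  (forall i, P i -> linear_form (L i)) -> linear_form (fun q => \sum_(i <- s | P i) L i q).
Proof.
move=> h n u e; under [RHS]eq_bigr do rewrite mulr_sumr.
by rewrite exchange_big /=; apply: eq_bigr => i Pi; exact: h.
Qed.

Definition linear_integrand (F : pwpoly R[i] M -> 'rV[R]_3 -> R[i]) : Prop :=
  (forall q, nice (F q)) /\
  (forall n u e x, F (@lincomb n u e) x = \sum_j u j * F (e j) x).

Lemma linear_surf E F : flat E -> linear_integrand F -> linear_form (fun q => surf_int E (F q)).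
Proof.
move=> fE [nF lF] n u e.
transitivity (surf_int E (fun x => \sum_j u j * F (e j) x)).
  by apply: eq_surf_int => // x; exact: lF.
rewrite surf_int_sum//; last by move=> j _; apply: niceM => //; exact: nice_cst.
by apply: eq_bigr => j _; rewrite surf_intZ.
Qed.

Lemma linear_vol E F : mset3 E -> bounded3 E -> linear_integrand F ->
  linear_form (fun q => vol_int E (F q)).
Proof.
move=> mE bE [nF lF] n u e.
have vol0 : vol_int E (fun=> 0) = 0.
  rewrite (_ : (fun=> 0) = fun x : 'rV[R]_3 => 0 * (fun=> 0) x) ; last first.
    by apply/funext => x; rewrite mul0r.
  by rewrite vol_intZ ?mul0r//; exact: nice_cst.
transitivity (vol_int E (fun x => \sum_j u j * F (e j) x)).
  by congr (vol_int E _); apply/funext => x; exact: lF.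
have nZ j : nice (fun x => u j * F (e j) x) by apply: niceM => //; exact: nice_cst.
elim: (index_enum _) => [|j s IH].
  rewrite big_nil -[RHS]vol0; congr (vol_int E _); apply/funext => x; exact: big_nil.
rewrite big_cons -IH -(vol_intZ (u j) mE bE (nF _)) -vol_intD//; last exact: nice_sum.
by congr (vol_int E _); apply/funext => x; exact: big_cons.
Qed.

Lemma linear_integrandM (f : 'rV[R]_3 -> R[i]) F : nice f -> linear_integrand F ->
  linear_integrand (fun q x => f x * F q x).
Proof.
move=> nf [nF lF]; split; first by move=> q; exact: niceM.
by move=> n u e x; rewrite lF mulr_sumr; apply: eq_bigr => j _; rewrite mulrCA.
Qed.

Lemma linear_integrandD F F' : linear_integrand F -> linear_integrand F' ->
  linear_integrand (fun q x => F q x + F' q x).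
Proof.
move=> [nF lF] [nF' lF']; split; first by move=> q; exact: niceD.
by move=> n u e x; rewrite lF lF' -big_split; apply: eq_bigr => j _ /=; rewrite mulrDr.
Qed.

Lemma linear_integrand_sum (I : Type) (s : seq I) (P : pred I) F :
  (forall i : I, P i -> linear_integrand (F i)) ->
  linear_integrand (fun q x => \sum_(i <- s | P i) F i q x).
Proof.
move=> h; split; first by move=> q; apply: nice_sum => i /h[].
move=> n u e x; under [RHS]eq_bigr do rewrite mulr_sumr.
by rewrite exchange_big /=; apply: eq_bigr => i /h[_ ->].
Qed.

Lemma linear_ceval K : linear_integrand (fun q => ceval (q K)).
Proof.
split; first by move=> q; exact: nice_ceval.
move=> n u e x; rewrite /lincomb /ceval /peval rmorph_sum; apply: eq_bigr => j _.
exact: mevalZ.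
Qed.

Lemma mderiv_lincomb i n u e K : mderiv i (@lincomb n u e K) = \sum_j u j *: mderiv i (e j K).
Proof. by rewrite /lincomb raddf_sum; apply: eq_bigr => j _ /=; rewrite mderivZ. Qed.

Lemma linear_mderiv i K : linear_integrand (fun q => ceval (mderiv i (q K))).
Proof.
split; first by move=> q; exact: nice_ceval.
move=> n u e x; rewrite mderiv_lincomb /ceval /peval rmorph_sum; apply: eq_bigr => j _.
exact: mevalZ.
Qed.

Lemma linear_dirder v K : linear_integrand (fun q => ceval (dirder v (q K))).
Proof.
have := @linear_integrand_sum _ (index_enum 'I_3) xpredT (fun i q x => (v 0 i)%:C * ceval (mderiv i (q K)) x).
rewrite (_ : (fun q x => \sum_i (v 0 i)%:C * ceval (mderiv i (q K)) x) = (fun q => ceval (dirder v (q K)))).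
  by apply=> i _; apply: linear_integrandM (linear_mderiv i K); exact: nice_cst.
by apply/funext => q; apply/funext => x; rewrite ceval_dirder.
Qed.

Lemma linear_prod (p : pwpoly R[i] M) K : linear_integrand (fun q => ceval (q K * p K)).
Proof.
have := linear_integrandM (nice_ceval (p K)) (linear_ceval K); congr linear_integrand.
by apply/funext => q; apply/funext => x; rewrite cevalM mulrC.
Qed.

Lemma linear_graddot (p : pwpoly R[i] M) K : linear_integrand (fun q => ceval (graddot (q K) (p K))).
Proof.
have := @linear_integrand_sum _ (index_enum 'I_3) xpredT (fun i q x => ceval (mderiv i (p K)) x * ceval (mderiv i (q K)) x).
rewrite (_ : (fun q x => \sum_i ceval (mderiv i (p K)) x * ceval (mderiv i (q K)) x) =
    (fun q => ceval (graddot (q K) (p K)))).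
  by apply=> i _; apply: linear_integrandM (linear_mderiv i K); exact: nice_ceval.
apply/funext => q; apply/funext => x; rewrite ceval_graddot; apply: eq_bigr => i _.
exact: mulrC.
Qed.

Lemma linear_psi c v (p : pwpoly R[i] M) K :
  linear_integrand (fun q => ceval (psi c v (q K) (p K))).
Proof.
pose A : R[i] := (delta_T c * wavenumber c ^+ 2)%:C * (('i%C - 1) * (heat_ratio c - 1)%:C / 2%:R).
pose B : R[i] := (delta_V c)%:C * (('i%C - 1) / 2%:R).
have := linear_integrandD (linear_integrandM (nice_cst A) (linear_prod p K))
  (linear_integrandD (linear_integrandM (nice_cst B) (linear_graddot p K))
    (linear_integrandM (nice_cst (- B)) (linear_integrandM (nice_ceval (dirder v (p K))) (linear_dirder v K)))).
have alg (r s t t' : R[i]) : A * r + (B * s + - B * (t * t')) = A * r + B * (s - t' * t) by ring.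
congr linear_integrand; apply/funext => q; apply/funext => x.
transitivity (A * ceval (q K * p K) x + B * (ceval (graddot (q K) (p K)) x - ceval (dirder v (q K)) x * ceval (dirder v (p K)) x)).
  by apply: alg.
by rewrite /psi cevalD !cevalZ cevalB [ceval (dirder v _ * _) x]cevalM.
Qed.

End linear_forms.

Section forms.
Variables (R : realType) (M : nat) (G : geometry R M) (c : coefs R).
Hypotheses (mesh_G : is_mesh G) (pmax_elts : pmax G \subset elts G).
Hypotheses (meas_out : <<s @open 'rV[R]_3 >> (Gout G)) (meas_w0 : <<s @open 'rV[R]_3 >> (Gw0 G)).
Implicit Types (K L S : {set 'I_M}) (phi w : pwpoly R M) (q p : pwpoly R[i] M).

Let pmaxE K : K \in pmax G -> K \in elts G. Proof. exact: (fintype.subsetP pmax_elts). Qed.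

Definition regular phi : Prop := piecewise_affine G phi /\
  forall K i, K \in pmax G -> i \in K -> reval (phi K) (vtx G i) != 0.

Lemma lvl0_empty phi K : regular phi -> K \in pmax G -> (level phi K).2 = 0 ->
  forall S, simplex G S `&` [set x | reval (phi K) x = 0] = set0.
Proof.
move=> [aphi nz] KP g0 S; apply/seteqP; split => // x /= [_].
have d0 y : dot 0 y = 0 :> R by rewrite /dot big1// => i _; rewrite mxE mul0r.
rewrite (level_reval _ aphi KP) /affr g0 d0 => h.
have /fintype.card_gt0P [j jK] : (0 < #|K|)%N by rewrite (card_elt mesh_G (pmaxE KP)).
by have := nz K j KP jK; rewrite (level_reval _ aphi KP) /affr g0 d0 h eqxx.
Qed.

Lemma flat_lvl0 phi K : regular phi -> K \in pmax G -> flat (lvl0 G phi K).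
Proof.
move=> rphi KP; have bK := baryP mesh_G (pmaxE KP).
have [g0|g0] := eqVneq (level phi K).2 0.
  rewrite /lvl0 (lvl0_empty rphi KP g0); split; [exact: mset3_set0|by exists 0|exact: planar0].
rewrite /lvl0 (_ : [set x | _] = [set x | affr (level phi K) x = 0]); first exact: (flat_level bK).
by apply/seteqP; split => x /=; rewrite (level_reval _ rphi.1 KP).
Qed.

Lemma linear_bdry (B : set 'rV[R]_3) F : <<s @open 'rV[R]_3 >> B ->
  (forall K S, linear_integrand (F K S)) ->
  linear_form (fun q => bdry_int G B (fun K S => F K S q)).
Proof.
move=> mB lF; apply: linear_form_sum => S /andP[SF _]; apply: linear_form_sum => K _.
by apply: linear_surf => //; apply: (flat_face mesh_G) => //; exact: mset3_borel.
Qed.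

Lemma linear_omega phi F : piecewise_affine G phi -> (forall K, linear_integrand (F K)) ->
  linear_form (fun q => omega_int G phi (fun K => F K q)).
Proof.
move=> aphi lF; apply: linear_form_sum => K Ke; apply: linear_vol => //.
  apply: mset3I; last exact: mset3_omega.
  exact: (mset3_simplex (baryP mesh_G Ke)).
by apply: bounded3S (bounded3_simplex mesh_G Ke) => x [].
Qed.

Lemma wall_intE phi q p : piecewise_affine G phi ->
  gamma_int G phi (fun K x => ceval (psi c (lsnormal phi K x) (q K) (p K)) x) =
  \sum_(K in pmax G) surf_int (lvl0 G phi K) (ceval (psi c (normal phi K) (q K) (p K))).
Proof.
move=> aphi; apply: eq_bigr => K KP; apply: eq_surf_int; first exact: gamma_pE.
move=> x; suff -> : lsnormal phi K x = normal phi K by [].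
by rewrite /lsnormal /normal (level_grad x aphi KP).
Qed.

Lemma linear_a_form phi p : regular phi -> linear_form (fun q => a_form G c phi q p).
Proof.
move=> rphi; have aphi := rphi.1.
have h1 := @linear_omega phi (fun K q => ceval (graddot (q K) (p K))) aphi (linear_graddot p).
have h2 := @linear_omega phi (fun K q => ceval (q K * p K)) aphi (linear_prod p).
have h3 := @linear_bdry _ (fun K _ q => ceval (q K * p K)) meas_out (fun K _ => linear_prod p K).
have h4 := @linear_bdry _ (fun K S q => ceval (psi c (face_normal G K S) (q K) (p K))) meas_w0
  (fun K S => linear_psi c (face_normal G K S) p K).
have h5 : linear_form (fun q => gamma_int G phi (fun K x => ceval (psi c (lsnormal phi K x) (q K) (p K)) x)).
  rewrite (_ : (fun q => _) = fun q => \sum_(K in pmax G) surf_int (lvl0 G phi K) (ceval (psi c (normal phi K) (q K) (p K)))).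
    apply: linear_form_sum => K KP.
    exact: (linear_surf (flat_lvl0 rphi KP) (linear_psi c (normal phi K) p K)).
  by apply/funext => q; exact: wall_intE.
have := linear_formD (linear_formD (linear_formD h1 (linear_formZ (- (wavenumber c ^+ 2)%:C) h2))
  (linear_formZ ('i%C * (wavenumber c)%:C) h3)) (linear_formD h4 h5).
by congr linear_form; apply/funext => q; rewrite /a_form mulNr.
Qed.

Lemma graddotC (q p : mpoly 3 R[i]) : graddot q p = graddot p q.
Proof. by apply: eq_bigr => i _; rewrite mulrC. Qed.

Lemma psiC v (q p : mpoly 3 R[i]) : psi c v q p = psi c v p q.
Proof. by rewrite /psi graddotC [q * p]mulrC [dirder v q * _]mulrC. Qed.

Lemma a_formC phi q p : a_form G c phi q p = a_form G c phi p q.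
Proof.
have e1 : omega_int G phi (fun K => ceval (graddot (q K) (p K))) = omega_int G phi (fun K => ceval (graddot (p K) (q K))).
  by apply: eq_bigr => K _; rewrite graddotC.
have e2 : omega_int G phi (fun K => ceval (q K * p K)) = omega_int G phi (fun K => ceval (p K * q K)).
  by apply: eq_bigr => K _; rewrite mulrC.
have e3 : bdry_int G (Gout G) (fun K _ => ceval (q K * p K)) = bdry_int G (Gout G) (fun K _ => ceval (p K * q K)).
  by apply: eq_bigr => S _; apply: eq_bigr => K _; rewrite [q K * _]mulrC.
have e4 : bdry_int G (Gw0 G) (fun K S => ceval (psi c (face_normal G K S) (q K) (p K))) =
    bdry_int G (Gw0 G) (fun K S => ceval (psi c (face_normal G K S) (p K) (q K))).
  by apply: eq_bigr => S _; apply: eq_bigr => K _; rewrite psiC.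
have e5 : gamma_int G phi (fun K x => ceval (psi c (lsnormal phi K x) (q K) (p K)) x) =
    gamma_int G phi (fun K x => ceval (psi c (lsnormal phi K x) (p K) (q K)) x).
  by apply: eq_bigr => K _; apply: eq_surf_int => [//|x]; rewrite psiC.
exact: (f_equal2 +%R (f_equal2 +%R (f_equal2 +%R e1 (congr1 -%R (congr1 ( *%R _) e2)))
  (congr1 ( *%R _) e3)) (f_equal2 +%R e4 e5)).
Qed.

Lemma s_formC phi q p : s_form G phi q p = s_form G phi p q.
Proof.
rewrite /s_form; apply: eq_bigr => S _; apply: eq_surf_int => [//|x].
have alg (k r s : R[i]) : k * r * s = k * s * r by ring.
exact: alg.
Qed.

Lemma linear_normal_jump S : linear_integrand (fun q => normal_jump G q S).
Proof. by apply: linear_integrand_sum => K _; exact: linear_dirder. Qed.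

Lemma linear_s_form phi p : linear_form (fun q => s_form G phi q p).
Proof.
apply: linear_form_sum => S; rewrite finset.inE => /andP[SF _].
have fS : flat (simplex G S).
  rewrite -[simplex G S]setIT; apply: (flat_face mesh_G) => //.
  by rewrite -setC0; apply: mset3C; exact: mset3_set0.
apply: linear_surf => //.
have := linear_integrandM ((linear_normal_jump S).1 p) (linear_integrandM (nice_cst (mesh_size G ^+ 3)%:C) (linear_normal_jump S)).
congr linear_integrand; apply/funext => q; apply/funext => x; exact: mulrC.
Qed.

End forms.

(** * The discrete problem *)

Section linear_systems.
Variables (R : realType) (T : Type) (F : set_system T) (FF : Filter F).
Notation C := R[i].

Lemma cvgZC (k : C) (f : T -> C) (l : C) : (f t : C^o) @[t --> F] --> (l : C^o) ->
  (k * f t : C^o) @[t --> F] --> (k * l : C^o).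
Proof. by move=> fl; exact: (@cvgM _ _ _ FF _ _ _ _ (@cvg_cst _ (k : C^o) _ _ FF) fl). Qed.

Lemma cvg_sumC (I : Type) (s : seq I) (P : pred I) (f : I -> T -> C) (l : I -> C) :
  (forall i, P i -> (f i t : C^o) @[t --> F] --> (l i : C^o)) ->
  (\sum_(i <- s | P i) f i t : C^o) @[t --> F] --> (\sum_(i <- s | P i) l i : C^o).
Proof.
move=> fl; elim: s => [|i s IH].
  rewrite big_nil (_ : (fun _ => _) = fun=> 0); first exact: cvg_cst.
  by apply/funext => t; rewrite big_nil.
rewrite big_cons (_ : (fun _ => _) = fun t => if P i then f i t + \sum_(j <- s | P j) f j t
    else \sum_(j <- s | P j) f j t); last by apply/funext => t; rewrite big_cons.
by case: ifPn => [/fl Pi|//]; exact: (cvgD Pi IH).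
Qed.

Lemma cvg_prodC (I : Type) (s : seq I) (P : pred I) (f : I -> T -> C) (l : I -> C) :
  (forall i, P i -> (f i t : C^o) @[t --> F] --> (l i : C^o)) ->
  (\prod_(i <- s | P i) f i t : C^o) @[t --> F] --> (\prod_(i <- s | P i) l i : C^o).
Proof.
move=> fl; elim: s => [|i s IH].
  rewrite big_nil (_ : (fun _ => _) = fun=> 1); first exact: cvg_cst.
  by apply/funext => t; rewrite big_nil.
rewrite big_cons (_ : (fun _ => _) = fun t => if P i then f i t * \prod_(j <- s | P j) f j t
    else \prod_(j <- s | P j) f j t); last by apply/funext => t; rewrite big_cons.
by case: ifPn => [/fl Pi|//]; exact: (cvgM Pi IH).
Qed.

Lemma cvg_det n (A : T -> 'M[C]_n) (B : 'M[C]_n) :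
  (forall i j, (A t i j : C^o) @[t --> F] --> (B i j : C^o)) ->
  (\det (A t) : C^o) @[t --> F] --> (\det B : C^o).
Proof.
move=> AB; apply: cvg_sumC => s _; apply: cvgZC.
by apply: cvg_prodC => i _; exact: AB.
Qed.

(** By the adjugate formula the solution is a rational function of the entries, with a denominator
    whose limit is nonzero; determinants converge because they are polynomials in the entries. *)
Lemma cvg_solution n (A : T -> 'M[C]_n) (B : 'M[C]_n) (u : T -> 'cV[C]_n) (v b : 'cV[C]_n) :
  (forall i j, (A t i j : C^o) @[t --> F] --> (B i j : C^o)) -> \det B != 0 ->
  (\forall t \near F, A t *m u t = b) -> B *m v = b ->
  forall j, (u t j 0 : C^o) @[t --> F] --> (v j 0 : C^o).
Proof.
move=> AB B0 Au Bv j.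
have adjE (X : 'M[C]_n) y : X *m y = b -> \det X != 0 -> y j 0 = (\det X)^-1 * \sum_k \adj X j k * b k 0.
  move=> <- X0; have := congr1 (fun Y : 'cV[C]_n => Y j 0) (esym (mulmxA (\adj X) X y)).
  rewrite mul_adj_mx mul_scalar_mx [in X in X = _]mxE [in X in _ = X]mxE => h.
  by apply: (mulfI X0); rewrite mulVKf//.
have dA := cvg_det AB.
have nz : \forall t \near F, \det (A t) != 0.
  have /(cvgr_neq0 _) := dA; exact.
rewrite (adjE _ _ Bv B0).
have cadj k : (\adj (A t) j k : C^o) @[t --> F] --> (\adj B j k : C^o).
  rewrite (_ : (fun t => _) = fun t => (-1) ^+ (k + j) * \det (row' k (col' j (A t)))); last first.
    by apply/funext => t; rewrite mxE.
  rewrite mxE; apply: cvgZC; apply: cvg_det => i i'.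
  have minorE (X : 'M[C]_n) : row' k (col' j X) i i' = X (lift k i) (lift j i') by rewrite !mxE.
  rewrite minorE (_ : (fun t => _) = fun t => A t (lift k i) (lift j i')); first exact: AB.
  by apply/funext => t; exact: minorE.
have lim : ((\det (A t))^-1 * \sum_k \adj (A t) j k * b k 0 : C^o) @[t --> F] --> ((\det B)^-1 * \sum_k \adj B j k * b k 0 : C^o).
  apply: (@cvgM _ _ _ FF _ _ _ _ (@cvgV _ _ _ FF _ _ B0 dA)); apply: cvg_sumC => k _.
  exact: (@cvgM _ _ _ FF _ _ _ _ (cadj k) (@cvg_cst _ (b k 0 : C^o) _ _ FF)).
apply: cvg_trans lim; apply: near_eq_cvg; near=> t.
by rewrite (adjE (A t))//; near: t.
Unshelve. all: by end_near. Qed.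

End linear_systems.

(** Take a subspace of maximal dimension inside [P]. A vector of [P] outside it could be adjoined,
    contradicting maximality. *)
Lemma prop_subspace (F : fieldType) (V : vectType F) (P : V -> Prop) : P 0 ->
  (forall k u v, P u -> P v -> P (k *: u + v)) ->
  exists U : {vspace V}, forall v, v \in U <-> P v.
Proof.
move=> P0 PD.
pose Q := [pred d : nat | `[< exists U : {vspace V}, (forall v, v \in U -> P v) /\ \dim U = d >]].
have Q0 : exists d, Q d.
  by exists 0%N; apply/asboolP; exists 0%VS; split; [move=> v; rewrite memv0 => /eqP ->|exact: dimv0].
have Qb d : Q d -> (d <= \dim {:V})%N by move=> /asboolP[U [_ <-]]; exact: dimvS (subvf U).
case: (ex_maxnP Q0 Qb) => d /asboolP[U [UP dU]] dmax; exists U => v; split; first exact: UP.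
move=> Pv; have : Q (\dim (U + <[v]>)%VS).
  apply/asboolP; exists (U + <[v]>)%VS; split => // x /memv_addP[y yU [z /vlineP[k ->] ->]].
  by rewrite addrC; apply: PD => //; exact: UP.
move=> /dmax; rewrite -dU => dle.
have := dimv_leqif_eq (addvSl U <[v]>); rewrite /leqif => -[le1 eq1].
have /eqP -> : U == (U + <[v]>)%VS by rewrite -eq1 eqn_leq le1.
by rewrite -{1}[v]add0r memv_add ?mem0v ?memv_line.
Qed.

(** * A basis of the discrete space *)

Section basis.
Variables (R : realType) (M : nat) (G : geometry R M) (phi : pwpoly R M).
Notation C := R[i].
Implicit Types q p : pwpoly C M.

Lemma Wh0 : Wh G phi (fun=> 0).
Proof.
exists (fun=> 0) => //; split; first by move=> K _; rewrite msize0.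
exists (fun=> 0); split; first by apply: continuous_subspaceT; exact: cst_continuous.
by move=> K x _ _; rewrite /peval rmorph0.
Qed.

Lemma WhD (k : C) q p : Wh G phi q -> Wh G phi p -> Wh G phi (fun K => k *: q K + p K).
Proof.
move=> [v [vd [f [fc fE]]] [v1 v2]] [v' [vd' [f' [fc' fE']]] [v1' v2']].
exists (fun K => k *: v K + v' K).
  split.
    move=> K Ke; apply: leq_trans (msizeD_le _ _) _; rewrite geq_max vd'// andbT.
    by apply: leq_trans (msizeZ_le _ _) _; exact: vd.
  exists (fun x => k * f x + f' x); split.
    move=> x; apply: (@cvgD _ _ _ _ _ _ _ _ _ _ (fc' x)); apply: (@cvgMr _ _ _ _ _ (k : C^o)); exact: fc.
  by move=> K x Ke xK; rewrite (fE K)// (fE' K)// /peval mevalD mevalZ.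
by split => K h; [rewrite v1// v1'|rewrite v2// v2'// scaler0 addr0].
Qed.

Lemma Wh_msize q K : Wh G phi q -> (msize (q K) <= 3)%N.
Proof.
move=> [v [vd _] [v1 v2]]; have [h|h] := pselect (active G phi K); last by rewrite v2// msize0.
by rewrite v1//; apply: vd; exact: h.1.
Qed.

Lemma Wh_basis : exists n (e : 'I_n -> pwpoly C M),
  [/\ forall j, Wh G phi (e j), forall u, Wh G phi (lincomb u e),
      forall q, Wh G phi q -> exists u, q = lincomb u e &
      forall u, lincomb u e = (fun=> 0) -> forall j, u j = 0].
Proof.
(* [bmultinom 3 3] indexes the monomials in three variables of degree less than 3, that is, at most
   2. *)
pose V := {ffun ({set 'I_M} * bmultinom 3 3) -> C^o}.
pose enc q : V := [ffun m => mcoeff (bmnm m.2) (q m.1)].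
pose dec (v : V) : pwpoly C M := fun K => \sum_(m : bmultinom 3 3) v (K, m) *: mpolyX C (bmnm m).
have encK q : Wh G phi q -> dec (enc q) = q.
  move=> qW; apply/funext => K; rewrite [RHS](mpolywE (Wh_msize K qW)).
  by apply: eq_bigr => m _; rewrite ffunE.
have dec_inj v : dec v = (fun=> 0) -> v = 0.
  move=> v0; apply/ffunP => -[K m]; rewrite ffunE.
  have := congr1 (fun f : pwpoly C M => mcoeff (bmnm m) (f K)) v0; rewrite /dec /= mcoeff0 raddf_sum (bigD1 m)//=.
  rewrite mcoeffZ mcoeffX eqxx mulr1 big1 ?addr0// => i im.
  by rewrite mcoeffZ mcoeffX -bmeqP (negPf im) mulr0.
have decE n (u : 'I_n -> C) (X : 'I_n -> V) : dec (\sum_j u j *: X j) = lincomb u (fun j => dec (X j)).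
  apply/funext => K; rewrite /dec /lincomb; under [RHS]eq_bigr do rewrite scaler_sumr.
  rewrite exchange_big /=; apply: eq_bigr => m _; rewrite sum_ffunE scaler_suml.
  by apply: eq_bigr => j _; rewrite ffunE scalerA.
have dec0 : dec 0 = fun=> 0.
  by apply/funext => K; rewrite /dec big1// => m _; rewrite ffunE scale0r.
have decD (k : C) (v v' : V) : dec ((k : C^o) *: v + v') = fun K => k *: dec v K + dec v' K.
  apply/funext => K; rewrite /dec scaler_sumr -big_split; apply: eq_bigr => m _.
  by rewrite !ffunE scalerDl scalerA.
have [||U UP] := @prop_subspace _ V (fun v => Wh G phi (dec v)).
- by rewrite dec0; exact: Wh0.
- by move=> k v v' hv hv'; rewrite decD; exact: WhD.
pose X := vbasis U.
exists (\dim U), (fun j => dec (tnth X j)); split.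
- by move=> j; apply/UP; apply: vbasis_mem; exact: mem_tnth.
- move=> u; rewrite -decE; apply/UP; apply: memv_suml => j _; apply: memvZ.
  by apply: vbasis_mem; exact: mem_tnth.
- move=> q qW; have qU : enc q \in U by apply/UP; rewrite encK.
  exists (fun j => coord X j (enc q)); rewrite -decE -[LHS]encK//.
  congr dec; rewrite {1}(coord_vbasis qU); apply: eq_bigr => j _.
  by rewrite -tnth_nth.
- move=> u; rewrite -decE => /dec_inj uX j.
  have /freeP := basis_free (vbasisP U); apply.
  transitivity (\sum_j u j *: tnth X j); last exact: uX.
  by apply: eq_bigr => i _; rewrite -tnth_nth.
Qed.

End basis.

Lemma cdiff_unique (R : realType) (F : R -> R[i]) D E : cdiff F D -> cdiff F E -> D = E.
Proof.
by move=> FD FE; exact: (cvg_unique (@norm_hausdorff _ (R[i]^o)) FD FE).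
Qed.

(* The derivative of the mean value is that of the form, by the adjoint identity
   m(p_t) - m(p) = a_0(p_t, z) - a_t(p_t, z). *)
Section adjoint_method.
Variables (R : realType) (M : nat).
Notation C := R[i].
Notation P := (pwpoly C M).
Variables (W : P -> Prop) (a : R -> P -> P -> C) (s D : P -> P -> C) (l m : P -> C) (pt : R -> P) (z : P).
Hypothesis basis : exists n (e : 'I_n -> P),
  [/\ forall j, W (e j), forall u, W (lincomb u e),
      forall q, W q -> exists u, q = lincomb u e &
      forall u, lincomb u e = (fun=> 0) -> forall j, u j = 0].
Hypotheses (aC : forall t q q', a t q q' = a t q' q) (sC : forall q q', s q q' = s q' q).
Hypothesis near_lin : \forall t \near (0 : R), forall q', linear_form (fun q => a t q q').
Hypothesis slin : forall q', linear_form (fun q => s q q').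
Hypothesis near_state : \forall t \near (0 : R), W (pt t) /\
  forall q, W q -> a t q (pt t) + s q (pt t) = l q.
Hypotheses (zW : W z) (zE : forall q, W q -> a 0 q z + s q z = m q).
Hypothesis zU : forall z', W z' -> (forall q, W q -> a 0 q z' + s q z' = m q) -> z' = z.
Hypothesis cdiff_a : forall q q', cdiff (fun t => a t q q') (D q q').

Let A t q q' := a t q q' + s q q'.
Let AC t q q' : A t q q' = A t q' q. Proof. by rewrite /A aC sC. Qed.
Let Alin : \forall t \near (0 : R), forall q', linear_form (fun q => A t q q').
Proof. by have := near_lin; apply: filterS => t h q'; apply: linear_formD; [exact: h|exact: slin]. Qed.

Let m_diff : \forall t \near (0 : R), m (pt t) - m (pt 0) = a 0 (pt t) z - a t (pt t) z.
Proof.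
have [p0W p0E] := nbhs_singleton near_state.
have := near_state; apply: filterS => t [ptW ptE].
rewrite -(zE ptW) -(zE p0W) [a 0 (pt 0) z]aC [s (pt 0) z]sC (p0E _ zW) -(ptE _ zW) [a t z _]aC [s z _]sC.
by ring.
Qed.

(** In a fixed basis the quotient is a finite sum of coordinates of the state at [t] times
    difference quotients of forms with fixed arguments. So convergence of the coordinates suffices,
    and differentiability of the state never enters. *)
Lemma adjoint_derivative :
  ((m (pt t) - m (pt 0)) / t%:C : C^o) @[t --> (0 : R)^'] --> (- D z (pt 0) : C^o).
Proof.
have [n [e [eW lW eS eF]]] := basis.
pose u t : 'I_n -> C := xget (fun=> 0) [set u | pt t = lincomb u e].
have near_u : \forall t \near (0 : R), pt t = lincomb (u t) e.
  have := near_state; apply: filterS => t [/eS[v vP] _].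
  exact: (@xgetPex _ (fun=> 0) [set u | pt t = lincomb u e] (ex_intro _ v vP)).
have linA0 q' : linear_form (fun q => A 0 q q') by have /(_ q') := nbhs_singleton Alin.
pose mat t : 'M[C]_n := \matrix_(i, j) A t (e i) (e j).
pose uv t : 'cV[C]_n := \col_j u t j.
pose b : 'cV[C]_n := \col_i l (e i).
have near_sys : \forall t \near (0 : R), mat t *m uv t = b.
  apply: filterS3 near_u near_state Alin => t ut [_ st] lt.
  apply/colP => i; rewrite !mxE -st// -[_ + _]/(A t (e i) (pt t)) AC ut lt; apply: eq_bigr => j _.
  by rewrite !mxE AC mulrC.
(* By symmetry a kernel vector defines an element of [W] that can be added to the adjoint solution,
   against its uniqueness. *)
have det0 : \det (mat 0) != 0.
  apply/negP => /det0P[v v0 vA].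
  have vA0 j : A 0 (lincomb (fun i => v 0 i) e) (e j) = 0.
    rewrite linA0; have := congr1 (fun X : 'rV[C]_n => X 0 j) vA; rewrite !mxE => h.
    by rewrite -[RHS]h; apply: eq_bigr => i _; rewrite !mxE.
  have vAq q : W q -> A 0 (lincomb (fun i => v 0 i) e) q = 0.
    by move=> /eS[uq ->]; rewrite AC linA0 big1// => j _; rewrite AC vA0 mulr0.
  have [uz zeq] := eS _ zW.
  pose z' := lincomb (fun i => uz i + v 0 i) e.
  have z'E q : W q -> A 0 q z' = m q.
    move=> qW; rewrite -(zE qW) -[RHS]/(A 0 q z) AC [RHS]AC zeq !linA0.
    under eq_bigr do rewrite mulrDl; rewrite big_split /= -(linA0 q n (fun i => v 0 i) e) vAq//.
    exact: addr0.
  have zz : z' = z by apply: zU => // ; exact: lW.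
  have ev j : v 0 j = 0.
    apply: (eF (fun i => v 0 i)); apply/funext => K; have := congr1 (fun f : P => f K) zz.
    rewrite zeq /z' /lincomb; under eq_bigr do rewrite scalerDl.
    by rewrite big_split /= => /eqP; rewrite -subr_eq0 addrAC subrr add0r => /eqP.
  by move/eqP: v0; apply; apply/rowP => j; rewrite ev mxE.
have entries i j : (mat t i j : C^o) @[t --> (0 : R)^'] --> (mat 0 i j : C^o).
  rewrite mxE (_ : (fun t => _) = fun t => A t (e i) (e j)); last by apply/funext => t; rewrite mxE.
  have h := cdiff_continuous (cdiffD (@cdiff_a (e i) (e j)) (cdiff_cst (s (e i) (e j)))).
  move: h; congr (_ --> _); by rewrite mxE.
have near_sys' : \forall t \near (0 : R)^', mat t *m uv t = b by exact: nbhs_dnbhs near_sys.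
have ucvg j : (u t j : C^o) @[t --> (0 : R)^'] --> (u 0 j : C^o).
  have := @cvg_solution R R _ (dnbhs_filter (0 : R)) n mat (mat 0) uv (uv 0) b entries det0 near_sys' (nbhs_singleton near_sys) j.
  rewrite [uv 0 j 0]mxE (_ : (fun t => uv t j 0) = fun t => u t j)//.
  by apply/funext => t; rewrite mxE.
(* [D] is known only as a family of derivatives; its linearity and symmetry are recovered here from
   those of the forms by uniqueness of limits. *)
have limE : - D z (pt 0) = - \sum_j u 0 j * D (e j) z.
  congr (- _); apply: (cdiff_unique (@cdiff_a z (pt 0))).
  have h := @cdiff_sum R 'I_n (index_enum _) xpredT (fun j t => u 0 j * a t (e j) z) (fun j => u 0 j * D (e j) z)
    (fun j _ => @cdiffZ R (u 0 j) _ _ (@cdiff_a (e j) z)).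
  have al : \forall t \near (0 : R), \sum_j u 0 j * a t (e j) z = a t z (pt 0).
    have := near_lin; apply: filterS => t lt.
    by rewrite aC (nbhs_singleton near_u) lt.
  by apply: (cdiff_near h); [exact: nbhs_singleton al|exact: nbhs_dnbhs].
rewrite limE.
have lim : (- \sum_j u t j * ((a t (e j) z - a 0 (e j) z) / t%:C) : C^o) @[t --> (0 : R)^'] -->
    (- \sum_j u 0 j * D (e j) z : C^o).
  apply: (@cvgN _ _ _ _ (dnbhs_filter (0 : R))).
  apply: (cvg_sumC (dnbhs_filter (0 : R))) => j _.
  exact: (@cvgM _ _ _ (dnbhs_filter (0 : R)) _ _ _ _ (ucvg j) (@cdiff_a (e j) z)).
apply: cvg_trans lim; apply: near_eq_cvg; apply: nbhs_dnbhs.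
apply: filterS3 near_u m_diff near_lin => t ut -> lt.
have lt0 := nbhs_singleton near_lin.
rewrite ut lt0 lt -sumrB mulr_suml -sumrN; apply: eq_bigr => j _; by ring.
Qed.

End adjoint_method.

Section objective.
Variables (R : realType) (M : nat) (G : geometry R M) (c : coefs R) (phi w : pwpoly R M) (p z : pwpoly R[i] M).
Hypotheses (mesh_G : is_mesh G) (pmax_elts : pmax G \subset elts G).
Hypotheses (meas_out : <<s @open 'rV[R]_3 >> (Gout G)) (meas_w0 : <<s @open 'rV[R]_3 >> (Gw0 G)).
Hypotheses (aphi : piecewise_affine G phi) (aw : piecewise_affine G w).
Hypothesis (no_node : forall i, ~ gamma_p G phi (vtx G i)).
Hypothesis state_wp : \forall t \near (0 : R), exists! p', is_state G c (perturb phi t w) p'.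
Hypothesis adjoint_wp : exists! z', is_adjoint G c phi z'.
Hypotheses (state_p : is_state G c phi p) (adjoint_z : is_adjoint G c phi z).
Notation C := R[i].

Let near_good : \forall t \near (0 : R), regular G (perturb phi t w) /\ vertex_signs G phi (perturb phi t w).
Proof.
have := near_vertex_signs w aphi no_node; apply: filterS => t ss; split => //; split.
  exact: piecewise_affine_perturb.
by move=> K i KP iK; have [] := ss K i KP iK.
Qed.

Let pt t : pwpoly C M := xget (fun=> 0) [set q | is_state G c (perturb phi t w) q].

Let pt0 : pt 0 = p.
Proof.
(* Unique solvability at [t = 0] identifies the chosen state with the given [p]. *)
have [p' [_ uP]] := nbhs_singleton state_wp; rewrite perturb0 in uP.
rewrite /pt perturb0 -(uP p state_p); symmetry; apply: uP.
exact: (@xgetPex _ (fun=> 0) [set q | is_state G c phi q] (ex_intro _ p state_p)).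
Qed.

Lemma objective_derivative :
  ((objective G c (perturb phi t w) - objective G c phi) / t%:C : C^o) @[t --> (0 : R)^']
    --> (- form_der G c phi w z p : C^o).
Proof.
have near_state : \forall t \near (0 : R), Wh G phi (pt t) /\
    forall q, Wh G phi q -> a_form G c (perturb phi t w) q (pt t) + (eps_s c)%:C * s_form G phi q (pt t) = l_form G c q.
  apply: filterS2 near_good state_wp => t [rt ss] [p' [p'S _]].
  have [h1 h2] : is_state G c (perturb phi t w) (pt t).
    exact: (@xgetPex _ (fun=> 0) [set q | is_state G c (perturb phi t w) q] (ex_intro _ p' p'S)).
  have eW := Wh_same_signs mesh_G pmax_elts aphi rt.1 ss.
  split; first by rewrite -eW.
  move=> q qW; have qW' : Wh G (perturb phi t w) q by rewrite eW.
  have := h2 q qW'; have := s_form_same_signs mesh_G pmax_elts aphi rt.1 ss q (pt t).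
  by move=> ->.
have near_lin : \forall t \near (0 : R), forall q', linear_form (fun q => a_form G c (perturb phi t w) q q').
  have := near_good; apply: filterS => t [rt _] q'; exact: linear_a_form.
have zE q : Wh G phi q -> a_form G c (perturb phi 0 w) q z + (eps_s c)%:C * s_form G phi q z = mean_out G q.
  by move=> qW; rewrite perturb0; exact: adjoint_z.2.
have zU z' : Wh G phi z' -> (forall q, Wh G phi q ->
    a_form G c (perturb phi 0 w) q z' + (eps_s c)%:C * s_form G phi q z' = mean_out G q) -> z' = z.
  move=> z'W; rewrite perturb0 => z'E; have [z0 [_ zU]] := adjoint_wp.
  by rewrite -(zU _ (conj z'W z'E)) (zU _ adjoint_z).
have sC q q' : (eps_s c)%:C * s_form G phi q q' = (eps_s c)%:C * s_form G phi q' q by rewrite s_formC.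
have := @adjoint_derivative R M (Wh G phi) (fun t => a_form G c (perturb phi t w))
  (fun q q' => (eps_s c)%:C * s_form G phi q q') (form_der G c phi w) (l_form G c) (@mean_out R M G) pt z
  (Wh_basis G phi) (fun t q q' => a_formC G c _ q q') sC near_lin
  (fun q' => linear_formZ _ (linear_s_form mesh_G phi q')) near_state adjoint_z.1 zE zU
  (fun q q' => @cdiff_a_form R M G c mesh_G pmax_elts phi w q q' aphi aw no_node).
have -> : objective G c phi = mean_out G (pt 0) by rewrite /pt perturb0.
by have -> : form_der G c phi w z p = form_der G c phi w z (pt 0) by exact: (congr1 (form_der G c phi w z) (esym pt0)).
Qed.

End objective.

(** * The derivative formula *)

Section line_integrals.
Variables (R : realType) (M : nat) (G : geometry R M) (K : {set 'I_M}) (b : 'I_M -> R * 'rV[R]_3).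
Hypothesis bK : barycentric G K b.
Implicit Types (E : set 'rV[R]_3) (f g : 'rV[R]_3 -> R[i]).

Definition collinear E : Prop := exists c, c.2 != 0 /\ E `<=` range (@line_pt R c).

Let cintegrable_line E f : mset3 E -> E `<=` simplex G K -> collinear E -> nice f ->
  cintegrable (@lebesgue_measure R) (line_pt (line_chart E) @^-1` E : set (measurableTypeR R))
    (f \o line_pt (line_chart E)).
Proof.
move=> mE EK [d [d0 Ed]] [f1 f2 f3 f4]; have [c1 _] := line_chart_exists d0 Ed.
have c0 : (line_chart E).2 != 0 by rewrite -enorm_gt0 c1.
have mD : measurable (line_pt (line_chart E) @^-1` E : set (measurableTypeR R)).
  by apply: mset3_measurable => // i; exact: measurable_line_pt.
have patchE (h : 'rV[R]_3 -> R) : (EFin \o (h \o line_pt (line_chart E))) \_ (line_pt (line_chart E) @^-1` E)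
    = EFin \o ((h \_ E) \o line_pt (line_chart E)).
  apply/funext => y; rewrite /= /patch (_ : (y \in _) = (line_pt (line_chart E) y \in E)); last first.
    by apply/idP/idP; rewrite !in_setE.
  by case: ifP.
split; apply/(integrable_mkcond _ mD).
  by rewrite (patchE (fun x => complex.Re (f x))); exact: (integrable_simplex_line bK c0 f1 mE EK f3).
by rewrite (patchE (fun x => complex.Im (f x))); exact: (integrable_simplex_line bK c0 f2 mE EK f4).
Qed.

Lemma line_int_sum (I : Type) (s : seq I) (P : pred I) E (F : I -> 'rV[R]_3 -> R[i]) :
  mset3 E -> E `<=` simplex G K -> collinear E -> (forall i, P i -> nice (F i)) ->
  line_int E (fun x => \sum_(i <- s | P i) F i x) = \sum_(i <- s | P i) line_int E (F i).
Proof.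
move=> mE EK cE nF.
have mD : measurable (line_pt (line_chart E) @^-1` E : set (measurableTypeR R)).
  by apply: mset3_measurable => // i; exact: measurable_line_pt.
have D f g : nice f -> nice g -> line_int E (fun x => f x + g x) = line_int E f + line_int E g.
  by move=> nf ng; apply: cintegralD => //; exact: cintegrable_line.
have Z : line_int E (fun=> 0) = 0.
  by apply: (addrI (line_int E (fun=> 0))); rewrite -D ?addr0//; exact: nice_cst.
elim: s => [|i s IH].
  by rewrite big_nil -[RHS]Z; apply: eq_line_int => [//|x]; rewrite big_nil.
have [Pi|Pi] := boolP (P i); rewrite big_cons ?Pi ?(negPf Pi).
  rewrite -IH -D; last 2 first.
  - exact: nF.
  - by apply: nice_sum => j; exact: nF.
  by apply: eq_line_int => [//|x]; rewrite big_cons Pi.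
by rewrite -IH; apply: eq_line_int => [//|x]; rewrite big_cons (negPf Pi).
Qed.

End line_integrals.

Lemma eq_line_int_in (R : realType) (E : set 'rV[R]_3) (f g : 'rV[R]_3 -> R[i]) :
  (forall x, E x -> f x = g x) -> line_int E f = line_int E g.
Proof.
move=> fg; rewrite /line_int /cintegral; congr (_ +i* _); apply: eq_Rintegral => y.
  by rewrite inE => yE; rewrite /= fg.
by rewrite inE => yE; rewrite /= fg.
Qed.

Section element_face.
Variables (R : realType) (M : nat) (G : geometry R M) (phi w : pwpoly R M).
Hypotheses (mesh_G : is_mesh G) (pmax_elts : pmax G \subset elts G).
Hypotheses (rphi : regular G phi) (aw : piecewise_affine G w).
Variables (K : {set 'I_M}) (k : 'I_M).
Hypotheses (KP : K \in pmax G) (kK : k \in K).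
Let S := K :\ k.
Let a := level phi K.
Let Ke : K \in elts G. Proof. exact: (fintype.subsetP pmax_elts). Qed.
Let bK := baryP mesh_G Ke.
Let K4 := card_elt mesh_G Ke.
Let SK : S \subset K. Proof. exact: subD1set. Qed.

Let SsubK x : simplex G S x -> simplex G K x. Proof. exact: simplexS. Qed.

Let aE x : reval (phi K) x = affr a x. Proof. by rewrite (level_reval x rphi.1 KP). Qed.

Let av i : i \in K -> affr a (vtx G i) != 0.
Proof. by move=> iK; rewrite -aE; exact: rphi.2. Qed.

Lemma gamma_face : simplex G S `&` gamma_p G phi = simplex G S `&` [set x | reval (phi K) x = 0].
Proof.
have h := gamma_pE rphi.1 KP; apply/seteqP; split => x [xS xg].
  have : (simplex G K `&` gamma_p G phi) x by split; [exact: SsubK|].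
  by rewrite h => -[].
have : (simplex G K `&` [set x | reval (phi K) x = 0]) x by split; [exact: SsubK|].
by rewrite -h => -[].
Qed.

Lemma omega_face : simplex G S `&` omega G phi = simplex G S `&` [set x | reval (phi K) x < 0].
Proof.
have h := omegaE rphi.1 KP; apply/seteqP; split => x [xS xg].
  have : (simplex G K `&` omega G phi) x by split; [exact: SsubK|].
  by rewrite h => -[].
have : (simplex G K `&` [set x | reval (phi K) x < 0]) x by split; [exact: SsubK|].
by rewrite -h => -[].
Qed.

Let gS x : (simplex G S `&` gamma_p G phi) x <-> simplex G S x /\ affr a x = 0.
Proof. by rewrite gamma_face; split=> -[h1]; rewrite /= aE. Qed.

Let gK x : (simplex G K `&` gamma_p G phi) x <-> simplex G K x /\ affr a x = 0.
Proof. by rewrite (gamma_pE rphi.1 KP); split=> -[h1]; rewrite /= aE. Qed.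

Let oS x : (simplex G S `&` omega G phi) x <-> simplex G S x /\ affr a x < 0.
Proof. by rewrite omega_face; split=> -[h1]; rewrite /= aE. Qed.

Let lsE x : lsnormal phi K x = (enorm a.2)^-1 *: a.2.
Proof. by rewrite /lsnormal (level_grad x rphi.1 KP). Qed.

Variable x0 : 'rV[R]_3.
Hypothesis x0P : (simplex G S `&` gamma_p G phi) x0.
Let x0S : simplex G S x0. Proof. by have [] := (gS x0).1 x0P. Qed.
Let ax0 : affr a x0 = 0. Proof. by have [] := (gS x0).1 x0P. Qed.

Let q := a.2 - (dot a.2 (bary G K k).2 / dot (bary G K k).2 (bary G K k).2) *: (bary G K k).2.
Let tau := (bary G K k).2 - dot (bary G K k).2 ((enorm a.2)^-1 *: a.2) *: ((enorm a.2)^-1 *: a.2).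

(** The chosen vector satisfies the specification because a witness exists, and uniqueness then
    gives its explicit value. *)
Lemma seg_normalE : seg_normal G phi S = (enorm q)^-1 *: q.
Proof.
have [q1 q2 q3 q4] := side_normal_exists K4 bK av kK x0S ax0.
pose P n := [/\ enorm n = 1,
    (exists c : 'I_M -> R, [/\ forall i, i \notin S -> c i = 0,
        \sum_i c i = 0 & n = \sum_i c i *: vtx G i]),
    forall x y, (simplex G S `&` gamma_p G phi) x -> (simplex G S `&` gamma_p G phi) y ->
      dot n (x - y) = 0 &
    forall x y, (simplex G S `&` gamma_p G phi) x -> (simplex G S `&` omega G phi) y ->
      dot n (y - x) <= 0].
have Pq : P ((enorm q)^-1 *: q).
  split => // [x y /gS[h1 h2] /gS[h3 h4]|x y /gS[h1 h2] /oS[h3 h4]]; [exact: q3|exact: q4].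
have [r1 r2 r3 r4] : P (seg_normal G phi S).
  exact: (@xgetPex _ 0 [set n | P n] (ex_intro _ _ Pq)).
apply: (side_normal_unique K4 bK av kK x0S ax0 r1 r2) => x y.
  by move=> h1 h2 h3 h4; apply: r3; apply/gS.
by move=> h1 h2 h3 h4; apply: r4; [apply/gS|apply/oS].
Qed.

Lemma conormalE : conormal G phi K S = (enorm (- tau))^-1 *: - tau.
Proof.
have [q1 q2 q3 q4] := conormal_exists K4 bK av kK x0S ax0.
pose P m := [/\ enorm m = 1,
    forall x, (simplex G K `&` gamma_p G phi) x -> dot m (lsnormal phi K x) = 0,
    forall x y, (simplex G S `&` gamma_p G phi) x -> (simplex G S `&` gamma_p G phi) y ->
      dot m (x - y) = 0 &
    forall x y, (simplex G S `&` gamma_p G phi) x -> (simplex G K `&` gamma_p G phi) y ->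
      dot m (y - x) <= 0].
have Pq : P ((enorm (- tau))^-1 *: - tau).
  split => // [x _|x y /gS[h1 h2] /gS[h3 h4]|x y /gS[h1 h2] /gK[h3 h4]]; [by rewrite lsE|exact: q3|exact: q4].
have [r1 r2 r3 r4] : P (conormal G phi K S).
  exact: (@xgetPex _ 0 [set n | P n] (ex_intro _ _ Pq)).
have x0K : (simplex G K `&` gamma_p G phi) x0 by apply/gK; split => //; exact: simplexS x0S.
apply: (conormal_unique K4 bK av kK x0S ax0 r1) => [|x y|x y].
- by have := r2 _ x0K; rewrite lsE.
- by move=> h1 h2 h3 h4; apply: r3; apply/gS.
- by move=> h1 h2 h3 h4; apply: r4; [apply/gS|apply/gK].
Qed.

Lemma seg_edge_weight :
  dot (seg_normal G phi S) (conormal G phi K S) / `|dot (seg_normal G phi S) a.2| =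
  edge_weight (bary G K) a k / enorm a.2.
Proof. by rewrite seg_normalE conormalE; exact: (edge_weight_identity K4 bK av kK x0S ax0). Qed.

(** The segment is orthogonal to the conormal and to the normal of the wall, so it runs along their
    cross product. *)
Lemma collinear_face : collinear (simplex G S `&` gamma_p G phi).
Proof.
have [q1 q2 q3 _] := conormal_exists K4 bK av kK x0S ax0.
set m := _ *: - _ in q1 q2 q3; set n := (enorm a.2)^-1 *: a.2 in q2.
have n1 : enorm n = 1 by apply: enorm_normalize; exact: (level_grad_neq0 K4 bK av kK x0S ax0).
have m1 := q1.
have r1 : enorm (cross m n) = 1.
  by rewrite /enorm -gram_cross gram_orthonormal// sqrtr1.
exists (x0, cross m n); split; first by rewrite -enorm_gt0 r1.
move=> x /gS[xS ax]; exists (dot (cross m n) (x - x0)) => //; rewrite /line_pt /=.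
have h := orthonormal_decomp (x - x0) m1 n1 r1 q2 (dot_crossl m n) (dot_crossr m n).
have mx : dot m (x - x0) = 0 by exact: q3.
have nx : dot n (x - x0) = 0.
  rewrite dotZl dotBr; move: ax ax0; rewrite /affr => h1 h2.
  by rewrite (_ : _ - _ = 0) ?mulr0//; lra.
by move: h; rewrite mx nx !scale0r !add0r => <-; rewrite addrC subrK.
Qed.

(* The tangential derivatives along a face are those of the trace. *)
Lemma seg_normal_grad L x : L \in pmax G -> S \subset L ->
  dot (seg_normal G phi S) (grad (phi L) x) = dot (seg_normal G phi S) a.2.
Proof.
move=> LP SL.
have [_ [c [c1 c2 nE]] _ _] := side_normal_exists K4 bK av kK x0S ax0.
rewrite seg_normalE nE (level_grad x rphi.1 LP).
have dE L' : L' \in pmax G -> dot (\sum_i c i *: vtx G i) (level phi L').2 = \sum_i c i * reval (phi L') (vtx G i).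
  move=> L'P; transitivity (\sum_i c i * dot (vtx G i) (level phi L').2).
    rewrite /dot; under eq_bigr do rewrite summxE mulr_suml.
    rewrite exchange_big /=; apply: eq_bigr => i _; rewrite mulr_sumr.
    by apply: eq_bigr => j _; rewrite mxE mulrA.
  transitivity (\sum_i c i * (level phi L').1 + \sum_i c i * dot (vtx G i) (level phi L').2).
    by rewrite -mulr_suml c2 mul0r add0r.
  rewrite -big_split; apply: eq_bigr => i _ /=.
  by rewrite -mulrDr (level_reval (vtx G i) rphi.1 L'P) /affr dotC.
rewrite !dE//; apply: eq_bigr => i _; have [iS|iS] := boolP (i \in S); last by rewrite c1// !mul0r.
congr (_ * _); apply: (rphi.1.1 _ _ _ LP KP); apply: vtx_simplex => //.
  exact: (fintype.subsetP SL).
exact: (fintype.subsetP SK).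
Qed.

End element_face.

Lemma line_int_eq0 (R : realType) (E : set 'rV[R]_3) (f : 'rV[R]_3 -> R[i]) :
  (forall x, f x = 0) -> line_int E f = 0.
Proof.
move=> f0; rewrite (_ : f = fun=> 0); last exact/funext.
rewrite /line_int /cintegral /Rintegral /=.
by rewrite integral0_eq.
Qed.

(** * Regrouping the edge integrals of the elements into conormal jumps on the faces *)

Section face_terms.
Variables (R : realType) (M : nat) (G : geometry R M) (c : coefs R) (phi w : pwpoly R M) (p z : pwpoly R[i] M).
Hypotheses (mesh_G : is_mesh G) (pmax_elts : pmax G \subset elts G).
Hypotheses (rphi : regular G phi) (aw : piecewise_affine G w).
Notation C := R[i].
Implicit Types (K L S : {set 'I_M}).

Let pmaxE K : K \in pmax G -> K \in elts G. Proof. exact: (fintype.subsetP pmax_elts). Qed.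

Definition face_weight K S : R :=
  dot (seg_normal G phi S) (conormal G phi K S) / `|dot (seg_normal G phi S) (level phi K).2|.

Definition face_term K S : C := line_int (simplex G S `&` gamma_p G phi) (fun x =>
  ceval (psi c (normal phi K) (z K) (p K)) x * (face_weight K S * reval (w K) x)%:C).

Lemma lsnormalE K x : K \in pmax G -> lsnormal phi K x = normal phi K.
Proof. by move=> KP; rewrite /lsnormal /normal (level_grad x rphi.1 KP). Qed.

Lemma dot_cvec (I : Type) (s : seq I) (P : pred I) (v : 'rV[R]_3) (f : I -> C) (m : I -> 'rV[R]_3) :
  dot (cvec v) (\sum_(i <- s | P i) f i *: cvec (m i)) = \sum_(i <- s | P i) f i * (dot v (m i))%:C.
Proof.
rewrite /dot; under eq_bigr do rewrite summxE mulr_sumr.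
rewrite exchange_big /=; apply: eq_bigr => i _; rewrite rmorph_sum mulr_sumr.
by apply: eq_bigr => j _; rewrite !mxE rmorphM mulrCA.
Qed.

(** On the segment, [w] and the slope of the level function along n^S have the same values from
    every adjacent element of [pmax]. The factor taken from [pside] can therefore be moved inside
    the jump, which becomes a sum of one-sided terms. *)
Lemma face_terms S : S \in faces G ->
  line_int (simplex G S `&` gamma_p G phi) (fun x =>
      let nS := seg_normal G phi S in
      let psi_zp K y := ceval (psi c (lsnormal phi K y) (z K) (p K)) y in
      dot (cvec nS) (conormal_jump G phi psi_zp S x)
      * (reval (w (pside G S)) x
           / `|dot nS (grad (phi (pside G S)) x)|)%:C) =
  \sum_(K in pmax G | S \subset K) face_term K S.
Proof.
move=> SF; cbv zeta.
have [E0|/set0P[x0 x0P]] := eqVneq (simplex G S `&` gamma_p G phi) set0.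
  rewrite big1 => [|K _]; last by rewrite /face_term E0 line_int_set0.
  by rewrite E0 line_int_set0.
(* A face without an adjacent element of [pmax] has an empty jump, so the default value of [pside]
   does not matter. *)
have [[K /andP[KP SK]]|nK] := pselect (exists K, (K \in pmax G) && (S \subset K)); last first.
  have nK' K : ~~ ((K \in pmax G) && (S \subset K)) by apply/negP => h; apply: nK; exists K.
  rewrite big_pred0 => [|K]; last exact/negbTE.
  apply: line_int_eq0 => x; rewrite /conormal_jump dot_cvec big_pred0 ?mul0r// => K.
  exact/negbTE.
have [ps1 ps2] : pside G S \in pmax G /\ S \subset pside G S.
  rewrite /pside; case: fintype.pickP => [L /andP[]//|/(_ K)]; by rewrite KP SK.
have [k kK SE] := face_setD1 mesh_G SF (pmaxE KP) SK.
have x0P' : (simplex G (K :\ k) `&` gamma_p G phi) x0 by rewrite -SE.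
have gradE L x : L \in pmax G -> S \subset L ->
    dot (seg_normal G phi S) (grad (phi L) x) = dot (seg_normal G phi S) (level phi K).2.
  by rewrite SE => LP SL; exact: (seg_normal_grad mesh_G pmax_elts rphi KP kK x0P' x LP SL).
have jumpE x : (simplex G S `&` gamma_p G phi) x ->
    dot (cvec (seg_normal G phi S)) (conormal_jump G phi
        (fun K y => ceval (psi c (lsnormal phi K y) (z K) (p K)) y) S x)
      * (reval (w (pside G S)) x / `|dot (seg_normal G phi S) (grad (phi (pside G S)) x)|)%:C =
    \sum_(L in pmax G | S \subset L)
       ceval (psi c (normal phi L) (z L) (p L)) x * (face_weight L S * reval (w L) x)%:C.
  move=> [xS _]; rewrite /conormal_jump dot_cvec mulr_suml; apply: eq_bigr => L /andP[LP SL].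
  rewrite (lsnormalE x LP) -mulrA -rmorphM /=; congr (_ * _%:C).
  rewrite (gradE _ x ps1 ps2) /face_weight -[(level phi L).2]/(grad (phi L) 0) (gradE L 0 LP SL).
  by rewrite (aw.1 _ _ _ ps1 LP (simplexS ps2 xS) (simplexS SL xS)) mulrA mulrAC.
rewrite (eq_line_int_in jumpE).
have bK := baryP mesh_G (pmaxE KP).
rewrite (line_int_sum bK)//.
- rewrite SE (gamma_face rphi k KP); apply: mset3I; first by apply: (mset3_simplex bK); exact: subD1set.
  by apply: mset3_eq0; exact: mfun3_reval.
- by move=> x [xS _]; exact: simplexS xS.
- by rewrite SE; exact: (collinear_face mesh_G pmax_elts rphi KP kK x0P').
- move=> L /andP[LP SL]; apply: niceM; first exact: nice_ceval.
  have -> : (fun x => (face_weight L S * reval (w L) x)%:C) = fun x => (face_weight L S)%:C * (affr (level w L) x)%:C.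
    by apply/funext => x; rewrite (level_reval x aw LP) rmorphM.
  by apply: niceM; [exact: nice_cst|exact: nice_affr].
Qed.

Lemma sum_faces K (f : {set 'I_M} -> C) : K \in elts G ->
  \sum_(S in faces G | S \subset K) f S = \sum_(k in K) f (K :\ k).
Proof.
move=> Ke; pose F := [set K :\ k | k in K]%SET.
transitivity (\sum_(S in F) f S).
  apply: eq_bigl => S; apply/andP/imsetP.
    by move=> [SF SK]; have [k kK ->] := face_setD1 mesh_G SF Ke SK; exists k.
  move=> [k kK ->]; have SK : K :\ k \subset K by exact: subD1set.
  split => //; rewrite inE; apply/andP; split; last by apply/existsP; exists K; rewrite Ke SK.
  by have := cardsD1 k K; rewrite kK (card_elt mesh_G Ke) add1n => -[<-].
rewrite big_imset//= => k k' kK k'K h; apply/eqP; apply: contraT => kk'.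
have : k' \in K :\ k by rewrite !inE k'K eq_sym kk'.
by rewrite h !inE eqxx.
Qed.

Lemma face_termE K k : K \in pmax G -> k \in K -> face_term K (K :\ k) =
  line_int (simplex G (K :\ k) `&` [set x | reval (phi K) x = 0]) (fun x =>
    ceval (psi c (normal phi K) (z K) (p K)) x *
    (edge_weight (bary G K) (level phi K) k * (reval (w K) x / enorm (level phi K).2))%:C).
Proof.
move=> KP kK; rewrite /face_term.
have [E0|/set0P[x0 x0P]] := eqVneq (simplex G (K :\ k) `&` gamma_p G phi) set0.
  by rewrite -(gamma_face rphi k KP) E0 !line_int_set0.
rewrite (gamma_face rphi k KP); apply: eq_line_int => [//|x].
have -> : edge_weight (bary G K) (level phi K) k * (reval (w K) x / enorm (level phi K).2) =
    edge_weight (bary G K) (level phi K) k / enorm (level phi K).2 * reval (w K) x by rewrite mulrA mulrAC.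
by rewrite -(seg_edge_weight mesh_G pmax_elts rphi KP kK x0P).
Qed.

(** The faces of an element are obtained by omitting one node each; a face shared by two elements of
    [pmax] is reached once from either side, as in the jump. *)
Lemma face_terms_exchange : \sum_(S in faces G) \sum_(K in pmax G | S \subset K) face_term K S =
  \sum_(K in pmax G) \sum_(k in K) line_int (simplex G (K :\ k) `&` [set x | reval (phi K) x = 0]) (fun x =>
    ceval (psi c (normal phi K) (z K) (p K)) x *
    (edge_weight (bary G K) (level phi K) k * (reval (w K) x / enorm (level phi K).2))%:C).
Proof.
rewrite (exchange_big_dep (mem (pmax G)))/=; last by move=> S K _ /andP[].
apply: eq_bigr => K KP; rewrite KP /= sum_faces; last exact: pmaxE.
by apply: eq_bigr => k kK; exact: face_termE.
Qed.

End face_terms.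

Section wall_terms.
Variables (R : realType) (M : nat) (G : geometry R M) (c : coefs R) (phi w : pwpoly R M) (p z : pwpoly R[i] M).
Hypotheses (mesh_G : is_mesh G) (pmax_elts : pmax G \subset elts G).
Hypotheses (rphi : regular G phi) (aw : piecewise_affine G w).
Notation C := R[i].
Implicit Types (K : {set 'I_M}) (x : 'rV[R]_3).

Let dot_normal (g : 'rV[R]_3) : `|dot ((enorm g)^-1 *: g) g| = enorm g.
Proof.
rewrite dotZl -enorm_sqr expr2; have [->|g0] := eqVneq (enorm g) 0.
  by rewrite !mulr0 normr0.
by rewrite mulKf// ger0_norm// enorm_ge0.
Qed.

Lemma normal_slope K x : K \in pmax G ->
  `|dot (lsnormal phi K x) (grad (phi K) x)| = enorm (level phi K).2.
Proof. by move=> KP; rewrite (level_grad x rphi.1 KP) /lsnormal (level_grad x rphi.1 KP) dot_normal. Qed.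

Let speed K x := reval (w K) x / enorm (level phi K).2.

Let nice_speed K : K \in pmax G -> nice (fun x => (speed K x)%:C).
Proof.
move=> KP; have -> : (fun x => (speed K x)%:C) = fun x => (affr (level w K) x)%:C * ((enorm (level phi K).2)^-1)%:C.
  by apply/funext => x; rewrite /speed (level_reval x aw KP) rmorphM.
by apply: niceM; [exact: nice_affr|exact: nice_cst].
Qed.

Lemma volume_terms : gamma_int G phi (fun K x =>
      let n := lsnormal phi K x in
      (ceval (graddot (z K) (p K)) x
         - (wavenumber c ^+ 2)%:C * ceval (z K * p K) x)
      * (reval (w K) x / `|dot n (grad (phi K) x)|)%:C) =
  \sum_(K in pmax G) surf_int (lvl0 G phi K) (fun x =>
      ceval (graddot (z K) (p K)) x * (reval (w K) x / enorm (level phi K).2)%:C)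
  - (wavenumber c ^+ 2)%:C * \sum_(K in pmax G) surf_int (lvl0 G phi K) (fun x =>
      ceval (z K * p K) x * (reval (w K) x / enorm (level phi K).2)%:C).
Proof.
rewrite mulr_sumr -sumrB; apply: eq_bigr => K KP.
have fl := flat_lvl0 mesh_G pmax_elts rphi KP.
have n1 : nice (fun x => ceval (graddot (z K) (p K)) x * (speed K x)%:C).
  by apply: niceM; [exact: nice_ceval|exact: nice_speed].
have n2 : nice (fun x => ceval (z K * p K) x * (speed K x)%:C).
  by apply: niceM; [exact: nice_ceval|exact: nice_speed].
have n3 := niceM (nice_cst (- (wavenumber c ^+ 2)%:C)) n2.
transitivity (surf_int (lvl0 G phi K) (fun x => ceval (graddot (z K) (p K)) x * (speed K x)%:C
    + - (wavenumber c ^+ 2)%:C * (ceval (z K * p K) x * (speed K x)%:C))).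
  apply: eq_surf_int => [|x]; first exact: (gamma_pE rphi.1 KP).
  cbv zeta; rewrite (normal_slope x KP) -/(speed K x).
  have alg (a b k s : C) : (a - k * b) * s = a * s + - k * (b * s) by ring.
  exact: alg.
rewrite (surf_intD fl n1 n3) (surf_intZ _ fl n2) mulNr.
by [].
Qed.

Lemma normal_terms : gamma_int G phi (fun K x =>
      let n := lsnormal phi K x in
      ceval (dirder n (psi c n (z K) (p K))) x
      * (reval (w K) x / `|dot n (grad (phi K) x)|)%:C) =
  \sum_(K in pmax G) surf_int (lvl0 G phi K) (fun x =>
       ceval (dirder (normal phi K) (psi c (normal phi K) (z K) (p K))) x *
       (reval (w K) x / enorm (level phi K).2)%:C).
Proof.
apply: eq_bigr => K KP; apply: eq_surf_int => [|x]; first exact: (gamma_pE rphi.1 KP).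
by cbv zeta; rewrite (normal_slope x KP) (lsnormalE rphi x KP).
Qed.

Let ceval_dirderZ (k : R) v (q : mpoly 3 C) x : ceval (dirder (k *: v) q) x = k%:C * ceval (dirder v q) x.
Proof.
rewrite !ceval_dirder mulr_sumr; apply: eq_bigr => i _.
by rewrite mxE rmorphM mulrA.
Qed.

Lemma tangential_terms : gamma_int G phi (fun K x =>
      let n := lsnormal phi K x in
      let PTw := grad (w K) x *m tanproj n in
      let dn_phi := `|dot n (grad (phi K) x)| in
      ceval (dirder PTw (z K)) x / dn_phi%:C * ceval (dirder n (p K)) x
      + ceval (dirder n (z K)) x * (ceval (dirder PTw (p K)) x / dn_phi%:C)) =
  \sum_(K in pmax G) surf_int (lvl0 G phi K) (fun x =>
      ceval (dirder (normal_der (level phi K).2 (level w K).2) (z K)) x * ceval (dirder (normal phi K) (p K)) x +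
      ceval (dirder (normal phi K) (z K)) x * ceval (dirder (normal_der (level phi K).2 (level w K).2) (p K)) x).
Proof.
apply: eq_bigr => K KP; apply: eq_surf_int => [|x]; first exact: (gamma_pE rphi.1 KP).
cbv zeta; rewrite (normal_slope x KP) (lsnormalE rphi x KP) (level_grad x aw KP).
have -> : (level w K).2 *m tanproj (normal phi K) =
    (level w K).2 - dot (level w K).2 (normal phi K) *: normal phi K.
  rewrite /tanproj mulmxBr mulmx1 mulmxA; congr (_ - _).
  rewrite (_ : _ *m _^T = (dot (level w K).2 (normal phi K))%:M) ?mul_scalar_mx//.
  apply/matrixP => i j; rewrite !ord1 !mxE eqxx mulr1n; apply: eq_bigr => k _.
  by rewrite !mxE.
(* The derivative of the unit normal is the projected gradient of [w] over the length of the
   gradient of the level function, and the real factor leaves the directional derivative. *)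
have dZ q : ceval (dirder (normal_der (level phi K).2 (level w K).2) q) x = (enorm (level phi K).2)%:C^-1 *
    ceval (dirder ((level w K).2 - dot (level w K).2 (normal phi K) *: normal phi K) q) x.
  by rewrite -fmorphV; exact: ceval_dirderZ.
have alg (d d' r s s' : C) : d / r * s + s' * (d' / r) = r^-1 * d * s + s' * (r^-1 * d') by ring.
exact: (etrans (alg _ _ _ _ _) (esym (f_equal2 +%R (congr1 (fun y => y * _) (dZ (z K)))
  (congr1 ( *%R _) (dZ (p K)))))).
Qed.

End wall_terms.

Section derivative_formula.
Variables (R : realType) (M : nat) (G : geometry R M) (c : coefs R) (phi w : pwpoly R M) (p z : pwpoly R[i] M).
Hypotheses (mesh_G : is_mesh G) (pmax_elts : pmax G \subset elts G).
Hypotheses (rphi : regular G phi) (aw : piecewise_affine G w).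

Lemma form_derE : - form_der G c phi w z p =
  gamma_int G phi (fun K x =>
      let n := lsnormal phi K x in
      (ceval (graddot (z K) (p K)) x
         - (wavenumber c ^+ 2)%:C * ceval (z K * p K) x)
      * (reval (w K) x / `|dot n (grad (phi K) x)|)%:C)
   + (delta_V c)%:C * (('i%C - 1) / 2%:R) *
     gamma_int G phi (fun K x =>
      let n := lsnormal phi K x in
      let PTw := grad (w K) x *m tanproj n in
      let dn_phi := `|dot n (grad (phi K) x)| in
      ceval (dirder PTw (z K)) x / dn_phi%:C * ceval (dirder n (p K)) x
      + ceval (dirder n (z K)) x * (ceval (dirder PTw (p K)) x / dn_phi%:C))
   + gamma_int G phi (fun K x =>
      let n := lsnormal phi K x in
      ceval (dirder n (psi c n (z K) (p K))) x
      * (reval (w K) x / `|dot n (grad (phi K) x)|)%:C)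
   + \sum_(S in faces G) line_int (simplex G S `&` gamma_p G phi) (fun x =>
      let nS := seg_normal G phi S in
      let psi_zp K y := ceval (psi c (lsnormal phi K y) (z K) (p K)) y in
      dot (cvec nS) (conormal_jump G phi psi_zp S x)
      * (reval (w (pside G S)) x
           / `|dot nS (grad (phi (pside G S)) x)|)%:C).
Proof.
rewrite (volume_terms c p z mesh_G pmax_elts rphi aw) (tangential_terms p z rphi aw) (normal_terms c w p z rphi).
rewrite (eq_bigr _ (fun S SF => face_terms c p z mesh_G pmax_elts rphi aw SF)).
rewrite (face_terms_exchange c w p z mesh_G pmax_elts rphi).
have alg (F1 F2 F3 F4 F5 : {set 'I_M} -> R[i]) k h :
    - (\sum_(K in pmax G) - F1 K - k * (\sum_(K in pmax G) - F2 K) +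
       \sum_(K in pmax G) (- (F3 K + F5 K) - h * F4 K)) =
    \sum_(K in pmax G) F1 K - k * \sum_(K in pmax G) F2 K + h * \sum_(K in pmax G) F4 K +
    \sum_(K in pmax G) F3 K + \sum_(K in pmax G) F5 K.
  by rewrite sumrB !sumrN big_split /= -mulr_sumr; ring.
exact: alg.
Qed.

End derivative_formula.

Theorem mainTheorem1 (R : realType) (M : nat) (G : geometry R M) (c : coefs R)
  (phi w : pwpoly R M) (l : 'I_M) (p z : pwpoly R[i] M)
  (mesh_G : is_mesh G)
  (domain_D : connected (holdall G)°)
  (pmax_elts : pmax G \subset elts G)
  (meas_out : <<s @open 'rV[R]_3 >> (Gout G))
  (meas_d : <<s @open 'rV[R]_3 >> (Gd G))
  (meas_w0 : <<s @open 'rV[R]_3 >> (Gw0 G))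
  (bdry_out : Gout G `<=` boundary (omega G phi) `&` boundary (omega0 G))
  (bdry_w0 : Gw0 G `<=` boundary (omega G phi) `&` boundary (omega0 G))
  (Gd_sub : Gd G `<=` Gw0 G)
  (area_out_gt0 : 0 < area_out G)
  (k_gt0 : 0 < wavenumber c)
  (delta_V_gt0 : 0 < delta_V c)
  (delta_T_gt0 : 0 < delta_T c)
  (gamma_gt1 : 1 < heat_ratio c)
  (rho_0_gt0 : 0 < rho_0 c)
  (eps_s_gt0 : 0 < eps_s c)
  (e_a_unit : enorm (e_a c) = 1)
  (Uh_phi : Uh G phi)
  (no_node : forall i, ~ gamma_p G phi (vtx G i))
  (basis_w : nodal_basis G l w)
  (state_wp : \forall t \near (0 : R),
     exists! p', is_state G c (perturb phi t w) p')
  (adjoint_wp : exists! z', is_adjoint G c phi z')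
  (state_p : is_state G c phi p)
  (adjoint_z : is_adjoint G c phi z) :
  ((objective G c (perturb phi t w) - objective G c phi) / t%:C : R[i]^o)
    @[t --> (0 : R)^'] -->
  (gamma_int G phi (fun K x =>
      let n := lsnormal phi K x in
      (ceval (graddot (z K) (p K)) x
         - (wavenumber c ^+ 2)%:C * ceval (z K * p K) x)
      * (reval (w K) x / `|dot n (grad (phi K) x)|)%:C)
   + (delta_V c)%:C * (('i%C - 1) / 2%:R) *
     gamma_int G phi (fun K x =>
      let n := lsnormal phi K x in
      let PTw := grad (w K) x *m tanproj n in
      let dn_phi := `|dot n (grad (phi K) x)| in
      ceval (dirder PTw (z K)) x / dn_phi%:C * ceval (dirder n (p K)) x
      + ceval (dirder n (z K)) x * (ceval (dirder PTw (p K)) x / dn_phi%:C))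
   + gamma_int G phi (fun K x =>
      let n := lsnormal phi K x in
      ceval (dirder n (psi c n (z K) (p K))) x
      * (reval (w K) x / `|dot n (grad (phi K) x)|)%:C)
   + \sum_(S in faces G) line_int (simplex G S `&` gamma_p G phi) (fun x =>
      let nS := seg_normal G phi S in
      let psi_zp K y := ceval (psi c (lsnormal phi K y) (z K) (p K)) y in
      dot (cvec nS) (conormal_jump G phi psi_zp S x)
      * (reval (w (pside G S)) x
           / `|dot nS (grad (phi (pside G S)) x)|)%:C)
   : R[i]^o).
Proof.
have aphi := Uh_piecewise_affine pmax_elts Uh_phi.
have [Uh_w _ _] := basis_w; have aw := Uh_piecewise_affine pmax_elts Uh_w.
have rphi : regular G phi.
  split=> // K i KP iK; apply/eqP => h; apply: (no_node i).
  by exists K; split => //; exact: vtx_simplex.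
rewrite -(form_derE c p z mesh_G pmax_elts rphi aw).
have adjoint_u : exists! z', is_adjoint G c phi z' by exact: adjoint_wp.
exact: (objective_derivative mesh_G pmax_elts meas_out meas_w0 aphi aw no_node state_wp adjoint_u state_p adjoint_z).
Qed.
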